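(* The index set problem for simple AF algebras is $\Pi^0_2$ complete: the set of all $e\in\mathbb{N}$ that index a c.e. presentation of a simple AF algebra is $\Pi^0_2$ complete, and likewise the set of all $e\in\mathbb{N}$ that index a computable presentation of a simple AF algebra is $\Pi^0_2$ complete.
   Context: An AF algebra is a C*-algebra isomorphic to an inductive limit of a sequence of finite-dimensional C*-algebras. A C*-algebra $\mathbf{A}$ is simple if it has no closed two-sided ideals other than $\{0\}$ and $\mathbf{A}$. A presentation $\mathbf{A}^\#$ of a C*-algebra $\mathbf{A}$ is a sequence $(a_0,a_1,\dots)$ in $\mathbf{A}$ (special points) generating a dense $*$-subalgebra; generated points are the values $p(a_0,\dots,a_n)$ of $*$-polynomials with coefficients in $\mathbb{Q}(i)$, effectively listed. $\mathbf{A}^\#$ is computable if there is an algorithm that, given a generated point $q$ and $k$, outputs a rational within $2^{-k}$ of $\|q\|$; it is c.e. if there is an algorithm that, given a generated point $q$, enumerates a decreasing sequence of rationals converging to $\|q\|$. A natural number $e$ indexes the computable (resp. c.e.) presentation $\mathbf{A}^\#$ if $e$ is a code of a Turing machine implementing such an algorithm. Completeness is with respect to many-one reductions. *)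

(* Defs.v *)
From HB Require Import structures.
From mathcomp Require Import all_boot all_order all_algebra.
From mathcomp Require Import complex.
From mathcomp Require Import all_classical all_reals all_analysis.
Import Order.TTheory GRing.Theory Num.Theory.
Import numFieldTopology.Exports numFieldNormedType.Exports.

Set Implicit Arguments.
Unset Strict Implicit.
Unset Printing Implicit Defensive.

Local Open Scope classical_set_scope.
Local Open Scope ring_scope.

(** A machine is a finite table of quintuples [((q, s), (q', s', d))]: in state
    [q] scanning [s], write [s'], enter state [q'] and move right if [d] is
    [true], left otherwise.  States and tape symbols are natural numbers, 0 is
    the initial state and also the blank; the first applicable quintuple is
    used, and the machine halts when there is none. *)

Definition turing_machine : Type :=
  seq ((nat * nat) * (nat * nat * bool)).

(** The left half of the tape is listed from the scanned cell outwards, as is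
    the right half; beyond both lists the tape is blank. *)
Record config := Config {
  state : nat; left_tape : seq nat; scanned : nat; right_tape : seq nat }.

Definition step (M : turing_machine) (c : config) : option config :=
  let: Config q l s r := c in
  if ohead [seq t.2 | t <- M & t.1 == (q, s)] is Some (q', s', d) then
    Some (if d then Config q' (s' :: l) (head 0%N r) (behead r)
          else Config q' (behead l) (head 0%N l) (s' :: r))
  else None.

Definition run (M : turing_machine) (t : nat) (c : config) : config :=
  iter t (fun c => odflt c (step M c)) c.

(** Input [n] is a block of [n] ones starting at the scanned cell; the output
    is the number of ones on the final tape. *)
Definition initial_config (n : nat) : config :=
  let tape := nseq n 1%N in Config 0 [::] (head 0%N tape) (behead tape).

Definition output (c : config) : nat :=
  count_mem 1%N (left_tape c ++ scanned c :: right_tape c).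

Definition tm_computes (M : turing_machine) (n m : nat) : Prop :=
  exists t : nat, let c := run M t (initial_config n) in
    step M c = None /\ output c = m.

(** [phi e n m] : the machine with code [e] halts on input [n] with output [m].
    All codings of finite objects by natural numbers are the explicit
    (effective) ones of the [countType] instances of MathComp. *)
Definition phi (e n m : nat) : Prop :=
  exists2 M : turing_machine, unpickle e = Some M & tm_computes M n m.

Definition total_computable (f : nat -> nat) : Prop :=
  exists e : nat, forall n, phi e n (f n).

Definition computable_rel3 (P : nat -> nat -> nat -> bool) : Prop :=
  exists e : nat, forall x y z : nat, phi e (pickle (x, y, z)) (P x y z).

Definition Pi02 (S : set nat) : Prop :=
  exists2 P : nat -> nat -> nat -> bool, computable_rel3 P &
    forall x, S x <-> forall y, exists z, P x y z.

Definition many_one_reducible (B S : set nat) : Prop :=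
  exists2 f : nat -> nat, total_computable f & forall n, B n <-> S (f n).

Definition Pi02_complete (S : set nat) : Prop :=
  Pi02 S /\ forall B : set nat, Pi02 B -> many_one_reducible B S.

(** C*-algebras are not assumed to be unital, so [A] is not a MathComp ring and
    the product is a separate operation. *)

HB.mixin Record CompleteNormedModule_isCStarAlgebra (R : realType) A
    of CompleteNormedModule R[i] A := {
  cmul : A -> A -> A;
  cstar : A -> A;
  cmulA : forall x y z, cmul x (cmul y z) = cmul (cmul x y) z;
  cmulDl : forall x y z, cmul (x + y) z = cmul x z + cmul y z;
  cmulDr : forall x y z, cmul x (y + z) = cmul x y + cmul x z;
  cmulZl : forall (k : R[i]) x y, cmul (k *: x) y = k *: cmul x y;
  cmulZr : forall (k : R[i]) x y, cmul x (k *: y) = k *: cmul x y;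
  cstarK : forall x, cstar (cstar x) = x;
  cstarD : forall x y, cstar (x + y) = cstar x + cstar y;
  cstarZ : forall (k : R[i]) x, cstar (k *: x) = k^*%C *: cstar x;
  cstarM : forall x y, cstar (cmul x y) = cmul (cstar y) (cstar x);
  cnormM : forall x y, `|cmul x y| <= `|x| * `|y|;
  cnorm_star : forall x, `|cmul (cstar x) x| = `|x| ^+ 2
}.

#[short(type="cstarType")]
HB.structure Definition CStarAlgebra (R : realType) :=
  { A of CompleteNormedModule_isCStarAlgebra R A & CompleteNormedModule R[i] A }.

Section CStarNotions.
Variable R : realType.
Implicit Types A B : cstarType R.

Definition star_hom A B (f : A -> B) : Prop :=
  [/\ linear f,
      forall x y, f (cmul x y) = cmul (f x) (f y) &
      forall x, f (cstar x) = cstar (f x)].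

Definition star_isomorphic A B : Prop :=
  exists2 f : A -> B, star_hom f & bijective f.

Definition finite_dimensional A : Prop :=
  exists (n : nat) (b : 'I_n -> A), forall x : A,
    exists c : 'I_n -> R[i], x = \sum_i c i *: b i.

Definition cocone (A : nat -> cstarType R) (f : forall n, A n -> A n.+1)
    B (mu : forall n, A n -> B) : Prop :=
  (forall n, star_hom (mu n)) /\ (forall n x, mu n.+1 (f n x) = mu n x).

(** Inductive limits are the colimits in the category of C*-algebras and
    *-homomorphisms. *)
Definition is_inductive_limit (A : nat -> cstarType R)
    (f : forall n, A n -> A n.+1) B (mu : forall n, A n -> B) : Prop :=
  cocone f mu /\
  forall (C : cstarType R) (nu : forall n, A n -> C), cocone f nu ->
    exists! psi : B -> C, star_hom psi /\ forall n x, psi (mu n x) = nu n x.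

Definition AF A : Prop :=
  exists (An : nat -> cstarType R) (f : forall n, An n -> An n.+1)
         (B : cstarType R) (mu : forall n, An n -> B),
    [/\ forall n, finite_dimensional (An n),
        forall n, star_hom (f n),
        is_inductive_limit f mu &
        star_isomorphic A B].

Definition closed_ideal A (I : set A) : Prop :=
  [/\ I 0,
      forall (k : R[i]) x y, I x -> I y -> I (k *: x + y),
      forall x y, I x -> I (cmul y x),
      forall x y, I x -> I (cmul x y) &
      closed I].

Definition simple_cstar A : Prop :=
  forall I : set A, closed_ideal I -> I = [set 0] \/ I = setT.

Definition star_subalgebra A (S : set A) : Prop :=
  [/\ S 0,
      forall (k : R[i]) x y, S x -> S y -> S (k *: x + y),
      forall x y, S x -> S y -> S (cmul x y) &
      forall x, S x -> S (cstar x)].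

Definition generated_star_subalgebra A (X : set A) : set A :=
  \bigcap_(S in [set S | star_subalgebra S /\ X `<=` S]) S.

Definition presentation A (a : nat -> A) : Prop :=
  dense (generated_star_subalgebra (range a)).

End CStarNotions.

(** The letter [(i, false)] is the variable x_i, the letter [(i, true)] is its
    adjoint x_i^*.  A word is nonempty, given by its first letter and the
    others: as algebras need not have a unit, *-polynomials have no constant
    term. *)
Definition letter : Type := nat * bool.
Definition word : Type := letter * seq letter.

(** Sums of monomials, the coefficient [(u, v)] standing for u + iv. *)
Definition star_poly : Type := seq ((rat * rat) * word).

Section Indices.
Variable R : realType.
Implicit Types A : cstarType R.

Definition gaussian_rat (z : rat * rat) : R[i] := (ratr z.1 +i* ratr z.2)%C.

Definition eval_letter A (a : nat -> A) (l : letter) : A :=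
  if l.2 then cstar (a l.1) else a l.1.

Definition eval_word A (a : nat -> A) (w : word) : A :=
  foldl (fun x l => cmul x (eval_letter a l)) (eval_letter a w.1) w.2.

Definition generated_point A (a : nat -> A) (p : star_poly) : A :=
  \sum_(m <- p) gaussian_rat m.1 *: eval_word a m.2.

(** [`|x|] is an element of [R[i]] with zero imaginary part. *)
Definition cnorm A (x : A) : R := complex.Re `|x|.

Definition indexes_computable (e : nat) A (a : nat -> A) : Prop :=
  forall (p : star_poly) (k : nat), exists r : rat,
    phi e (pickle (p, k)) (pickle r) /\
    `|ratr r - cnorm (generated_point a p)| < 2 ^- k.

(** On input [(p, k)] the algorithm returns the [k]-th term of the sequence
    that it enumerates for [p]. *)
Definition indexes_ce (e : nat) A (a : nat -> A) : Prop :=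
  forall p : star_poly, exists r : nat -> rat,
    [/\ forall k, phi e (pickle (p, k)) (pickle (r k)),
        forall k, r k.+1 <= r k &
        (ratr (r k) : R) @[k --> \oo] --> cnorm (generated_point a p)].

Definition ce_simple_AF_indices : set nat :=
  [set e | exists (A : cstarType R) (a : nat -> A),
    [/\ presentation a, indexes_ce e a, simple_cstar A & AF A]].

Definition computable_simple_AF_indices : set nat :=
  [set e | exists (A : cstarType R) (a : nat -> A),
    [/\ presentation a, indexes_computable e a, simple_cstar A & AF A]].

End Indices.

(* Main.v *)
(** An AF algebra is locally approximated by finite-dimensional subalgebras, and
    these are spanned by systems of matrix units.  The relations defining such
    systems are stable under small perturbations, so "every finite set of
    generated points is within 1/(k+1) of the span of approximate matrix units"
    only involves strict upper bounds on norms, which are semi-decidable; in the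
    converse direction one conjugates by unitaries near 1 to nest the spans.
    Simplicity is certified together with this: for [a] of norm at least 1/2 the
    matrix units can be chosen of the form [u a w] up to 1/4, with bounds on
    [u] and [w], because [a^* a] has a spectral projection of large eigenvalue
    that generates the algebra as an ideal.  Hence being an index means that the
    output is consistent with a C*-seminorm on the *-polynomials for which such
    certificates exist, a Pi02 condition, the algebra being recovered by
    completion.

    For hardness, given [n] one programs a machine that on input [(p, k)] outputs
    the norm 0 once it has found, for all [y <= k], a [z] with [P n y z]: it
    indexes the zero algebra if all searches succeed, and is not total
    otherwise. *)

Require Import Defs.
From HB Require Import structures.
From mathcomp Require Import all_boot all_order all_algebra.
From mathcomp Require Import complex.
From mathcomp Require Import all_classical all_reals all_analysis.
From mathcomp Require Import zify ring lra.
Import Order.TTheory GRing.Theory Num.Theory.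
Import numFieldTopology.Exports numFieldNormedType.Exports.

Set Implicit Arguments.
Unset Strict Implicit.
Unset Printing Implicit Defensive.

(** * While programs and Turing machines *)

Local Open Scope nat_scope.

Section Machines.

(** All spectral theory is drawn from one construction: for self-adjoint [h] of norm at most 1/8,
    the inverse square root of [1 - h] as the fixed point of a contraction ([inv_sqrt]). It yields
    projections near almost idempotent elements, polar decompositions, unitaries near 1 and the
    contractivity of homomorphisms. Since there need be no unit, an element [1 + t] is represented
    by [t]; this is where the long polynomial identities settled by [cring] come from. The root
    stays in every closed subalgebra that contains [h], which replaces functional calculus whenever
    a commutation or a corner has to be preserved. Both index sets are reduced to one condition,
    [core], on the relation that a rational is a strict upper bound of a norm. Upper bounds are all
    that a c.e. presentation gives; for computable presentations, conditions on the lower bounds are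
    added. All perturbation constants are explicit because a certificate must carry a precision that
    makes them applicable. Reductions need machine codes that depend computably on a parameter, so
    the parameter is confined to a jump and a number of similar blocks. *)

Inductive cmd :=
  Inc of nat | Dec of nat | Seq of cmd & cmd | While of nat & cmd.

Definition upd (s : nat -> nat) r v := fun i => if i == r then v else s i.

Inductive exec : cmd -> (nat -> nat) -> (nat -> nat) -> Prop :=
| EInc r s : exec (Inc r) s (upd s r (s r).+1)
| EDec r s : exec (Dec r) s (upd s r (s r).-1)
| ESeq c d s1 s2 s3 : exec c s1 s2 -> exec d s2 s3 -> exec (Seq c d) s1 s3
| EWhileF r c s : s r = 0 -> exec (While r c) s s
| EWhileT r c s1 s2 s3 : s1 r <> 0 -> exec c s1 s2 ->
    exec (While r c) s2 s3 -> exec (While r c) s1 s3.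

Fixpoint regs_lt k c := match c with
  | Inc r | Dec r => r < k
  | Seq c d => regs_lt k c && regs_lt k d
  | While r c => (r < k) && regs_lt k c end.

(* A symbol packs the left-end marker and one bit per register: register [r]
   holds the number of cells whose bit [r] is set. *)
Fixpoint enc (m : bool) (bs : bitseq) : nat :=
  if bs is b :: bs' then b + (enc m bs').*2 else m.

Lemma enc_inj m m' bs bs' : size bs = size bs' ->
  enc m bs = enc m' bs' -> m = m' /\ bs = bs'.
Proof.
elim: bs bs' => [|b bs IH] [|b' bs'] //=; first by case: m; case: m'.
move=> [sz] e; have [e1 e2] : b = b' /\ enc m bs = enc m' bs'.
  by case: b b' e => [] [] /= e; split=> //; lia.
by have [-> ->] := IH bs' sz e2; rewrite e1.
Qed.

Definition rule : Type := bool -> bitseq -> nat * bitseq * bool.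

(** Every quintuple moves the head, so the walk to the left steps off the marker to the right and
    then left again; in this way a phase ends exactly on cell 0. *)
Definition back q ex : seq rule :=
  [:: fun m bs => if m then (q.+1, bs, true) else (q, bs, false);
      fun _ bs => (ex, bs, false)].

Fixpoint len c := match c with
  | Inc _ => 3 | Dec _ => 4 | Seq c d => len c + len d
  | While _ c => (len c).+3 end.

(** The code occupies the states from [q] on, starts on cell 0 and leaves to [ex] on cell 0. In
    [Dec], a clear bit on the marker cell means that the register is 0: the head steps right, and
    the second state of [back] brings it home. Otherwise the last set bit, one cell to the left, is
    cleared. *)
Fixpoint cmp c q ex : seq rule := match c with
  | Inc r => (fun m bs => if nth false bs r then (q, bs, true)
               else (q.+1, set_nth false bs r true, true)) :: back q.+1 ex
  | Dec r => (fun m bs => if nth false bs r then (q, bs, true)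
               else if m then (q.+2, bs, true) else (q.+3, bs, false)) ::
             back q.+1 ex ++
             [:: fun m bs => (q.+1, set_nth false bs r false, true)]
  | Seq c d => cmp c q (q + len c) ++ cmp d (q + len c) ex
  | While r c => [:: fun m bs => (if nth false bs r then q.+1 else q.+2, bs, true);
                 fun _ bs => (q.+3, bs, false);
                 fun _ bs => (ex, bs, false)] ++ cmp c q.+3 q end.

Lemma size_cmp c q ex : size (cmp c q ex) = len c.
Proof. by elim: c q ex => //= [c IHc d IHd|r c IH] q ex; rewrite ?size_cat ?IHc ?IHd ?IH. Qed.

Definition lookup (M : turing_machine) x := ohead [seq t.2 | t <- M & t.1 == x].

Lemma lookup_cat M N x :
  lookup (M ++ N) x = if lookup M x is Some y then Some y else lookup N x.
Proof. rewrite /lookup filter_cat map_cat; by case: [seq t <- M | _]. Qed.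

Lemma lookup_map (T : eqType) (f : T -> nat * nat) g (s : seq T) z :
  {in s &, injective f} -> z \in s ->
  lookup [seq (f y, g y) | y <- s] (f z) = Some (g z).
Proof.
move=> fi zs; rewrite /lookup filter_map -map_comp /=.
have : all (pred1 z) [seq x <- s | preim (fun y => (f y, g y)) (fun t => t.1 == f z) x].
  by apply/allP => y; rewrite mem_filter /= => /andP[/eqP fe ys]; apply/eqP/fi.
have : z \in [seq x <- s | preim (fun y => (f y, g y)) (fun t => t.1 == f z) x].
  by rewrite mem_filter /= eqxx.
by case: [seq x <- s | _] => //= y l _ /andP[/eqP ->].
Qed.

Lemma lookup_none (M : turing_machine) x :
  all (fun t => t.1 != x) M -> lookup M x = None.
Proof. by rewrite /lookup; elim: M => //= t M IH /andP[/negbTE-> /IH]. Qed.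

(** * Correctness of the compilation of while programs *)

Section Compile.
Variable k : nat.

Definition symbols : seq (bool * bitseq) :=
  [seq (m, val t) | m <- [:: true; false], t <- enum {: k.-tuple bool}].

Lemma symbolsP m bs : ((m, bs) \in symbols) = (size bs == k).
Proof.
apply/allpairsP/idP => [[[m' t] /= [_ _ [_ ->]]]|sz]; first by rewrite size_tuple.
by exists (m, Tuple sz); split=> //; [case: m|rewrite mem_enum].
Qed.

Definition rule0 : rule := fun _ bs => (0, bs, true).

Definition quint b (P : seq rule) (z : nat * (bool * bitseq)) :
    (nat * nat) * (nat * nat * bool) :=
  let: (q', bs', d) := nth rule0 P z.1 z.2.1 z.2.2 in
  ((b + z.1, enc z.2.1 z.2.2), (q', enc z.2.1 bs', d)).

Definition table b P : turing_machine :=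
  [seq quint b P z | z <- [seq (i, y) | i <- iota 0 (size P), y <- symbols]].

Lemma lookup_table b P q m bs : size bs = k ->
  lookup (table b P) (q, enc m bs) =
  if b <= q < b + size P then
    let: (q', bs', d) := nth rule0 P (q - b) m bs in Some (q', enc m bs', d)
  else None.
Proof.
move=> sz; pose f (z : nat * (bool * bitseq)) := (b + z.1, enc z.2.1 z.2.2).
pose g (z : nat * (bool * bitseq)) := let: (q', bs', d) := nth rule0 P z.1 z.2.1 z.2.2 in
  (q', enc z.2.1 bs', d).
have E : table b P = [seq (f z, g z) | z <- [seq (i, y) | i <- iota 0 (size P), y <- symbols]].
  by apply: eq_map => z; rewrite /quint /f /g; case: (nth _ _ _ _ _) => [[]].
case: ifPn => H.
- have -> : (q, enc m bs) = f (q - b, (m, bs)) by rewrite /f /= subnKC //; case/andP: H.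
  rewrite E lookup_map.
  + by rewrite /g /=; case: (nth _ _ _ _ _) => [[]].
  + move=> [i [m1 b1]] [j [m2 b2]] /allpairsP[[i' [? ?]] /= [_ h1 [-> -> ->]]].
    move=> /allpairsP[[j' [? ?]] /= [_ h2 [-> -> ->]]].
    move: h1 h2; rewrite !symbolsP => /eqP h1 /eqP h2.
    by move=> [/addnI ->] /enc_inj[|-> ->] //; rewrite h1.
  + apply/allpairsP; exists (q - b, (m, bs)); split=> //=; last by rewrite symbolsP sz.
    by rewrite mem_iota; lia.
- rewrite E lookup_none //; apply/allP => t /mapP[[i y]] /allpairsP[[i' ?] /= [h1 _ [-> _]]] ->.
  rewrite /= /f; apply: contra H => /eqP[<- _].
  by rewrite mem_iota in h1; lia.
Qed.

(** Reading both halves of the tape as one function hides trailing blanks, since [nth] also defaults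
    to the blank 0. *)
Definition rep (c : config) q p (T : nat -> nat) :=
  [/\ state c = q, size (left_tape c) = p &
      forall i, nth 0 (catrev (left_tape c) (scanned c :: right_tape c)) i = T i].

Lemma nth_catrev (l r : seq nat) i : nth 0 (catrev l r) (size l + i) = nth 0 r i.
Proof. by elim: l r i => //= x l IH r i; rewrite addSnnS IH. Qed.

Lemma rep_scanned c q p T : rep c q p T -> scanned c = T p.
Proof. by case: c => q' l s r [_ <- <-] /=; rewrite -[size l]addn0 nth_catrev. Qed.

Lemma nth_catrev2 (l r r' : seq nat) i : (forall j, nth 0 r j = nth 0 r' j) ->
  nth 0 (catrev l r) i = nth 0 (catrev l r') i.
Proof.
elim: l r r' => [|x l IH] r r' H /=; first exact: H.
by apply: IH; case.
Qed.

Lemma nth_catrev_set (l r : seq nat) x y i :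
  nth 0 (catrev l (y :: r)) i =
  if i == size l then y else nth 0 (catrev l (x :: r)) i.
Proof.
rewrite !catrevE !nth_cat size_rev; case: ltngtP => // [h|->]; last by rewrite subnn.
by case E: (i - size l) => //; lia.
Qed.

Lemma rep_step M c q p T q' s' (d : bool) :
  rep c q p T -> lookup M (q, T p) = Some (q', s', d) -> d || (0 < p) ->
  exists2 c', step M c = Some c' &
    rep c' q' (if d then p.+1 else p.-1) (upd T p s').
Proof.
move=> H; have sc := rep_scanned H; case: c H sc => qq l s r [/= -> sz HT] ->.
rewrite /lookup => ->; case: d => [_|/= p0]; eexists; try reflexivity.
- split=> //=; first by rewrite sz.
  move=> i; rewrite /upd -HT -sz -(nth_catrev_set l r s s') /=.
  apply: nth_catrev2 => -[|j] //=.
  by case: r {HT} => //=; case: j => [|j] //=; rewrite nth_nil.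
- case: l sz HT => [|x l] /= sz HT; first lia.
  split=> //=; first by rewrite -sz.
  by move=> i; rewrite /upd -HT -sz -[catrev l _]/(catrev (x :: l) _) (nth_catrev_set (x :: l) r s s').
Qed.

(** Unlike [run], which stays put after halting, this is [None] beyond the halting time and can
    therefore express divergence. *)
Definition srun M t c := iter t (obind (step M)) (Some c).

Lemma srunD M t u c c' c'' :
  srun M t c = Some c' -> srun M u c' = Some c'' -> srun M (u + t) c = Some c''.
Proof. by rewrite /srun iterD => ->. Qed.

Lemma srun_run M t c c' : srun M t c = Some c' -> run M t c = c'.
Proof.
rewrite /srun /run; elim: t c' => [|t IH] c' /=; first by case.
by case E: (iter t _ (Some c)) => [d|] //= h; rewrite (IH _ E) h.
Qed.

(** At least one step is demanded so that infinitely many rounds of a loop give arbitrarily long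
    runs in [machine_diverges]. *)
Definition goes M q p T q' p' T' := forall c, rep c q p T ->
  exists t c', [/\ 0 < t, srun M t c = Some c' & rep c' q' p' T'].

Lemma goes_trans M q p T q1 p1 T1 q2 p2 T2 :
  goes M q p T q1 p1 T1 -> goes M q1 p1 T1 q2 p2 T2 -> goes M q p T q2 p2 T2.
Proof.
move=> H1 H2 c /H1[t [c1 [t0 r1 /H2[u [c2 [u0 r2 rp]]]]]].
by exists (u + t), c2; split; [lia|exact: srunD r1 r2|].
Qed.

(** Each register is stored in unary on its own track. A cell with all bits clear and no marker has
    symbol 0, so the tape is blank beyond all registers. *)
Definition tape (s : nat -> nat) p := enc (p == 0) (mkseq (fun r => p < s r) k).

Definition holds M b P := forall q m bs, size bs = k -> b <= q < b + size P ->
  lookup M (q, enc m bs) =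
  let: (q', bs', d) := nth rule0 P (q - b) m bs in Some (q', enc m bs', d).

Lemma holds_cat M b P Q : holds M b (P ++ Q) <-> holds M b P /\ holds M (b + size P) Q.
Proof.
split=> [H|[H1 H2] q m bs sz qb].
  split=> q m bs sz qb; rewrite H // ?size_cat ?nth_cat; try lia.
    by have -> : q - b < size P by lia.
  have -> : (q - b < size P) = false by lia.
  by rewrite subnDA.
rewrite size_cat in qb; rewrite nth_cat; case: ifP => h; first by apply: H1 => //; lia.
by rewrite H2 ?subnDA //; lia.
Qed.

Lemma goes1 M b P q p s (d : bool) q' bs' :
  holds M b P -> b <= q < b + size P ->
  nth rule0 P (q - b) (p == 0) (mkseq (fun r => p < s r) k) = (q', bs', d) ->
  d || (0 < p) ->
  goes M q p (tape s) q' (if d then p.+1 else p.-1) (upd (tape s) p (enc (p == 0) bs')).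
Proof.
move=> H qb E dp c rc.
have [|c' st rc'] := rep_step (M := M) (q' := q') (s' := enc (p == 0) bs') (d := d) rc _ dp.
  by rewrite /tape (H q) ?size_mkseq // E.
by exists 1, c'; split.
Qed.

Lemma upd_tape s p : upd (tape s) p (enc (p == 0) (mkseq (fun r => p < s r) k)) = tape s.
Proof. by apply: boolp.funext => i; rewrite /upd; case: eqP => [->|]. Qed.

Lemma goes1_id M b P q p s (d : bool) q' :
  holds M b P -> b <= q < b + size P ->
  nth rule0 P (q - b) (p == 0) (mkseq (fun r => p < s r) k) =
    (q', mkseq (fun r => p < s r) k, d) ->
  d || (0 < p) ->
  goes M q p (tape s) q' (if d then p.+1 else p.-1) (tape s).
Proof. by move=> H qb E dp; have := goes1 H qb E dp; rewrite upd_tape. Qed.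

Lemma set_nth_mkseq (f : nat -> bool) r b : r < k ->
  set_nth false (mkseq f k) r b = mkseq (fun i => if i == r then b else f i) k.
Proof.
move=> rk; apply: (@eq_from_nth _ false).
  by rewrite size_set_nth !size_mkseq; lia.
move=> i; rewrite size_set_nth size_mkseq => hi; rewrite nth_set_nth /=.
by rewrite !nth_mkseq //; try lia; case: eqP => // _; rewrite nth_mkseq //; lia.
Qed.

Lemma goes_back M q ex p s : holds M q (back q ex) ->
  goes M q p (tape s) ex 0 (tape s).
Proof.
move=> H; elim: p => [|p IH].
  apply: goes_trans (_ : goes M q.+1 1 (tape s) ex 0 (tape s)).
    by apply: (goes1_id H (d := true)) => //=; [lia|rewrite subnn].
  apply: (goes1_id H (d := false)) => //=; first lia.
  by have -> : q.+1 - q = 1 by lia.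
apply: goes_trans IH.
by apply: (goes1_id H (d := false)) => //=; [lia|rewrite subnn].
Qed.

Lemma goes_right M b P q r n s p : r < k -> holds M b P -> b <= q < b + size P ->
  (forall m bs, nth false bs r -> nth rule0 P (q - b) m bs = (q, bs, true)) ->
  p + n.+1 = s r -> goes M q p (tape s) q (s r) (tape s).
Proof.
move=> rk H qb E; elim: n p => [|n IH] p e.
  have -> : s r = p.+1 by lia.
  apply: (goes1_id H (d := true)) => //; rewrite E // nth_mkseq //; lia.
apply: goes_trans (IH p.+1 _); last by lia.
apply: (goes1_id H (d := true)) => //; rewrite E // nth_mkseq //; lia.
Qed.

Lemma upd_tape_inc s r b p : r < k ->
  upd (tape s) p (enc (p == 0) (set_nth false (mkseq (fun r => p < s r) k) r b)) =
  (fun i => enc (i == 0) (mkseq (fun j => if (i == p) && (j == r) then b else i < s j) k)).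
Proof.
move=> rk; apply: boolp.funext => i; rewrite /upd; case: eqP => [->|] //.
by rewrite set_nth_mkseq.
Qed.

Lemma tape_inc s r : r < k ->
  upd (tape s) (s r) (enc (s r == 0) (set_nth false (mkseq (fun j => s r < s j) k) r true)) =
  tape (upd s r (s r).+1).
Proof.
move=> rk; rewrite upd_tape_inc //; apply: boolp.funext => i; congr enc.
apply: (@eq_from_nth _ false); rewrite ?size_mkseq // => j jk.
by rewrite !nth_mkseq // /upd; case: (j =P r) => [->|]; rewrite ?andbF ?andbT //=; case: (eqVneq i); lia.
Qed.

Lemma tape_dec s r : r < k -> 0 < s r ->
  upd (tape s) (s r).-1 (enc ((s r).-1 == 0)
    (set_nth false (mkseq (fun j => (s r).-1 < s j) k) r false)) =
  tape (upd s r (s r).-1).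
Proof.
move=> rk s0; rewrite upd_tape_inc //; apply: boolp.funext => i; congr enc.
apply: (@eq_from_nth _ false); rewrite ?size_mkseq // => j jk.
by rewrite !nth_mkseq // /upd; case: (j =P r) => [->|]; rewrite ?andbF ?andbT //=; case: (eqVneq i); lia.
Qed.

Lemma rule_at0 x P m bs : nth rule0 (x :: P) 0 m bs = x m bs. Proof. by []. Qed.

(** The induction is on the execution, so the later rounds of a terminating loop are covered by a
    sub-derivation for the same program. *)
Lemma compile_ok M c s s' : exec c s s' -> regs_lt k c ->
  forall q ex, holds M q (cmp c q ex) -> goes M q 0 (tape s) ex 0 (tape s').
Proof.
elim=> {c s s'}.
- move=> r s /= rk q ex H.
  have /(holds_cat _ _ [:: _])[_ Hb] := H.
  have G : goes M q (s r) (tape s) q.+1 (s r).+1 (tape (upd s r (s r).+1)).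
    rewrite -tape_inc //; apply: (goes1 H (d := true)) => //=; first lia.
    by rewrite subnn rule_at0 nth_mkseq // ltnn.
  have {}G : goes M q 0 (tape s) q.+1 (s r).+1 (tape (upd s r (s r).+1)).
    case: (posnP (s r)) => s0; first by move: G; rewrite s0.
    apply: goes_trans G; apply: (goes_right (n := (s r).-1) rk H) => //=; try lia.
    by move=> m bs h; rewrite subnn rule_at0 h.
  by apply: goes_trans G _; apply: goes_back; move: Hb; rewrite addn1.
- move=> r s /= rk q ex H.
  have /(holds_cat _ _ [:: _])[_ Hb] := H; rewrite addn1 in Hb.
  have /(holds_cat _ _ (back q.+1 ex))[{}Hb _] := Hb.
  case: (posnP (s r)) => s0.
    have -> : upd s r (s r).-1 = s.
      by apply: boolp.funext => i; rewrite /upd; case: eqP => // ->; rewrite s0.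
    apply: goes_trans (_ : goes M q.+2 1 (tape s) ex 0 (tape s)).
      apply: (goes1_id H (d := true)) => //=; first lia.
      by rewrite subnn rule_at0 nth_mkseq // s0.
    apply: (goes1_id H (d := false)) => //=; first lia.
    by have -> : q.+2 - q = 2 by lia.
  apply: goes_trans (_ : goes M q (s r) (tape s) ex 0 (tape (upd s r (s r).-1))).
    apply: (goes_right (n := (s r).-1) rk H) => //=; try lia.
    by move=> m bs h; rewrite subnn rule_at0 h.
  apply: goes_trans (_ : goes M q.+3 (s r).-1 (tape s) ex 0 (tape (upd s r (s r).-1))).
    apply: (goes1_id H (d := false)) => //=; first lia.
    rewrite subnn rule_at0 nth_mkseq // ltnn.
    by have -> : (s r == 0) = false by lia.
  apply: goes_trans _ (goes_back Hb).
  rewrite -tape_dec //; apply: (goes1 H (d := true)) => //=; first lia.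
  by have -> : q.+3 - q = 3 by lia.
- move=> c d s1 s2 s3 _ IH1 _ IH2 /= /andP[k1 k2] q ex /holds_cat[H1 H2].
  by rewrite size_cmp in H2; apply: goes_trans (IH1 k1 _ _ H1) (IH2 k2 _ _ H2).
- move=> r c s s0 /= /andP[rk _] q ex H.
  apply: goes_trans (_ : goes M q.+2 1 (tape s) ex 0 (tape s)).
    apply: (goes1_id H (d := true)) => //=; first lia.
    by rewrite subnn rule_at0 nth_mkseq // s0.
  apply: (goes1_id H (d := false)) => //=; first lia.
  by have -> : q.+2 - q = 2 by lia.
- move=> r c s1 s2 s3 s0 _ IH1 _ IH2 /= /andP[rk kc] q ex H.
  have /(holds_cat _ _ [:: _; _; _])[_ Hb] := H; rewrite addn3 in Hb.
  apply: goes_trans (_ : goes M q.+1 1 (tape s1) ex 0 (tape s3)).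
    apply: (goes1_id H (d := true)) => //=; first lia.
    by rewrite subnn rule_at0 nth_mkseq //; have -> : 0 < s1 r by lia.
  apply: goes_trans (_ : goes M q.+3 0 (tape s1) ex 0 (tape s3)).
    apply: (goes1_id H (d := false)) => //=; first lia.
    by have -> : q.+1 - q = 1 by lia.
  by apply: goes_trans (IH1 kc _ _ Hb) _; apply: IH2 => //=; rewrite rk.
Qed.
End Compile.
End Machines.

(** * Machines with a parameter, and compilation of expressions *)

Section Programs.

Section Machine.
Variables (k : nat) (main : cmd).

Definition entry := (3 + len main).

(* The [i]-th block increments register 1, so that running blocks [a], ..., 0
   passes the parameter [a + 1] to the main program. *)
Definition block i := table k (entry + 3 * i)
  (cmp (Inc 1) (entry + 3 * i) (if i is j.+1 then entry + 3 * j else 3)).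

(** State 1 turns the cells whose bit 0 is set into plain ones and halts on the first other cell.
    Further registers may leave non-blank cells behind, but bit 0 is clear there, so their symbol is
    even and [output] does not count it. *)
Definition fixed_part : turing_machine :=
  [seq ((1, enc z.1 z.2), (1, 1, true)) | z <- symbols k & head false z.2] ++
  table k 3 (cmp main 3 1).

(** Symbol 1 encodes an unmarked cell with only bit 0 set, so the input block already is register 0
    in unary. Only the marker has to be added to cell 0; state 2 then brings the head back and jumps
    to block [a]. *)
Definition param_part a : turing_machine :=
  [:: ((0, 0), (2, enc true (nseq k false), true));
      ((0, 1), (2, (enc true (nseq k false)).+1, true))] ++
  table k 2 [:: fun _ bs => (entry + 3 * a, bs, false)].

(** The parameter only affects a jump target and the number of blocks; this is what makes [machine]
    computable in [a]. *)
Definition machine a : turing_machine :=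
  param_part a ++ fixed_part ++ flatten [seq block i | i <- iota 0 a.+1].

Hypothesis k2 : 1 < k.
Hypothesis km : regs_lt k main.

Lemma lookup_param a q m bs : size bs = k -> q != 0 -> q != 2 ->
  lookup (param_part a) (q, enc m bs) = None.
Proof.
move=> sz q0 q2; rewrite lookup_cat lookup_none.
  rewrite lookup_table //; case: ifP => //= h; lia.
by rewrite /= andbT; apply/andP; split; apply: contra q0 => /eqP[<-].
Qed.

Lemma lookup_fixed q m bs : size bs = k -> (q < 3) || (entry <= q) -> q != 1 ->
  lookup fixed_part (q, enc m bs) = None.
Proof.
move=> sz qb q1; rewrite lookup_cat lookup_none.
  rewrite lookup_table // size_cmp; case: ifP => //= h; rewrite /entry in qb; lia.
by apply/allP => t /mapP[z _ ->]; apply: contra q1 => /eqP[<-].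
Qed.

Lemma lookup_blocks q m bs a : size bs = k -> q < entry ->
  lookup (flatten [seq block i | i <- iota 0 a]) (q, enc m bs) = None.
Proof.
move=> sz qb; elim: iota => //= i s IH; rewrite lookup_cat lookup_table //.
by case: ifP => // h; lia.
Qed.

Lemma lookup_block q m bs a i : size bs = k -> i <= a ->
  entry + 3 * i <= q < entry + 3 * i + 3 ->
  lookup (flatten [seq block i | i <- iota 0 a.+1]) (q, enc m bs) =
  lookup (block i) (q, enc m bs).
Proof.
move=> sz ia qb; have : i \in iota 0 a.+1 by rewrite mem_iota; lia.
elim: iota => //= j s IH; rewrite in_cons; case: eqVneq => [<-|ij] /= h; rewrite lookup_cat.
  have : lookup (block i) (q, enc m bs) <> None.
    rewrite lookup_table //; case: ifP => [_|/= h2]; last lia.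
    by case: (nth _ _ _ _ _) => [[]].
  by case: (lookup (block i)).
rewrite {1}/block lookup_table //; case: ifP => [/= h'|_]; first lia.
exact: IH.
Qed.

Lemma holds_z a : holds k (machine a) 2 [:: fun _ bs => (entry + 3 * a, bs, false)].
Proof.
move=> q m bs sz /= qb; have {qb} -> : q = 2 by lia.
rewrite !lookup_cat lookup_none // lookup_table //=.
Qed.

Lemma holds_main a : holds k (machine a) 3 (cmp main 3 1).
Proof.
move=> q m bs sz; rewrite size_cmp => qb.
rewrite !lookup_cat -lookup_cat lookup_param //; try lia.
rewrite lookup_none; first by rewrite lookup_table // size_cmp qb; case: (nth _ _ _ _ _) => [[]].
apply/allP => t /mapP[z _ ->] /=; apply: contraTN qb => /eqP[<-]; lia.
Qed.

Lemma holds_block a i : i <= a ->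
  holds k (machine a) (entry + 3 * i)
   (cmp (Inc 1) (entry + 3 * i) (if i is j.+1 then entry + 3 * j else 3)).
Proof.
move=> ia q m bs sz /= qb; have ge: 3 <= entry by rewrite /entry; lia.
rewrite lookup_cat lookup_param //; try lia; rewrite lookup_cat lookup_fixed //; try lia.
by rewrite (lookup_block _ (i := i)) ?lookup_table //= qb.
Qed.

Definition input n a r := if r is 0 then n else if r is 1 then a else 0.

Lemma goes_blocks a n i : i <= a -> goes (machine a) (entry + 3 * i) 0
   (tape k (input n (a - i))) 3 0 (tape k (input n a.+1)).
Proof.
move=> ia; have G j b : j <= a -> goes (machine a) (entry + 3 * j) 0 (tape k (input n b))
    (if j is l.+1 then entry + 3 * l else 3) 0 (tape k (input n b.+1)).
  move=> ja; have -> : input n b.+1 = upd (input n b) 1 (input n b 1).+1.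
    by apply: boolp.funext => -[|[|r]].
  by apply: compile_ok (EInc 1 _) _ _ _ (holds_block ja).
elim: i ia => [|i IH] ia; first by have := G 0 (a - 0) isT; rewrite subn0.
apply: goes_trans (G _ _ ia) _.
have -> : (a - i.+1).+1 = a - i by lia.
by apply: IH; lia.
Qed.

Lemma machine_start a n : exists t c, [/\ srun (machine a) t (initial_config n) = Some c &
  rep c 3 0 (tape k (input n a.+1))].
Proof.
pose T i : nat := i < n.
have R0 : rep (initial_config n) 0 0 T.
  split=> // i /=; rewrite {}/T; case: n => [|n] /=; first by case: i => [|[]].
  by case: i => [|i] //=; rewrite nth_nseq; case: ltnP => ?; case: ltnP; lia.
have G0 : goes (machine a) 0 0 T 2 1 (tape k (input n 0)).
  move=> c rc.
  have ez p : mkseq (fun r => p < input n 0 r) k = (p < n) :: nseq k.-1 false.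
    apply: (@eq_from_nth _ false); first by rewrite /= size_mkseq size_nseq; lia.
    by move=> [|i]; rewrite size_mkseq => ik; rewrite nth_mkseq //= nth_nseq; case: ifP; case: i ik.
  have U : upd T 0 (enc true (mkseq (fun r => 0 < input n 0 r) k)) = tape k (input n 0).
    apply: boolp.funext => -[|i]; rewrite /upd /tape //= ez /T /=.
    by have -> : enc false (nseq k.-1 false) = 0; [elim: k.-1 => //= j ->|rewrite addn0].
  have [|c' st rc'] := rep_step (M := machine a) (q' := 2) (d := true)
     (s' := enc true (mkseq (fun r => 0 < input n 0 r) k)) rc _ isT.
    rewrite /machine /param_part /T ez; have -> : nseq k false = false :: nseq k.-1 false by case: k k2.
    by case: n {R0 T U ez rc} => [|n]; rewrite /machine /lookup /=.
  exists 1, c'; split=> //; move: rc'; rewrite U //.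
have G1 : goes (machine a) 2 1 (tape k (input n 0)) (entry + 3 * a) 0 (tape k (input n 0)).
  by apply: (goes1_id (holds_z (a := a)) (d := false)).
have G2 := @goes_blocks a n a (leqnn a); rewrite subnn in G2.
have [t [c [_ r rc]]] := goes_trans G0 (goes_trans G1 G2) R0.
by exists t, c.
Qed.

Lemma count_ones (L : seq nat) m :
  (forall i, (nth 0 L i == 1) = (i < m)) -> count_mem 1 L = m.
Proof.
elim: L m => [|x L IH] m H /=; first by have := H 0; case: m {H}.
case: m H => [|m] H; have := H 0 => /= ->.
  by rewrite (IH 0) // => i; exact: (H i.+1).
by rewrite (IH m) // => i; exact: (H i.+1).
Qed.

Lemma machine_halt a c s : rep c 1 0 (tape k s) ->
  exists t c', [/\ srun (machine a) t c = Some c', step (machine a) c' = None & output c' = s 0].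
Proof.
(* [T p] is the tape whose first [p] cells have already been rewritten. *)
pose T p i := if i < p then 1 else tape k s i.
have -> : tape k s = T 0 by apply: boolp.funext => i; rewrite /T ltn0.
have L1 m bs : size bs = k -> lookup (machine a) (1, enc m bs) =
    if head false bs then Some (1, 1, true) else None.
  move=> sz; rewrite lookup_cat lookup_param // lookup_cat.
  have e1 : 1 < entry by rewrite /entry; lia.
  rewrite lookup_blocks //.
  rewrite lookup_cat lookup_table //=; case: ifP => hb.
    rewrite (@lookup_map _ (fun z => (1, enc z.1 z.2)) (fun=> (1, 1, true)) _ (m, bs)) //.
      move=> [m1 b1] [m2 b2]; rewrite !mem_filter !symbolsP => /andP[_ /eqP h1] /andP[_ /eqP h2].
      by move=> [/enc_inj[|-> ->]] //; rewrite h1.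
    by rewrite mem_filter /= hb symbolsP sz /=.
  rewrite lookup_none //; apply/allP => t /mapP[[m1 b1]]; rewrite mem_filter symbolsP /=.
  move=> /andP[hb1 /eqP sz1] -> /=; apply/negP => /eqP[/enc_inj[|_ e]]; first by rewrite sz1.
  by rewrite e hb in hb1.
have main_loop d p c0 : p + d = s 0 -> rep c0 1 p (T p) ->
  exists t c', srun (machine a) t c0 = Some c' /\ rep c' 1 (s 0) (T (s 0)).
  elim: d p c0 => [|d IH] p c0 e rc; first by exists 0, c0; split=> //; rewrite -e addn0.
  have [|c1 st rc1] := rep_step (M := machine a) (q' := 1) (s' := 1) (d := true) rc _ isT.
    rewrite /T ltnn L1 ?size_mkseq //; case: k k2 => //= k' _.
    by have -> : p < s 0 by lia.
  have [||t [c' [r rc']]] := IH p.+1 c1; first lia.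
    move: rc1; have -> // : upd (T p) p 1 = T p.+1.
    by apply: boolp.funext => i; rewrite /upd /T ltnS; case: ltngtP.
  by exists (t + 1), c'; split=> //; apply: srunD r.
move=> /(main_loop (s 0) 0 c (add0n _)) [t [c' [r rc']]]; exists t, c'; split=> //.
  have := rep_scanned rc'; case: c' {r} rc' => q l x y [/= -> sz HT] ->.
  have := L1 (s 0 == 0) (mkseq (fun r => s 0 < s r) k); rewrite size_mkseq => /(_ erefl).
  rewrite /T ltnn /lookup /tape => ->; by case: k k2 => //= k' _; rewrite ltnn.
have -> : output c' = count_mem 1 (catrev (left_tape c') (scanned c' :: right_tape c')).
  by rewrite catrevE /output !count_cat count_rev.
apply: count_ones => i; case: rc' => _ _ ->; rewrite /T; case: ltnP => // h.
rewrite /tape; case: k k2 => //= k' _.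
have -> : (i < s 0) = false by lia.
by apply/negP => /eqP; lia.
Qed.

Lemma srun_neq_none M t u c : t <= u -> srun M u c <> None -> srun M t c <> None.
Proof.
move=> /subnK <-; rewrite /srun iterD; case: (iter t _ _) => // H _.
by apply: H; elim: (u - t) => //= n ->.
Qed.

Lemma machine_computes a n s : exec main (input n a.+1) s ->
  tm_computes (machine a) n (s 0).
Proof.
move=> /compile_ok -/(_ _ _ km _ _ (@holds_main a)) G.
have [t [c [r /G[t1 [c1 [_ r1 /(machine_halt a)[t2 [c2 [r2 st o]]]]]]]]] := machine_start a n.
exists (t2 + (t1 + t)).
by rewrite (srun_run (srunD (srunD r r1) r2)).
Qed.

(** Each round of the loop takes at least one step, so for every [i] the strict run is still defined
    at some time [u >= i]; halting at time [t] contradicts this for [i = t.+1]. *)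
Lemma machine_diverges a n (c b d : cmd) r (s : nat -> nat -> nat) m :
  main = Seq (Seq c (While r b)) d -> exec c (input n a.+1) (s 0) ->
  (forall i, s i r <> 0 /\ exec b (s i) (s i.+1)) ->
  ~ tm_computes (machine a) n m.
Proof.
move=> em ec H [t [ht _]].
have [t0 [c0 [r0 rc0]]] := machine_start a n.
have := @holds_main a; have := km; rewrite {1 2}em /= => /andP[/and3P[kc kr kb] _] /holds_cat[/holds_cat[Hc Hw] _].
rewrite size_cmp in Hw; set q := 3 + len c in Hc Hw.
have [t1 [c1 [_ r1 rc1]]] := compile_ok ec kc Hc rc0.
have loop i : exists u c', [/\ i <= u, srun (machine a) u (initial_config n) = Some c' &
    rep c' q 0 (tape k (s i))].
  elim: i => [|i [u [c' [iu ru rc']]]]; first by exists (t1 + t0), c1; split=> //; apply: srunD r0 r1.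
  have [si ei] := H i.
  have Hw' := Hw; move: Hw' => /(holds_cat _ _ _ [:: _; _; _])[_]; rewrite addn3 => Hb.
  have G : goes (machine a) q 0 (tape k (s i)) q 0 (tape k (s i.+1)).
    apply: goes_trans (_ : goes (machine a) q.+1 1 (tape k (s i)) q 0 (tape k (s i.+1))).
      apply: (goes1_id Hw (d := true)) => //=; first lia.
      by rewrite subnn rule_at0 nth_mkseq //; have -> : 0 < s i r by lia.
    apply: goes_trans (_ : goes (machine a) q.+3 0 (tape k (s i)) q 0 (tape k (s i.+1))).
      apply: (goes1_id Hw (d := false)) => //=; first lia.
      by have -> : q.+1 - q = 1 by lia.
    exact: compile_ok ei kb _ _ Hb.
  have [v [c2 [v0 rv rd]]] := G _ rc'.
  by exists (v + u), c2; split=> //; [lia|apply: srunD ru rv].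
have [u [c' [tu ru _]]] := loop t.+1.
have h1 : srun (machine a) t.+1 (initial_config n) <> None.
  by apply: srun_neq_none tu _; rewrite ru.
case E: (srun (machine a) t (initial_config n)) => [c3|]; last first.
  by apply: (srun_neq_none (leqnSn t) h1).
by move: h1 ht; rewrite /srun iterS -/(srun _ _ _) E /= (srun_run E) => h1 h2.
Qed.
End Machine.

Lemma regs_ltW k k' c : k <= k' -> regs_lt k c -> regs_lt k' c.
Proof.
move=> h; elim: c => //= [r|r|c IHc d IHd /andP[/IHc-> /IHd->] //|r c IHc /andP[rk /IHc->]]; try lia.
Qed.

Lemma regs_bound c : exists k, regs_lt k c.
Proof.
elim: c => /= [r|r|c [k1 h1] d [k2 h2]|r c [k1 h1]]; try by exists r.+1.
  by exists (maxn k1 k2); rewrite !(regs_ltW _ h1, regs_ltW _ h2) //; lia.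
by exists (maxn r.+1 k1); rewrite (regs_ltW _ h1) //; lia.
Qed.

(* Variables are de Bruijn indices; [Iter n z s] binds [n] in [z], and the
   accumulator and the number of remaining iterations in [s]. *)
Inductive expr := Var of nat | Zero | Succ of expr | Let of expr & expr
  | Iter of expr & expr & expr.

Fixpoint loop (f : nat -> nat -> nat) k a :=
  if k is k'.+1 then loop f k' (f a k') else a.

Fixpoint eval (env : seq nat) e : nat := match e with
  | Var i => nth 0 env i
  | Zero => 0
  | Succ e => (eval env e).+1
  | Let e1 e2 => eval (eval env e1 :: env) e2
  | Iter n z s =>
      let N := eval env n in
      loop (fun a k => eval (a :: k :: env) s) N (eval (N :: env) z) end.

Definition clear r := While r (Dec r).
Definition move a b := While a (Seq (Dec a) (Inc b)).

(** The environment sits in the registers below [m], the innermost variable in [m - 1]; the result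
    goes to register [m], and all registers from [m] on are 0 at the start. Hence [While m (Inc m)]
    does nothing and leaves the value 0. Reading a variable empties its register, so a second copy
    is made in [m.+1] and moved back. *)
Fixpoint comp m e : cmd := match e with
  | Var i => if i < m then
      Seq (While (m - i.+1) (Seq (Dec (m - i.+1)) (Seq (Inc m) (Inc m.+1))))
          (move m.+1 (m - i.+1)) else While m (Inc m)
  | Zero => While m (Inc m)
  | Succ e => Seq (comp m e) (Inc m)
  | Let e1 e2 => Seq (Seq (comp m e1) (comp m.+1 e2)) (Seq (clear m) (move m.+1 m))
  | Iter n z s => Seq (Seq (comp m n) (comp m.+1 z))
     (Seq (While m (Seq (Dec m) (Seq (comp m.+2 s) (Seq (clear m.+1) (move m.+2 m.+1)))))
       (move m.+1 m)) end.

Lemma exec_clear r s : exec (clear r) s (upd s r 0).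
Proof.
move: {2}(s r) (erefl (s r)) => n; elim: n s => [|n IH] s e.
  have -> : upd s r 0 = s; last exact: EWhileF.
  by apply: boolp.funext => i; rewrite /upd; case: eqP => // ->.
apply: (EWhileT (s2 := upd s r (s r).-1)); [by rewrite e|exact: EDec|].
have -> : upd s r 0 = upd (upd s r (s r).-1) r 0.
  by apply: boolp.funext => i; rewrite /upd; case: eqP.
by apply: IH; rewrite /upd eqxx e.
Qed.

Lemma exec_move a b s : a != b ->
  exec (move a b) s (upd (upd s b (s b + s a)) a 0).
Proof.
move=> ab; move: {2}(s a) (erefl (s a)) => n; elim: n s => [|n IH] s e.
  have -> : upd (upd s b (s b + s a)) a 0 = s; last exact: EWhileF.
  by apply: boolp.funext => i; rewrite /upd; case: eqP => [->|_] //; case: eqP => // ->; lia.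
have ba : b == a = false by rewrite eq_sym (negbTE ab).
pose s1 := upd s a (s a).-1; pose s2 := upd s1 b (s1 b).+1.
apply: (EWhileT (s2 := s2)); [by rewrite e|exact: ESeq (EDec _ _) (EInc _ _)|].
have -> : upd (upd s b (s b + s a)) a 0 = upd (upd s2 b (s2 b + s2 a)) a 0.
  apply: boolp.funext => i; rewrite /s2 /s1 /upd !eqxx (negbTE ab) ba.
  by case: eqP => // _; case: eqP => // _; lia.
by apply: IH; rewrite /s2 /s1 /upd (negbTE ab) eqxx e.
Qed.

Lemma exec_dup j m s : j < m -> exists2 s', exec
  (While j (Seq (Dec j) (Seq (Inc m) (Inc m.+1)))) s s' &
  s' = upd (upd (upd s m.+1 (s m.+1 + s j)) m (s m + s j)) j 0.
Proof.
move=> jm; eexists; last reflexivity.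
move: {2}(s j) (erefl (s j)) => n; elim: n s => [|n IH] s e.
  set s' := upd _ _ _; have -> : s' = s; last exact: EWhileF.
  apply: boolp.funext => i; rewrite /s' /upd e !addn0.
  by do 3 (case: eqP => [->|_] //).
pose s1 := upd s j (s j).-1; pose s2 := upd s1 m (s1 m).+1; pose s3 := upd s2 m.+1 (s2 m.+1).+1.
apply: (EWhileT (s2 := s3)); [by rewrite e|exact: ESeq (EDec _ _) (ESeq (EInc _ _) (EInc _ _))|].
have e3 : [/\ s3 j = (s j).-1, s3 m = (s m).+1 & s3 m.+1 = (s m.+1).+1].
  by rewrite /s3 /s2 /s1 /upd; split; repeat (case: eqP => //; try lia).
have := IH s3; case: e3 => -> -> ->; rewrite e => /(_ erefl) /=.
set u := upd _ _ _; set v := upd _ _ _; have -> // : u = v.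
apply: boolp.funext => i; rewrite /u /v /s3 /s2 /s1 /upd.
by repeat (case: eqP => //= ?; try lia).
Qed.

(** The reversal makes a pushed value occupy the next free register without moving the others. A top
    value 0 is indistinguishable from no value, so clearing a register pops it. *)
Definition st (env : seq nat) i := nth 0 (rev env) i.

Lemma stE env i : st env i = if i < size env then nth 0 env (size env - i.+1) else 0.
Proof. by rewrite /st; case: ltnP => h; [rewrite nth_rev|rewrite nth_default ?size_rev]. Qed.

Lemma st_cons x env i : st (x :: env) i = if i == size env then x else st env i.
Proof. by rewrite /st rev_cons nth_rcons size_rev; case: ltngtP => // h; rewrite nth_default ?size_rev; lia. Qed.

Lemma exec_comp e env : exec (comp (size env) e) (st env) (st (eval env e :: env)).
Proof.
have st0 env' : st (0 :: env') = st env'.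
  by apply: boolp.funext => i; rewrite st_cons; case: eqP => // ->; rewrite stE ltnn.
have sts env' : st env' (size env') = 0 by rewrite stE ltnn.
have mv0 b env' : exec (move (size env').+1 (size env')) (st [:: b, 0 & env']) (st (b :: env')).
  set s := st _; have := @exec_move (size env').+1 (size env') s.
  rewrite neq_ltn ltnSn orbT => /(_ isT); set u := upd _ _ _; have -> // : u = st (b :: env').
  apply: boolp.funext => i; rewrite /u /s /upd !st_cons /= !eqxx.
  have -> : (size env' == (size env').+1) = false by lia.
  case: (eqVneq i) => [->|h1]; first by rewrite stE; repeat (case: ifP => //; try lia).
  by case: eqP.
have mv a b env' : exec (Seq (clear (size env')) (move (size env').+1 (size env')))
    (st (b :: a :: env')) (st (b :: env')).
  apply: ESeq (exec_clear _ _) _; have := mv0 b env'; set s := st _; set u := upd _ _ _.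
  have -> // : s = u; apply: boolp.funext => i; rewrite /u /s /upd !st_cons /=.
  by case: (eqVneq i (size env')) => [->|//]; case: eqP => //; lia.
elim: e env => [i||e IH|e1 IH1 e2 IH2|n IHn z IHz b IHb] env /=.
- case: ltnP => im; last by rewrite nth_default // st0; exact/EWhileF/sts.
  set m := size env in im *; set j := m - i.+1; have jm : j < m by lia.
  have [s' es' e'] := @exec_dup j m (st env) jm; apply: ESeq es' _.
  have := @exec_move m.+1 j s'; rewrite neq_ltn ltnS (ltnW jm) orbT => /(_ isT).
  set u := upd _ _ _; have -> // : u = st (nth 0 env i :: env).
  have v0 : st env m.+1 = 0 by rewrite stE; case: ltnP => //; lia.
  have v1 : st env j = nth 0 env i by rewrite stE -/m jm; congr nth; lia.
  apply: boolp.funext => l; rewrite st_cons -/m /u e' /upd v0 sts -v1 !eqxx.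
  by repeat (case: eqP => //= ?; try lia); subst.
- by rewrite st0; exact/EWhileF/sts.
- apply: ESeq (IH env) _; have := EInc (size env) (st (eval env e :: env)).
  rewrite st_cons eqxx; set u := upd _ _ _; have -> // : u = st ((eval env e).+1 :: env).
  by apply: boolp.funext => i; rewrite /u /upd !st_cons; case: eqP.
- by apply: ESeq (mv _ _ _); apply: ESeq (IH1 env) (IH2 (_ :: env)).
- set N := eval env n; set L := loop _.
  apply: ESeq (ESeq (IHn env) (IHz (_ :: env))) _; rewrite -/N.
  move: (eval (N :: env) z) => a; apply: ESeq (_ : exec _ _ (st (L N a :: 0 :: env))) _.
    elim: N a => [|N IH] a /=; first by apply: EWhileF; rewrite !st_cons /= eqxx; case: eqP => //; lia.
    apply: EWhileT (IH _); first by rewrite !st_cons /= eqxx; case: eqP => //; lia.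
    have := EDec (size env) (st (a :: N.+1 :: env)); set u := upd _ _ _.
    have -> : u = st (a :: N :: env).
      apply: boolp.funext => i; rewrite /u /upd !st_cons /= eqxx.
      by case: eqP => [->|_] //; case: eqP; lia.
    move=> h; apply: ESeq h _; apply: ESeq (IHb [:: a, N & env]) (mv _ _ (N :: env)).
  exact: mv0.
Qed.
End Programs.

(** * Arithmetic and coding of sequences by expressions *)

Section Expressions.

Definition up (r : nat -> nat) i := if i is j.+1 then (r j).+1 else 0.

Fixpoint ren r e := match e with
  | Var i => Var (r i) | Zero => Zero | Succ e => Succ (ren r e)
  | Let e1 e2 => Let (ren r e1) (ren (up r) e2)
  | Iter n z s => Iter (ren r n) (ren (up r) z) (ren (up (up r)) s) end.

Lemma up_nth r env env' x : (forall i, nth 0 env' i = nth 0 env (r i)) ->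
  forall i, nth 0 (x :: env') i = nth 0 (x :: env) (up r i).
Proof. by move=> H [|i] /=. Qed.

Lemma eval_ren e r env env' : (forall i, nth 0 env' i = nth 0 env (r i)) ->
  eval env (ren r e) = eval env' e.
Proof.
elim: e r env env' => //= [e IH|e1 IH1 e2 IH2|n IHn z IHz s IHs] r env env' H.
- by rewrite (IH _ _ _ H).
- by rewrite (IH1 _ _ _ H); apply: IH2; apply: up_nth.
- rewrite (IHn _ _ _ H) (IHz _ _ (eval env' n :: env')); last exact: up_nth.
  elim: (eval env' n) (eval _ z) => //= k IH a.
  by rewrite (IHs _ _ (a :: k :: env')) ?IH //; do 2 apply: up_nth.
Qed.

Definition E (F : seq nat -> nat) := exists e, forall env, eval env e = F env.

Lemma E_ext F G : F =1 G -> E F -> E G.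
Proof. by move=> h [e H]; exists e => env; rewrite H h. Qed.

Lemma E_ren F (g : seq nat -> seq nat) r :
  (forall env i, nth 0 (g env) i = nth 0 env (r i)) -> E F -> E (fun env => F (g env)).
Proof. by move=> H [e h]; exists (ren r e) => env; rewrite (eval_ren _ (H env)) h. Qed.

Lemma E_var i : E (fun env => nth 0 env i). Proof. by exists (Var i). Qed.
Lemma E_succ F : E F -> E (fun env => (F env).+1).
Proof. by move=> [e H]; exists (Succ e) => env /=; rewrite H. Qed.
Lemma E_const n : E (fun=> n).
Proof. by elim: n => [|n IH]; [exists Zero|exact: E_succ]. Qed.
Lemma E_let F G : E F -> E G -> E (fun env => G (F env :: env)).
Proof. by move=> [e H] [f h]; exists (Let e f) => env /=; rewrite H h. Qed.
Lemma E_loop N Z S : E N -> E Z -> E S ->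
  E (fun env => loop (fun a k => S [:: a, k & env]) (N env) (Z (N env :: env))).
Proof.
move=> [n Hn] [z Hz] [s Hs]; exists (Iter n z s) => env /=; rewrite Hn Hz.
by elim: (N env) (Z _) => //= k IH a; rewrite IH Hs.
Qed.
Lemma E_loop' N Z S : E N -> E Z -> E S ->
  E (fun env => loop (fun a k => S [:: a, k & env]) (N env) (Z env)).
Proof.
move=> hN hZ; apply: (E_loop (Z := fun env => Z (behead env))) hN _.
by apply: (E_ren (g := behead) (r := succn) _ hZ) => env i; rewrite nth_behead.
Qed.

Definition E1 f := E (fun env => f (nth 0 env 0)).
Definition E2 (f : nat -> nat -> nat) := E (fun env => f (nth 0 env 0) (nth 0 env 1)).

Lemma E1_app f F : E1 f -> E F -> E (fun env => f (F env)).
Proof. by move=> hf hF; have := E_let hF hf. Qed.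
Lemma E2_app f F G : E2 f -> E F -> E G -> E (fun env => f (F env) (G env)).
Proof.
move=> hf hF hG; have := E_let hG (E_let (F := fun env => F (behead env)) _ hf); apply.
by apply: (E_ren (g := behead) (r := succn) _ hF) => env i; rewrite nth_behead.
Qed.

Definition cond (c a b : nat) := if c is 0 then b else a.
(** A branch is a loop whose body ignores the accumulator: no round keeps the initial value, any
    positive number of rounds gives the other one. *)
Lemma E_cond F G H : E F -> E G -> E H -> E (fun env => cond (F env) (G env) (H env)).
Proof.
move=> hF hG hH.
have := E_loop' (S := fun env => G (behead (behead env))) hF hH.
have hG' : E (fun env => G (behead (behead env))).
  by apply: (E_ren (g := fun e => behead (behead e)) (r := fun i => i.+2) _ hG) => env i; rewrite !nth_behead.
move=> /(_ hG'); apply: E_ext => env /=.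
have L x m : loop (fun _ _ => x) m x = x by elim: m.
by case: (F env) => //= n; rewrite L.
Qed.

(** The counter of remaining rounds equals [n.-1] in the first round; an accumulator that is nonzero
    is kept from then on. *)
Lemma E1_pred : E1 predn.
Proof.
have := E_loop' (E_var 0) (E_const 0) (E_cond (E_var 0) (E_var 0) (E_var 1)).
apply: E_ext => env /=; case: (nth 0 env 0) => //= n.
have H m a : 0 < a -> loop (fun a k => cond a a k) m a = a by elim: m a => //= m IH [|a] // _; exact: IH.
by case: n => //= n; rewrite H.
Qed.

Lemma E2_add : E2 addn.
Proof.
have := E_loop' (E_var 0) (E_var 1) (E_succ (E_var 0)).
by apply: E_ext => env /=; elim: (nth 0 env 0) (nth 0 env 1) => //= n IH m; rewrite IH addnS.
Qed.
Lemma E2_sub : E2 subn.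
Proof.
have := E_loop' (E_var 1) (E_var 0) (E1_app E1_pred (E_var 0)).
apply: E_ext => env /=; elim: (nth 0 env 1) (nth 0 env 0) => /= [m|n IH m]; first by rewrite subn0.
by rewrite IH subnS -predn_sub; lia.
Qed.
Lemma E2_mul : E2 muln.
Proof.
have := E_loop' (E_var 0) (E_const 0) (E2_app E2_add (E_var 0) (E_var 3)).
apply: E_ext => env /=; suff H n a m : loop (fun a _ => a + m) n a = a + n * m by rewrite H.
by elim: n a => [|n IH] a /=; rewrite ?IH; lia.
Qed.
Lemma E2_exp : E2 expn.
Proof.
have := E_loop' (E_var 1) (E_const 1) (E2_app E2_mul (E_var 0) (E_var 2)).
apply: E_ext => env /=; suff H n a m : loop (fun a _ => a * m) n a = a * m ^ n by rewrite H mul1n.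
by elim: n a => [|n IH] a /=; rewrite ?muln1 // IH expnS mulnA.
Qed.
Lemma E2_leq : E2 leq.
Proof.
have := E_cond (E2_app E2_sub (E_var 0) (E_var 1)) (E_const 0) (E_const 1).
by apply: E_ext => env /=; rewrite /leq; case: (_ - _).
Qed.
Lemma E2_eq : E2 (fun a b => a == b).
Proof.
have := E2_app E2_mul (E2_app E2_leq (E_var 0) (E_var 1)) (E2_app E2_leq (E_var 1) (E_var 0)).
by apply: E_ext => env /=; case: ltngtP.
Qed.

(** The counter descends, so the last overwriting comes from the smallest hit; the value is 0 if
    there is none. *)
Definition least (p : nat -> nat) n := loop (fun a k => cond (p k) k a) n 0.

Lemma leastP p n k : k < n -> p k != 0 -> (forall j, p j != 0 -> j = k) -> least p n = k.
Proof.
move=> kn pk uk; rewrite /least; move: kn 0.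
have L m a : m <= k -> loop (fun a k => cond (p k) k a) m a = a.
  elim: m a => //= m IH a mk; case E : (p m) => [|c] /=; first by apply: IH; lia.
  by have := uk m; rewrite E => /(_ isT); lia.
elim: n => //= n IH kn a; case: (ltngtP k n) => h; [exact: IH|lia|].
by rewrite -h L //; case: (p k) pk.
Qed.

Lemma E_least P N : E P -> E N -> E (fun env => least (fun k => P (k :: env)) (N env)).
Proof.
move=> hP hN.
have hP' : E (fun env => P (nth 0 env 1 :: behead (behead env))).
  by apply: (E_ren (g := fun env => nth 0 env 1 :: behead (behead env)) (r := succn) _ hP) => env [|i] //=; rewrite !nth_behead.
exact: (E_loop' hN (E_const 0) (E_cond hP' (E_var 1) (E_var 0))).
Qed.

(** The cons operation of [CodeSeq.code], by which MathComp pickles sequences and hence pairs. *)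
Definition ncons a c := 2 ^ a * c.*2.+1.

Lemma ncons_gt0 a c : 0 < ncons a c. Proof. by rewrite /ncons muln_gt0 expn_gt0. Qed.

Lemma E2_ncons : E2 ncons.
Proof.
have := E2_app E2_mul (E2_app E2_exp (E_const 2) (E_var 0))
   (E_succ (E2_app E2_add (E_var 1) (E_var 1))).
by apply: E_ext => env /=; rewrite /ncons addnn.
Qed.

Lemma ncons_decode a c : CodeSeq.decode (ncons a c) = a :: CodeSeq.decode c.
Proof. by rewrite -{1}[c]CodeSeq.decodeK -[ncons _ _]/(CodeSeq.code (a :: CodeSeq.decode c)) CodeSeq.codeK. Qed.

Lemma ncons_inj a c a' c' : ncons a c = ncons a' c' -> a = a' /\ c = c'.
Proof.
move=> /(congr1 CodeSeq.decode); rewrite !ncons_decode => -[-> /(congr1 CodeSeq.code)].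
by rewrite !CodeSeq.decodeK.
Qed.

Lemma ncons_bound a c : a < (ncons a c).+1 /\ c < (ncons a c).+1.
Proof.
have := CodeSeq.ltn_code (a :: CodeSeq.decode c); rewrite /= CodeSeq.decodeK => /andP[h _].
split; first exact: ltnW. 
have : 0 < 2 ^ a by rewrite expn_gt0.
by rewrite /ncons; nia.
Qed.

Definition nhead c := nth 0 (CodeSeq.decode c) 0.
Definition ntail c := CodeSeq.code (behead (CodeSeq.decode c)).

Lemma ncons_cases c : c = 0 \/ exists a d, c = ncons a d.
Proof.
rewrite -[c]CodeSeq.decodeK; case: (CodeSeq.decode c) => [|a s]; first by left.
by right; exists a, (CodeSeq.code s).
Qed.

Lemma nhead_cons a c : nhead (ncons a c) = a. Proof. by rewrite /nhead ncons_decode. Qed.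
Lemma ntail_cons a c : ntail (ncons a c) = c.
Proof. by rewrite /ntail ncons_decode /= CodeSeq.decodeK. Qed.

Definition bex (p : nat -> nat) n := loop (fun a k => cond (p k) 1 a) n 0.

Lemma bexP p n : reflect (exists2 k, k < n & p k != 0) (bex p n == 1).
Proof.
have H m a : loop (fun a k => cond (p k) 1 a) m a = 1 <-> a = 1 \/ exists2 k, k < m & p k != 0.
  elim: m a => [|m IH] a /=; first by split; [left|case=> [//|[]]].
  split=> [/IH[]|].
  - by case E : (p m) => [|c] /= h; [left|right; exists m => //; rewrite E].
  - by move=> [k km pk]; right; exists k => //; lia.
  case=> [->|[k km pk]]; apply/IH; first by left; case: (p m).
  case: (ltngtP k m) => h; [by right; exists k|lia|left].
  by rewrite -h; case: (p k) pk.
by apply: (iffP eqP) => [/H[]//|h]; apply/H; right.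
Qed.

Lemma E_bex P N : E P -> E N -> E (fun env => bex (fun k => P (k :: env)) (N env)).
Proof.
move=> hP hN.
have hP' : E (fun env => P (nth 0 env 1 :: behead (behead env))).
  by apply: (E_ren (g := fun env => nth 0 env 1 :: behead (behead env)) (r := succn) _ hP) => env [|i] //=; rewrite !nth_behead.
exact: (E_loop' hN (E_const 0) (E_cond hP' (E_const 1) (E_var 0))).
Qed.

Lemma bex_le1 p n : bex p n = (bex p n == 1) :> nat.
Proof.
have H m a : a <= 1 -> loop (fun a k => cond (p k) 1 a) m a <= 1.
  by elim: m a => //= m IH a a1; apply: IH; case: (p m).
by have := H n 0 isT; rewrite -/(bex p n); case: (bex p n) => [|[]].
Qed.

(** Both components of [ncons a d] are bounded by the code, so decoding is a bounded search. The
    code 0 of the empty sequence falls on the default 0 of [least]. *)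
Lemma E1_nhead : E1 nhead.
Proof.
have := E_least (E_bex (E2_app E2_eq (E2_app E2_ncons (E_var 1) (E_var 0)) (E_var 2))
  (E_succ (E_var 1))) (E_succ (E_var 0)).
apply: E_ext => env /=; set c := nth 0 env 0.
case: (ncons_cases c) => [->|[a [d ec]]].
  by [].
have -> : nhead c = a by rewrite ec nhead_cons.
have [ba bd] := ncons_bound a d; rewrite -ec in ba bd.
apply: leastP => //.
  by rewrite bex_le1; have -> // : bex (fun k => ncons a k == c) c.+1 == 1; apply/bexP; exists d => //; rewrite ec eqxx.
move=> j; rewrite bex_le1; case: bexP => // -[k _].
by rewrite ec eqb0 negbK => /eqP/ncons_inj[].
Qed.

Lemma E1_ntail : E1 ntail.
Proof.
have := E_least (E2_app E2_eq (E2_app E2_ncons (E1_app E1_nhead (E_var 1)) (E_var 0)) (E_var 1))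
  (E_succ (E_var 0)).
apply: E_ext => env /=; set c := nth 0 env 0.
case: (ncons_cases c) => [->|[a [d ec]]].
  by [].
have eh : nhead c = a by rewrite ec nhead_cons.
have -> : ntail c = d by rewrite ec ntail_cons.
have [ba bd] := ncons_bound a d; rewrite -ec in ba bd.
apply: leastP => //; first by rewrite eh -ec eqxx.
by move=> j; rewrite eh ec eqb0 negbK => /eqP/ncons_inj[].
Qed.
End Expressions.

(** * Computable functions on countable types *)

Section Typed.
Local Open Scope nat_scope.

(* [C f]: the function [f] is computable, arguments and values being coded by
   [pickle]. *)
Definition C (T U : countType) (f : T -> U) :=
  exists2 F, E1 F & forall x, F (pickle x) = pickle (f x).

Implicit Types T U V W A : countType.

Definition npair a b := ncons a (ncons b 0).
Lemma E2_npair : E2 npair.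
Proof. exact: (E2_app E2_ncons (E_var 0) (E2_app E2_ncons (E_var 1) (E_const 0))). Qed.
Lemma pickle_pair T U (x : T) (y : U) : pickle (x, y) = npair (pickle x) (pickle y).
Proof. by []. Qed.
Lemma pickle_cons T (x : T) s : pickle (x :: s) = ncons (pickle x) (pickle s).
Proof. by []. Qed.
Lemma pickle_bool (b : bool) : pickle b = b. Proof. by case: b. Qed.
Lemma pickle_nat (n : nat) : pickle n = n. Proof. by []. Qed.
Lemma pickle_inj T : injective (@pickle T).
Proof. exact: pcan_inj pickleK. Qed.

Lemma C_ext T U (f g : T -> U) : f =1 g -> C f -> C g.
Proof. by move=> h [F eF H]; exists F => // x; rewrite H h. Qed.

Lemma C_comp T U V (g : U -> V) (f : T -> U) : C g -> C f -> C (fun x => g (f x)).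
Proof.
move=> [G eG hG] [F eF hF]; exists (G \o F); last by move=> x /=; rewrite hF hG.
exact: (E1_app eG eF).
Qed.

Lemma C_E1 T U V F (g : U -> V) (f : T -> U) : E1 F ->
  (forall y, F (pickle y) = pickle (g y)) -> C f -> C (fun x => g (f x)).
Proof. by move=> eF hF; apply: C_comp; exists F. Qed.

Lemma C_E2 T U V W F (g : U -> V -> W) (f1 : T -> U) (f2 : T -> V) : E2 F ->
  (forall x y, F (pickle x) (pickle y) = pickle (g x y)) ->
  C f1 -> C f2 -> C (fun x => g (f1 x) (f2 x)).
Proof.
move=> eF hF [F1 e1 h1] [F2 e2 h2]; exists (fun n => F (F1 n) (F2 n)).
  exact: (E2_app eF e1 e2).
by move=> x; rewrite h1 h2 hF.
Qed.

Lemma C_id T : C (fun x : T => x).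
Proof. by exists id => //; exact: E_var. Qed.
Lemma C_const T U (c : U) : C (fun _ : T => c).
Proof. by exists (fun=> pickle c) => //; exact: E_const. Qed.
Lemma C_pair T U V (f : T -> U) (g : T -> V) : C f -> C g -> C (fun x => (f x, g x)).
Proof.
exact: (C_E2 E2_npair).
Qed.
Lemma C_fst T U V (f : T -> U * V) : C f -> C (fun x => (f x).1).
Proof. by apply: (C_E1 E1_nhead) => -[a b]; exact: nhead_cons. Qed.
Lemma C_snd T U V (f : T -> U * V) : C f -> C (fun x => (f x).2).
Proof.
apply: (C_E1 (F := nhead \o ntail)); first exact: (E1_app E1_nhead E1_ntail).
by case=> a b; rewrite pickle_pair /npair /= ntail_cons nhead_cons.
Qed.
Lemma C_S T (f : T -> nat) : C f -> C (fun x => (f x).+1).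
Proof. by apply: (C_E1 (F := succn)) => //; exact: E_succ (E_var 0). Qed.
Lemma C_pred T (f : T -> nat) : C f -> C (fun x => (f x).-1).
Proof. by apply: (C_E1 E1_pred). Qed.
Lemma C_addn T (f g : T -> nat) : C f -> C g -> C (fun x => f x + g x).
Proof. by apply: (C_E2 E2_add). Qed.
Lemma C_subn T (f g : T -> nat) : C f -> C g -> C (fun x => f x - g x).
Proof. by apply: (C_E2 E2_sub). Qed.
Lemma C_muln T (f g : T -> nat) : C f -> C g -> C (fun x => f x * g x).
Proof. by apply: (C_E2 E2_mul). Qed.
Lemma C_expn T (f g : T -> nat) : C f -> C g -> C (fun x => f x ^ g x).
Proof. by apply: (C_E2 E2_exp). Qed.
Lemma C_leq T (f g : T -> nat) : C f -> C g -> C (fun x => f x <= g x).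
Proof. by apply: (C_E2 E2_leq). Qed.
Lemma C_eq T U (f g : T -> U) : C f -> C g -> C (fun x => f x == g x).
Proof. by apply: (C_E2 E2_eq) => x y; rewrite (inj_eq (@pickle_inj U)). Qed.
Lemma C_andb T (f g : T -> bool) : C f -> C g -> C (fun x => f x && g x).
Proof. by apply: (C_E2 E2_mul) => -[] []. Qed.
Lemma C_negb T (f : T -> bool) : C f -> C (fun x => ~~ f x).
Proof.
by apply: (C_E1 (F := fun n => 1 - n)); [exact: (E2_app E2_sub (E_const 1) (E_var 0))|case].
Qed.
Lemma C_orb T (f g : T -> bool) : C f -> C g -> C (fun x => f x || g x).
Proof.
move=> hf hg; apply: (C_ext (f := fun x => ~~ (~~ f x && ~~ g x))).
  by move=> x; rewrite negb_and !negbK.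
exact/C_negb/C_andb/C_negb/hg/C_negb.
Qed.
Lemma C_implb T (f g : T -> bool) : C f -> C g -> C (fun x => f x ==> g x).
Proof.
move=> hf hg; apply: (C_ext (f := fun x => ~~ f x || g x)); first by move=> x; rewrite implybE.
exact/C_orb/hg/C_negb.
Qed.
Lemma C_nat_of_bool T (f : T -> bool) : C f -> C (fun x => nat_of_bool (f x)).
Proof. by case=> F eF h; exists F. Qed.
Lemma C_if T U (b : T -> bool) (f g : T -> U) : C b -> C f -> C g ->
  C (fun x => if b x then f x else g x).
Proof.
move=> [B eB hB] [F eF hF] [G eG hG]; exists (fun n => cond (B n) (F n) (G n)).
  exact: E_cond.
by move=> x; rewrite hB hF hG; case: (b x).
Qed.

Lemma C_cons T U (f : T -> U) (g : T -> seq U) : C f -> C g -> C (fun x => f x :: g x).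
Proof. by apply: (C_E2 E2_ncons). Qed.
Lemma C_behead T U (f : T -> seq U) : C f -> C (fun x => behead (f x)).
Proof. by apply: (C_E1 E1_ntail) => -[|a s] //; rewrite pickle_cons ntail_cons. Qed.
Lemma C_head T U (a : T -> U) (f : T -> seq U) : C a -> C f -> C (fun x => head (a x) (f x)).
Proof.
apply: (C_E2 (F := fun a s => cond s (nhead s) a)).
  exact: (E_cond (E_var 1) (E1_app E1_nhead (E_var 1)) (E_var 0)).
move=> b [|x s] //; rewrite pickle_cons nhead_cons /=.
by case: (ncons _ _) (ncons_gt0 (pickle x) (pickle s)).
Qed.

Fixpoint rloop (U : Type) (f : U -> nat -> U) k a :=
  if k is k'.+1 then rloop f k' (f a k') else a.

Lemma C_rloop T U (n : T -> nat) (z : T -> U) (s : T -> U -> nat -> U) :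
  C n -> C z -> C (fun y : T * (U * nat) => s y.1 y.2.1 y.2.2) ->
  C (fun x => rloop (s x) (n x) (z x)).
Proof.
move=> [N eN hN] [Z eZ hZ] [F eF hF].
exists (fun x => loop (fun a k => F (npair x (npair a k))) (N x) (Z x)).
  apply: (E_loop' (S := fun env => F (npair (nth 0 env 2) (npair (nth 0 env 0) (nth 0 env 1))))) => //.
  exact: (E1_app eF (E2_app E2_npair (E_var 2) (E2_app E2_npair (E_var 0) (E_var 1)))).
move=> x; rewrite hN hZ pickle_nat; elim: (n x) (z x) => //= k IH a.
by rewrite -IH; congr loop; rewrite -[npair (pickle a) _]/(pickle (a, k)) -pickle_pair hF.
Qed.

Lemma C_iter T U (n : T -> nat) (z : T -> U) (s : T -> U -> U) :
  C n -> C z -> C (fun y : T * U => s y.1 y.2) -> C (fun x => iter (n x) (s x) (z x)).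
Proof.
move=> hn hz hs; apply: (C_ext (f := fun x => rloop (fun a _ => s x a) (n x) (z x))).
  by move=> x; elim: (n x) (z x) => //= k IH a; rewrite IH -iterSr.
apply: C_rloop => //; apply: (C_comp (f := fun y : T * (U * nat) => (y.1, y.2.1)) hs).
by apply: C_pair; [apply: C_fst; exact: C_id|apply/C_fst/C_snd; exact: C_id].
Qed.

Lemma size_pickle T (s : seq T) : size s <= pickle s.
Proof.
elim: s => //= x s IH; rewrite pickle_cons /ncons.
have : 0 < 2 ^ pickle x by rewrite expn_gt0.
by nia.
Qed.

(** The accumulator is carried at the head of the remaining list. The code of the list serves as the
    number of rounds, being at least its length; surplus rounds find an empty tail and change
    nothing. *)
Lemma C_foldl T U A (l : T -> seq A) (z : T -> U) (s : T -> U -> A -> U) :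
  C l -> C z -> C (fun y : T * (U * A) => s y.1 y.2.1 y.2.2) ->
  C (fun x => foldl (s x) (z x) (l x)).
Proof.
move=> [L eL hL] [Z eZ hZ] [F eF hF].
pose G x a := cond (ntail a) (ncons (F (npair x (npair (nhead a) (nhead (ntail a))))) (ntail (ntail a))) a.
exists (fun x => nhead (loop (fun a k => G x a) (L x) (ncons (Z x) (L x)))).
  apply: (E1_app E1_nhead); apply: (E_loop' (S := fun env => G (nth 0 env 2) (nth 0 env 0))) => //.
    exact: (E2_app E2_ncons).
  have v := E_var; have c0 := E_const 0; rewrite /G.
  have t0 := E1_app E1_ntail (v 0); have h0 := E1_app E1_nhead (v 0).
  apply: E_cond => //; apply: (E2_app E2_ncons); last exact: (E1_app E1_ntail).
  exact: (E1_app eF (E2_app E2_npair (v 2) (E2_app E2_npair h0 (E1_app E1_nhead t0)))).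
move=> x; rewrite hL hZ.
suff H n t a : size t <= n -> nhead (loop (fun a _ => G (pickle x) a) n
    (ncons (pickle a) (pickle t))) = pickle (foldl (s x) a t).
  by apply: H; exact: size_pickle.
elim: n t a => [|n IH] [|b t] a //=.
- by rewrite nhead_cons.
- by move=> _; rewrite -[RHS](IH [::] a) // /G ntail_cons.
move=> h; rewrite -(IH t) //; congr (nhead (loop _ _ _)).
rewrite /G pickle_cons !ntail_cons !nhead_cons.
rewrite -!pickle_pair hF /=.
by case: (ncons _ _) (ncons_gt0 (pickle b) (pickle t)).
Qed.

Lemma C_rev T U (l : T -> seq U) : C l -> C (fun x => rev (l x)).
Proof.
move=> h; apply: (C_ext (f := fun x => foldl (fun acc a => a :: acc) [::] (l x))).
  by move=> x; rewrite /rev; elim: (l x) [::] => //=.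
apply: C_foldl => //; [exact: C_const|apply: C_cons].
  exact/C_snd/C_snd/C_id.
exact/C_fst/C_snd/C_id.
Qed.

Lemma C_cat T U (l m : T -> seq U) : C l -> C m -> C (fun x => l x ++ m x).
Proof.
move=> h k; apply: (C_ext (f := fun x => foldl (fun acc a => a :: acc) (m x) (rev (l x)))).
  by move=> x; rewrite -[in RHS](revK (l x)) -catrevE; elim: (rev (l x)) (m x) => //=.
apply: C_foldl => //; [exact: C_rev|apply: C_cons].
  exact/C_snd/C_snd/C_id.
exact/C_fst/C_snd/C_id.
Qed.

Lemma C_map T U A (l : T -> seq A) (s : T -> A -> U) :
  C l -> C (fun y : T * A => s y.1 y.2) -> C (fun x => [seq s x a | a <- l x]).
Proof.
move=> h k; apply: (C_ext (f := fun x => rev (foldl (fun acc a => s x a :: acc) [::] (l x)))).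
  move=> x; have H t (acc : seq U) : rev (foldl (fun acc a => s x a :: acc) acc t) = rev acc ++ map (s x) t.
    by elim: t acc => [|b t IH] acc /=; rewrite ?cats0 // IH rev_cons cat_rcons.
  by rewrite H.
apply: C_rev; apply: C_foldl => //; [exact: C_const|apply: C_cons].
  apply: (C_comp (f := fun y : T * (seq U * A) => (y.1, y.2.2)) k).
  by apply: C_pair; [exact/C_fst/C_id|exact/C_snd/C_snd/C_id].
exact/C_fst/C_snd/C_id.
Qed.

Lemma C_flatten T U (l : T -> seq (seq U)) : C l -> C (fun x => flatten (l x)).
Proof.
move=> h; apply: (C_ext (f := fun x => foldl (fun acc a => acc ++ a) [::] (l x))).
  move=> x; rewrite -[RHS]/([::] ++ flatten (l x)); elim: (l x) [::] => [|a t IH] acc /=.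
    by rewrite cats0.
  by rewrite IH catA.
apply: C_foldl => //; [exact: C_const|apply: C_cat].
  exact/C_fst/C_snd/C_id.
exact/C_snd/C_snd/C_id.
Qed.

Lemma C_all T A (l : T -> seq A) (p : T -> A -> bool) :
  C l -> C (fun y : T * A => p y.1 y.2) -> C (fun x => all (p x) (l x)).
Proof.
move=> h k; apply: (C_ext (f := fun x => foldl (fun b a => b && p x a) true (l x))).
  move=> x; rewrite -[RHS]/(true && _); elim: (l x) true => [|a t IH] b /=; first by rewrite andbT.
  by rewrite IH andbA.
apply: C_foldl => //; [exact: C_const|apply: C_andb; first exact/C_fst/C_snd/C_id].
apply: (C_comp (f := fun y : T * (bool * A) => (y.1, y.2.2)) k).
by apply: C_pair; [exact/C_fst/C_id|exact/C_snd/C_snd/C_id].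
Qed.

Lemma C_has T A (l : T -> seq A) (p : T -> A -> bool) :
  C l -> C (fun y : T * A => p y.1 y.2) -> C (fun x => has (p x) (l x)).
Proof.
move=> h k; apply: (C_ext (f := fun x => ~~ all (fun a => ~~ p x a) (l x))).
  by move=> x; rewrite -has_predC; apply: eq_has => a /=; rewrite negbK.
by apply: C_negb; apply: C_all => //; exact: C_negb.
Qed.

Lemma C_filter T A (l : T -> seq A) (p : T -> A -> bool) :
  C l -> C (fun y : T * A => p y.1 y.2) -> C (fun x => [seq a <- l x | p x a]).
Proof.
move=> h k; apply: (C_ext (f := fun x => flatten [seq if p x a then [:: a] else [::] | a <- l x])).
  by move=> x; elim: (l x) => //= a t ->; case: (p x a).
apply: C_flatten; apply: C_map => //; apply: C_if => //; last exact: C_const.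
by apply: C_cons; [exact/C_snd/C_id|exact: C_const].
Qed.

Lemma C_iota T (m n : T -> nat) : C m -> C n -> C (fun x => iota (m x) (n x)).
Proof.
move=> h k; apply: (C_ext (f := fun x => rloop (fun a k => (m x + k) :: a) (n x) [::])).
  move=> x; rewrite -[RHS]cats0; elim: (n x) [::] => // j IH s.
  by rewrite [LHS]/= IH -addn1 iotaD -catA.
apply: C_rloop => //; first exact: C_const.
apply: C_cons; last exact/C_fst/C_snd/C_id.
apply: C_addn; last exact/C_snd/C_snd/C_id.
exact: (C_comp h (C_fst (C_id _))).
Qed.

Lemma C_size T U (l : T -> seq U) : C l -> C (fun x => size (l x)).
Proof.
move=> h; apply: (C_ext (f := fun x => foldl (fun n _ => n.+1) 0 (l x))).
  by move=> x; rewrite -[RHS]/(0 + _); elim: (l x) 0 => [|a t IH] n /=; rewrite ?addn0 // IH addSnnS.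
by apply: C_foldl => //; [exact: C_const|exact/C_S/C_fst/C_snd/C_id].
Qed.

Lemma C_nth T U (d : T -> U) (l : T -> seq U) (i : T -> nat) : C d -> C l -> C i ->
  C (fun x => nth (d x) (l x) (i x)).
Proof.
move=> hd hl hi; apply: (C_ext (f := fun x => head (d x) (iter (i x) behead (l x)))).
  by move=> x; elim: (i x) (l x) => [|k IH] [|a t] //; rewrite iterSr // IH /= nth_nil.
apply: C_head => //; apply: (C_iter (s := fun _ => behead)) => //.
exact/C_behead/C_snd/C_id.
Qed.

Lemma C_Some T U (f : T -> U) : C f -> C (fun x => Some (f x)).
Proof. by apply: (C_E1 (F := fun n => ncons n 0)) => //; exact: (E2_app E2_ncons (E_var 0) (E_const 0)). Qed.

(** An option is coded like the sequence of its at most one element, so matching becomes a fold. *)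
Lemma C_omatch T U A (o : T -> option A) (s : T -> A -> U) (z : T -> U) :
  C o -> C (fun y : T * A => s y.1 y.2) -> C z ->
  C (fun x => if o x is Some a then s x a else z x).
Proof.
move=> [F eF hF] hs hz.
have h : C (fun x => seq_of_opt (o x)) by exists F.
apply: (C_ext (f := fun x => foldl (fun _ a => s x a) (z x) (seq_of_opt (o x)))).
  by move=> x; case: (o x).
apply: C_foldl => //.
apply: (C_comp (f := fun y : T * (U * A) => (y.1, y.2.2)) hs).
by apply: C_pair; [exact/C_fst/C_id|exact/C_snd/C_snd/C_id].
Qed.

End Typed.

(** A hook, refilled later with [::=] so that [comp] also handles the operations treated after this
    point. *)
Ltac comp_ext := fail.
Ltac comp_step := first [ assumption |
  match goal with H : C ?g |- C (fun x => ?g (@?f x)) => refine (C_comp (f := f) H _) end | lazymatch goal with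
  | |- C (fun x => x) => exact (C_id _)
  | |- C (fun _ => ?c) => exact (C_const _ c)
  | |- C (fun x => (@?f x, @?g x)) => refine (C_pair (f := f) (g := g) _ _)
  | |- C (fun x => fst (@?f x)) => refine (C_fst (f := f) _)
  | |- C (fun x => snd (@?f x)) => refine (C_snd (f := f) _)
  | |- C (fun x => S (@?f x)) => refine (C_S (f := f) _)
  | |- C (fun x => predn (@?f x)) => refine (C_pred (f := f) _)
  | |- C (fun x => addn (@?f x) (@?g x)) => refine (C_addn (f := f) (g := g) _ _)
  | |- C (fun x => subn (@?f x) (@?g x)) => refine (C_subn (f := f) (g := g) _ _)
  | |- C (fun x => muln (@?f x) (@?g x)) => refine (C_muln (f := f) (g := g) _ _)
  | |- C (fun x => expn (@?f x) (@?g x)) => refine (C_expn (f := f) (g := g) _ _)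
  | |- C (fun x => leq (@?f x) (@?g x)) => refine (C_leq (f := f) (g := g) _ _)
  | |- C (fun x => eq_op (@?f x) (@?g x)) => refine (C_eq (f := f) (g := g) _ _)
  | |- C (fun x => andb (@?f x) (@?g x)) => refine (C_andb (f := f) (g := g) _ _)
  | |- C (fun x => orb (@?f x) (@?g x)) => refine (C_orb (f := f) (g := g) _ _)
  | |- C (fun x => implb (@?f x) (@?g x)) => refine (C_implb (f := f) (g := g) _ _)
  | |- C (fun x => negb (@?f x)) => refine (C_negb (f := f) _)
  | |- C (fun x => nat_of_bool (@?f x)) => refine (C_nat_of_bool (f := f) _)
  | |- C (fun x => cons (@?f x) (@?g x)) => refine (C_cons (f := f) (g := g) _ _)
  | |- C (fun x => behead (@?f x)) => refine (C_behead (f := f) _)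
  | |- C (fun x => head (@?a x) (@?f x)) => refine (C_head (a := a) (f := f) _ _)
  | |- C (fun x => rloop (@?s x) (@?n x) (@?z x)) => refine (C_rloop (s := s) (n := n) (z := z) _ _ _)
  | |- C (fun x => iter (@?n x) (@?s x) (@?z x)) => refine (C_iter (s := s) (n := n) (z := z) _ _ _)
  | |- C (fun x => foldl (@?s x) (@?z x) (@?l x)) => refine (C_foldl (s := s) (l := l) (z := z) _ _ _)
  | |- C (fun x => rev (@?f x)) => refine (C_rev (l := f) _)
  | |- C (fun x => cat (@?f x) (@?g x)) => refine (C_cat (l := f) (m := g) _ _)
  | |- C (fun x => map (@?s x) (@?l x)) => refine (C_map (s := s) (l := l) _ _)
  | |- C (fun x => flatten (@?f x)) => refine (C_flatten (l := f) _)
  | |- C (fun x => all (@?s x) (@?l x)) => refine (C_all (p := s) (l := l) _ _)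
  | |- C (fun x => has (@?s x) (@?l x)) => refine (C_has (p := s) (l := l) _ _)
  | |- C (fun x => seq.filter (@?s x) (@?l x)) => refine (C_filter (p := s) (l := l) _ _)
  | |- C (fun x => iota (@?s x) (@?l x)) => refine (C_iota (m := s) (n := l) _ _)
  | |- C (fun x => size (@?f x)) => refine (C_size (l := f) _)
  | |- C (fun x => nth (@?d x) (@?l x) (@?i x)) => refine (C_nth (d := d) (l := l) (i := i) _ _ _)
  | |- C (fun x => Some (@?f x)) => refine (C_Some (f := f) _)
  | |- C (fun x => match (@?b x) with true => _ | false => _ end) =>
      refine (C_if (b := b) _ _ _)
  | |- C (fun x => match (@?o x) with Some _ => _ | None => _ end) =>
      refine (C_omatch (o := o) _ _ _)
  | |- C (fun x => _) => comp_ext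
  | |- @C ?T ?U ?f => change (@C T U (fun x => f x)) end ].
Ltac comp := repeat (cbv beta; comp_step).

(** * Effective decoding and simulation of Turing machines *)

Section Data.
Local Open Scope nat_scope.
Implicit Types T U V W A : countType.

Lemma C_ohead T U (f : T -> seq U) : C f -> C (fun x => ohead (f x)).
Proof.
move=> h; apply: (C_ext (f := fun x => foldl (fun acc a =>
  if acc is Some b then Some b else Some a) None (f x))); last by comp.
move=> x; case: (f x) => //= a s.
by elim: s.
Qed.

Lemma C_odflt T U (d : T -> U) (f : T -> option U) : C d -> C f -> C (fun x => odflt (d x) (f x)).
Proof. by move=> hd hf; apply: C_omatch => //; comp. Qed.

Lemma C_count T A (l : T -> seq A) (p : T -> A -> bool) :
  C l -> C (fun y : T * A => p y.1 y.2) -> C (fun x => count (p x) (l x)).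
Proof.
move=> h k; apply: (C_ext (f := fun x => size [seq a <- l x | p x a])).
  by move=> x; rewrite size_filter.
by comp.
Qed.

Lemma C_odd T (f : T -> nat) : C f -> C (fun x => odd (f x)).
Proof.
move=> h; apply: (C_ext (f := fun x => iter (f x) negb false)); last first.
  by apply: (C_iter (s := fun _ => negb)); comp.
by move=> x; elim: (f x) => //= n ->.
Qed.

Lemma C_decode T (f : T -> nat) : C f -> C (fun x => CodeSeq.decode (f x)).
Proof.
case=> F e h; exists F => // x; rewrite h.
by rewrite -[RHS]/(CodeSeq.code (map id _)) map_id CodeSeq.decodeK.
Qed.

Lemma C_unpickle_nat T (f : T -> nat) : C f -> C (fun x => unpickle (f x) : option nat).
Proof. exact: C_Some. Qed.

Lemma C_unpickle_bool T (f : T -> nat) : C f -> C (fun x => unpickle (f x) : option bool).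
Proof. by move=> h; apply: C_Some; exact: C_odd. Qed.

Definition unpicklable U := C (@unpickle U).

Lemma unpickle_pairE U V (n : nat) : unpickle n = 
  (if size (CodeSeq.decode n) == 2 then
     if unpickle (nth 0 (CodeSeq.decode n) 0) is Some x then
       if unpickle (nth 0 (CodeSeq.decode n) 1) is Some y then Some (x, y) else None
     else None
   else None) :> option (U * V).
Proof.
rewrite -[LHS]/(obind (fun y => Some (pair_of_tag y)) (unpickle_tagged (fun=> V) n)).
rewrite /unpickle_tagged.
case: (CodeSeq.decode n) => [|a [|b [|c s]]] //=.
by case: (unpickle a) => //= x; case: (unpickle b).
Qed.

Lemma unpicklable_pair U V : unpicklable U -> unpicklable V -> unpicklable (U * V)%type.
Proof.
move=> hU hV; apply: (C_ext (fun n => esym (unpickle_pairE U V n))).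
have d : C CodeSeq.decode by apply: C_decode; comp.
by rewrite /unpicklable in hU hV; comp.
Qed.

Lemma unpicklable_seq U : unpicklable U -> unpicklable (seq U).
Proof.
move=> hU; apply: (C_ext (f := fun n => Some (flatten
  [seq (if unpickle a is Some x then [:: x] else [::]) | a <- CodeSeq.decode n]) : option (seq U))).
  by move=> n; congr Some; elim: (CodeSeq.decode n) => //= a s ->; case: (unpickle a).
have d : C CodeSeq.decode by apply: C_decode; comp.
by rewrite /unpicklable in hU; comp.
Qed.

Lemma unpicklable_tm : unpicklable turing_machine.
Proof.
have hn : unpicklable nat by apply: C_unpickle_nat; comp.
have hb : unpicklable bool by apply: C_unpickle_bool; comp.
by apply: unpicklable_seq; do ?apply: unpicklable_pair.
Qed.

(** Configurations as nested pairs, a type that comes with a coding. *)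
Definition tconf : Type := (nat * seq nat * (nat * seq nat))%type.
Definition of_conf (c : config) : tconf := (state c, left_tape c, (scanned c, right_tape c)).

Definition tstep (M : turing_machine) (c : tconf) : option tconf :=
  if ohead [seq t.2 | t <- M & t.1 == (c.1.1, c.2.1)] is Some y then
    Some (if y.2 then (y.1.1, y.1.2 :: c.1.2, (head 0 c.2.2, behead c.2.2))
          else (y.1.1, behead c.1.2, (head 0 c.1.2, y.1.2 :: c.2.2))) else None.

Lemma tstepE M c : tstep M (of_conf c) = omap of_conf (step M c).
Proof.
case: c => q l s r; rewrite /tstep /step /=.
by case: (ohead _) => // [[[q' s'] []]].
Qed.

Lemma C_tstep : C (fun x : turing_machine * tconf => tstep x.1 x.2).
Proof. by rewrite /tstep; apply: C_omatch; [apply: C_ohead; apply: C_map|..]; comp. Qed.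

Definition trun M t c := iter t (fun c => odflt c (tstep M c)) c.

Lemma trunE M t c : trun M t (of_conf c) = of_conf (run M t c).
Proof.
rewrite /trun /run; elim: t => //= t ->; rewrite tstepE.
by case: (step _ _).
Qed.

Definition tm_halts (M : turing_machine) (n m t : nat) : bool :=
  let c := trun M t (of_conf (initial_config n)) in
  (tstep M c == None) && (count (pred1 1) (c.1.2 ++ c.2.1 :: c.2.2) == m).

(** Kleene's predicate with a clock [t]: it is decidable and monotone in [t], and [phi] is its
    existential closure. *)
Definition halts (e n m t : nat) : bool :=
  if unpickle e is Some M then tm_halts M n m t else false.

Lemma tm_haltsE M n m t : tm_halts M n m t <->
  let c := run M t (initial_config n) in step M c = None /\ output c = m.
Proof.
rewrite /tm_halts trunE tstepE /=; case: (run _ _ _) => q l s r.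
split=> [/andP[/eqP h /eqP <-]|[-> <-]]; last by rewrite /= eqxx.
by split=> //; case: (step _ _) h.
Qed.

Lemma phiP e n m : phi e n m <-> exists t, halts e n m t.
Proof.
rewrite /phi /halts; case: (unpickle e) => [M|]; last by split=> [[M]|[]].
split=> [[N [->]] [t h]|[t h]]; first by exists t; apply/tm_haltsE.
by exists M => //; exists t; apply/tm_haltsE.
Qed.

Lemma run_stop M t u c : step M (run M t c) = None -> t <= u -> run M u c = run M t c.
Proof.
move=> h /subnK <-; elim: (u - t) => //= n IH; rewrite -[LHS]/(odflt _ (step M (run M (n + t) c))).
by rewrite IH h.
Qed.

Lemma halts_mono e n m t u : halts e n m t -> t <= u -> halts e n m u.
Proof.
rewrite /halts; case: unpickle => // M /tm_haltsE[h o] tu.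
by apply/tm_haltsE; rewrite /= (run_stop h tu).
Qed.

Lemma halts_fun e n m m' t u : halts e n m t -> halts e n m' u -> m = m'.
Proof.
move=> h h'; have {h} := halts_mono h (leq_maxl t u).
have {h'} := halts_mono h' (leq_maxr t u).
by rewrite /halts; case: unpickle => // M /andP[_ /eqP <-] /andP[_ /eqP <-].
Qed.

Lemma phi_fun e n m m' : phi e n m -> phi e n m' -> m = m'.
Proof. by move=> /phiP[t h] /phiP[u h']; exact: halts_fun h h'. Qed.

Lemma C_halts T (e n m t : T -> nat) : C e -> C n -> C m -> C t ->
  C (fun x => halts (e x) (n x) (m x) (t x)).
Proof.
move=> he hn hm ht; apply: (C_omatch (o := fun x => unpickle (e x)) (s := fun x (M : turing_machine) => tm_halts M (n x) (m x) (t x))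
  (z := fun=> false)); comp.
  exact: (C_comp unpicklable_tm).
pose c (y : T * turing_machine) := trun y.2 (t y.1) (of_conf (initial_config (n y.1))).
have e1 U (f : T -> U) : C f -> C (fun y : T * turing_machine => f y.1).
  by move=> h; apply: (C_comp h); comp.
have hc : C c.
  apply: (C_iter (n := fun y => t y.1) (s := fun y c => odflt c (tstep y.2 c))
     (z := fun y => of_conf (initial_config (n y.1)))); first exact: e1.
    rewrite /of_conf /initial_config /=.
    have hq : C (fun y : T * turing_machine => nseq (n y.1) 1).
      apply: (C_ext (f := fun y => rloop (fun s _ => 1 :: s) (n y.1) [::])).
        by move=> y; rewrite -[RHS]cats0; elim: (n _) [::] => //= k IH s; rewrite IH; elim: k {IH} => //= k ->.
      by comp; exact: e1.
    by comp.
  apply: C_odflt; comp; apply: (C_comp (f := fun y : (T * turing_machine) * tconf => (y.1.2, y.2)) C_tstep).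
  by comp.
apply: (C_ext (f := fun y : T * turing_machine => (tstep y.2 (c y) == None) &&
  (count (pred1 1) ((c y).1.2 ++ (c y).2.1 :: (c y).2.2) == m y.1))) => //.
have hs : C (fun y => tstep y.2 (c y)).
  by apply: (C_comp (f := fun y : T * turing_machine => (y.2, c y)) C_tstep); comp.
have hk : C (fun y => count (pred1 1) ((c y).1.2 ++ (c y).2.1 :: (c y).2.2)).
  by apply: (C_count (p := fun _ a => a == 1)); comp.
by comp; apply: e1.
Qed.
End Data.

(** * Computable integer and rational arithmetic *)

Section Naturals.
Local Open Scope nat_scope.
Implicit Types T U V W A : countType.

Lemma C_divn T (f g : T -> nat) : C f -> C g -> C (fun x => f x %/ g x).
Proof.
move=> hf hg; apply: (C_ext (f := fun x => if g x == 0 then 0 else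
  rloop (fun q _ => if q.+1 * g x <= f x then q.+1 else q) (f x) 0)); last first.
  by comp; apply: (C_comp _ (C_fst (C_id _))).
move=> x; case: eqP => [->|/eqP]; rewrite ?divn0 // -lt0n => g0.
have H n q : q <= f x %/ g x -> rloop (fun q _ => if q.+1 * g x <= f x then q.+1 else q) n q =
    minn (q + n) (f x %/ g x).
  elim: n q => [|n IH] q qd /=; first by rewrite addn0; lia.
  by rewrite -leq_divRL //; case: ifP => h; rewrite IH; lia.
by rewrite H // add0n; apply/minn_idPr; exact: leq_div.
Qed.

Lemma C_modn T (f g : T -> nat) : C f -> C g -> C (fun x => f x %% g x).
Proof.
move=> hf hg; apply: (C_ext (f := fun x => f x - f x %/ g x * g x)).
  by move=> x; rewrite {1}(divn_eq (f x) (g x)) addKn.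
by comp; exact: C_divn.
Qed.

Lemma C_gcdn T (f g : T -> nat) : C f -> C g -> C (fun x => gcdn (f x) (g x)).
Proof.
(* One Euclidean step strictly decreases a positive first component, so [f x] rounds suffice. *)
move=> hf hg; pose s (p : nat * nat) := if p.1 == 0 then p else (p.2 %% p.1, p.1).
apply: (C_ext (f := fun x => (iter (f x) s (f x, g x)).2)); last first.
  apply: C_snd; apply: (C_iter (s := fun _ => s)); comp; rewrite /s; comp.
  by apply: C_modn; comp.
move=> x; have H n a b : a <= n -> (iter n s (a, b)).2 = gcdn a b.
  elim: n a b => [|n IH] a b an; first by move: an; rewrite leqn0 => /eqP ->; rewrite gcd0n.
  rewrite iterSr /s /=; case: eqP => [->|/eqP a0]; first by rewrite IH // gcd0n.
  rewrite IH; first by rewrite gcdn_modl gcdnC.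
  by rewrite -ltnS; apply: leq_trans an; rewrite ltn_mod lt0n.
exact: H.
Qed.

(** This pair has the same code as the integer itself, which reduces case analysis on [int] to
    options. *)
Definition opair_of_int (z : int) : option nat * option nat :=
  match z with Posz n => (Some n, None) | Negz n => (None, Some n) end.

Lemma pickle_opair z : pickle (opair_of_int z) = pickle z. Proof. by case: z. Qed.

Lemma C_Posz T (f : T -> nat) : C f -> C (fun x => Posz (f x)).
Proof.
move=> h; have [F e hF] : C (fun x => (Some (f x), None : option nat)) by comp.
by exists F => // x; rewrite hF.
Qed.
Lemma C_Negz T (f : T -> nat) : C f -> C (fun x => Negz (f x)).
Proof.
move=> h; have [F e hF] : C (fun x => (None : option nat, Some (f x))) by comp.
by exists F => // x; rewrite hF.
Qed.
Lemma C_int T U (z : T -> int) (f g : T -> nat -> U) : C z ->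
  C (fun y : T * nat => f y.1 y.2) -> C (fun y : T * nat => g y.1 y.2) ->
  C (fun x => match z x with Posz n => f x n | Negz n => g x n end).
Proof.
move=> hz hf hg; have h : C (fun x => opair_of_int (z x)).
  by case: hz => F e hF; exists F => // x; rewrite hF pickle_opair.
apply: (C_ext (f := fun x => if (opair_of_int (z x)).1 is Some n then f x n else
  if (opair_of_int (z x)).2 is Some n then g x n else f x 0)).
  by move=> x; case: (z x).
comp; apply: (C_comp (f := fun x => (x, 0)) hf); comp.
Qed.

End Naturals.

Ltac comp_ext ::= lazymatch goal with
  | |- C (fun x => divn (@?f x) (@?g x)) => refine (C_divn (f := f) (g := g) _ _)
  | |- C (fun x => modn (@?f x) (@?g x)) => refine (C_modn (f := f) (g := g) _ _)
  | |- C (fun x => gcdn (@?f x) (@?g x)) => refine (C_gcdn (f := f) (g := g) _ _)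
  | |- C (fun x => Posz (@?f x)) => refine (C_Posz (f := f) _)
  | |- C (fun x => Negz (@?f x)) => refine (C_Negz (f := f) _)
  | |- C (fun x => match (@?z x) with Posz _ => _ | Negz _ => _ end) =>
      refine (C_int (z := z) _ _ _) end.

Section Numbers.
Local Open Scope nat_scope.
Implicit Types T U V W A : countType.
Local Open Scope ring_scope.

Lemma C_oppz T (f : T -> int) : C f -> C (fun x => - f x).
Proof.
move=> h; apply: (C_ext (f := fun x => match f x with
  | Posz n => if n == 0%N then Posz 0 else Negz n.-1 | Negz n => Posz n.+1 end)).
  by move=> x; case: (f x) => // -[].
by comp.
Qed.

Lemma C_addz T (f g : T -> int) : C f -> C g -> C (fun x => f x + g x).
Proof.
move=> hf hg; apply: (C_ext (f := fun x => match f x with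
  | Posz m => match g x with Posz n => Posz (m + n)
      | Negz n => if (n < m)%N then Posz (m - n.+1) else Negz (n - m) end
  | Negz m => match g x with Posz n => if (m < n)%N then Posz (n - m.+1) else Negz (m - n)
      | Negz n => Negz (m + n).+1 end end)).
  by move=> x; case: (f x) (g x) => m [] n //; try (case: ifP); lia.
by comp.
Qed.

Lemma C_absz T (f : T -> int) : C f -> C (fun x => `|f x|%N).
Proof.
move=> h; apply: (C_ext (f := fun x => match f x with Posz n => n | Negz n => n.+1 end)).
  by move=> x; case: (f x).
by comp.
Qed.

Lemma C_ltz0 T (f : T -> int) : C f -> C (fun x => f x < 0).
Proof.
move=> h; apply: (C_ext (f := fun x => match f x with Posz n => false | Negz n => true end)).
  by move=> x; case: (f x).
by comp.
Qed.

Lemma C_signz T (b : T -> bool) (n : T -> nat) : C b -> C n ->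
  C (fun x => (-1) ^ (b x) * (n x)%:Z : int).
Proof.
move=> hb hn; apply: (C_ext (f := fun x => if b x then - (n x)%:Z else (n x)%:Z)).
  by move=> x; case: (b x); rewrite /= ?expr0z ?expr1z ?mul1r ?mulN1r.
by comp; apply: C_oppz; comp.
Qed.

Lemma C_mulz T (f g : T -> int) : C f -> C g -> C (fun x => f x * g x).
Proof.
move=> hf hg; apply: (C_ext (f := fun x => (-1) ^ (if f x < 0 then ~~ (g x < 0) else g x < 0) *
  (`|f x| * `|g x|)%N%:Z)).
  move=> x; case: (f x) (g x) => m [] n //=; rewrite ?expr0z ?expr1z; try lia.
apply: C_signz; last by apply: C_muln; exact: C_absz.
by apply: C_if; [|apply: C_negb|]; exact: C_ltz0.
Qed.

Lemma C_lez T (f g : T -> int) : C f -> C g -> C (fun x => f x <= g x).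
Proof.
move=> hf hg; apply: (C_ext (f := fun x => ~~ (g x + - f x < 0))).
  by move=> x; rewrite -leNgt subr_ge0.
by apply/C_negb/C_ltz0/C_addz => //; apply: C_oppz.
Qed.

Lemma C_valq T (f : T -> rat) : C f -> C (fun x => valq (f x)).
Proof. by case=> F e h; exists F. Qed.
Lemma C_numq T (f : T -> rat) : C f -> C (fun x => numq (f x)).
Proof. by move=> /C_valq h; apply: C_fst. Qed.
Lemma C_denq T (f : T -> rat) : C f -> C (fun x => denq (f x)).
Proof. by move=> /C_valq h; apply: C_snd. Qed.

Lemma valq_fracq z : valq (fracq z) = fracq_subdef z.
Proof. by rewrite -fracq_opt_subdef_id; case: z => -[n|n] [[|d]|d]. Qed.

(** A rational has the code of its pair [valq], so only the reduction to lowest terms has to be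
    computed. *)
Lemma C_fracq T (f : T -> int * int) : C f -> C (fun x => fracq (f x)).
Proof.
move=> h; suff [F e hF] : C (fun x => valq (fracq (f x))) by exists F.
apply: (C_ext (f := fun x => fracq_subdef (f x))); first by move=> x; rewrite valq_fracq.
have ha := C_absz (C_fst h); have hb := C_absz (C_snd h).
have hg := C_gcdn ha hb; rewrite /fracq_subdef.
apply: C_if; [by apply: C_negb; comp|apply: C_pair|by comp].
  apply: C_signz; last exact: C_divn.
  apply: (C_ext (f := fun x => if (f x).2 < 0 then ~~ ((f x).1 < 0) else (f x).1 < 0)).
    by move=> x; case: (_ < 0).
  by apply: C_if; [|apply: C_negb|]; apply: C_ltz0; comp.
by apply: C_Posz; exact: C_divn.
Qed.

Lemma C_addq T (f g : T -> rat) : C f -> C g -> C (fun x => f x + g x).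
Proof.
move=> hf hg; apply: (C_ext (f := fun x => fracq
  (numq (f x) * denq (g x) + numq (g x) * denq (f x), denq (f x) * denq (g x)))).
  by move=> x; rewrite -[RHS]/(addq _ _) addq_def addq_subdefE.
by apply: C_fracq; apply: C_pair; [apply: C_addz|]; apply: C_mulz; (apply: C_numq || apply: C_denq).
Qed.

Lemma C_mulq T (f g : T -> rat) : C f -> C g -> C (fun x => f x * g x).
Proof.
move=> hf hg; apply: (C_ext (f := fun x => fracq
  (numq (f x) * numq (g x), denq (f x) * denq (g x)))).
  by move=> x; rewrite fracqE /= !rmorphM /= -mulf_div !divq_num_den.
by apply: C_fracq; apply: C_pair; apply: C_mulz; (apply: C_numq || apply: C_denq).
Qed.

Lemma C_oppq T (f : T -> rat) : C f -> C (fun x => - f x).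
Proof.
move=> hf; apply: (C_ext (f := fun x => (-1) * f x)); first by move=> x; rewrite mulN1r.
by apply: C_mulq => //; comp.
Qed.

Lemma C_leq_rat T (f g : T -> rat) : C f -> C g -> C (fun x => f x <= g x).
Proof.
move=> hf hg; apply: (C_ext (f := fun x => numq (f x) * denq (g x) <= numq (g x) * denq (f x))).
  by move=> x; rewrite -le_ratE.
by apply: C_lez; apply: C_mulz; (apply: C_numq || apply: C_denq).
Qed.

Lemma C_ltq T (f g : T -> rat) : C f -> C g -> C (fun x => f x < g x).
Proof.
move=> hf hg; apply: (C_ext (f := fun x => ~~ (g x <= f x))); first by move=> x; rewrite ltNge.
by apply: C_negb; exact: C_leq_rat.
Qed.
End Numbers.

(** * From computable functions to machine codes *)

Section Phi.
Local Open Scope nat_scope.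
Implicit Types T U : countType.

Lemma exec_st_clear env x : exec (clear (size env)) (st (x :: env)) (st env).
Proof.
have := exec_clear (size env) (st (x :: env)); set u := upd _ _ _; have -> // : u = st env.
by apply: boolp.funext => i; rewrite /u /upd st_cons; case: eqP => [->|//]; rewrite stE ltnn.
Qed.

(** The language has no empty command, so [n.+1] is added; for this reason [search_machine] outputs
    successors only. *)
Lemma exec_incs r n : exists c, forall s, exec c s (upd s r (s r + n.+1)).
Proof.
elim: n => [|n [c H]]; first by exists (Inc r) => s'; rewrite addn1; exact: EInc.
exists (Seq c (Inc r)) => s'; apply: ESeq (H _) _.
set s1 := upd s' r _; have -> : upd s' r (s' r + n.+2) = upd s1 r (s1 r).+1; last exact: EInc.
by apply: boolp.funext => i; rewrite /s1 /upd eqxx; case: eqP => // _; lia.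
Qed.

Lemma C_phi T U (f : T -> U) : C f -> exists e, forall x, phi e (pickle x) (pickle (f x)).
Proof.
case=> F [e he] hF.
(* The single block of [machine k main 0] has put 1 into register 1, which must be cleared first. *)
pose main := Seq (Seq (clear 1) (comp 1 e)) (Seq (clear 0) (move 1 0)).
have [k0 hk] := regs_bound main; pose k := maxn k0 2.
have km : regs_lt k main by apply: regs_ltW hk; exact: leq_maxl.
exists (pickle (machine k main 0)) => x; exists (machine k main 0); first by rewrite pickleK.
set n := pickle x; set m := pickle _.
have -> : m = upd (upd (upd (st [:: m; n]) 0 0) 0 m) 1 0 0 by [].
apply: machine_computes => //; first exact: leq_maxr.
apply: (ESeq (s2 := st [:: m; n])).
  have -> : input n 1 = st [:: 1; n] by apply: boolp.funext => -[|[|[|i]]].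
  apply: ESeq (exec_st_clear [:: n] 1) _.
  by have := exec_comp e [:: n]; rewrite he /= hF.
apply: ESeq (exec_clear 0 _) _.
by have := @exec_move 1 0 (upd (st [:: m; n]) 0 0) isT.
Qed.

Lemma C_total (f : nat -> nat) : C f -> total_computable f.
Proof. by move=> /C_phi[e h]; exists e. Qed.

Lemma C_rel3 (P : nat -> nat -> nat -> bool) :
  C (fun x : nat * nat * nat => P x.1.1 x.1.2 x.2) -> computable_rel3 P.
Proof. by move=> /C_phi[e h]; exists e => x y z; have := h (x, y, z); rewrite pickle_bool. Qed.

(** Unbounded search combined with an effective choice of the parameter, as in the s-m-n theorem.
    Register 0 holds the input [m], register 1 the parameter as [a.+1], register 2 the candidate
    [z], register 3 the negated test. *)
Lemma search_machine (Q : nat -> nat -> nat -> bool) c :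
  C (fun x : nat * nat * nat => Q x.1.1 x.1.2 x.2) ->
  exists M : nat -> turing_machine,
    [/\ C M, forall a m, (exists z, Q a m z) -> tm_computes (M a) m c.+1 &
        forall a m n, (forall z, ~~ Q a m z) -> ~ tm_computes (M a) m n].
Proof.
case=> F eF hF.
have [e he] : E (fun env => 1 - F (npair (npair (nth 0 env 1).-1 (nth 0 env 2)) (nth 0 env 0))).
  apply: (E2_app E2_sub (E_const 1)); apply: (E1_app eF).
  apply: (E2_app E2_npair); last exact: E_var.
  by apply: (E2_app E2_npair); [exact: (E1_app E1_pred (E_var 1))|exact: E_var].
have {}he a m z : eval [:: z; a.+1; m] e = ~~ Q a m z.
  by rewrite he /= -[npair (npair a m) z]/(pickle (a, m, z)) hF pickle_bool /=; case: (Q a m z).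
have [incs hincs] := exec_incs 0 c.
pose body := Seq (clear 3) (Seq (Inc 2) (comp 3 e)).
pose main := Seq (Seq (comp 3 e) (While 3 body)) (Seq (clear 0) incs).
have [k0 hk] := regs_bound main; pose k := maxn k0 2.
have km : regs_lt k main by apply: regs_ltW hk; exact: leq_maxl.
have k2 : 1 < k by exact: leq_maxr.
pose s a m z := st [:: nat_of_bool (~~ Q a m z); z; a.+1; m].
have einit a m : exec (comp 3 e) (input m a.+1) (s a m 0).
  have -> : input m a.+1 = st [:: 0; a.+1; m] by apply: boolp.funext => -[|[|[|[|i]]]].
  by have := exec_comp e [:: 0; a.+1; m]; rewrite he.
have ebody a m z : exec body (s a m z) (s a m z.+1).
  apply: ESeq (exec_st_clear [:: z; a.+1; m] _) _.
  apply: (ESeq (s2 := st [:: z.+1; a.+1; m])).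
    have := EInc 2 (st [:: z; a.+1; m]); set u := upd _ _ _; have -> // : u = st [:: z.+1; a.+1; m].
    by apply: boolp.funext => -[|[|[|[|i]]]].
  by have := exec_comp e [:: z.+1; a.+1; m]; rewrite he.
exists (machine k main); split.
- rewrite /machine /param_part; apply: C_cat; [apply: C_cat|apply: C_cat].
  + exact: C_const.
  + rewrite /table /=; apply: (C_ext (f := fun a => [seq ((2, enc z.1 z.2), (entry main + 3 * a, enc z.1 z.2, false)) | z <- symbols k])).
      by move=> a; rewrite /= cats0 -map_comp; apply: eq_map => z.
    apply: C_map; first exact: C_const.
    have [G [g hg] hG] : C (fun z : bool * bitseq => enc z.1 z.2).
      apply: (C_ext (f := fun z : bool * seq bool => foldl (fun (acc : nat) (b : bool) => nat_of_bool b + (acc + acc)) (nat_of_bool z.1) (rev z.2))).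
        case=> m bs /=; rewrite foldl_rev; elim: bs => //= b bs ->; lia.
      by comp.
    have hc : C (fun y : nat * (bool * bitseq) => enc y.2.1 y.2.2).
      apply: (C_comp (g := fun z : bool * bitseq => enc z.1 z.2)); last by comp.
      by exists G => //; exists g.
    by comp.
  + exact: C_const.
  (* The blocks from 1 on are shifts of one table by multiples of 3: the exit [entry main - 3],
     shifted by [3 * i], is the entry of block [i - 1]. Block 0 is treated apart since it exits to
     state 3. *)
  pose B := table k (entry main) (cmp (Inc 1) (entry main) (entry main - 3)).
  pose sh i (t : (nat * nat) * (nat * nat * bool)) :=
    ((t.1.1 + 3 * i, t.1.2), (t.2.1.1 + 3 * i, t.2.1.2, t.2.2)).
  apply: (C_ext (f := fun a => block k main 0 ++ flatten [seq [seq sh i t | t <- B] | i <- iota 1 a])).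
    move=> a /=; congr (_ ++ flatten _); apply/eq_in_map => -[|i]; rewrite mem_iota // => _.
    rewrite /B /block /table -map_comp; apply/eq_in_map => -[j [m bs]] hj.
    have {hj} : j < 3 by case/allpairsP: hj => -[j' y] /= [hj _ [-> _]]; rewrite !inE in hj; lia.
    have e3 : 3 <= entry main by rewrite /entry; lia.
    case: j => [|[|[|//]]] _; lazy beta iota zeta delta [nth cmp back quint sh fst snd ssrfun.comp].
    + by case: ifP => _ /=; do ![congr (_, _)]; lia.
    + by case: m => /=; do ![congr (_, _)]; lia.
    + by do ![congr (_, _)]; lia.
  comp; rewrite /sh; comp.
- move=> a m [z hz]; have {z hz} [z [hz uz]] : exists z, Q a m z /\ forall y, y < z -> ~~ Q a m y.
    have exz : exists z, Q a m z by exists z.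
    exists (ex_minn exz); case: ex_minnP => y hy my; split=> // j jy.
    by apply/negP => /my; lia.
  have ew : exec (While 3 body) (s a m 0) (s a m z).
    suff H d y : y + d = z -> exec (While 3 body) (s a m y) (s a m z) by apply: (H z 0).
    elim: d y => [|d IH] y yz.
      have <- : y = z by lia.
      by apply: EWhileF; have -> : y = z by [lia|]; rewrite /s hz.
    by apply: EWhileT (ebody _ _ _) (IH _ _); [rewrite /s /st /= uz //; lia|lia].
  pose r := upd (s a m z) 0 0.
  have -> : c.+1 = upd r 0 (r 0 + c.+1) 0 by [].
  apply: machine_computes => //.
  exact: ESeq (ESeq (einit a m) ew) (ESeq (exec_clear 0 _) (hincs _)).
- move=> a m n h.
  apply: (@machine_diverges k main _ _ a m (comp 3 e) body (Seq (clear 0) incs) 3 (s a m) n) => //.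
  by move=> i; split=> //; rewrite /s /st /= h.
Qed.
End Phi.

(** * Star-algebra identities *)

Local Open Scope classical_set_scope.
Local Open Scope ring_scope.

Section StarAlgebra.
Variables (R : realType) (A : cstarType R).
Implicit Types x y z : A.

Lemma cmul0l x : cmul 0 x = 0.
Proof. by have := cmulZl 0 0 x; rewrite !scale0r. Qed.
Lemma cmul0r x : cmul x 0 = 0.
Proof. by have := cmulZr 0 x 0; rewrite !scale0r. Qed.
Lemma cmulNl x y : cmul (- x) y = - cmul x y.
Proof. by have := cmulZl (-1) x y; rewrite !scaleN1r. Qed.
Lemma cmulNr x y : cmul x (- y) = - cmul x y.
Proof. by have := cmulZr (-1) x y; rewrite !scaleN1r. Qed.
Lemma cmulBl x y z : cmul (x - y) z = cmul x z - cmul y z.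
Proof. by rewrite cmulDl cmulNl. Qed.
Lemma cmulBr x y z : cmul x (y - z) = cmul x y - cmul x z.
Proof. by rewrite cmulDr cmulNr. Qed.
Lemma cstar0 : cstar (0 : A) = 0.
Proof. by have := cstarZ 0 (0 : A); rewrite conjc0 !scale0r. Qed.
Lemma cstarN x : cstar (- x) = - cstar x.
Proof. by apply: (addIr (cstar x)); rewrite -cstarD !addNr cstar0. Qed.
Lemma cstarB x y : cstar (x - y) = cstar x - cstar y.
Proof. by rewrite cstarD cstarN. Qed.
Lemma cmul_suml I (s : seq I) (P : pred I) F y :
  cmul (\sum_(i <- s | P i) F i) y = \sum_(i <- s | P i) cmul (F i) y.
Proof. by apply: (big_morph (cmul^~ y)) => [u v|]; rewrite ?cmulDl ?cmul0l. Qed.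
Lemma cmul_sumr I (s : seq I) (P : pred I) F y :
  cmul y (\sum_(i <- s | P i) F i) = \sum_(i <- s | P i) cmul y (F i).
Proof. by apply: (big_morph (cmul y)) => [u v|]; rewrite ?cmulDr ?cmul0r. Qed.
Lemma cstar_sum I (s : seq I) (P : pred I) (F : I -> A) :
  cstar (\sum_(i <- s | P i) F i) = \sum_(i <- s | P i) cstar (F i).
Proof. by apply: big_morph => [u v|]; rewrite ?cstarD ?cstar0. Qed.
End StarAlgebra.

Definition wmul (w u : word) : word := (w.1, w.2 ++ u.1 :: u.2).
Definition wstar (w : word) : word :=
  let r := rev [seq (l.1, ~~ l.2) | l <- w.1 :: w.2] in (head (0%N, false) r, behead r).

Section GenericPoly.
Variables (K : zmodType) (mul : K -> K -> K) (conj : K -> K).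
Implicit Types p q : seq (K * word).

(** The coefficients and their action are kept abstract for two instances: integers in the decision
    procedure [cring], Gaussian rationals in generated points. *)
Definition gpmul p q := flatten [seq [seq (mul m.1 n.1, wmul m.2 n.2) | n <- q] | m <- p].
Definition gpstar p := [seq (conj m.1, wstar m.2) | m <- p].
Definition gpcoef p w := foldl (fun acc m => if m.2 == w then acc + m.1 else acc) 0 p.
(** Testing the words that occur in [p] suffices, all other coefficients being 0; this makes formal
    equality decidable. *)
Definition gpzero p := all (fun m => gpcoef p m.2 == 0) p.

Lemma gpcoefE p w : gpcoef p w = \sum_(m <- p | m.2 == w) m.1.
Proof.
suff H c : foldl (fun acc m => if m.2 == w then acc + m.1 else acc) c p =
    c + \sum_(m <- p | m.2 == w) m.1 by rewrite /gpcoef H add0r.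
elim: p c => [|m p IH] c /=; first by rewrite big_nil addr0.
by rewrite IH big_cons; case: eqP => // _; rewrite addrA.
Qed.

Variables (R : realType) (A : cstarType R) (phi : K -> A -> A) (a : nat -> A).
Hypothesis phiD : forall c d x, phi (c + d) x = phi c x + phi d x.
Hypothesis phiM : forall c d x y, phi (mul c d) (cmul x y) = cmul (phi c x) (phi d y).
Hypothesis phiS : forall c x, phi (conj c) (cstar x) = cstar (phi c x).

Definition gpeval p : A := \sum_(m <- p) phi m.1 (eval_word a m.2).

Lemma phi0 x : phi 0 x = 0.
Proof. by apply: (addrI (phi 0 x)); rewrite -phiD !addr0. Qed.

Lemma eval_wordM w u : eval_word a (wmul w u) = cmul (eval_word a w) (eval_word a u).
Proof.
rewrite /eval_word /wmul /= foldl_cat /=; move: (foldl _ _ w.2) => x.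
elim/last_ind: u.2 => [|s l IH] //=.
by rewrite -!cats1 !foldl_cat /= IH cmulA.
Qed.

Lemma eval_letter_flip l : eval_letter a (l.1, ~~ l.2) = cstar (eval_letter a l).
Proof. by rewrite /eval_letter /=; case: l.2 => //=; rewrite cstarK. Qed.

Lemma eval_wordS w : eval_word a (wstar w) = cstar (eval_word a w).
Proof.
case: w => l s; rewrite /wstar /=; elim/last_ind: s => [|s m IH].
  by rewrite /rev /= /eval_word /= eval_letter_flip.
set t := [seq _ | _ <- _] in IH *; set t' := [seq _ | _ <- _].
have -> : t' = rcons t (m.1, ~~ m.2) by rewrite /t' map_rcons.
rewrite -rcons_cons rev_rcons /=.
have -> : eval_word a (l, rcons s m) = cmul (eval_word a (l, s)) (eval_letter a m).
  by rewrite /eval_word /= -cats1 foldl_cat.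
rewrite cstarM -IH -eval_letter_flip -[eval_letter a (m.1, _)]/(eval_word a ((m.1, ~~ m.2), [::])).
rewrite -eval_wordM /wmul /=; congr (eval_word a (_, _)).
by case E: (rev _) => //; have := congr1 size E; rewrite size_rev.
Qed.

Lemma gpeval_cat p q : gpeval (p ++ q) = gpeval p + gpeval q.
Proof. by rewrite /gpeval big_cat. Qed.

Lemma gpeval_mul p q : gpeval (gpmul p q) = cmul (gpeval p) (gpeval q).
Proof.
rewrite /gpeval /gpmul big_flatten big_map cmul_suml; apply: eq_bigr => m _.
by rewrite big_map cmul_sumr; apply: eq_bigr => n _; rewrite /= eval_wordM phiM.
Qed.

Lemma gpeval_star p : gpeval (gpstar p) = cstar (gpeval p).
Proof.
rewrite /gpeval /gpstar big_map cstar_sum; apply: eq_bigr => m _.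
by rewrite /= eval_wordS phiS.
Qed.

(** The monomials are regrouped by word, and each group evaluates through its total coefficient,
    which is 0. *)
Lemma gpeval_zero p : gpzero p -> gpeval p = 0.
Proof.
move=> /allP pz; pose W := undup [seq m.2 | m <- p].
transitivity (\sum_(m <- p) \sum_(w <- W | w == m.2) phi m.1 (eval_word a w)).
  apply: eq_big_seq => m mp.
  rewrite (big_rem m.2) /=; last by rewrite mem_undup map_f.
  rewrite eqxx big_seq_cond big1 ?addr0 // => w.
  by rewrite mem_rem_uniq ?undup_uniq // inE => /andP[/andP[/negbTE /= -> _]].
rewrite (exchange_big_dep xpredT) //= big_seq big1 // => w.
rewrite mem_undup => /mapP[m0 mp ew].
transitivity (phi (\sum_(m <- p | m.2 == w) m.1) (eval_word a w)).
  rewrite (big_morph (fun c => phi c (eval_word a w)) (id1 := 0) (op1 := +%R)).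
  - by apply: eq_bigl => m; rewrite eq_sym.
  - by move=> c d; rewrite phiD.
  - exact: phi0.
by rewrite -gpcoefE ew (eqP (pz _ mp)) phi0.
Qed.
End GenericPoly.

(* Reflexive decision procedure for identities that hold in every
   *-algebra. *)
Inductive cexpr := CVar of nat | CZero | CAdd of cexpr & cexpr | COpp of cexpr
  | CMul of cexpr & cexpr | CStar of cexpr | CMuln of cexpr & nat.

Fixpoint cnf (e : cexpr) : seq (int * word) := match e with
  | CVar i => [:: (1, ((i, false), [::]))]
  | CZero => [::]
  | CAdd e f => cnf e ++ cnf f
  | COpp e => [seq (- m.1, m.2) | m <- cnf e]
  | CMul e f => gpmul intRing.mulz (cnf e) (cnf f)
  | CStar e => gpstar id (cnf e)
  | CMuln e n => [seq (intRing.mulz m.1 (Posz n), m.2) | m <- cnf e] end.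

Section Reflect.
Variables (R : realType) (A : cstarType R).

Fixpoint ceval (s : seq A) (e : cexpr) : A := match e with
  | CVar i => nth 0 s i
  | CZero => 0
  | CAdd e f => ceval s e + ceval s f
  | COpp e => - ceval s e
  | CMul e f => cmul (ceval s e) (ceval s f)
  | CStar e => cstar (ceval s e)
  | CMuln e n => ceval s e *+ n end.

Let phi (c : int) (x : A) := x *~ c.

Lemma ceval_nf s e : gpeval phi (nth 0 s) (cnf e) = ceval s e.
Proof.
have pz c x : phi c x = c%:~R *: x by rewrite scaler_int.
have phiM c d x y : phi (c * d) (cmul x y) = cmul (phi c x) (phi d y).
  by rewrite !pz cmulZl cmulZr scalerA intrM.
have phiS c x : phi (id c) (cstar x) = cstar (phi c x).
  by rewrite !pz cstarZ rmorph_int.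
elim: e => /= [i||e IHe f IHf|e IH|e IHe f IHf|e IH|e IH n].
- by rewrite /gpeval big_seq1 /phi mulr1z.
- by rewrite /gpeval big_nil.
- by rewrite gpeval_cat IHe IHf.
- rewrite -IH /gpeval big_map -sumrN; apply: eq_bigr => m _.
  by rewrite /phi mulrNz.
- by rewrite (gpeval_mul _ phiM) IHe IHf.
- by rewrite (gpeval_star _ phiS) IH.
- rewrite -IH /gpeval big_map -sumrMnl; apply: eq_bigr => m _.
  by rewrite /phi -[intRing.mulz _ _]/(m.1 * Posz n)%R mulrzA -pmulrn.
Qed.

Lemma cring_correct s e f : gpzero (cnf (CAdd e (COpp f))) -> ceval s e = ceval s f.
Proof.
move=> h; apply/eqP; rewrite -subr_eq0 -[_ - _]/(ceval s (CAdd e (COpp f))) -ceval_nf.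
by rewrite gpeval_zero // => c d x; rewrite /phi mulrzDr.
Qed.
End Reflect.

(* Scalar multiples are compared up to conversion, as they may involve
   different projections to the module structure. *)
Ltac cring_same x y := match x with
  | y => constr:(true)
  | ?k *: ?v => lazymatch y with
      | k *: v => constr:(true)
      | _ *: _ => match goal with
          | _ => let _ := constr:(erefl x : x = y) in constr:(true)
          | _ => constr:(false) end
      | _ => constr:(false) end
  | _ => constr:(false) end.
Ltac cring_index x s := lazymatch s with
  | ?y :: ?t => lazymatch cring_same x y with
     | true => constr:(O) | false => let i := cring_index x t in constr:(S i) end end.
Ltac cring_mem x s := lazymatch s with
  | ?y :: ?t => lazymatch cring_same x y with
     | true => constr:(true) | false => cring_mem x t end
  | _ => constr:(false) end.
Ltac cring_atoms t s := lazymatch t with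
  | GRing.zero => s | 0 => s
  | ?x + ?y => let s := cring_atoms x s in cring_atoms y s
  | - ?x => cring_atoms x s
  | cmul ?x ?y => let s := cring_atoms x s in cring_atoms y s
  | cstar ?x => cring_atoms x s
  | ?x *+ ?n => cring_atoms x s
  | _ => lazymatch cring_mem t s with true => s | false => constr:(t :: s) end end.
Ltac cring_reify t s := lazymatch t with
  | 0 => constr:(CZero)
  | ?x + ?y => let e := cring_reify x s in let f := cring_reify y s in constr:(CAdd e f)
  | - ?x => let e := cring_reify x s in constr:(COpp e)
  | cmul ?x ?y => let e := cring_reify x s in let f := cring_reify y s in constr:(CMul e f)
  | cstar ?x => let e := cring_reify x s in constr:(CStar e)
  | ?x *+ ?n => let e := cring_reify x s in constr:(CMuln e n)
  | _ => let i := cring_index t s in constr:(CVar i) end.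
Ltac cring := lazymatch goal with |- @eq ?T ?x ?y =>
  let s := cring_atoms x (@nil T) in let s := cring_atoms y s in
  let e := cring_reify x s in let f := cring_reify y s in
  refine (@cring_correct _ _ s e f _); vm_compute; reflexivity end.

(** * Norms, subalgebras and homomorphisms of C*-algebras *)

Section RealParts.
Variable R : realType.
Implicit Types k : R[i].

Lemma ge0_ReE k : 0 <= k -> k = (complex.Re k)%:C%C.
Proof. by case: k => a b; rewrite lecE /= => /andP[/eqP ->]. Qed.

Definition cabs k : R := complex.Re `|k|.
Lemma cabsE k : `|k| = (cabs k)%:C%C. Proof. exact/ge0_ReE. Qed.
Lemma cabs_ge0 k : 0 <= cabs k. Proof. rewrite -lecR -cabsE; exact: normr_ge0. Qed.
Lemma cabs_real (r : R) : cabs r%:C%C = `|r|.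
Proof. by rewrite /cabs normc_def /= expr0n addr0 sqrtr_sqr. Qed.
Lemma cabsM k l : cabs (k * l) = cabs k * cabs l.
Proof. by apply: (@complexI R); rewrite -cabsE normrM !cabsE -rmorphM. Qed.
Lemma cabsD k l : cabs (k + l) <= cabs k + cabs l.
Proof. by rewrite -lecR rmorphD /= -!cabsE ler_normD. Qed.
Lemma cabsN k : cabs (- k) = cabs k. Proof. by rewrite /cabs normrN. Qed.
Lemma cabs_conj k : cabs k^*%C = cabs k. Proof. by rewrite /cabs normcJ. Qed.
Lemma cabs_eq0 k : (cabs k == 0) = (k == 0).
Proof. by rewrite -[RHS]normr_eq0 cabsE (inj_eq (@complexI R)). Qed.
Lemma cabs_le k : cabs k <= `|complex.Re k| + `|complex.Im k|.
Proof.
rewrite /cabs normc_def /= -[leRHS]ger0_norm ?addr_ge0 // -sqrtr_sqr ler_wsqrtr //.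
by rewrite sqrrD !real_normK ?num_real // addrAC lerDl mulrn_wge0 // mulr_ge0.
Qed.
Lemma cabs_ltP (e : R[i]) : 0 < e -> 0 < complex.Re e /\ e = (complex.Re e)%:C%C.
Proof. by case: e => a b; rewrite ltcE /= => /andP[/eqP ->]. Qed.
End RealParts.

Section Norm.
Variables (R : realType) (A : cstarType R).
Implicit Types x y z : A.

Lemma cnormE x : `|x| = (cnorm x)%:C%C. Proof. exact/ge0_ReE. Qed.
Lemma cnorm_ge0 x : 0 <= cnorm x. Proof. rewrite -lecR -cnormE; exact: normr_ge0. Qed.
Lemma cnorm0 : cnorm (0 : A) = 0. Proof. by rewrite /cnorm normr0. Qed.
Lemma cnorm_eq0 x : cnorm x = 0 -> x = 0.
Proof. by move=> h; apply/eqP; rewrite -normr_eq0 cnormE h. Qed.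
Lemma cnorm_gt0 x : x <> 0 -> 0 < cnorm x.
Proof. by move=> h; rewrite lt_def cnorm_ge0 andbT; apply/eqP => /cnorm_eq0. Qed.
Lemma cnormD x y : cnorm (x + y) <= cnorm x + cnorm y.
Proof. by rewrite -lecR rmorphD /= -!cnormE ler_normD. Qed.
Lemma cnormN x : cnorm (- x) = cnorm x. Proof. by rewrite /cnorm normrN. Qed.
Lemma cnormC x y : cnorm (x - y) = cnorm (y - x). Proof. by rewrite /cnorm distrC. Qed.
Lemma cnormB x y : cnorm (x - y) <= cnorm x + cnorm y.
Proof. by rewrite -(cnormN y) cnormD. Qed.
Lemma cnorm_tri y x z : cnorm (x - z) <= cnorm (x - y) + cnorm (y - z).
Proof. by apply: le_trans (cnormD _ _); rewrite subrKA. Qed.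
Lemma cnorm_le x y : cnorm x <= cnorm (x - y) + cnorm y.
Proof. by apply: le_trans (cnormD _ _); rewrite subrK. Qed.
Lemma cnormZ k x : cnorm (k *: x) = cabs k * cnorm x.
Proof. by apply: (@complexI R); rewrite -cnormE normrZ cnormE cabsE -rmorphM. Qed.
Lemma cnormM_le x y : cnorm (cmul x y) <= cnorm x * cnorm y.
Proof. by rewrite -lecR rmorphM /= -!cnormE cnormM. Qed.
Lemma cnorm_cstar x : cnorm (cmul (cstar x) x) = cnorm x ^+ 2.
Proof. by apply: (@complexI R); rewrite -cnormE cnorm_star cnormE rmorphXn. Qed.
Lemma cnorm_sum I (s : seq I) (P : pred I) (F : I -> A) :
  cnorm (\sum_(i <- s | P i) F i) <= \sum_(i <- s | P i) cnorm (F i).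
Proof.
elim/big_ind2: _ => [|x a y b xa yb|//]; first by rewrite cnorm0.
exact: le_trans (cnormD _ _) (lerD xa yb).
Qed.
Lemma cnormS x : cnorm (cstar x) = cnorm x.
Proof.
have H y : cnorm y <= cnorm (cstar y).
  have [->|y0] := EM (y = 0); first by rewrite cstar0.
  have : cnorm y ^+ 2 <= cnorm (cstar y) * cnorm y by rewrite -cnorm_cstar cnormM_le.
  by rewrite expr2 ler_pM2r // cnorm_gt0.
by apply/eqP; rewrite eq_le H andbT -{2}[x]cstarK H.
Qed.
Lemma cnorm_sa x : cstar x = x -> cnorm (cmul x x) = cnorm x ^+ 2.
Proof. by move=> h; rewrite -cnorm_cstar h. Qed.

Lemma eps_eq0 (a : R) : 0 <= a -> (forall e, 0 < e -> a <= e) -> a = 0.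
Proof.
move=> a0 h; apply/eqP; rewrite eq_le a0 andbT leNgt; apply/negP => ap.
by have := h (a / 2); rewrite divr_gt0 // => /(_ isT); lra.
Qed.

Lemma cnorm_small x : (forall e, 0 < e -> cnorm x <= e) -> x = 0.
Proof. by move=> h; apply/cnorm_eq0/eps_eq0 => //; exact: cnorm_ge0. Qed.

Lemma cnbhsP x (B : set A) :
  nbhs x B <-> exists2 e : R, 0 < e & forall y, cnorm (x - y) < e -> B y.
Proof.
split=> [/nbhs_ballP[e /= /cabs_ltP[e0 ee] h]|[e e0 h]].
  exists (complex.Re e) => // y xy; apply: h; rewrite -ball_normE /= ee cnormE ltcR //.
apply/nbhs_ballP; exists e%:C%C => /=; first by rewrite ltcR.
by move=> y; rewrite -ball_normE /= cnormE ltcR; exact: h.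
Qed.

Lemma cclosedP (I : set A) :
  closed I <-> forall x, (forall e, 0 < e -> exists2 y, I y & cnorm (x - y) < e) -> I x.
Proof.
split=> [cI x h|h x cx]; last first.
  apply: h => e e0; have [|y [Iy xy]] := cx [set y | cnorm (x - y) < e]; last by exists y.
  by apply/cnbhsP; exists e.
by apply: cI => B /cnbhsP[e e0 hB]; have [y Iy xy] := h e e0; exists y; split=> //; exact: hB.
Qed.

Lemma cdenseP (S : set A) :
  dense S <-> forall x e, 0 < e -> exists2 y, S y & cnorm (x - y) < e.
Proof.
split=> [dS x e e0|h U [x Ux] oU]; last first.
  have /cnbhsP[e e0 hU] := open_nbhs_nbhs (conj oU Ux).
  by have [y Sy xy] := h x e e0; exists y; split=> //; exact: hU.
have [||y [xy Sy]] := dS [set y | cnorm (x - y) < e].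
- by exists x; rewrite /= subrr cnorm0.
- rewrite openE => y /= xy; apply/cnbhsP; exists (e - cnorm (x - y)); first by rewrite subr_gt0.
  by move=> z yz /=; apply: le_lt_trans (cnorm_tri y _ _) _; lra.
by exists y.
Qed.

Lemma ccomplete (u : nat -> A) :
  (forall e, 0 < e -> exists N, forall m n, (N <= m)%N -> (N <= n)%N -> cnorm (u m - u n) <= e) ->
  exists l, forall e, 0 < e -> exists N, forall n, (N <= n)%N -> cnorm (l - u n) <= e.
Proof.
move=> cu; have cvgu : cvg (u @ \oo).
  apply/cauchy_cvgP/cauchy_exP => e /cabs_ltP[e0 ee].
  have [|N hN] := cu (complex.Re e / 2); first by rewrite divr_gt0.
  exists (u N); exists N => // n /= Nn; rewrite -ball_normE /= ee cnormE ltcR.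
  by apply: le_lt_trans (hN _ _ (leqnn _) Nn) _; lra.
exists (lim (u @ \oo)) => e e0.
have /cvgrPdist_lt /(_ e%:C%C) := cvgu; rewrite ltcR => /(_ e0) [N _ hN].
by exists N => n /hN /=; rewrite cnormE ltcR => /ltW.
Qed.

Definition halves (n : nat) : R := 2^-1 ^+ n.
Lemma halves_gt0 n : 0 < halves n. Proof. by rewrite exprn_gt0 ?invr_gt0. Qed.
Lemma halvesS n : halves n.+1 = halves n / 2. Proof. by rewrite /halves exprSr. Qed.
Lemma halves_small e : 0 < e -> exists N, forall n, (N <= n)%N -> halves n <= e.
Proof.
move=> e0; have [N hN] : exists N : nat, e^-1 <= N%:R.
  by exists (Num.bound e^-1); apply/ltW; rewrite archi_boundP // invr_ge0 ltW.
exists N => n Nn; rewrite /halves exprVn -[e]invrK lef_pV2 ?posrE ?exprn_gt0 ?invr_gt0 //.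
apply: le_trans hN _; rewrite -natrX ler_nat; apply: leq_trans Nn _; exact/ltnW/ltn_expl.
Qed.

Lemma fast_cauchy (u : nat -> A) c : (forall n, cnorm (u n.+1 - u n) <= c * halves n) ->
  forall n m, (n <= m)%N -> cnorm (u m - u n) <= c * 2 * halves n.
Proof.
move=> h n m /subnK <-; move: (m - n)%N => d.
have c0 : 0 <= c by have := le_trans (cnorm_ge0 _) (h 0%N); rewrite /halves expr0 mulr1.
suff: cnorm (u (d + n)%N - u n) <= c * 2 * (halves n - halves (d + n)).
  move=> H; apply: le_trans H _; apply: ler_wpM2l; first by rewrite mulr_ge0.
  by rewrite gerBl ltW // halves_gt0.
elim: d => [|d IH]; first by rewrite add0n !subrr cnorm0 mulr0.
apply: le_trans (cnorm_tri (u (d + n)%N) _ _) _; rewrite addSn halvesS.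
by have := h (d + n)%N; lra.
Qed.

Lemma fast_cvg (u : nat -> A) c : (forall n, cnorm (u n.+1 - u n) <= c * halves n) ->
  exists l, forall n, cnorm (l - u n) <= c * 2 * halves n.
Proof.
move=> h; have fc := fast_cauchy h.
have c0 : 0 <= c by have := le_trans (cnorm_ge0 _) (h 0%N); rewrite /halves expr0 mulr1.
have [|l hl] := @ccomplete u.
  move=> e e0; have [|N hN] := @halves_small (e / (4 * (c + 1))).
    by rewrite divr_gt0 // mulr_gt0 // ltr_wpDl.
  exists N => m n Nm Nn; apply: le_trans (cnorm_tri (u N) _ _) _.
  rewrite [X in _ + X]cnormC; have := fc _ _ Nm; have := fc _ _ Nn; have := hN N (leqnn _).
  have c1 : 0 < 4 * (c + 1) by lra.
  rewrite ler_pdivlMr // => h1 h2 h3; have := halves_gt0 N; nra.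
exists l => n; apply/ler_addgt0Pr => e e0; have [N hN] := hl e e0.
have := hN (maxn N n) (leq_maxl _ _); have := fc _ _ (leq_maxr N n).
by have := cnorm_tri (u (maxn N n)) l (u n); lra.
Qed.
End Norm.

(** An unbundled list of operations and laws with a real-valued norm, from which closed subalgebras
    and completions are built. Completeness is asked for sequences only; [cstar_of] derives the
    topology and the convergence of Cauchy filters. *)
Record cstar_data (R : realType) := CStarData {
  cd_sort :> Type;
  cd_zero : cd_sort; cd_add : cd_sort -> cd_sort -> cd_sort; cd_opp : cd_sort -> cd_sort;
  cd_scale : R[i] -> cd_sort -> cd_sort; cd_mul : cd_sort -> cd_sort -> cd_sort;
  cd_star : cd_sort -> cd_sort; cd_norm : cd_sort -> R;
  cd_addA : associative cd_add; cd_addC : commutative cd_add;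
  cd_add0 : left_id cd_zero cd_add; cd_addN : left_inverse cd_zero cd_opp cd_add;
  cd_scaleA : forall k l x, cd_scale k (cd_scale l x) = cd_scale (k * l) x;
  cd_scale1 : left_id 1 cd_scale; cd_scaleDr : right_distributive cd_scale cd_add;
  cd_scaleDl : forall x, {morph cd_scale^~ x : k l / k + l >-> cd_add k l};
  cd_mulA : forall x y z, cd_mul x (cd_mul y z) = cd_mul (cd_mul x y) z;
  cd_mulDl : forall x y z, cd_mul (cd_add x y) z = cd_add (cd_mul x z) (cd_mul y z);
  cd_mulDr : forall x y z, cd_mul x (cd_add y z) = cd_add (cd_mul x y) (cd_mul x z);
  cd_mulZl : forall k x y, cd_mul (cd_scale k x) y = cd_scale k (cd_mul x y);
  cd_mulZr : forall k x y, cd_mul x (cd_scale k y) = cd_scale k (cd_mul x y);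
  cd_starK : forall x, cd_star (cd_star x) = x;
  cd_starD : forall x y, cd_star (cd_add x y) = cd_add (cd_star x) (cd_star y);
  cd_starZ : forall k x, cd_star (cd_scale k x) = cd_scale k^*%C (cd_star x);
  cd_starM : forall x y, cd_star (cd_mul x y) = cd_mul (cd_star y) (cd_star x);
  cd_normD : forall x y, cd_norm (cd_add x y) <= cd_norm x + cd_norm y;
  cd_normZ : forall k x, cd_norm (cd_scale k x) = cabs k * cd_norm x;
  cd_norm_eq0 : forall x, cd_norm x = 0 -> x = cd_zero;
  cd_normM : forall x y, cd_norm (cd_mul x y) <= cd_norm x * cd_norm y;
  cd_norm_star : forall x, cd_norm (cd_mul (cd_star x) x) = cd_norm x ^+ 2;
  cd_complete : forall u : nat -> cd_sort,
    (forall e, 0 < e -> exists N, forall m n, (N <= m)%N -> (N <= n)%N ->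
       cd_norm (cd_add (u m) (cd_opp (u n))) <= e) ->
    exists l, forall e, 0 < e -> exists N, forall n, (N <= n)%N ->
       cd_norm (cd_add l (cd_opp (u n))) <= e }.

Section OfData.
Variables (R : realType) (d : cstar_data R).

Definition cstar_of : Type := d.
HB.instance Definition _ := gen_eqMixin cstar_of.
HB.instance Definition _ := gen_choiceMixin cstar_of.
HB.instance Definition _ := GRing.isZmodule.Build cstar_of
  (@cd_addA R d) (@cd_addC R d) (@cd_add0 R d) (@cd_addN R d).
HB.instance Definition _ := GRing.Zmodule_isLmodule.Build R[i] cstar_of
  (@cd_scaleA R d) (@cd_scale1 R d) (@cd_scaleDr R d) (@cd_scaleDl R d).

Let nrm (x : cstar_of) : R[i] := (cd_norm x)%:C%C.
Fact nrmD (x y : cstar_of) : nrm (x + y) <= nrm x + nrm y.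
Proof. by rewrite /nrm -rmorphD lecR cd_normD. Qed.
Fact nrmZ k (x : cstar_of) : nrm (k *: x) = `|k| * nrm x.
Proof. by rewrite /nrm cabsE -rmorphM cd_normZ. Qed.
Fact nrm_eq0 (x : cstar_of) : nrm x = 0 -> x = 0.
Proof. by move=> /complexI /cd_norm_eq0. Qed.
HB.instance Definition _ := Lmodule_isNormed.Build R[i] cstar_of nrmD nrmZ nrm_eq0.

Lemma data_normE (x : cstar_of) : `|x| = (cd_norm x)%:C%C. Proof. by []. Qed.

(** A Cauchy filter contains a ball of each radius [halves R n]; the centres form a Cauchy sequence,
    and the filter converges to its limit. *)
Fact data_cauchy_cvg (F : set_system cstar_of) : ProperFilter F -> cauchy F -> cvg F.
Proof.
move=> FF cF.
have ch (n : nat) : exists x : cstar_of, F (ball x (halves R n)%:C%C).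
  by have /cauchyP/(_ (halves R n)%:C%C) := cF; rewrite ltcR halves_gt0; apply.
have [u hu] := choice ch.
have uu m n : cd_norm (u m - u n) <= halves R m + halves R n.
  have [x [h1 h2]] := filter_ex (filterI (hu m) (hu n)).
  move: h1 h2; rewrite -!ball_normE /= !data_normE !ltcR => h1 h2.
  have -> : u m - u n = (u m - x) - (u n - x) by rewrite opprB addrA subrK.
  apply: le_trans (cd_normD _ _) (lerD (ltW h1) _).
  have : cd_norm (- (u n - x)) = cd_norm (u n - x).
    by apply: (@complexI R); rewrite -!data_normE normrN.
  by move=> ->; exact: ltW.
have [|l hl] := @cd_complete R d u.
  move=> e e0; have [|N hN] := @halves_small R (e / 2); first by rewrite divr_gt0.
  exists N => m n Nm Nn; rewrite -[cd_add _ _]/(u m - u n); have := uu m n.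
  by have := hN m Nm; have := hN n Nn; lra.
apply/cvg_ex; pose l' : cstar_of := l; exists l'; apply/cvg_ballP => e /cabs_ltP[e0 ee].
have [|N hN] := @halves_small R (complex.Re e / 2); first by rewrite divr_gt0.
have [|K hK] := hl (complex.Re e / 2); first by rewrite divr_gt0.
have := hu (maxn N K); apply: filterS => x; rewrite -!ball_normE /= ee !data_normE !ltcR => h.
have h1 := hN _ (leq_maxl N K); have := hK _ (leq_maxr N K); rewrite -[cd_add _ _]/(l' - u (maxn N K)) => h2.
have -> : l' - x = (l' - u (maxn N K)) + (u (maxn N K) - x) by rewrite addrA subrK.
by apply: le_lt_trans (cd_normD _ _) _; rewrite -[X in X + _]/(cd_norm (l' - u (maxn N K))); lra.
Qed.
HB.instance Definition _ := Uniform_isComplete.Build cstar_of data_cauchy_cvg.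

Fact data_normM (x y : cstar_of) : `|cd_mul x y : cstar_of| <= `|x| * `|y|.
Proof. by rewrite !data_normE -rmorphM lecR cd_normM. Qed.
Fact data_norm_star (x : cstar_of) : `|cd_mul (cd_star x) x : cstar_of| = `|x| ^+ 2.
Proof. by rewrite !data_normE cd_norm_star rmorphXn. Qed.
HB.instance Definition _ := CompleteNormedModule_isCStarAlgebra.Build R cstar_of
  (@cd_mulA R d) (@cd_mulDl R d) (@cd_mulDr R d) (@cd_mulZl R d) (@cd_mulZr R d)
  (@cd_starK R d) (@cd_starD R d) (@cd_starZ R d) (@cd_starM R d) data_normM data_norm_star.

Lemma data_cnorm (x : cstar_of) : cnorm x = cd_norm x. Proof. by []. Qed.
End OfData.

Section SubalgebraTheory.
Variables (R : realType) (A : cstarType R) (S : set A).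
Hypothesis hS : star_subalgebra S.

Lemma sub0 : S 0. Proof. by case: hS. Qed.
Lemma subD x y : S x -> S y -> S (x + y).
Proof. by case: hS => _ h _ _ sx sy; rewrite -[x]scale1r; exact: h. Qed.
Lemma subZ k x : S x -> S (k *: x).
Proof. by case: hS => h0 h _ _ sx; rewrite -[k *: x]addr0; exact: h. Qed.
Lemma subN x : S x -> S (- x). Proof. by rewrite -scaleN1r; exact: subZ. Qed.
Lemma subB x y : S x -> S y -> S (x - y). Proof. by move=> sx /subN; exact: subD. Qed.
Lemma subM x y : S x -> S y -> S (cmul x y). Proof. by case: hS => _ _ h _; exact: h. Qed.
Lemma subS x : S x -> S (cstar x). Proof. by case: hS => _ _ _ h; exact: h. Qed.
Lemma subMn x n : S x -> S (x *+ n).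
Proof. by move=> sx; elim: n => [|n IH]; rewrite ?mulr0n ?mulrS; [exact: sub0|exact: subD]. Qed.
Lemma sub_sum I (s : seq I) (P : pred I) F :
  (forall i, P i -> S (F i)) -> S (\sum_(i <- s | P i) F i).
Proof. by move=> h; elim/big_ind: _ => //; [exact: sub0|exact: subD]. Qed.

Lemma closure_sub : star_subalgebra [set x | forall e, 0 < e -> exists2 y, S y & cnorm (x - y) < e].
Proof.
split=> [e e0|k x y hx hy e e0|x y hx hy e e0|x hx e e0].
- by exists 0; [exact: sub0|rewrite subrr cnorm0].
- have k0 : 0 < cabs k + 1 by rewrite ltr_wpDl // cabs_ge0.
  have [|x' sx ex] := hx (e / 2 / (cabs k + 1)); first by rewrite !divr_gt0.
  have [|y' sy ey] := hy (e / 2); first by rewrite divr_gt0.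
  exists (k *: x' + y'); first by apply: subD => //; exact: subZ.
  have -> : k *: x + y - (k *: x' + y') = k *: (x - x') + (y - y').
    by rewrite scalerBr opprD addrACA.
  apply: le_lt_trans (cnormD _ _) _; rewrite cnormZ.
  have : cabs k * cnorm (x - x') <= (cabs k + 1) * cnorm (x - x').
    by rewrite ler_wpM2r ?cnorm_ge0 // lerDl.
  move: ex; rewrite ltr_pdivlMr // => ex; lra.
- have c0 : 0 < cnorm x + cnorm y + 1 by have := cnorm_ge0 x; have := cnorm_ge0 y; lra.
  pose d := Num.min 1 (e / 2 / (cnorm x + cnorm y + 1)).
  have d0 : 0 < d by rewrite lt_min ltr01 !divr_gt0.
  have d1 : d <= 1 by rewrite ge_min lexx.
  have d2 : d * (cnorm x + cnorm y + 1) <= e / 2 by rewrite -ler_pdivlMr // ge_min lexx orbT.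
  have [x' sx ex] := hx d d0; have [y' sy ey] := hy d d0.
  exists (cmul x' y'); first exact: subM.
  have -> : cmul x y - cmul x' y' = cmul (x - x') y + cmul x (y - y') - cmul (x - x') (y - y') by cring.
  apply: le_lt_trans (cnormB _ _) _; have := cnormM_le (x - x') (y - y').
  have := cnormD (cmul (x - x') y) (cmul x (y - y')).
  have := cnormM_le (x - x') y; have := cnormM_le x (y - y').
  have := cnorm_ge0 (x - x'); have := cnorm_ge0 (y - y').
  by have := cnorm_ge0 x; have := cnorm_ge0 y; nra.
- have [y sy ey] := hx e e0; exists (cstar y); first exact: subS.
  by rewrite -cstarB cnormS.
Qed.
End SubalgebraTheory.

Lemma closure_closed (R : realType) (A : cstarType R) (S : set A) :
  closed [set x | forall e, 0 < e -> exists2 y, S y & cnorm (x - y) < e].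
Proof.
apply/cclosedP => x hx e e0; have e2 : 0 < e / 2 by rewrite divr_gt0.
have [y hy xy] := hx _ e2; have [z sz yz] := hy _ e2.
by exists z => //; apply: le_lt_trans (cnorm_tri y _ _) _; lra.
Qed.

Section SubAlgebra.
Variables (R : realType) (A : cstarType R) (S : set A).
Hypotheses (hS : star_subalgebra S) (cS : closed S).

Let T := {x : A | S x}.
Let mk x (h : S x) : T := exist _ x h.
Let T_inj (x y : T) : sval x = sval y -> x = y.
Proof. by case: x y => [x hx] [y hy] /= e; subst y; rewrite (Prop_irrelevance hx hy). Qed.

Fact sub_complete (u : nat -> T) :
  (forall e, 0 < e -> exists N, forall m n, (N <= m)%N -> (N <= n)%N ->
     cnorm (sval (u m) - sval (u n)) <= e) ->
  exists l : T, forall e, 0 < e -> exists N, forall n, (N <= n)%N ->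
     cnorm (sval l - sval (u n)) <= e.
Proof.
move=> /ccomplete[l hl]; suff sl : S l by exists (mk sl).
move/cclosedP: cS; apply => e e0; have [|N hN] := hl (e / 2); first by rewrite divr_gt0.
by exists (sval (u N)); [exact: (svalP (u N))|apply: le_lt_trans (hN _ (leqnn _)) _; lra].
Qed.

Definition sub_data : cstar_data R.
refine (@CStarData R T (mk (sub0 hS))
  (fun x y => mk (subD hS (svalP x) (svalP y))) (fun x => mk (subN hS (svalP x)))
  (fun k x => mk (subZ hS k (svalP x))) (fun x y => mk (subM hS (svalP x) (svalP y)))
  (fun x => mk (subS hS (svalP x))) (fun x => cnorm (sval x))
  _ _ _ _ _ _ _ _ _ _ _ _ _ _ _ _ _ _ _ _ _ _ sub_complete); move=> *;
  rewrite ?/mk; try apply: T_inj; rewrite /=.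
- exact: addrA.
- exact: addrC.
- exact: add0r.
- exact: addNr.
- exact: scalerA.
- exact: scale1r.
- exact: scalerDr.
- by move=> k l; apply: T_inj; exact: scalerDl.
- exact: cmulA.
- exact: cmulDl.
- exact: cmulDr.
- exact: cmulZl.
- exact: cmulZr.
- exact: cstarK.
- exact: cstarD.
- exact: cstarZ.
- exact: cstarM.
- exact: cnormD.
- exact: cnormZ.
- exact: cnorm_eq0.
- exact: cnormM_le.
- exact: cnorm_cstar.
Defined.

Definition sub_cstar : cstarType R := cstar_of sub_data.
Definition sub_val (x : sub_cstar) : A := sval (x : T).
Definition sub_mk (x : A) (h : S x) : sub_cstar := mk h.

Lemma sub_valP x : S (sub_val x). Proof. exact: (svalP (x : T)). Qed.
Lemma sub_val_inj : injective sub_val. Proof. exact: T_inj. Qed.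
Lemma sub_val_hom : star_hom sub_val. Proof. by []. Qed.
Lemma sub_val_norm x : cnorm (sub_val x) = cnorm x. Proof. by []. Qed.
End SubAlgebra.

Section Homs.
Variables (R : realType) (A B : cstarType R) (f : A -> B).
Hypothesis hf : star_hom f.

Lemma homD x y : f (x + y) = f x + f y.
Proof. by case: hf => h _ _; have := h 1 x y; rewrite !scale1r. Qed.
Lemma hom0 : f 0 = 0. Proof. by apply: (addrI (f 0)); rewrite -homD !addr0. Qed.
Lemma homZ k x : f (k *: x) = k *: f x.
Proof. by case: hf => h _ _; have := h k x 0; rewrite hom0 !addr0. Qed.
Lemma homN x : f (- x) = - f x. Proof. by rewrite -scaleN1r homZ scaleN1r. Qed.
Lemma homB x y : f (x - y) = f x - f y. Proof. by rewrite homD homN. Qed.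
Lemma homM x y : f (cmul x y) = cmul (f x) (f y). Proof. by case: hf. Qed.
Lemma homS x : f (cstar x) = cstar (f x). Proof. by case: hf. Qed.
Lemma homMn x n : f (x *+ n) = f x *+ n. Proof. by elim: n => [|n IH]; rewrite ?mulr0n ?hom0 // !mulrS homD IH. Qed.
Lemma hom_sum I (s : seq I) (P : pred I) F :
  f (\sum_(i <- s | P i) F i) = \sum_(i <- s | P i) f (F i).
Proof. by apply: big_morph; [exact: homD|exact: hom0]. Qed.
End Homs.

Lemma hom_comp (R : realType) (A B D : cstarType R) (f : A -> B) (g : B -> D) :
  star_hom f -> star_hom g -> star_hom (g \o f).
Proof.
move=> hf hg; split=> [k x y|x y|x] /=.
- by rewrite (homD hf) (homZ hf) (homD hg) (homZ hg).
- by rewrite (homM hf) (homM hg).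
- by rewrite (homS hf) (homS hg).
Qed.

(** * Inverse square roots and contractivity of homomorphisms *)

Section SquareRoots.
Variables (R : realType).

(** Removes a constant from an estimate by passing to powers [2 ^ n], the exponents reached by
    iterating the C*-identity on self-adjoint elements. If [b < a], the powers of [a / b1 > 1] would
    be bounded, against Bernoulli; the midpoint [b1] is used because [b] may be 0. *)
Lemma pow_trick (a b c : R) : 0 <= a -> 0 <= b ->
  (forall n, a ^+ (2 ^ n) <= c * b ^+ (2 ^ n)) -> a <= b.
Proof.
move=> a0 b0 h; rewrite leNgt; apply/negP => ba.
pose b1 := (a + b) / 2; have [bb1 b1a b1p] : [/\ b <= b1, b1 < a & 0 < b1].
  by rewrite /b1; split; lra.
pose q := a / b1; have q1 : 0 < q - 1 by rewrite subr_gt0 ltr_pdivlMr // mul1r.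
have hq n : q ^+ (2 ^ n) <= `|c|.
  rewrite /q expr_div_n ler_pdivrMr ?exprn_gt0 //; apply: le_trans (h n) _.
  apply: le_trans (_ : `|c| * b ^+ (2 ^ n) <= _).
    by apply: ler_wpM2r; [exact: exprn_ge0|exact: ler_norm].
  by apply: ler_wpM2l => //; apply: lerXn2r; rewrite ?nnegrE ?(ltW b1p).
have bern n : 1 + n%:R * (q - 1) <= q ^+ n.
  elim: n => [|n IH]; first by rewrite mul0r addr0 expr0.
  rewrite exprS -natr1; have n0 : 0 <= n%:R :> R by rewrite ler0n.
  have : q * (1 + n%:R * (q - 1)) <= q * q ^+ n by rewrite ler_wpM2l // ltW //; lra.
  move=> H; apply: le_trans H; have := mulr_ge0 n0 (sqr_ge0 (q - 1)); rewrite expr2; nra.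
pose n := Num.bound (`|c| / (q - 1)).
have : `|c| / (q - 1) < n%:R by rewrite archi_boundP // divr_ge0 // ltW.
rewrite ltr_pdivrMr // => hn; have := hq n; have := bern (2 ^ n)%N.
have : n%:R <= (2 ^ n)%:R :> R by rewrite ler_nat ltnW // ltn_expl.
by nra.
Qed.

Variable A : cstarType R.
Implicit Types x y z h : A.

(** Together with [commutant_closed] and the last clause of [inv_sqrt], this shows that the root
    commutes with whatever self-adjoint element commutes with [h]. *)
Lemma commutant_sub x : cstar x = x -> star_subalgebra [set y | cmul x y = cmul y x].
Proof.
move=> sx; split=> [|k y z /= hy hz|y z /= hy hz|y /= hy].
- by rewrite /= cmul0l cmul0r.
- by rewrite cmulDl cmulDr cmulZl cmulZr hy hz.
- by rewrite cmulA hy -cmulA hz cmulA.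
- by rewrite -{1}sx -cstarM -hy cstarM sx.
Qed.

Lemma commutant_closed x : closed [set y | cmul x y = cmul y x].
Proof.
apply/cclosedP => y hy; apply/eqP; rewrite -subr_eq0; apply/eqP/cnorm_small => e e0.
have c0 : 0 < 2 * cnorm x + 1 by have := cnorm_ge0 x; lra.
have [|z hz yz] := hy (e / (2 * cnorm x + 1)); first by rewrite divr_gt0.
have -> : cmul x y - cmul y x = cmul x (y - z) - cmul (y - z) x + (cmul x z - cmul z x) by cring.
rewrite hz subrr addr0; apply: le_trans (cnormB _ _) _.
have := cnormM_le x (y - z); have := cnormM_le (y - z) x; have := cnorm_ge0 (y - z).
by move: yz; rewrite ltr_pdivlMr //; have := cnorm_ge0 x; nra.
Qed.

(* [1 + z] is the inverse square root of [1 - h]. *)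
Lemma inv_sqrt h : cstar h = h -> cnorm h <= 8^-1 ->
  exists z, [/\ cstar z = z, cnorm z <= cnorm h,
    z *+ 2 + cmul z z = h + cmul h z *+ 2 + cmul h (cmul z z) &
    forall S : set A, star_subalgebra S -> closed S -> S h -> S z].
Proof.
move=> sh h8; pose q z := h + cmul h z *+ 2 + cmul h (cmul z z) - cmul z z.
(* The equation [(1 - h)(1 + z)^2 = 1], written without unit, reads [z = F z]. On the ball of radius
   [cnorm h <= 1/8] the map [F] halves distances, so its iterates from 0 converge. *)
pose F z := (2^-1 : R)%:C%C *: q z; pose u n := iter n F 0.
have n0 := cnorm_ge0 h.
have cF z : cnorm (F z) = 2^-1 * cnorm (q z).
  by rewrite cnormZ cabs_real ger0_norm // invr_ge0.
have qlip z w : cnorm z <= cnorm h -> cnorm w <= cnorm h -> cnorm (F z - F w) <= cnorm (z - w) / 2.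
  move=> hz hw; have -> : F z - F w = (2^-1 : R)%:C%C *: (q z - q w) by rewrite scalerBr.
  rewrite cnormZ cabs_real ger0_norm ?invr_ge0 //.
  pose d := cmul z (z - w) + cmul (z - w) w.
  have -> : q z - q w = cmul h (z - w) *+ 2 + cmul h d - d by rewrite /q /d; cring.
  have dle : cnorm d <= 2 * cnorm h * cnorm (z - w).
    apply: le_trans (cnormD _ _) _; have := cnormM_le z (z - w); have := cnormM_le (z - w) w.
    by have := cnorm_ge0 (z - w); nra.
  have := cnormB (cmul h (z - w) *+ 2 + cmul h d) d; have := cnormD (cmul h (z - w) *+ 2) (cmul h d).
  have := cnormM_le h d; have : cnorm (cmul h (z - w) *+ 2) <= 2 * (cnorm h * cnorm (z - w)).
    by rewrite mulr2n; have := cnormD (cmul h (z - w)) (cmul h (z - w)); have := cnormM_le h (z - w); lra.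
  have := cnorm_ge0 (z - w); have := cnorm_ge0 d; nra.
have F0 : cnorm (F 0) <= 2^-1 * cnorm h.
  by rewrite cF ler_wpM2l ?invr_ge0 // /q !cmul0r mul0rn !addr0 subr0.
have uS n : u n.+1 = F (u n) by [].
have un n : cnorm (u n) <= cnorm h.
  elim: n => [|n IH]; first by rewrite cnorm0.
  have := qlip _ _ IH (_ : cnorm 0 <= cnorm h); rewrite cnorm0 subr0 => /(_ n0) h1.
  by have := cnorm_le (F (u n)) (F 0); rewrite uS; lra.
have du n : cnorm (u n.+1 - u n) <= cnorm h * halves R n.
  elim: n => [|n IH]; first by rewrite /halves expr0 mulr1 subr0 un.
  by have := qlip _ _ (un n.+1) (un n); rewrite -!uS halvesS; lra.
have [l hl] := fast_cvg du.
have approx e : 0 < e -> exists n, cnorm (l - u n) <= e /\ cnorm (l - u n.+1) <= e.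
  move=> e0; have [|N hN] := @halves_small R (e / (2 * cnorm h + 1)).
    by rewrite divr_gt0 //; lra.
  have c1 : 0 < 2 * cnorm h + 1 by lra.
  have H n : (N <= n)%N -> cnorm (l - u n) <= e.
    move=> Nn; apply: le_trans (hl n) _; have := hN n Nn; rewrite ler_pdivlMr // => h1.
    by have := halves_gt0 R n; nra.
  by exists N; split; apply: H.
have cl : cnorm l <= cnorm h.
  apply/ler_addgt0Pr => e /approx[n [h1 _]].
  by have := cnorm_le l (u n); have := un n; lra.
have Su S : star_subalgebra S -> S h -> forall n, S (u n).
  move=> hS Sh; elim=> [|n IH]; first exact: sub0.
  apply: subZ => //; apply: subB => //; last exact: (subM hS).
  apply: (subD hS); last by apply: (subM hS) => //; exact: (subM hS).
  by apply: (subD hS) => //; apply: (subMn hS); exact: (subM hS).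
have SP S : star_subalgebra S -> closed S -> S h -> S l.
  move=> hS /cclosedP cS Sh; apply: cS => e e0.
  have [|n [h1 _]] := approx (e / 2); first by rewrite divr_gt0.
  by exists (u n); [exact: Su|lra].
have hl' : cmul h l = cmul l h by apply: (SP _ (commutant_sub sh)) => //; exact: commutant_closed.
have lF : F l = l.
  apply/eqP; rewrite -subr_eq0; apply/eqP/cnorm_small => e e0.
  have [|n [h1 h2]] := approx (e / 2); first by rewrite divr_gt0.
  have := cnorm_tri (u n.+1) (F l) l; have := qlip _ _ cl (un n); rewrite -uS.
  by rewrite [cnorm (u n.+1 - l)]cnormC; have := cnorm_ge0 (l - u n); lra.
have sl : cstar l = l.
  have hu n : cmul h (u n) = cmul (u n) h by exact: (Su _ (commutant_sub sh)).
  have su n : cstar (u n) = u n.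
    elim: n => [|n IH]; first by rewrite cstar0.
    rewrite uS /F cstarZ conjc_real; congr (_ *: _); rewrite /q mulr2n.
    rewrite !(cstarB, cstarD, cstarM) sh IH -hu.
    by congr (_ + _ - _); rewrite -cmulA -hu cmulA -hu cmulA.
  apply/eqP; rewrite -subr_eq0; apply/eqP/cnorm_small => e e0.
  have [|n [h1 _]] := approx (e / 2); first by rewrite divr_gt0.
  have -> : cstar l - l = cstar (l - u n) - (l - u n) by rewrite cstarB su opprB addrA subrK.
  by apply: le_trans (cnormB _ _) _; rewrite cnormS; lra.
exists l; split=> //.
have -> : l *+ 2 = q l.
  rewrite -{1}lF /F -scaler_nat scalerA -(rmorph_nat (real_complex R)) -rmorphM /=.
  by rewrite divff ?pnatr_eq0 // scale1r.
by rewrite /q subrK.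
Qed.
End SquareRoots.

Section Contractivity.
Variables (R : realType).

(** Formally [k + i (1 + w)] is unitary. Multiplying it by [k] gives [p + i q], which lies in the
    algebra and has norm [cnorm k], and likewise for [p - i q]. Their sum is [2 k^2], whence
    [2 |k|^2 <= 2 |k|]. *)
Lemma unitary_bound (A : cstarType R) (k w : A) : cstar k = k -> cstar w = w ->
  cmul k w = cmul w k -> w *+ 2 + cmul w w = - cmul k k -> cnorm k <= 1.
Proof.
move=> sk sw kw e; pose p := cmul k k; pose q := k + cmul w k.
pose i := 'i%C : R[i].
have sq c : c = i \/ c = - i -> cnorm (p + c *: q) = cnorm k.
  move=> hc; have cc : c^*%C = - c by case: hc => ->; rewrite /i ?rmorphN /=; apply/eqP; rewrite eq_complex /= ?oppr0 ?opprK ?eqxx.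
  have c2 : c * c = -1 by case: hc => ->; rewrite ?mulrNN /i -expr2 sqr_i.
  apply/eqP; rewrite -(eqrXn2 (n := 2)) ?cnorm_ge0 // -!cnorm_cstar; apply/eqP; congr cnorm.
  have sp : cstar p = p by rewrite /p cstarM sk.
  have qs : cstar q = k + cmul k w by rewrite /q cstarD cstarM sk sw.
  pose s := k + cmul k w; rewrite cstarD cstarZ cc sp qs -/s scaleNr.
  have -> : cmul (p - c *: s) (p + c *: q) =
      cmul p p + cmul s q + (c *: cmul p q - c *: cmul s p).
    by rewrite cmulDr !cmulBl !cmulZl !cmulZr scalerA c2 scaleN1r; cring.
  have -> : cmul p q = cmul s p.
    have D : cmul k w - cmul w k = 0 by rewrite kw subrr.
    rewrite -[RHS]addr0 -[X in _ + X](cmul0r k) -(cmul0l k) -D /p /q /s.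
    by cring.
  rewrite subrr addr0 sk.
  have H : cmul k (cmul (cmul k k + (w *+ 2 + cmul w w)) k) = 0 by rewrite e addrN cmul0l cmul0r.
  by rewrite -[RHS]addr0 -H /p /q /s; cring.
have : cnorm (p *+ 2) <= cnorm k + cnorm k.
  have -> : p *+ 2 = (p + i *: q) + (p + (- i) *: q) by rewrite scaleNr addrACA subrr addr0 mulr2n.
  by apply: le_trans (cnormD _ _) _; rewrite !sq; [|right|left].
have -> : cnorm (p *+ 2) = 2 * cnorm p.
  by rewrite -scaler_nat cnormZ -(rmorph_nat (real_complex R)) cabs_real ger0_norm.
rewrite /p cnorm_sa // => h; have [->|k0] := EM (k = 0); first by rewrite cnorm0.
by have := cnorm_gt0 k0; nra.
Qed.

Variables (A B : cstarType R) (f : A -> B).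
Hypothesis hf : star_hom f.

Lemma hom_small h : cstar h = h -> cnorm h <= 4^-1 -> cnorm (f h) <= 1.
Proof.
move=> sh h4; pose g := cmul h h; have sg : cstar g = g by rewrite /g cstarM sh.
have g8 : cnorm g <= 8^-1.
  by rewrite /g cnorm_sa //; have := cnorm_ge0 h; nra.
have [z [sz _ ez zS]] := inv_sqrt sg g8.
have hz : cmul h z = cmul z h.
  apply: (zS _ (commutant_sub sh)); first exact: commutant_closed.
  by rewrite /= /g cmulA.
have gz : cmul g z = cmul z g by rewrite /g -cmulA hz cmulA hz -cmulA.
(* Here [1 + w = (1 - g)(1 + z)] is the square root of [1 - h^2], so [h] and [w] satisfy the
   relations of [unitary_bound], and any homomorphism preserves these. *)
pose w := z - g - cmul g z.
have hw : cmul h w = cmul w h.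
  have hS := commutant_sub sh.
  have gS : cmul h g = cmul g h by rewrite /g cmulA.
  by apply: (subB hS); [exact: (subB hS)|exact: (subM hS)].
apply: (@unitary_bound _ (f h) (f w)).
- by rewrite -(homS hf) sh.
- by rewrite -(homS hf) /w !cstarB cstarM sz sg gz.
- by rewrite -!(homM hf) hw.
- rewrite -!(homM hf) -(homMn hf) -(homD hf) -(homN hf); congr f; rewrite -/g.
  pose E := z *+ 2 + cmul z z - (g + cmul g z *+ 2 + cmul g (cmul z z)).
  have E0 : E = 0 by rewrite /E ez subrr.
  pose D := cmul g z - cmul z g; have D0 : D = 0 by rewrite /D gz subrr.
  transitivity (- g + (E - cmul g E) + (D + cmul D z - cmul g D - cmul g (cmul D z))).
    by rewrite /w /E /D; cring.
  by rewrite E0 D0 !(cmul0l, cmul0r) !subr0 !addr0.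
Qed.

(** Scaling [hom_small] gives a bound with constant 4 on self-adjoint elements; [pow_trick] on their
    powers removes the constant, and the C*-identity passes to arbitrary [x]. *)
Lemma hom_le x : cnorm (f x) <= cnorm x.
Proof.
have bound h : cstar h = h -> cnorm (f h) <= 4 * cnorm h.
  move=> sh; have [->|h0] := EM (h = 0); first by rewrite (hom0 hf) !cnorm0 mulr0.
  have n0 := cnorm_gt0 h0; pose t : R := (4 * cnorm h)^-1.
  have t0 : 0 < t by rewrite invr_gt0 mulr_gt0.
  have ct y (D : cstarType R) (d : D) : y = t%:C%C -> cnorm (y *: d) = t * cnorm d.
    by move=> ->; rewrite cnormZ cabs_real gtr0_norm.
  have := @hom_small (t%:C%C *: h); rewrite cstarZ conjc_real sh => /(_ erefl).
  have tn : t * cnorm h = 4^-1 by rewrite /t invfM -mulrA mulVf ?mulr1 // gt_eqF.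
  rewrite (homZ hf) !ct // tn => /(_ (lexx _)); rewrite /t mulrC ler_pdivrMr ?mulr_gt0 //.
  by rewrite mul1r.
have sa h : cstar h = h -> cnorm (f h) <= cnorm h.
  move=> sh; apply: (@pow_trick _ _ _ 4) => [||n]; try exact: cnorm_ge0.
  have H (D : cstarType R) n' (d : D) : cstar d = d ->
      let y := iter n' (fun y => cmul y y) d in cstar y = y /\ cnorm y = cnorm d ^+ (2 ^ n').
    move=> sd; elim: n' => [|m [IH1 IH2]] //=; split; first by rewrite cstarM IH1.
    by rewrite cnorm_sa // IH2 -exprM -expnSr.
  have fi : iter n (fun y => cmul y y) (f h) = f (iter n (fun y => cmul y y) h).
    by elim: n => //= m ->; rewrite (homM hf).
  have sfh : cstar (f h) = f h by rewrite -(homS hf) sh.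
  have [_ <-] := H B n _ sfh; have [s1 <-] := H A n _ sh.
  by rewrite fi bound.
have := sa (cmul (cstar x) x); rewrite cstarM cstarK => /(_ erefl).
rewrite (homM hf) (homS hf) !cnorm_cstar ler_sqr ?nnegrE //; exact: cnorm_ge0.
Qed.

End Contractivity.

(** * Perturbation of matrix unit systems *)

Section Projections.
Variables (R : realType) (A : cstarType R).
Implicit Types x y z p q s h u v w : A.

Definition projection p := cstar p = p /\ cmul p p = p.

Lemma projection_le1 p : projection p -> cnorm p <= 1.
Proof.
move=> [sp pp]; have [->|p0] := EM (p = 0); first by rewrite cnorm0.
have := cnorm_sa sp; rewrite pp expr2 => e; have p1 := cnorm_gt0 p0.
by rewrite -(ler_pM2r p1) mul1r -e.
Qed.

Lemma projection_lt1 p : projection p -> cnorm p < 1 -> p = 0.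
Proof.
move=> [sp pp] h; have [//|p0] := EM (p = 0); have p1 := cnorm_gt0 p0.
by have := cnorm_sa sp; rewrite pp => e; clear sp pp p0; exfalso; nra.
Qed.

Lemma cnorm_half k x : cnorm ((k : R)%:C%C *: x) = `|k| * cnorm x.
Proof. by rewrite cnormZ cabs_real. Qed.

Lemma scale2 x : ((2^-1 : R)%:C%C *: x) *+ 2 = x.
Proof.
rewrite -scaler_nat scalerA -(rmorph_nat (real_complex R)) -rmorphM /=.
by rewrite divff ?pnatr_eq0 // scale1r.
Qed.

Lemma mul2I x y : x *+ 2 = y *+ 2 -> x = y.
Proof.
move=> h; rewrite -[x]scale2 -[y]scale2 !scalerMnr.
by rewrite h.
Qed.

Lemma cnormMn x n : cnorm (x *+ n) <= n%:R * cnorm x.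
Proof.
elim: n => [|n IH]; first by rewrite mulr0n cnorm0 mul0r.
by rewrite mulrS; apply: le_trans (cnormD _ _) _; rewrite -natr1 mulrDl mul1r; lra.
Qed.

(** For [h = 4 (s - s^2)] one has [1 - h = (1 - 2 s)^2], so [(2 s - 1)(1 + z)] is the sign of
    [2 s - 1], and [p] is [(1 + sign) / 2] after cancellation of the unit. *)
Lemma near_projection s : cstar s = s -> cnorm s <= 3 / 2 ->
  cnorm (cmul s s - s) <= 32^-1 ->
  exists2 p, projection p & cnorm (p - s) <= 8 * cnorm (cmul s s - s).
Proof.
move=> ss s2 h1; pose h := (s - cmul s s) *+ 4; set d := cnorm (_ - _) in h1 *.
have hd : cnorm h <= 4 * d by rewrite /d cnormC; exact: cnormMn.
have sh : cstar h = h by rewrite /h !mulrS mulr0n !(cstarD, cstarB, cstarM, cstar0) ss.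
have [|z [sz zh ez zS]] := inv_sqrt sh _; first by lra.
have sz' : cmul s z = cmul z s.
  apply: (zS _ (commutant_sub ss)); first exact: commutant_closed.
  by rewrite /= /h; cring.
pose p := s + cmul s z - (2^-1 : R)%:C%C *: z.
exists p; last first.
  have -> : p - s = cmul s z - (2^-1 : R)%:C%C *: z by rewrite /p; cring.
  apply: le_trans (cnormB _ _) _; rewrite cnorm_half ger0_norm ?invr_ge0 //.
  have := cnormM_le s z; have := cnorm_ge0 z; nra.
split; first by rewrite /p !(cstarD, cstarB, cstarM) cstarZ conjc_real sz ss -sz'.
apply: mul2I; apply: mul2I.
have e1 : p *+ 2 = s *+ 2 + cmul s z *+ 2 - z by rewrite /p mulrnBl mulrnDl scale2.
have -> : cmul p p *+ 2 *+ 2 = cmul (p *+ 2) (p *+ 2) by cring.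
rewrite e1; apply/eqP; rewrite -subr_eq0; apply/eqP.
pose E := z *+ 2 + cmul z z - (h + cmul h z *+ 2 + cmul h (cmul z z)).
have E0 : E = 0 by rewrite /E ez subrr.
pose D := cmul s z - cmul z s; have D0 : D = 0 by rewrite /D sz' subrr.
transitivity (E + (D *+ 2 - cmul s D *+ 4 - cmul s (cmul D z) *+ 4 + cmul D z *+ 2)).
  by rewrite /E /D /h; cring.
by rewrite E0 D0 !(cmul0l, cmul0r) !mul0rn !subr0 !addr0.
Qed.

Lemma cnorm_sq_le x (c : R) : 0 <= c -> cnorm (cmul (cstar x) x) <= c ^+ 2 -> cnorm x <= c.
Proof. by move=> c0; rewrite cnorm_cstar ler_sqr ?nnegrE // cnorm_ge0. Qed.

(* Polar decomposition: [w^* w] is close to the projection [p]. *)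
Lemma near_isometry p w : projection p -> cmul w p = w ->
  cnorm (cmul (cstar w) w - p) <= 8^-1 ->
  exists z, [/\ cnorm z <= cnorm (cmul (cstar w) w - p), cmul z p = z &
    cmul (cstar (w + cmul w z)) (w + cmul w z) = p].
Proof.
move=> [sp pp] wp h8; pose h := p - cmul (cstar w) w.
have sh : cstar h = h by rewrite /h cstarB cstarM cstarK sp.
have hd : cnorm h = cnorm (cmul (cstar w) w - p) by rewrite cnormC.
rewrite -hd in h8 *; have [z [sz zh ez zS]] := inv_sqrt sh h8.
have pw : cmul p (cstar w) = cstar w by rewrite -{2}wp cstarM sp.
have ph : cmul p h = h by rewrite /h cmulBr pp cmulA pw.
have hp : cmul h p = h by rewrite /h cmulBl pp -cmulA wp.
(* The corner of [p] is a closed subalgebra containing [h], hence [z]; there [p] is the unit, and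
   the equation for [z] becomes [(w^* w)(p + z)^2 = p]. *)
pose S := [set x : A | cmul p x = x /\ cmul x p = x].
have [pz zp] : S z.
  apply: zS => //.
  - split=> [|k x y [h1 h2] [h3 h4]|x y [h1 h2] [h3 h4]|x [h1 h2]].
    + by rewrite /S /= cmul0l cmul0r.
    + by split; rewrite ?cmulDr ?cmulDl ?cmulZr ?cmulZl ?h1 ?h2 ?h3 ?h4.
    + by split; [rewrite cmulA h1|rewrite -cmulA h4].
    + by split; rewrite -{1}sp -cstarM ?h1 ?h2.
  apply/cclosedP => x hx.
  have small e : 0 < e -> exists2 y, S y & cnorm (x - y) <= e / 2.
    by move=> e0; have [|y Sy /ltW xy] := hx (e / 2); [rewrite divr_gt0|exists y].
  have p1 := projection_le1 (conj sp pp).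
  split; apply/eqP; rewrite -subr_eq0; apply/eqP/cnorm_small => e /small[y [h1 h2] xy].
    have -> : cmul p x - x = cmul p (x - y) - (x - y) by rewrite cmulBr h1; cring.
    by apply: le_trans (cnormB _ _) _; have := cnormM_le p (x - y); have := cnorm_ge0 (x - y); clear -xy p1; nra.
  have -> : cmul x p - x = cmul (x - y) p - (x - y) by rewrite cmulBl h2; cring.
  by apply: le_trans (cnormB _ _) _; have := cnormM_le (x - y) p; have := cnorm_ge0 (x - y); clear -xy p1; nra.
have hz : cmul h z = cmul z h by apply: (zS _ (commutant_sub sh)) => //; exact: commutant_closed.
exists z; split=> //.
rewrite cstarD cstarM sz.
have -> : cmul (cstar w + cmul z (cstar w)) (w + cmul w z) =
    p - h + (cmul z p - cmul z h) + (cmul p z - cmul h z)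
    + (cmul z (cmul p z) - cmul (cmul z h) z) by rewrite /h; cring.
rewrite pz zp -hz -cmulA.
rewrite -[RHS]addr0; have E0 : z *+ 2 + cmul z z - (h + cmul h z *+ 2 + cmul h (cmul z z)) = 0.
  by rewrite ez subrr.
by rewrite -E0; cring.
Qed.
End Projections.

Section Systems.
Variables (R : realType) (A : cstarType R).
Implicit Types x y z p : A.

(* [v 0, ..., v (n - 1)] are partial isometries with orthogonal ranges; the
   source projection of [v i] is [v (b i)], so that the [v i v_j^*] with
   [b i = b j] are matrix units. *)
Definition block_map (n : nat) (b : nat -> nat) :=
  forall i, (i < n)%N -> (b i < n)%N /\ b (b i) = b i.
Definition gram (b : nat -> nat) (v : nat -> A) i j : A := if i == j then v (b i) else 0.
Definition msystem n b (v : nat -> A) := block_map n b /\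
  forall i j, (i < n)%N -> (j < n)%N -> cmul (cstar (v i)) (v j) = gram b v i j.
Definition munit (v : nat -> A) i j := cmul (v i) (cstar (v j)).
Definition mspan n (b : nat -> nat) (v : nat -> A) : set A :=
  [set x | exists c : nat -> nat -> R[i],
    x = \sum_(i < n) \sum_(j < n | b i == b j) c i j *: munit v i j].

(** The components of [u] along the earlier [w i] are subtracted. The rest is exactly orthogonal to
    them and still nearly isometric on [p]; [near_isometry] corrects it by multiplication on the
    right, which keeps the orthogonality. *)
Lemma gram_schmidt_step n (P : nat -> A) (w : nat -> A) (p u : A) (s t : R) :
  projection p -> cmul u p = u -> (forall i, (i < n)%N -> projection (P i)) ->
  (forall i, (i < n)%N -> cmul (w i) (P i) = w i) ->
  (forall i j, (i < n)%N -> (j < n)%N ->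
     cmul (cstar (w i)) (w j) = if i == j then P i else 0) ->
  0 <= s <= t -> 0 < t -> t <= 16^-1 -> 9 * n%:R * t <= 1 -> cnorm u <= 2 ->
  cnorm (cmul (cstar u) u - p) <= s ->
  (forall i, (i < n)%N -> cnorm (cmul (cstar (w i)) u) <= 3 * t) ->
  (forall i, (i < n)%N -> cnorm (w i) <= 1) ->
  exists w', [/\ cmul w' p = w', cmul (cstar w') w' = p, 
     cnorm (w' - u) <= (3 * n%:R + 4) * t &
     forall i, (i < n)%N -> cmul (cstar (w i)) w' = 0].
Proof.
move=> hp up hP wP ww /andP[s0 st] t0 t16 nt u2 hu hwu w1.
pose y i := cmul (cstar (w i)) u.
pose w0 := u - \sum_(i < n) cmul (w i) (y i).
have w0p : cmul w0 p = w0.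
  rewrite /w0 cmulBl up cmul_suml; congr (_ - _); apply: eq_bigr => i _.
  by rewrite /y -!cmulA up.
have orth i : (i < n)%N -> cmul (cstar (w i)) w0 = 0.
  move=> hi; rewrite /w0 cmulBr cmul_sumr (bigD1 (Ordinal hi)) //= big1.
    rewrite addr0 cmulA ww // eqxx /y cmulA.
    have [sP _] := hP i hi; have -> : cmul (P i) (cstar (w i)) = cstar (w i).
      by rewrite -{2}(wP i hi) cstarM sP.
    by rewrite subrr.
  move=> j ji; rewrite cmulA ww //; have -> : i == j = false.
    by apply/negbTE; apply: contra ji => /eqP ij; apply/eqP/val_inj; rewrite /= ij.
  by rewrite cmul0l.
have e0 : cmul (cstar w0) w0 - p = (cmul (cstar u) u - p) - \sum_(i < n) cmul (cstar (y i)) (y i).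
  have -> : cmul (cstar w0) w0 = cmul (cstar u) w0.
    rewrite {1}/w0 cstarB cmulBl cstar_sum cmul_suml big1 ?subr0 // => i _.
    by rewrite cstarM -cmulA orth // cmul0r.
  rewrite /w0 cmulBr cmul_sumr addrAC; congr (_ - _ - _); apply: eq_bigr => i _.
  by rewrite cmulA /y cstarM cstarK.
have n0 : 0 <= n%:R :> R by rewrite ler0n.
have sumle (F : 'I_n -> R) (c : R) : (forall i, F i <= c) -> \sum_(i < n) F i <= n%:R * c.
  move=> h; apply: le_trans (ler_sum _ (fun i _ => h i)) _.
  by rewrite sumr_const card_ord mulr_natl lexx.
have d0 : cnorm (cmul (cstar w0) w0 - p) <= 2 * t.
  rewrite e0; apply: le_trans (cnormB _ _) _.
  have h1 : cnorm (\sum_(i < n) cmul (cstar (y i)) (y i)) <= n%:R * (9 * t * t).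
    apply: le_trans (cnorm_sum _ _ _) _; apply: sumle => i; rewrite cnorm_cstar.
    by have := hwu i (ltn_ord i); have := cnorm_ge0 (y i); rewrite -/(y i); nra.
  have : 9 * n%:R * t * t <= 1 * t by rewrite ler_pM2r.
  by lra.
have [|z [zd zp ez]] := near_isometry hp w0p _; first by lra.
have w0u : cnorm (w0 - u) <= 3 * n%:R * t.
  have -> : w0 - u = - \sum_(i < n) cmul (w i) (y i) by rewrite /w0; cring.
  rewrite cnormN; apply: le_trans (cnorm_sum _ _ _) _.
  have -> : 3 * n%:R * t = n%:R * (3 * t) by ring.
  apply: sumle => i; apply: le_trans (cnormM_le _ _) _.
  have := w1 i (ltn_ord i); have := hwu i (ltn_ord i); rewrite -/(y i).
  by have := cnorm_ge0 (w i); have := cnorm_ge0 (y i); nra.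
have w02 : cnorm w0 <= 2.
  apply: cnorm_sq_le => //; apply: le_trans (cnorm_le _ p) _.
  by have := projection_le1 hp; lra.
exists (w0 + cmul w0 z); split=> //.
- by rewrite cmulDl w0p -cmulA zp.
- have -> : w0 + cmul w0 z - u = (w0 - u) + cmul w0 z by cring.
  apply: le_trans (cnormD _ _) _; have := cnormM_le w0 z; have := cnorm_ge0 z.
  by have := cnorm_ge0 w0; clear - w0u w02 zd d0 t0; nra.
- by move=> i hi; rewrite cmulDr cmulA orth // cmul0l addr0.
Qed.

Lemma projection_normM p x : projection p -> cnorm (cmul x p) <= cnorm x /\ cnorm (cmul p x) <= cnorm x.
Proof.
move=> /projection_le1 p1; have := cnormM_le x p; have := cnormM_le p x.
by have := cnorm_ge0 x; clear -p1; nra.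
Qed.

Lemma isometry_le1 w p : projection p -> cmul (cstar w) w = p -> cnorm w <= 1.
Proof. by move=> hp e; apply: cnorm_sq_le => //; rewrite e expr1n projection_le1. Qed.

(** One step multiplies the error by at most [K = 3 n + 4], whence the power in the conclusion; the
    last hypothesis keeps [16 K t <= 1] in every step. *)
Lemma gram_schmidt n (P u : nat -> A) (s : R) :
  (forall i, (i < n)%N -> projection (P i)) ->
  (forall i, (i < n)%N -> cmul (u i) (P i) = u i) -> 
  (forall i, (i < n)%N -> cnorm (u i) <= 2) -> 0 < s ->
  (forall i j, (i < n)%N -> (j < n)%N ->
    cnorm (cmul (cstar (u i)) (u j) - if i == j then P i else 0) <= s) ->
  16 * (3 * n%:R + 4) ^+ n.+1 * s <= 1 ->
  exists w : nat -> A, [/\ forall i, (i < n)%N -> cmul (w i) (P i) = w i,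
    forall i j, (i < n)%N -> (j < n)%N -> cmul (cstar (w i)) (w j) = if i == j then P i else 0 &
    forall i, (i < n)%N -> cnorm (w i - u i) <= (3 * n%:R + 4) ^+ n * s].
Proof.
move=> hP uP u2 s0 hu hs; set K := 3 * n%:R + 4 in hs *.
have n0 : 0 <= n%:R :> R by rewrite ler0n.
have K4 : 4 <= K by rewrite /K; lra.
have K1 : 1 <= K by lra.
suff H m : (m <= n)%N -> exists w : nat -> A, [/\ forall i, (i < m)%N -> cmul (w i) (P i) = w i,
    forall i j, (i < m)%N -> (j < m)%N -> cmul (cstar (w i)) (w j) = if i == j then P i else 0 &
    forall i, (i < m)%N -> cnorm (w i - u i) <= K ^+ m * s] by exact: H.
elim: m => [|m IH] mn; first by exists u.
have [w [wP ww wu]] := IH (ltnW mn); pose t := K ^+ m * s.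
have Km : K ^+ m <= K ^+ n by rewrite ler_weXn2l // ltnW.
have Km1 : 1 <= K ^+ m by rewrite exprn_ege1.
have t0 : 0 < t by rewrite mulr_gt0 // (lt_le_trans ltr01).
have st : s <= t by rewrite -{1}[s]mul1r ler_pM2r.
have tK : 16 * K * t <= 1.
  apply: le_trans hs; rewrite exprS /t !mulrA ler_pM2r // -!mulrA ler_pM2l // ler_pM2l //.
  by lra.
have t16 : t <= 16^-1.
  have : 1 * t <= K * t by rewrite ler_pM2r.
  by lra.
have mn' : m%:R <= n%:R :> R by rewrite ler_nat ltnW.
have m0 : 0 <= m%:R :> R by rewrite ler0n.
have lt i : (i < m)%N -> (i < n)%N by move=> im; exact: ltn_trans mn.
have w1 i : (i < m)%N -> cnorm (w i) <= 1.
  by move=> im; apply: (isometry_le1 (hP i (lt i im))); rewrite ww // eqxx.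
have [|||||||||||||w' [w'P w'w' w'u w'w]] := @gram_schmidt_step m P w (P m) (u m) s t.
- exact: hP.
- exact: uP.
- by move=> i im; apply/hP/lt.
- exact: wP.
- exact: ww.
- by rewrite st ltW.
- by [].
- by [].
- have : 9 * m%:R * t <= 16 * K * t by rewrite ler_pM2r // /K; lra.
  by lra.
- exact: u2.
- by have := hu m m mn mn; rewrite eqxx.
- move=> i im; have -> : cmul (cstar (w i)) (u m) =
      cmul (cstar (w i - u i)) (u m) + cmul (cstar (u i)) (u m) by rewrite cstarB cmulBl subrK.
  apply: le_trans (cnormD _ _) _; have := hu i m (lt i im) mn; rewrite ltn_eqF // subr0.
  have := cnormM_le (cstar (w i - u i)) (u m); rewrite cnormS.
  have := wu i im; rewrite -/t; have := u2 m mn; have := cnorm_ge0 (u m).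
  have := cnorm_ge0 (w i - u i); clear -st; nra.
- exact: w1.
exists (fun i => if (i < m)%N then w i else w'); split.
- move=> i; rewrite ltnS leq_eqVlt => /orP[/eqP->|im]; first by rewrite ltnn.
  by rewrite im wP.
- have sw i : (i < m)%N -> cmul (cstar w') (w i) = 0.
    by move=> im; rewrite -[w i]cstarK -cstarM w'w // cstar0.
  move=> i j; rewrite ltnS leq_eqVlt => /orP[/eqP->|im]; rewrite ltnS leq_eqVlt => /orP[/eqP->|jm].
  + by rewrite ltnn eqxx.
  + by rewrite ltnn jm sw // gtn_eqF.
  + by rewrite ltnn im w'w // ltn_eqF.
  + by rewrite im jm ww.
- move=> i; rewrite ltnS leq_eqVlt => /orP[/eqP->|im].
    rewrite ltnn exprS -mulrA -/t; apply: le_trans w'u _; rewrite ler_pM2r // /K; lra.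
  rewrite im; apply: le_trans (wu i im) _; rewrite exprS -mulrA -/t -{1}[t]mul1r ler_pM2r //.
Qed.
End Systems.

(** * Spans of matrix units are closed subalgebras *)

Section ComplexComplete.
Variable R : realType.

Lemma Re_le_cabs (z : R[i]) : `|complex.Re z| <= cabs z.
Proof. by rewrite -lecR -cabsE normc_ge_Re. Qed.
Lemma Im_le_cabs (z : R[i]) : `|complex.Im z| <= cabs z.
Proof.
have -> : cabs z = cabs (z * 'i%C) by rewrite cabsM [X in _ * X]/cabs normc_def /= expr0n expr1n add0r sqrtr1 mulr1.
apply: le_trans (Re_le_cabs _); case: z => a b /=.
by rewrite mulr0 mulr1 sub0r normrN.
Qed.

Lemma real_complete (u : nat -> R) :
  (forall e, 0 < e -> exists N, forall m n, (N <= m)%N -> (N <= n)%N -> `|u m - u n| <= e) ->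
  exists l, forall e, 0 < e -> exists N, forall n, (N <= n)%N -> `|l - u n| <= e.
Proof.
move=> cu; have cvgu : cvg (u @ \oo).
  apply/cauchy_cvgP/cauchy_exP => e e0.
  have [|N hN] := cu (e / 2); first by rewrite divr_gt0.
  exists (u N); exists N => // n /= Nn; rewrite -ball_normE /=.
  by apply: le_lt_trans (hN _ _ (leqnn _) Nn) _; lra.
exists (lim (u @ \oo)) => e e0.
have /cvgrPdist_lt /(_ e) := cvgu => /(_ e0) [N _ hN].
by exists N => n /hN /= /ltW.
Qed.

Lemma complex_complete (u : nat -> R[i]) :
  (forall e, 0 < e -> exists N, forall m n, (N <= m)%N -> (N <= n)%N -> cabs (u m - u n) <= e) ->
  exists l, forall e, 0 < e -> exists N, forall n, (N <= n)%N -> cabs (l - u n) <= e.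
Proof.
move=> cu; have ReB (z w : R[i]) : complex.Re (z - w) = complex.Re z - complex.Re w by case: z w => ? ? [].
have ImB (z w : R[i]) : complex.Im (z - w) = complex.Im z - complex.Im w by case: z w => ? ? [].
have [|a ha] := @real_complete (fun n => complex.Re (u n)).
  move=> e /cu[N hN]; exists N => m n Nm Nn; apply: le_trans (hN m n Nm Nn).
  by rewrite -ReB Re_le_cabs.
have [|b hb] := @real_complete (fun n => complex.Im (u n)).
  move=> e /cu[N hN]; exists N => m n Nm Nn; apply: le_trans (hN m n Nm Nn).
  by rewrite -ImB Im_le_cabs.
exists (a +i* b)%C => e e0; have e2 : 0 < e / 2 by rewrite divr_gt0.
have [N hN] := ha _ e2; have [K hK] := hb _ e2; exists (maxn N K) => n.
rewrite geq_max => /andP[/hN h1 /hK h2]; apply: le_trans (cabs_le _) _.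
by rewrite ReB ImB /=; lra.
Qed.

Variable A : cstarType R.

(** The one-dimensional case to which [mspan_closed] is reduced by means of the coordinates
    [v_k^* x v_l]. *)
Lemma line_closed (p x : A) :
  (forall e, 0 < e -> exists c, cnorm (x - c *: p) < e) -> exists c, x = c *: p.
Proof.
move=> hx; have [p0|p0] := EM (p = 0).
  exists 0; rewrite scale0r; apply: cnorm_small => e /hx[c].
  by rewrite p0 scaler0 subr0 => /ltW.
have p1 := cnorm_gt0 p0.
have [c hc] := choice (fun n => hx _ (halves_gt0 R n)).
have cc m n : cabs (c m - c n) * cnorm p <= halves R m + halves R n.
  rewrite -cnormZ scalerBl; have -> : c m *: p - c n *: p = (x - c n *: p) - (x - c m *: p) by cring.
  by apply: le_trans (cnormB _ _) _; have := hc m; have := hc n; lra.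
have [|l hl] := @complex_complete c.
  move=> e e0; have [|N hN] := @halves_small R (e * cnorm p / 2); first by rewrite divr_gt0 ?mulr_gt0.
  exists N => m n Nm Nn; rewrite -(ler_pM2r p1); apply: le_trans (cc m n) _.
  by have := hN m Nm; have := hN n Nn; lra.
exists l; apply/eqP; rewrite -subr_eq0; apply/eqP/cnorm_small => e e0.
have [|N hN] := @halves_small R (e / 2); first by rewrite divr_gt0.
have [|K hK] := hl (e / 2 / cnorm p); first by rewrite !divr_gt0.
pose n := maxn N K; have h1 := hN n (leq_maxl _ _); have := hK n (leq_maxr _ _).
rewrite ler_pdivlMr // -cnormZ => h2.
have -> : x - l *: p = (x - c n *: p) - (l - c n) *: p by rewrite scalerBl; cring.
by apply: le_trans (cnormB _ _) _; have := hc n; lra.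
Qed.
End ComplexComplete.

Section Span.
Variables (R : realType) (A : cstarType R) (n : nat) (b : nat -> nat) (v : nat -> A).
Hypothesis hv : msystem n b v.
Implicit Types x y z : A.

Let blk i : (i < n)%N -> (b i < n)%N. Proof. by case: hv => h _ /h[]. Qed.
Let blkb i : (i < n)%N -> b (b i) = b i. Proof. by case: hv => h _ /h[]. Qed.
Let gr i j : (i < n)%N -> (j < n)%N -> cmul (cstar (v i)) (v j) = gram b v i j.
Proof. by case: hv => _ h; exact: h. Qed.

Lemma block_projection i : (i < n)%N -> projection (v (b i)).
Proof.
move=> hi; have := gr (blk hi) (blk hi); rewrite /gram eqxx blkb // => e.
have s : cstar (v (b i)) = v (b i) by rewrite -{1}e cstarM cstarK e.
by split=> //; rewrite -{3}e s.
Qed.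

Lemma mv_block i : (i < n)%N -> cmul (v i) (v (b i)) = v i.
Proof.
move=> hi; have [sp pp] := block_projection hi; set p := v (b i) in sp pp *.
apply/eqP; rewrite -subr_eq0; apply/eqP/cnorm_eq0/eqP.
rewrite -sqrf_eq0 -cnorm_cstar cstarB cstarM sp.
have e : cmul (cstar (v i)) (v i) = p by rewrite gr // /gram eqxx.
have -> : cmul (cmul p (cstar (v i)) - cstar (v i)) (cmul (v i) p - v i) =
   cmul p (cmul (cmul (cstar (v i)) (v i)) p) - cmul p (cmul (cstar (v i)) (v i))
   - cmul (cmul (cstar (v i)) (v i)) p + cmul (cstar (v i)) (v i) by cring.
by rewrite e !pp subrr sub0r addNr cnorm0.
Qed.

Lemma mnorm_le1 i : (i < n)%N -> cnorm (v i) <= 1.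
Proof. by move=> hi; apply: (isometry_le1 (block_projection hi)); rewrite gr // /gram eqxx. Qed.

Lemma munitM i j k l : (i < n)%N -> (j < n)%N -> (k < n)%N -> (l < n)%N -> b i = b j ->
  cmul (munit v i j) (munit v k l) = if j == k then munit v i l else 0.
Proof.
move=> hi hj hk hl bij; rewrite /munit.
have -> : cmul (cmul (v i) (cstar (v j))) (cmul (v k) (cstar (v l))) =
  cmul (v i) (cmul (cmul (cstar (v j)) (v k)) (cstar (v l))) by cring.
rewrite gr // /gram; case: eqP => // _; last by rewrite cmul0l cmul0r.
by rewrite cmulA -bij mv_block.
Qed.

Lemma mspan0 : mspan n b v 0.
Proof.
exists (fun _ _ => 0); rewrite big1 // => i _; rewrite big1 // => j _; exact: scale0r.
Qed.

Lemma mspan_lin k x y : mspan n b v x -> mspan n b v y -> mspan n b v (k *: x + y).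
Proof.
move=> [c ->] [d ->]; exists (fun i j => k * c i j + d i j).
rewrite scaler_sumr -big_split; apply: eq_bigr => i _ /=.
rewrite scaler_sumr -big_split; apply: eq_bigr => j _ /=.
by rewrite scalerDl scalerA.
Qed.

Lemma mspan_sum I (s : seq I) (P : pred I) F :
  (forall i, P i -> mspan n b v (F i)) -> mspan n b v (\sum_(i <- s | P i) F i).
Proof.
move=> h; elim/big_ind: _ => //; first exact: mspan0.
by move=> x y hx hy; rewrite -[x]scale1r; exact: mspan_lin.
Qed.

Lemma mspanZ k x : mspan n b v x -> mspan n b v (k *: x).
Proof. by move=> hx; rewrite -[_ *: x]addr0; apply: mspan_lin => //; exact: mspan0. Qed.

Lemma mspan_munit i j : (i < n)%N -> (j < n)%N -> b i = b j -> mspan n b v (munit v i j).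
Proof.
move=> hi hj bij; exists (fun k l => ((k == i) && (l == j))%:R).
rewrite (bigD1 (Ordinal hi)) //= (bigD1 (Ordinal hj)) /=; last by rewrite bij.
rewrite !eqxx scale1r !big1 ?addr0 //.
- move=> k ki; rewrite big1 // => l _; case: eqP => e; last by rewrite scale0r.
  by case/eqP: ki; apply/val_inj.
- move=> l /andP[_ lj]; rewrite andTb; case: eqP => e; last by rewrite scale0r.
  by case/eqP: lj; apply/val_inj.
Qed.

Lemma mspan_sub : star_subalgebra (mspan n b v).
Proof.
split; [exact: mspan0|exact: mspan_lin| |].
- move=> x y [c ->] [d ->]; rewrite cmul_suml; apply: mspan_sum => i _.
  rewrite cmul_suml; apply: mspan_sum => j /eqP bij; rewrite cmul_sumr; apply: mspan_sum => k _.
  rewrite cmul_sumr; apply: mspan_sum => l /eqP bkl.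
  rewrite cmulZl cmulZr; do 2 apply: mspanZ; rewrite munitM //.
  case: eqP => [e|_]; last exact: mspan0.
  by apply: mspan_munit => //; rewrite bij e.
- move=> x [c ->]; rewrite cstar_sum; apply: mspan_sum => i _.
  rewrite cstar_sum; apply: mspan_sum => j /eqP bij; rewrite cstarZ; apply: mspanZ.
  by rewrite /munit cstarM cstarK; apply: mspan_munit.
Qed.

Lemma mspan_coord (c : nat -> nat -> R[i]) k l x : (k < n)%N -> (l < n)%N ->
  x = \sum_(i < n) \sum_(j < n | b i == b j) c i j *: munit v i j ->
  cmul (cstar (v k)) (cmul x (v l)) = if b k == b l then c k l *: v (b k) else 0.
Proof.
move=> hk hl ->; rewrite cmul_suml cmul_sumr (bigD1 (Ordinal hk)) //= [X in _ + X]big1 ?addr0.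
  rewrite cmul_suml cmul_sumr.
  have tm j : (j < n)%N -> cmul (cstar (v k)) (cmul (c k j *: munit v k j) (v l)) =
      if j == l then c k j *: cmul (v (b k)) (v (b j)) else 0.
    move=> hj; rewrite cmulZl cmulZr /munit.
    have -> : cmul (cstar (v k)) (cmul (cmul (v k) (cstar (v j))) (v l)) =
      cmul (cmul (cstar (v k)) (v k)) (cmul (cstar (v j)) (v l)) by cring.
    by rewrite !gr // /gram eqxx; case: eqP; rewrite ?cmul0r ?scaler0.
  case: eqP => bkl; last first.
    rewrite big1 // => j /eqP bkj; rewrite tm //; case: eqP => // e.
    by case: bkl; rewrite bkj e.
  rewrite (bigD1 (Ordinal hl)) /=; last by rewrite bkl.
  rewrite tm // eqxx -bkl (block_projection hk).2 big1 ?addr0 // => j /andP[_ jl].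
  rewrite tm //; case: eqP => // e; by case/eqP: jl; apply/val_inj.
move=> i ik; rewrite cmul_suml cmul_sumr big1 // => j _.
rewrite cmulZl cmulZr /munit.
have -> : cmul (cstar (v k)) (cmul (cmul (v i) (cstar (v j))) (v l)) =
  cmul (cmul (cstar (v k)) (v i)) (cmul (cstar (v j)) (v l)) by cring.
rewrite !gr // {1}/gram; case: eqP => e; last by rewrite cmul0l scaler0.
by case/eqP: ik; apply/val_inj.
Qed.

Definition msunit := \sum_(i < n) munit v i i.

Lemma msunit_mul x : mspan n b v x -> cmul msunit (cmul x msunit) = x.
Proof.
have sub_unit j k : (j < n)%N -> (k < n)%N -> b j = b k -> cmul msunit (munit v j k) = munit v j k.
  move=> hj hk bjk; rewrite /msunit cmul_suml (bigD1 (Ordinal hj)) //= munitM // eqxx.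
  rewrite big1 ?addr0 // => i ij; rewrite munitM //; case: eqP => // e.
  by case/eqP: ij; apply/val_inj.
have sub_unit' j k : (j < n)%N -> (k < n)%N -> b j = b k -> cmul (munit v j k) msunit = munit v j k.
  move=> hj hk bjk; rewrite /msunit cmul_sumr (bigD1 (Ordinal hk)) //= munitM // eqxx.
  rewrite big1 ?addr0 // => i ij; rewrite munitM //; case: eqP => // e.
  by case/eqP: ij; apply/val_inj.
move=> [c ->]; move: msunit sub_unit sub_unit' => m h1 h2.
rewrite cmul_suml cmul_sumr; apply: eq_bigr => i _.
rewrite cmul_suml cmul_sumr; apply: eq_bigr => j /eqP bij.
by rewrite cmulZl cmulZr h2 // h1.
Qed.

Lemma mspan_decomp x : cmul msunit (cmul x msunit) =
  \sum_(i < n) \sum_(j < n) cmul (v i) (cmul (cmul (cstar (v i)) (cmul x (v j))) (cstar (v j))).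
Proof.
rewrite /msunit cmul_suml; apply: eq_bigr => i _.
by rewrite !cmul_sumr; apply: eq_bigr => j _; rewrite /munit; cring.
Qed.

Lemma mspan_closed : closed (mspan n b v).
Proof.
apply/cclosedP => x hx.
have ub : exists2 m : R, 0 <= m & cnorm msunit <= m by exists (cnorm msunit); [exact: cnorm_ge0|].
have ex : cmul msunit (cmul x msunit) = x.
  have [m m0 hm] := ub.
  apply/eqP; rewrite -subr_eq0; apply/eqP/cnorm_small => e e0.
  have [|y sy xy] := hx (e / (m * m + 1)); first by rewrite divr_gt0 // ltr_wpDl // mulr_ge0.
  have -> : cmul msunit (cmul x msunit) - x = cmul msunit (cmul (x - y) msunit) - (x - y).
    by rewrite cmulBl cmulBr (msunit_mul sy); cring.
  apply: le_trans (cnormB _ _) _; have h1 := cnormM_le msunit (cmul (x - y) msunit).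
  have h2 := cnormM_le (x - y) msunit; have := cnorm_ge0 (x - y); have := cnorm_ge0 msunit.
  have mm : 0 < m * m + 1 by rewrite ltr_wpDl // mulr_ge0.
  move: xy; rewrite ltr_pdivlMr // => xy g1 g2.
  have h3 : cnorm msunit * (cnorm (x - y) * cnorm msunit) <= m * m * cnorm (x - y).
    rewrite mulrCA -[leRHS]mulrC; apply: ler_wpM2l => //; exact: ler_pM.
  have h4 : cnorm msunit * cnorm (cmul (x - y) msunit) <= cnorm msunit * (cnorm (x - y) * cnorm msunit).
    exact: ler_wpM2l.
  lra.
have coord (k l : 'I_n) : exists c : R[i],
    cmul (cstar (v k)) (cmul x (v l)) = (if b k == b l then c else 0) *: v (b k).
  have [|c hc] := @line_closed R A (if b k == b l then v (b k) else 0) (cmul (cstar (v k)) (cmul x (v l))).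
    move=> e e0; have [y [c ey] xy] := hx e e0; exists (c k l).
    have -> : c k l *: (if b k == b l then v (b k) else 0) = cmul (cstar (v k)) (cmul y (v l)).
      by rewrite (mspan_coord _ _ ey) //; case: eqP => // _; rewrite scaler0.
    apply: le_lt_trans xy; rewrite -cmulBr -cmulBl; apply: le_trans (cnormM_le _ _) _.
    rewrite cnormS; have := cnormM_le (x - y) (v l); have := mnorm_le1 (ltn_ord k); have := mnorm_le1 (ltn_ord l).
    have := cnorm_ge0 (v k); have := cnorm_ge0 (v l); have := cnorm_ge0 (x - y).
    have := cnorm_ge0 (cmul (x - y) (v l)); clear; nra.
  by exists c; rewrite hc; case: eqP => // _; rewrite scaler0 scale0r.
have [c hc] := choice (fun kl : 'I_n * 'I_n => coord kl.1 kl.2).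
rewrite -ex mspan_decomp; apply: mspan_sum => i _; apply: mspan_sum => j _.
rewrite (hc (i, j)) /=; case: eqP => bij; last by rewrite scale0r cmul0l cmul0r; exact: mspan0.
rewrite cmulZl cmulZr cmulA mv_block //; apply: mspanZ.
exact: mspan_munit.
Qed.
End Span.

Section Perturbation.
Variables (R : realType) (A : cstarType R).

(** The self-adjoint [s = v^* v] is within [d] of [v] and [s^2] within [3 d] of [s];
    [near_projection] costs [8 * 3 d], in all [25 d]. *)
Lemma near_idempotent (v : A) (d : R) : 0 <= d -> d <= 4096^-1 ->
  cnorm (cmul (cstar v) v - v) <= d ->
  exists2 p, projection p & cnorm (p - v) <= 25 * d.
Proof.
move=> d0 d1 h; set s := cmul (cstar v) v in h.
have v1 : cnorm v <= 33 / 32.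
  have : cnorm v ^+ 2 <= d + cnorm v by rewrite -cnorm_cstar; apply: le_trans (cnorm_le _ v) _; rewrite lerD2r.
  by have := cnorm_ge0 v; rewrite expr2; clear h; nra.
have s1 : cnorm s <= 3 / 2.
  by rewrite /s cnorm_cstar expr2; have := cnorm_ge0 v; clear h; nra.
have ss : cstar s = s by rewrite /s cstarM cstarK.
have h2 : cnorm (cmul s s - s) <= 3 * d.
  have -> : cmul s s - s = cmul (cstar (s - v)) s + cmul (cstar v) (s - v).
    by rewrite cstarB ss /s; cring.
  apply: le_trans (cnormD _ _) _; have := cnormM_le (cstar (s - v)) s; have := cnormM_le (cstar v) (s - v).
  by rewrite !cnormS; have := cnorm_ge0 (s - v); have := cnorm_ge0 v; have := cnorm_ge0 s; clear ss; nra.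
have [||p hp ps] := near_projection ss; [by []|by lra|exists p => //].
by apply: le_trans (cnorm_tri s _ _) _; lra.
Qed.

(** The defect is measured by [s ^+ 2] although the conclusion is linear in [s], because the
    distance from [v i] to its cut-down [u i] is only controlled through its square. *)
Theorem system_perturbation n b (v : nat -> A) (s : R) : block_map n b -> 0 < s ->
  16 * (3 * n%:R + 4) ^+ n.+1 * s <= 1 ->
  (forall i j, (i < n)%N -> (j < n)%N ->
     cnorm (cmul (cstar (v i)) (v j) - gram b v i j) <= s ^+ 2) ->
  exists w, msystem n b w /\
    forall i, (i < n)%N -> cnorm (w i - v i) <= 64 * (3 * n%:R + 4) ^+ n * s.
Proof.
move=> hb s0 hs hv; set K := 3 * n%:R + 4 in hs *; set d := s ^+ 2 in hv.
have n0 : 0 <= n%:R :> R by rewrite ler0n.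
have K1 : 4 <= K by rewrite /K; lra.
have Kn : 1 <= K ^+ n by rewrite exprn_ege1 //; lra.
have s64 : s <= 64^-1.
  have : 4 * 1 * s <= K ^+ n.+1 * s by rewrite ler_pM2r // exprS; apply: ler_pM.
  by lra.
have d0 : 0 <= d by rewrite sqr_ge0.
have ds : d <= s / 64 by rewrite /d expr2; nra.
have d1 : d <= 4096^-1 by lra.
(* Only indices fixed by [b] carry source projections; setting [P i := p (b i)] gives a whole block
   literally the same one. *)
have projs r : exists p, (r < n)%N -> b r = r -> projection p /\ cnorm (p - v r) <= 25 * d.
  have [/andP[hr /eqP br]|no] := EM ((r < n)%N && (b r == r)); last first.
    by exists 0 => hr br; case: no; rewrite hr br eqxx.
  have := hv r r hr hr; rewrite /gram eqxx br => /(near_idempotent d0 d1)[p hp ep].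
  by exists p.
have {projs} [p hp] := choice projs.
pose P i := p (b i).
have hP i : (i < n)%N -> projection (P i) /\ cnorm (P i - v (b i)) <= 25 * d.
  by move=> hi; have [h1 h2] := hb i hi; apply: hp.
have v1 i : (i < n)%N -> cnorm (v i) <= 33 / 32.
  move=> hi; have [h1 h2] := hb i hi; have := hv i i hi hi; rewrite /gram eqxx => hi2.
  have [pj pv] := hP i hi; have := projection_le1 pj => p1.
  have : cnorm (v i) ^+ 2 <= d + (25 * d + 1).
    rewrite -cnorm_cstar; apply: le_trans (cnorm_le _ (v (b i))) _; apply: lerD => //.
    by apply: le_trans (cnorm_le _ (P i)) _; rewrite cnormC; lra.
  by rewrite expr2; have := cnorm_ge0 (v i); clear hi2; nra.
pose D i := cmul (cstar (v i)) (v i) - P i.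
have hD i : (i < n)%N -> cnorm (D i) <= 26 * d.
  move=> hi; have := hv i i hi hi; rewrite /gram eqxx => h1; have [_ h2] := hP i hi.
  by apply: le_trans (cnorm_tri (v (b i)) _ _) _; rewrite [X in _ + X]cnormC; lra.
pose u i := cmul (v i) (P i).
have uv i : (i < n)%N -> cnorm (u i - v i) <= 11 * s.
  move=> hi; have [hp1 _] := hP i hi; have [sp pp] := hp1.
  rewrite cnormC; apply: cnorm_sq_le; first by rewrite mulr_ge0 // ltW.
  (* This is [(1 - P i) (D i) (1 - P i)] expanded without unit, so its norm is at most [4 * 26 d],
     below [(11 s)^2]. *)
  have -> : cmul (cstar (v i - u i)) (v i - u i) =
     D i - cmul (D i) (P i) - (cmul (P i) (D i) - cmul (cmul (P i) (D i)) (P i)).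
    rewrite /u cstarB cstarM sp.
    transitivity (D i - cmul (D i) (P i) - (cmul (P i) (D i) - cmul (cmul (P i) (D i)) (P i))
       + (P i - cmul (P i) (P i) *+ 2 + cmul (cmul (P i) (P i)) (P i))); first by rewrite /D; cring.
    by rewrite !pp; cring.
  have h := hD i hi; have [h1 _] := projection_normM (D i) hp1.
  have [_ h2] := projection_normM (D i) hp1; have [h3 _] := projection_normM (cmul (P i) (D i)) hp1.
  apply: le_trans (cnormB _ _) _; apply: le_trans (lerD (cnormB _ _) (cnormB _ _)) _.
  have -> : (11 * s) ^+ 2 = 121 * d by rewrite /d; ring.
  by lra.
have u2 i : (i < n)%N -> cnorm (u i) <= 2.
  move=> hi; have [hp1 _] := hP i hi; have [h1 _] := projection_normM (v i) hp1.
  by have := v1 i hi; rewrite /u; lra.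
have [||||||w [wP ww wu]] := @gram_schmidt R A n P u s.
- by move=> i /hP[].
- by move=> i /hP[[_ pp] _]; rewrite /u -cmulA pp.
- exact: u2.
- by [].
- move=> i j hi hj; have [hpi _] := hP i hi; have [hpj _] := hP j hj.
  have eu : cmul (cstar (u i)) (u j) = cmul (cmul (P i) (cmul (cstar (v i)) (v j))) (P j).
    by rewrite /u cstarM (hpi.1); cring.
  rewrite eu; case: eqP => ij.
    subst j; have -> : cmul (cmul (P i) (cmul (cstar (v i)) (v i))) (P i) - P i = cmul (cmul (P i) (D i)) (P i).
      by rewrite /D cmulBr hpi.2 cmulBl hpi.2.
    have [h3 _] := projection_normM (cmul (P i) (D i)) hpi; have [_ h4] := projection_normM (D i) hpi.
    by have := hD i hi; lra.
  rewrite subr0; have [h3 _] := projection_normM (cmul (P i) (cmul (cstar (v i)) (v j))) hpj.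
  have [_ h4] := projection_normM (cmul (cstar (v i)) (v j)) hpi.
  by have := hv i j hi hj; rewrite /gram; case: eqP => // _; rewrite subr0; lra.
- exact: hs.
have w1 i : (i < n)%N -> cnorm (w i) <= 1.
  by move=> hi; apply: (isometry_le1 (hP i hi).1); rewrite ww // eqxx.
(* Gram-Schmidt makes [w (b i)] a partial isometry with source [P i], not yet a projection.
   Multiplication by its adjoint moves the source of the whole block to the range projection of
   [w (b i)], which is the new element at index [b i]. *)
exists (fun i => cmul (w i) (cstar (w (b i)))); split; [split=> // i j hi hj|move=> i hi].
- have [bi bbi] := hb i hi.
  have -> : cmul (cstar (cmul (w i) (cstar (w (b i))))) (cmul (w j) (cstar (w (b j)))) =
     cmul (cmul (w (b i)) (cmul (cstar (w i)) (w j))) (cstar (w (b j))) by cring.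
  rewrite ww // /gram; case: eqP => [<-|_]; last by rewrite cmul0r cmul0l.
  by rewrite bbi; have := wP _ bi; rewrite /P bbi => ->.
- have [bi bbi] := hb i hi; have [hp1 hp2] := hP i hi; set t := K ^+ n * s.
  have st : s <= t by rewrite /t -{1}[s]mul1r ler_pM2r.
  have wv j : (j < n)%N -> cnorm (w j - v j) <= 12 * t.
    by move=> hj; apply: le_trans (cnorm_tri (u j) _ _) _; have := wu j hj; have := uv j hj; rewrite -/t; lra.
  have -> : cmul (w i) (cstar (w (b i))) - v i = cmul (w i - v i) (cstar (w (b i)))
     + cmul (v i) (cstar (w (b i) - v (b i))) + cmul (v i) (cstar (v (b i) - P i)) + (u i - v i).
    by rewrite !cstarB hp1.1 /u; cring.
  have h1 : cnorm (cmul (w i - v i) (cstar (w (b i)))) <= 12 * t * 1.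
    apply: le_trans (cnormM_le _ _) _; rewrite cnormS.
    by apply: ler_pM; rewrite ?cnorm_ge0 ?wv ?w1.
  have h2 : cnorm (cmul (v i) (cstar (w (b i) - v (b i)))) <= 33 / 32 * (12 * t).
    apply: le_trans (cnormM_le _ _) _; rewrite cnormS.
    by apply: ler_pM; rewrite ?cnorm_ge0 ?wv ?v1.
  have h3 : cnorm (cmul (v i) (cstar (v (b i) - P i))) <= 33 / 32 * (25 * d).
    apply: le_trans (cnormM_le _ _) _; rewrite cnormS.
    by apply: ler_pM; rewrite ?cnorm_ge0 ?v1 // cnormC.
  have h4 := uv i hi.
  have := cnormD (cmul (w i - v i) (cstar (w (b i)))) (cmul (v i) (cstar (w (b i) - v (b i)))).
  set x1 := cmul _ _ + cmul _ _; have := cnormD x1 (cmul (v i) (cstar (v (b i) - P i))).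
  set x2 := x1 + _; have := cnormD x2 (u i - v i).
  by rewrite -mulrA -/t; lra.
Qed.
End Perturbation.

(** * Finite-dimensional algebras *)

Section Structure.
Variables (R : realType) (A : cstarType R).
Implicit Types x y z p q h : A.

Lemma cabs1 : cabs (1 : R[i]) = 1.
Proof. by rewrite /cabs normr1. Qed.

Lemma cstar_eq0 x : cmul (cstar x) x = 0 -> x = 0.
Proof.
move=> h; apply: cnorm_eq0; have := cnorm_cstar x; rewrite h cnorm0 => /esym/eqP.
by rewrite sqrf_eq0 => /eqP.
Qed.

Lemma sa_eq0 x : cstar x = x -> cmul x x = 0 -> x = 0.
Proof. by move=> sx h; apply: cstar_eq0; rewrite sx. Qed.

Lemma scale_eq0 (k : R[i]) x : k *: x = 0 -> x <> 0 -> k = 0.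
Proof. by move=> /eqP; rewrite scaler_eq0 => /orP[/eqP|/eqP]. Qed.

(** Dimension bounded through linear dependence, a form that passes to subsets at once. *)
Definition dimension_le (S : set A) N := forall x : 'I_N.+1 -> A, (forall i, S (x i)) ->
  exists2 c : 'I_N.+1 -> R[i], exists i, c i <> 0 & \sum_i c i *: x i = 0.

Lemma dimension_le_sub (S T : set A) N : T `<=` S -> dimension_le S N -> dimension_le T N.
Proof. by move=> TS dS x Tx; apply: dS => i; exact: TS. Qed.

Lemma spanned_dimension (S : set A) N (g : 'I_N -> A) :
  (forall x, S x -> exists c : 'I_N -> R[i], x = \sum_i c i *: g i) -> dimension_le S N.
Proof.
move=> hg x Sx; have [c hc] := choice (fun i => hg _ (Sx i)).
pose M : 'M[R[i]]_(N.+1, N) := \matrix_(i, j) c i j.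
have : kermx M != 0.
  by rewrite kermx_eq0 /row_free neq_ltn (leq_ltn_trans (rank_leq_col M)) ?ltnSn.
case/rowV0Pn => u /sub_kermxP uM u0; exists (fun i => u 0 i).
  apply: contrapT => h; case/eqP: u0; apply/rowP => i; rewrite mxE.
  by apply: contrapT => ui; apply: h; exists i.
under eq_bigr => i _ do rewrite hc scaler_sumr.
rewrite exchange_big big1 //= => j _; under eq_bigr => i _ do rewrite scalerA.
rewrite -scaler_suml; have := congr1 (fun m : 'rV_N => m 0 j) uM; rewrite !mxE => e.
by rewrite (eq_bigr (fun i => u 0 i * M i j)) ?e ?scale0r // => i _; rewrite mxE.
Qed.

Section FiniteDimensional.
Variables (S : set A) (N : nat).
Hypotheses (hS : star_subalgebra S) (dependent : dimension_le S N).

Definition ofamily k (p : nat -> A) :=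
  (forall i, (i < k)%N -> [/\ S (p i), projection (p i) & p i <> 0]) /\
  forall i j, (i < k)%N -> (j < k)%N -> i <> j -> cmul (p i) (p j) = 0.

Lemma ofamily_bound k (p : nat -> A) : ofamily k p -> (k <= N)%N.
Proof.
move=> [hp op]; rewrite leqNgt; apply/negP => Nk.
have lk (i : 'I_N.+1) : (i < k)%N by apply: leq_trans Nk; exact: ltn_ord.
have Sp (i : 'I_N.+1) : S (p i) by have [] := hp i (lk i).
have [c [i ci] e] := dependent Sp.
have [_ [_ pp] p0] := hp i (lk i); apply: ci.
have : cmul (p i) (\sum_i c i *: p i) = 0 by rewrite e cmul0r.
rewrite cmul_sumr (bigD1 i) //= cmulZr pp big1 ?addr0; first by move=> /scale_eq0; apply.
by move=> j ji; rewrite cmulZr op ?scaler0 //; apply/eqP; rewrite eq_sym.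
Qed.

Section Eigen.
Variable h : A.
Hypothesis sh : cstar h = h.

(** The polynomial in [h] acts on a vector by left multiplication, so its constant term makes sense
    without a unit. *)
Definition pact (P : {poly R[i]}) x := \sum_(i < size P) P`_i *: iter i (cmul h) x.

Lemma pactE (P : {poly R[i]}) x n : (size P <= n)%N -> pact P x = \sum_(i < n) P`_i *: iter i (cmul h) x.
Proof.
move=> sn; rewrite /pact (big_ord_widen n (fun i => P`_i *: iter i (cmul h) x)) // big_mkcond.
by apply: eq_bigr => i _; case: ltnP => // hi; rewrite nth_default // scale0r.
Qed.

Lemma pact_factor (Q : {poly R[i]}) (z : R[i]) x :
  pact (Q * ('X - z%:P)) x = cmul h (pact Q x) - z *: pact Q x.
Proof.
have sQ : (size (Q * ('X - z%:P))%R <= (size Q).+1)%N.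
  by apply: leq_trans (size_polyMleq _ _) _; rewrite size_XsubC addn2.
rewrite (pactE _ sQ) [pact Q x](pactE x (leqnSn (size Q))).
under eq_bigr => i _ do rewrite mulrBr coefB coefMX coefMC scalerBl.
rewrite sumrB cmul_sumr; congr (_ - _); last first.
  by rewrite scaler_sumr; apply: eq_bigr => i _; rewrite scalerA mulrC.
rewrite big_ord_recl /= scale0r add0r big_ord_recr /= nth_default // scale0r cmul0r addr0.
by apply: eq_bigr => i _; rewrite cmulZr.
Qed.

(** Linear factors are split off [P] over the algebraically closed field [R[i]] until the quotient
    no longer kills [x]; the last root is the eigenvalue. *)
Lemma eigenvector (P : {poly R[i]}) x : P != 0 -> pact P x = 0 -> x <> 0 ->
  exists Q (z : R[i]), pact Q x <> 0 /\ cmul h (pact Q x) = z *: pact Q x.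
Proof.
move: {2}(size P) (leqnn (size P)) => n; elim: n P => [|n IH] P.
  by rewrite leqn0 size_poly_eq0 => ->.
move=> sP P0 e x0; have [s1|s1] := boolP (size P == 1)%N.
  case/size_poly1P: s1 => c c0 eP; case: x0.
  by move: e; rewrite eP (pactE x (size_polyC_leq1 c)) big_ord1 coefC /= => /scale_eq0 h'; apply: contrapT => /h' /eqP; rewrite (negbTE c0).
have /closed_rootP[z /factor_theorem[Q eQ]] := s1.
have Q0 : Q != 0 by apply: contraNneq P0 => Q0; rewrite eQ Q0 mul0r.
have [y0|y0] := EM (pact Q x = 0).
  apply: (IH Q) => //; rewrite -ltnS; apply: leq_trans sP.
  by rewrite eQ size_Mmonic ?monicXsubC // size_XsubC addn2.
exists Q, z; split=> //; apply/eqP; rewrite -subr_eq0 -pact_factor -eQ; exact/eqP.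
Qed.

(* If [y] is an eigenvector in the algebra generated by [h], then [y^* y] is
   proportional to a projection. *)
Lemma eigenprojection : S h -> h <> 0 -> exists q (z : R[i]),
  [/\ projection q, q <> 0, cmul h q = z *: q &
      forall T : set A, star_subalgebra T -> T h -> T q].
Proof.
move=> Sh h0.
have Tpow (T : set A) x i : star_subalgebra T -> T h -> T x -> T (iter i (cmul h) x).
  by move=> hT Th Tx; elim: i => //= i; exact: (subM hT).
have [c [i0 ci] e] := dependent (fun i => Tpow S h i hS Sh Sh).
pose P := \poly_(i < N.+1) c (inord i).
have cP (i : 'I_N.+1) : P`_i = c i by rewrite coef_poly ltn_ord inord_val.
have P0 : P != 0.
  by apply/eqP => P0; apply: ci; rewrite -cP P0 coef0.
have [|Q [z [y0 hy]]] := eigenvector P0 _ h0.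
  rewrite (pactE _ (size_poly _ _)) -[RHS]e; apply: eq_bigr => i _; by rewrite cP.
set y := pact Q h in y0 hy.
have Ty T : star_subalgebra T -> T h -> T y.
  by move=> hT Th; apply: (sub_sum hT) => i _; apply: (subZ hT); exact: Tpow.
have hys : cmul h (cstar y) = cmul (cstar y) h.
  have hC := commutant_sub sh; apply: (subS hC).
  exact: (Ty _ hC).
pose u := cmul (cstar y) y; have su : cstar u = u by rewrite /u cstarM cstarK.
have u0 : u <> 0 by move=> /cstar_eq0.
have hu : cmul h u = z *: u by rewrite /u cmulA hys -cmulA hy cmulZr.
(* The elements that act on [u] as scalars, together with their adjoints, form a star-subalgebra. It
   contains [h], hence [u] itself, so that [u^2] is a multiple of [u]. *)
pose T := [set t : A | (exists m, cmul t u = m *: u) /\ (exists m, cmul (cstar t) u = m *: u)].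
have hT : star_subalgebra T.
  split=> [|k s t [[m1 e1] [m2 e2]] [[m3 e3] [m4 e4]]|s t [[m1 e1] [m2 e2]] [[m3 e3] [m4 e4]]|t [? ?]].
  - by rewrite /T /= cstar0 cmul0l; split; exists 0; rewrite scale0r.
  - split; first by exists (k * m1 + m3); rewrite cmulDl cmulZl e1 e3 scalerA scalerDl.
    by exists (k^*%C * m2 + m4); rewrite cstarD cstarZ cmulDl cmulZl e2 e4 scalerA scalerDl.
  - split; first by exists (m3 * m1); rewrite -cmulA e3 cmulZr e1 scalerA.
    by exists (m2 * m4); rewrite cstarM -cmulA e2 cmulZr e4 scalerA.
  - by rewrite /T /= cstarK.
have Th : T h by split; exists z => //; rewrite sh.
have Tu : T u by apply: (subM hT); [apply: (subS hT)|]; exact: Ty.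
have [[m em] _] := Tu.
have m0 : m != 0.
  by apply/eqP => m0; apply: u0; apply: (sa_eq0 su); rewrite em m0 scale0r.
have mr : m^*%C = m.
  apply/eqP; rewrite -subr_eq0; apply/eqP; apply: (@scale_eq0 _ u) => //.
  by rewrite scalerBl -em -{1}su -cstarZ -em cstarM su subrr.
exists (m^-1 *: u), z; split.
- split; first by rewrite cstarZ su conjc_inv mr.
  by rewrite cmulZl cmulZr em !scalerA -mulrA mulVf // mulr1.
- by move/scale_eq0 => /(_ u0) /eqP; rewrite invr_eq0 (negbTE m0).
- by rewrite cmulZr hu !scalerA mulrC.
- move=> U hU Uh; apply: (subZ hU); apply: (subM hU); [apply: (subS hU)|]; exact: Ty.
Qed.
End Eigen.

Lemma corner_sub p : projection p -> star_subalgebra [set x | cmul p x = x /\ cmul x p = x].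
Proof.
move=> [sp pp]; split=> [|k x y [h1 h2] [h3 h4]|x y [h1 h2] [h3 h4]|x [h1 h2]].
- by rewrite /= cmul0l cmul0r.
- by split; rewrite ?cmulDr ?cmulDl ?cmulZr ?cmulZl ?h1 ?h2 ?h3 ?h4.
- by split; [rewrite cmulA h1|rewrite -cmulA h4].
- by split; rewrite -{1}sp -cstarM ?h1 ?h2.
Qed.

Section MaximalFamily.
Variables (k : nat) (p : nat -> A).
Hypotheses (hp : ofamily k p) (kmax : forall k' (p' : nat -> A), ofamily k' p' -> (k' <= k)%N).

Let Sp i : (i < k)%N -> S (p i). Proof. by case: hp => h _ /h[]. Qed.
Let pj i : (i < k)%N -> projection (p i). Proof. by case: hp => h _ /h[]. Qed.
Let p0 i : (i < k)%N -> p i <> 0. Proof. by case: hp => h _ /h[]. Qed.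
Let po i j : (i < k)%N -> (j < k)%N -> i <> j -> cmul (p i) (p j) = 0.
Proof. by case: hp => _; apply. Qed.

Let annih_sub : star_subalgebra [set x | forall i, (i < k)%N -> cmul (p i) x = 0 /\ cmul x (p i) = 0].
Proof.
split=> [|c x y hx hy|x y hx hy|x hx] i ik.
- by rewrite cmul0l cmul0r.
- have [h1 h2] := hx i ik; have [h3 h4] := hy i ik.
  by rewrite cmulDl cmulDr cmulZl cmulZr h1 h2 h3 h4 scaler0 addr0.
- have [h1 h2] := hx i ik; have [h3 h4] := hy i ik.
  by rewrite cmulA h1 cmul0l -cmulA h4 cmul0r.
- have [h1 h2] := hx i ik; have [sp _] := pj ik.
  by rewrite -{1 2}sp -!cstarM h1 h2 cstar0.
Qed.

Lemma no_new_projection q : S q -> projection q -> q <> 0 ->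
  (forall i, (i < k)%N -> cmul (p i) q = 0 /\ cmul q (p i) = 0) -> False.
Proof.
move=> Sq hq q0 qo; suff /kmax : ofamily k.+1 (fun i => if (i < k)%N then p i else q) by rewrite ltnn.
split=> [i|i j]; first by rewrite ltnS => _; case: ifP => ik; split=> //; [exact: Sp|exact: pj|exact: p0].
rewrite !ltnS => ik jk ij; case: (ltnP i k) => h1; case: (ltnP j k) => h2.
- exact: po.
- by have [] := qo i h1.
- by have [] := qo j h2.
- by case: ij; apply/eqP; rewrite eqn_leq (leq_trans ik) // (leq_trans jk).
Qed.

Definition funit := \sum_(i < k) p i.

Lemma funitK i : (i < k)%N -> cmul funit (p i) = p i /\ cmul (p i) funit = p i.
Proof.
move=> ik; have [_ pp] := pj ik; rewrite /funit cmul_suml cmul_sumr.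
have ne (j : 'I_k) : j != Ordinal ik -> (j : nat) <> i by move=> ji e; case/eqP: ji; apply: val_inj.
split; rewrite (bigD1 (Ordinal ik)) //= pp big1 ?addr0 // => j /ne ji; apply: po => //.
by move=> e; apply: ji.
Qed.

Lemma funit_sa : cstar funit = funit.
Proof. by rewrite cstar_sum; apply: eq_bigr => i _; have [] := pj (ltn_ord i). Qed.

(** If [z = x - funit x] is nonzero, an eigenprojection of [z z^*] is orthogonal to all [p i] and
    contradicts maximality. *)
Lemma funit_id x : S x -> cmul funit x = x.
Proof.
move=> Sx; apply: contrapT => ne; pose z := x - cmul funit x.
have z0 : z <> 0 by move=> /eqP; rewrite subr_eq0 => /eqP e; apply: ne.
have Se : S funit by apply: (sub_sum hS) => i _; exact: Sp.
have Sz : S z by apply: (subB hS) => //; apply: (subM hS).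
pose t := cmul z (cstar z); have st : cstar t = t by rewrite /t cstarM cstarK.
have t0 : t <> 0.
  move=> e; apply: z0; rewrite -[z]cstarK; have -> : cstar z = 0; last by rewrite cstar0.
  by apply: cstar_eq0; rewrite cstarK.
have pz i : (i < k)%N -> cmul (p i) z = 0.
  by move=> ik; rewrite /z cmulBr cmulA (funitK ik).2 subrr.
have [|q [w [qj q0 _ Tq]]] := eigenprojection st _ t0; first by apply: (subM hS) => //; apply: (subS hS).
apply: (no_new_projection (Tq _ hS _) qj q0); first by apply: (subM hS) => //; apply: (subS hS).
apply: (Tq _ annih_sub) => i ik /=; have [sp _] := pj ik; rewrite /t; split.
  by rewrite cmulA pz // cmul0l.
by rewrite -cmulA -{1}sp -cstarM pz // cstar0 cmul0r.
Qed.

Lemma funit_idr x : S x -> cmul x funit = x.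
Proof.
by move=> Sx; have /(congr1 cstar) := funit_id (subS hS Sx); rewrite cstarM cstarK funit_sa.
Qed.

(** An eigenprojection [q] of a self-adjoint element of the corner lies under [p i]. If it were
    proper, replacing [p i] by [q] and [p i - q] would enlarge the family. A general element is
    split into its real and imaginary parts. *)
Lemma corner_scalar i x : (i < k)%N -> S x -> cmul (p i) (cmul x (p i)) = x ->
  exists c, x = c *: p i.
Proof.
move=> ik Sx ex; have hpi := pj ik; have [sp pp] := hpi.
have [px xp] : cmul (p i) x = x /\ cmul x (p i) = x.
  by split; rewrite -ex; [rewrite cmulA pp|rewrite -!cmulA pp].
have hC := corner_sub hpi.
have sa h : S h -> cstar h = h -> cmul (p i) h = h /\ cmul h (p i) = h -> exists c, h = c *: p i.
  move=> Sh sh hc; have [->|h0] := EM (h = 0); first by exists 0; rewrite scale0r.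
  have [q [w [qj q0 hq Tq]]] := eigenprojection sh Sh h0.
  have [pq qp] := Tq _ hC hc; have Sq := Tq _ hS Sh.
  suff eq : q = p i by exists w; rewrite -hc.2 -eq.
  apply: contrapT => nq; have [sq qq] := qj.
  have d0 : p i - q <> 0 by move=> /eqP; rewrite subr_eq0 => /eqP/esym.
  have dj : projection (p i - q).
    by split; rewrite ?cstarB ?sp ?sq // cmulBl !cmulBr pp pq qp qq subrr subr0.
  pose p' j := if j == i then q else if (j < k)%N then p j else p i - q.
  suff /kmax : ofamily k.+1 p' by rewrite ltnn.
  have qo j : (j < k)%N -> j <> i -> cmul q (p j) = 0 /\ cmul (p j) q = 0.
    move=> jk ji; split; first by rewrite -qp -cmulA po ?cmul0r // => /esym.
    by rewrite -pq cmulA po ?cmul0l.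
  have dq : cmul (p i - q) q = 0 /\ cmul q (p i - q) = 0 by rewrite cmulBl cmulBr pq qp qq subrr.
  have dop j : (j < k)%N -> j <> i -> cmul (p i - q) (p j) = 0 /\ cmul (p j) (p i - q) = 0.
    move=> jk ji; have [e1 e2] := qo j jk ji.
    by rewrite cmulBl cmulBr e1 e2 !po // ?subrr // => /esym.
  split=> [j jk|j l jk lk jl]; rewrite /p'.
    case: eqP => [_|ji]; first by split.
    case: ltnP => jk'; first by split; [exact: Sp|exact: pj|exact: p0].
    by split=> //; apply: (subB hS) => //; exact: Sp.
  have outer m : (m < k.+1)%N -> (k <= m)%N -> m = k by rewrite ltnS => ? ?; apply/eqP; rewrite eqn_leq; apply/andP.
  case: (eqVneq j i) => [ji|/eqP ji]; case: (eqVneq l i) => [li|/eqP li]; try by case: jl; rewrite ji li.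
  - by case: ltnP => lk'; [have [] := qo l lk' li|have [] := dq].
  - by case: ltnP => jk'; [have [] := qo j jk' ji|have [] := dq].
  - case: ltnP => h1; case: ltnP => h2.
    + exact: po.
    + by have [] := dop j h1 ji.
    + by have [] := dop l h2 li.
    + by case: jl; rewrite (outer j) // (outer l).
have cx : cmul (p i) (cstar x) = cstar x /\ cmul (cstar x) (p i) = cstar x by exact: (subS hC).
have Sx' : S (cstar x) by exact: (subS hS).
have [||c1 e1] := sa (x + cstar x) (subD hS Sx Sx').
- by rewrite cstarD cstarK addrC.
- exact: (subD hC).
have [||c2 e2] := sa ('i%C *: (x - cstar x)) (subZ hS _ (subB hS Sx Sx')).
- have -> : cstar ('i%C *: (x - cstar x)) = (- 'i%C) *: (cstar x - x).
    rewrite cstarZ cstarB cstarK; congr (_ *: _); apply/eqP.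
    by rewrite eq_complex /= oppr0 !eqxx.
  by rewrite scaleNr -scalerN opprB.
- by apply: (subZ hC); exact: (subB hC).
exists ((2^-1 : R)%:C%C * (c1 - 'i%C * c2)); apply: mul2I.
rewrite -scalerA scale2 scalerBl -scalerA -e1 -e2 scalerA -expr2 sqr_i scaleN1r.
by rewrite opprK; cring.
Qed.

Definition linked i j := exists x, [/\ S x, x <> 0, cmul (p i) x = x & cmul x (p j) = x].

(** By [corner_scalar], [x^* x] and [x x^*] are multiples of [p j] and [p i], with the same scalar,
    so [x] rescales to a partial isometry once that scalar is positive. The last clause makes the
    representative of a block a projection. *)
Lemma linkedP i j : (i < k)%N -> (j < k)%N -> linked i j ->
  exists v, [/\ S v, cmul (cstar v) v = p j, cmul v (cstar v) = p i,
    cmul (p i) v = v /\ cmul v (p j) = v & i = j -> v = p i].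
Proof.
move=> ik jk [x [Sx x0 px xp]]; have [sj pj2] := pj jk; have [si pi2] := pj ik.
have [ij|ij] := EM (i = j).
  by exists (p i); rewrite -ij si !pi2; split=> //; exact: Sp.
have Sxs := subS hS Sx.
have spx : cmul (cstar x) (p i) = cstar x by rewrite -{1}si -cstarM px.
have sxp : cmul (p j) (cstar x) = cstar x by rewrite -{1}sj -cstarM xp.
have [||a ea] := @corner_scalar j (cmul (cstar x) x) jk; first exact: (subM hS).
  by rewrite -(cmulA _ _ (p j)) xp cmulA sxp.
have [||c ec] := @corner_scalar i (cmul x (cstar x)) ik; first exact: (subM hS).
  by rewrite -(cmulA _ _ (p i)) spx cmulA px.
have xx0 : cmul (cstar x) x <> 0 by move=> /cstar_eq0.
have xx0' : cmul x (cstar x) <> 0.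
  move=> e; apply: x0; rewrite -[x]cstarK; have -> : cstar x = 0; last by rewrite cstar0.
  by apply: cstar_eq0; rewrite cstarK.
have ca : a = c.
  apply/eqP; rewrite -subr_eq0; apply/eqP; apply: (@scale_eq0 _ (cmul x (cstar x))) => //.
  have e1 : cmul (cmul x (cstar x)) (cmul x (cstar x)) = a *: cmul x (cstar x).
    have -> : cmul (cmul x (cstar x)) (cmul x (cstar x)) = cmul x (cmul (cmul (cstar x) x) (cstar x)) by cring.
    by rewrite ea cmulZl sxp cmulZr.
  by rewrite scalerBl -e1 {1}ec cmulZl cmulA px subrr.
have ar : a^*%C = a.
  apply/eqP; rewrite -subr_eq0; apply/eqP; apply: (@scale_eq0 _ (p j)); last exact: p0.
  by rewrite scalerBl -ea -{1}sj -cstarZ -ea cstarM cstarK subrr.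
have [r er] : exists r : R, a = r%:C%C.
  by exists (complex.Re a); case: (a) ar => u w [] /eqP; rewrite eq_sym -subr_eq0 opprK -mulr2n mulrn_eq0 /= => /eqP ->.
have r0 : r != 0 by apply/eqP => r0; apply: xx0; rewrite ea er r0 scale0r.
(* Positivity follows from the C*-identity alone. If [r < 0], then [h = x + x^*] squares to [r e];
   with [I] imaginary and [I^2 = r], the product [(h - I e)(h + I e)] is [0], and it has the form
   [y^* y]. Hence [h + I e = 0], by adjunction [h - I e = 0], and so [e = 0]. *)
have rp : 0 < r.
  rewrite lt_neqAle eq_sym r0 /= leNgt; apply/negP => rn.
  pose s := Num.sqrt (- r); have ss : s * s = - r by rewrite -expr2 sqr_sqrtr // oppr_ge0 ltW.
  pose h := x + cstar x; pose e := p i + p j.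
  have xx : cmul x x = 0 by rewrite -{1}xp -px -cmulA (cmulA (p j)) po ?cmul0l ?cmul0r // => /esym.
  have xsxs : cmul (cstar x) (cstar x) = 0 by rewrite -cstarM xx cstar0.
  have ee : cmul e e = e by rewrite /e cmulDl !cmulDr pi2 pj2 !po ?addr0 ?add0r // => /esym.
  have se : cstar e = e by rewrite /e cstarD si sj.
  have pjx : cmul (p j) x = 0 by rewrite -px cmulA po ?cmul0l // => /esym.
  have pixs : cmul (p i) (cstar x) = 0 by rewrite -sxp cmulA po ?cmul0l.
  have eh : cmul e h = h by rewrite /h /e cmulDl !cmulDr px sxp pjx pixs addr0 add0r.
  have sh : cstar h = h by rewrite /h cstarD cstarK addrC.
  have he : cmul h e = h by rewrite -{1}sh -{1}se -cstarM eh sh.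
  have hh : cmul h h = r%:C%C *: e.
    by rewrite /h cmulDl !cmulDr xx xsxs ec ea -ca er addr0 add0r -scalerDr.
  pose I : R[i] := ('i * s%:C)%C.
  have Ic : I^*%C = - I.
    by rewrite /I; apply/eqP; rewrite eq_complex /=; apply/andP; split; apply/eqP; ring.
  have II : I * I = r%:C%C.
    by rewrite /I mulrACA -expr2 sqr_i -rmorphM /= ss rmorphN mulrNN mul1r.
  have u0 : h + I *: e = 0.
    apply: cstar_eq0; rewrite cstarD cstarZ sh se Ic scaleNr.
    have -> : cmul (h - I *: e) (h + I *: e) = cmul h h - I *: cmul e h + I *: cmul h e - (I * I) *: cmul e e.
      by rewrite cmulDr !cmulBl !cmulZl !cmulZr scalerA; cring.
    by rewrite eh he ee hh II; cring.
  have u1 : h - I *: e = 0 by rewrite -[h - _]cstarK cstarB cstarZ sh se Ic scaleNr opprK u0 cstar0.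
  have e0 : I *: e = 0.
    by apply: mul2I; rewrite mul0rn; have -> : (I *: e) *+ 2 = (h + I *: e) - (h - I *: e) by [cring|]; rewrite u0 u1 subrr.
  have I0 : I != 0 by apply/eqP => I0; move: II; rewrite I0 mul0r => /esym/complexI; exact/eqP.
  apply: (p0 ik); have -> : p i = cmul (p i) e by rewrite /e cmulDr pi2 po ?addr0.
  by move: e0 => /eqP; rewrite scaler_eq0 (negbTE I0) => /eqP ->; rewrite cmul0r.
pose s := (Num.sqrt r)^-1; have ss : s * s * r = 1.
  by rewrite /s -invfM -expr2 sqr_sqrtr ?ltW // mulVf // gt_eqF.
exists (s%:C%C *: x); split=> //.
- exact: (subZ hS).
- by rewrite cstarZ conjc_real cmulZl cmulZr ea er !scalerA -!rmorphM /= ss scale1r.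
- by rewrite cstarZ conjc_real cmulZl cmulZr ec -ca er !scalerA -!rmorphM /= ss scale1r.
- by rewrite cmulZl cmulZr px xp.
Qed.

Lemma linked_refl i : (i < k)%N -> linked i i.
Proof. by move=> ik; exists (p i); have [_ pp] := pj ik; split=> //; [exact: Sp|exact: p0]. Qed.
Lemma linked_sym i j : (i < k)%N -> (j < k)%N -> linked i j -> linked j i.
Proof.
move=> ik jk [x [Sx x0 px xp]]; exists (cstar x); have [sj _] := pj jk; have [si _] := pj ik.
split; [exact: (subS hS)|by move=> e; apply: x0; rewrite -[x]cstarK e cstar0| |].
- by rewrite -{1}sj -cstarM xp.
- by rewrite -{1}si -cstarM px.
Qed.
Lemma linked_trans i j l : (i < k)%N -> (j < k)%N -> (l < k)%N ->
  linked i j -> linked j l -> linked i l.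
Proof.
move=> ik jk lk /(linkedP ik jk)[v [Sv v1 v2 [v3 v4] _]] /(linkedP jk lk)[w [Sw w1 w2 [w3 w4] _]].
exists (cmul v w); split; [exact: (subM hS)| |by rewrite cmulA v3|by rewrite -cmulA w4].
move=> e; apply: (p0 lk); rewrite -w1 -{2}w3 -v1.
have -> : cmul (cstar w) (cmul (cmul (cstar v) v) w) = cmul (cstar w) (cmul (cstar v) (cmul v w)) by cring.
by rewrite e !cmul0r.
Qed.

(** The blocks are the classes of the equivalence relation [linked], represented by their least
    index, and [v i] carries [p (b i)] to [p i]. Every corner [p i S p j] is then zero or the line
    of [munit v i j]. *)
Lemma family_system : exists n b v, msystem n b v /\ mspan n b v = S.
Proof.
have ex i : exists j, (i < k)%N -> [/\ (j < k)%N, linked i j & forall l, (l < k)%N -> linked i l -> (j <= l)%N].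
  have [ik|ik] := boolP (i < k)%N; last by exists 0%N.
  have exj : exists j, `[< (j < k)%N /\ linked i j >] by exists i; apply/asboolP; split=> //; exact: linked_refl.
  exists (ex_minn exj) => _; case: ex_minnP => j /asboolP[jk ij] mj; split=> // l lk il.
  by apply: mj; apply/asboolP.
have {ex} [b hb] := choice ex.
have ek i j : (i < k)%N -> (j < k)%N -> linked i j -> b i = b j.
  move=> ik jk ij; have [bi li mi] := hb i ik; have [bj lj mj] := hb j jk.
  apply/eqP; rewrite eqn_leq; apply/andP; split.
    by apply: mi => //; exact: linked_trans ij lj.
  by apply: mj => //; apply: linked_trans (linked_sym ik jk ij) li.
have bb : block_map k b.
  by move=> i ik; have [bi li _] := hb i ik; split=> //; rewrite -(ek _ _ ik bi).
have exv i : exists v, (i < k)%N -> [/\ S v, cmul (cstar v) v = p (b i), cmul v (cstar v) = p i,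
    cmul (p i) v = v /\ cmul v (p (b i)) = v & i = b i -> v = p i].
  have [ik|ik] := boolP (i < k)%N; last by exists 0.
  by have [bi li _] := hb i ik; have [v hv] := linkedP ik bi li; exists v.
have [v hv] := choice exv.
have vb i : (i < k)%N -> v (b i) = p (b i).
  by move=> ik; have [bi bbi] := bb i ik; have [_ _ _ _] := hv _ bi; rewrite bbi => ->.
have sys : msystem k b v.
  split=> // i j ik jk; have [_ vi1 _ [pv _] _] := hv i ik; have [_ _ _ [pv' _] _] := hv j jk.
  rewrite /gram; case: eqP => [<-|ij]; first by rewrite vi1 vb.
  have [si _] := pj ik; rewrite -pv' -{1}pv cstarM si -cmulA (cmulA (p i) (p j)) po //.
  by rewrite cmul0l cmul0r.
exists k, b, v; split=> //; apply/seteqP; split=> x.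
  move=> [c ->]; apply: (sub_sum hS) => i _; apply: (sub_sum hS) => j _; apply: (subZ hS).
  apply: (subM hS); first by have [] := hv i (ltn_ord i).
  by apply: (subS hS); have [] := hv j (ltn_ord j).
move=> Sx; have -> : x = \sum_(i < k) \sum_(j < k) cmul (p i) (cmul x (p j)).
  rewrite -{1}(funit_idr Sx) -{1}(funit_id (subM hS Sx (_ : S funit))); last first.
    by apply: (sub_sum hS) => i _; exact: Sp.
  rewrite /funit cmul_suml; apply: eq_bigr => i _; rewrite !cmul_sumr //.
apply: mspan_sum => i _; apply: mspan_sum => j _.
have [ik jk] := (ltn_ord i, ltn_ord j).
have [->|x0] := EM (cmul (p i) (cmul x (p j)) = 0); first exact: mspan0.
have [_ pi2] := pj ik; have [_ pj2] := pj jk.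
have Sy : S (cmul (p i) (cmul x (p j))) by apply: (subM hS); [exact: Sp|apply: (subM hS) => //; exact: Sp].
have lij : linked i j.
  by exists (cmul (p i) (cmul x (p j))); split; rewrite // -?cmulA ?pj2 // cmulA pi2.
have bij := ek i j ik jk lij.
have [Si vi1 vi2 [vi3 vi4] _] := hv i ik; have [Sj vj1 vj2 [vj3 vj4] _] := hv j jk.
have [bi bbi] := bb i ik; have [sb pb2] := pj bi.
pose y := cmul (cstar (v i)) (cmul x (v j)).
have [||c ec] := @corner_scalar (b i) y bi.
- by apply: (subM hS); [exact: (subS hS)|exact: (subM hS)].
- rewrite /y {2}bij -!cmulA vj4 cmulA; congr (cmul _ _).
  by rewrite -{1}sb -cstarM vi4.
have -> : cmul (p i) (cmul x (p j)) = c *: munit v i j.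
  rewrite -vi2 -vj2.
  have -> : cmul (cmul (v i) (cstar (v i))) (cmul x (cmul (v j) (cstar (v j)))) =
    cmul (v i) (cmul y (cstar (v j))) by rewrite /y; cring.
  by rewrite ec cmulZl cmulZr cmulA vi4.
by apply: mspanZ; exact: mspan_munit.
Qed.
End MaximalFamily.

(** A maximal family exists because nonzero orthogonal projections are linearly independent, which
    bounds its size by [N]. *)
Theorem finite_dimensional_system : exists n b v, msystem n b v /\ mspan n b v = S.
Proof.
pose Q k := `[< exists p : nat -> A, ofamily k p >].
have exQ : exists k, Q k by exists 0%N; apply/asboolP; exists (fun=> 0); split.
have bQ k : Q k -> (k <= N)%N by move=> /asboolP[p /ofamily_bound].
case: (ex_maxnP exQ bQ) => k /asboolP[p hp] km.
apply: (@family_system k p hp) => k' p' hp'; apply: km; apply/asboolP; by exists p'.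
Qed.

(** A maximal family of eigenprojections diagonalizes [y]. If all eigenvalues were at most
    [|y| / 2], the powers of [y] would satisfy [|y|^(2^m) <= k (|y| / 2)^(2^m)], and [pow_trick]
    would give [|y| <= |y| / 2]. The factor 2 avoids an exact formula for the norm. *)
Lemma spectral_projection y : S y -> cstar y = y -> y <> 0 -> exists q (l : R[i]),
  [/\ S q, projection q, q <> 0, cmul y q = l *: q & cnorm y <= 2 * cabs l].
Proof.
move=> Sy sy y0.
pose Q k := `[< exists (p : nat -> A) (l : nat -> R[i]), ofamily k p /\
  forall i, (i < k)%N -> cmul y (p i) = l i *: p i >].
have exQ : exists k, Q k.
  by exists 0%N; apply/asboolP; exists (fun=> 0), (fun=> 0); split=> //; split.
have bQ k : Q k -> (k <= N)%N by move=> /asboolP[p [l [/ofamily_bound]]].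
case: (ex_maxnP exQ bQ) => k /asboolP[p [l [[hp op] hl]]] km.
have Sp i : (i < k)%N -> S (p i) by case/hp.
have pj i : (i < k)%N -> projection (p i) by case/hp.
have pl i : (i < k)%N -> cmul (p i) y = l i *: p i.
  move=> ik; have [si pp] := pj i ik; have h1 := hl i ik.
  have h2 : cmul (p i) y = (l i)^*%C *: p i by rewrite -{1}si -sy -cstarM h1 cstarZ si.
  have h3 : l i *: p i = (l i)^*%C *: p i.
    by rewrite -{1}pp -cmulZr -h1 cmulA h2 cmulZl pp.
  by rewrite h2 h3.
pose z m := \sum_(i < k) (l i ^+ (2 ^ m)) *: p i.
have zp m i : (i < k)%N -> cmul (z m) (p i) = l i ^+ (2 ^ m) *: p i.
  move=> ik; rewrite /z cmul_suml (bigD1 (Ordinal ik)) //= cmulZl (pj i ik).2 big1 ?addr0 //.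
  move=> j ji; rewrite cmulZl op ?scaler0 // => e; case/eqP: ji; exact: val_inj.
have pz m i : (i < k)%N -> cmul (p i) (z m) = l i ^+ (2 ^ m) *: p i.
  move=> ik; rewrite /z cmul_sumr (bigD1 (Ordinal ik)) //= cmulZr (pj i ik).2 big1 ?addr0 //.
  move=> j ji; rewrite cmulZr op ?scaler0 // => e; case/eqP: ji; exact: val_inj.
(* Otherwise the remainder [h], orthogonal to all [p i], has an eigenprojection; it is one of [y] as
   well and enlarges the family. *)
have ez : y = z 0%N.
  apply: contrapT => ne; pose h := y - z 0%N.
  have Sh : S h by apply: (subB hS) => //; apply: (sub_sum hS) => i _; apply: (subZ hS); exact: Sp.
  have h0 : h <> 0 by move=> /eqP; rewrite subr_eq0 => /eqP.
  have hpi i : (i < k)%N -> cmul h (p i) = 0 /\ cmul (p i) h = 0.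
    by move=> ik; rewrite cmulBl cmulBr hl // pl // zp // pz // expr1 subrr.
  have sz : cstar (z 0%N) = z 0%N.
    rewrite cstar_sum; apply: eq_bigr => i _; have [si pp] := pj i (ltn_ord i).
    by rewrite expr1 -hl // cstarM si sy pl // hl.
  have sh : cstar h = h by rewrite cstarB sy sz.
  have [q [w [qj q0 hq Tq]]] := eigenprojection sh Sh h0.
  have [qp pq] : (forall i, (i < k)%N -> cmul q (p i) = 0) /\ (forall i, (i < k)%N -> cmul (p i) q = 0).
    suff H i : (i < k)%N -> cmul q (p i) = 0 /\ cmul (p i) q = 0 by split=> i /H[].
    move=> ik; have [si _] := pj i ik.
    apply: (Tq [set x | cmul x (p i) = 0 /\ cmul (p i) x = 0]); last exact: hpi.
    split=> [|c x x' [h1 h2] [h3 h4]|x x' [h1 h2] [h3 h4]|x [h1 h2]].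
    - by rewrite /= cmul0l cmul0r.
    - by split; rewrite ?cmulDl ?cmulDr ?cmulZl ?cmulZr ?h1 ?h2 ?h3 ?h4 scaler0 addr0.
    - by split; rewrite -?cmulA ?h3 ?cmul0r // cmulA h2 cmul0l.
    - by split; rewrite -{1}si -cstarM ?h1 ?h2 cstar0.
  have zq : cmul (z 0%N) q = 0.
    by rewrite /z cmul_suml big1 // => i _; rewrite cmulZl pq // scaler0.
  suff /km : Q k.+1 by rewrite ltnn.
  apply/asboolP; exists (fun i => if (i < k)%N then p i else q), (fun i => if (i < k)%N then l i else w).
  split; last first.
    move=> i _; case: ifP => [/hl //|_]; rewrite -hq /h cmulBl zq subr0 //.
  split=> [i _|i j]; first by case: ifP => [/hp //|_]; split=> //; exact: Tq hS Sh.
  rewrite !ltnS => ik jk ij; case: (ltnP i k) => h1; case: (ltnP j k) => h2.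
  - exact: op.
  - exact: pq.
  - exact: qp.
  - by case: ij; apply/eqP; rewrite eqn_leq (leq_trans ik) // (leq_trans jk).
apply: contrapT => hno; have small i : (i < k)%N -> cabs (l i) <= cnorm y / 2.
  move=> ik; have [Si pi p0] := hp i ik; rewrite leNgt; apply/negP => hlt; apply: hno.
  exists (p i), (l i); split=> //; [exact: hl|lra].
have zS m : z m.+1 = cmul (z m) (z m).
  rewrite {2}/z cmul_sumr; apply: eq_bigr => i _.
  by rewrite cmulZr zp // scalerA -exprD addnn -mul2n expnS.
have zs m : cstar (z m) = z m by elim: m => [|m IH]; [rewrite -ez|rewrite zS cstarM IH].
have zn m : cnorm (z m) = cnorm y ^+ (2 ^ m).
  elim: m => [|m IH]; first by rewrite -ez expr1.
  by rewrite zS cnorm_sa // IH -exprM expnS mulnC.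
have : cnorm y <= cnorm y / 2.
  apply: (@pow_trick _ _ _ k%:R); rewrite ?divr_ge0 ?cnorm_ge0 // => m.
  rewrite -zn; apply: le_trans (cnorm_sum _ _ _) _.
  apply: (@le_trans _ _ (\sum_(i < k) (cnorm y / 2) ^+ (2 ^ m))); last first.
    by rewrite sumr_const card_ord mulr_natl lexx.
  apply: ler_sum => i _; rewrite cnormZ; have p1 := projection_le1 (pj i (ltn_ord i)).
  have cX (c : R[i]) n : cabs (c ^+ n) = cabs c ^+ n.
    by elim: n => [|n IH]; [rewrite !expr0 cabs1|rewrite !exprS cabsM IH].
  rewrite cX; apply: le_trans (ler_wpM2l _ p1) _; first by rewrite exprn_ge0 ?cabs_ge0.
  by rewrite mulr1 lerXn2r ?nnegrE ?cabs_ge0 ?divr_ge0 ?cnorm_ge0 //; exact: small.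
have := cnorm_gt0 y0; lra.
Qed.
End FiniteDimensional.
End Structure.

(** * Simple AF algebras *)

Lemma chain_le (T : Type) (S : nat -> set T) : (forall n, S n `<=` S n.+1) ->
  forall m n, (m <= n)%N -> S m `<=` S n.
Proof.
move=> h m n /subnK <-; elim: (n - m)%N => [|k IH] x; first by rewrite add0n.
by move=> /IH /h; rewrite addSn.
Qed.

Section Chains.
Variables (R : realType) (A : cstarType R).

Definition fd_chain (S : nat -> set A) :=
  [/\ forall n, star_subalgebra (S n), forall n, exists N, dimension_le (S n) N,
      forall n, S n `<=` S n.+1 &
      forall x e, 0 < e -> exists n, exists2 y, S n y & cnorm (x - y) < e].

(** The universal property yields density: the closure [D] of the union of the images receives a
    cocone, and the mediating map into [D] followed by the inclusion is the identity by uniqueness,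
    so [D] is everything. Contractivity of the inverse isomorphism transports the approximation to
    [A]. *)
Lemma AF_chain : AF A -> exists S, fd_chain S.
Proof.
move=> [An [f [B [mu [fd hf [[hmu muf] univ] [phi hphi [psi phiK psiK]]]]]]].
have hpsi : star_hom psi.
  split=> [k x y|x y|x]; apply: (can_inj phiK).
  - by rewrite (homD hphi) (homZ hphi) !psiK.
  - by rewrite (homM hphi) !psiK.
  - by rewrite (homS hphi) !psiK.
pose T n := range (mu n).
have hT n : star_subalgebra (T n).
  split=> [|k x y [s _ <-] [t _ <-]|x y [s _ <-] [t _ <-]|x [s _ <-]].
  - by exists 0 => //; exact: hom0.
  - by exists (k *: s + t) => //; rewrite (homD (hmu n)) (homZ (hmu n)).
  - by exists (cmul s t) => //; rewrite (homM (hmu n)).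
  - by exists (cstar s) => //; rewrite (homS (hmu n)).
have TS n : T n `<=` T n.+1 by move=> x [s _ <-]; exists (f n s).
have TU := chain_le TS.
pose U := [set x | exists n, T n x].
have hU : star_subalgebra U.
  split=> [|k x y [n hx] [m hy]|x y [n hx] [m hy]|x [n hx]].
  - by exists 0%N; exact: (sub0 (hT _)).
  - exists (maxn n m); apply: (subD (hT _)); [apply: (subZ (hT _))|].
      exact: TU (leq_maxl _ _) _ hx.
    exact: TU (leq_maxr _ _) _ hy.
  - exists (maxn n m); apply: (subM (hT _)); first exact: TU (leq_maxl _ _) _ hx.
    exact: TU (leq_maxr _ _) _ hy.
  - by exists n; exact: (subS (hT _)).
have hD := closure_sub hU; have cD := @closure_closed _ _ U.
set D := (X in star_subalgebra X) in hD cD.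
have UD x : U x -> D x by move=> Ux e e0; exists x; rewrite // subrr cnorm0.
pose nu n (x : An n) : sub_cstar hD cD := sub_mk hD cD (UD _ (ex_intro _ n (ex_intro2 _ _ x I erefl))).
have nuE n x : sub_val (nu n x) = mu n x by [].
have hnu : cocone f nu.
  split=> [n|n x]; last by apply: sub_val_inj; rewrite !nuE.
  split=> [k x y|x y|x]; apply: sub_val_inj.
  - by rewrite (homD (sub_val_hom hD cD)) (homZ (sub_val_hom hD cD)) !nuE (homD (hmu n)) (homZ (hmu n)).
  - by rewrite (homM (sub_val_hom hD cD)) !nuE (homM (hmu n)).
  - by rewrite (homS (sub_val_hom hD cD)) !nuE (homS (hmu n)).
have [g [[hg gnu] _]] := univ _ _ hnu.
have [i [_ iU]] := univ B mu (conj hmu muf).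
have e1 : i = id by apply: iU; split.
have e2 : i = (@sub_val _ _ _ hD cD) \o g.
  apply: iU; split; first exact: hom_comp hg (sub_val_hom hD cD).
  by move=> n x; rewrite /= gnu.
have allD x : D x by have -> : x = sub_val (g x); [rewrite -[LHS]/(id x) -e1 e2|exact: sub_valP].
exists (fun n => [set x | T n (phi x)]); split=> [n|n|n|x e e0].
- split=> [|k x y hx hy|x y hx hy|x hx] /=.
  + rewrite (hom0 hphi); exact: (sub0 (hT n)).
  + by rewrite (homD hphi) (homZ hphi); apply: (subD (hT n)) => //; exact: (subZ (hT n)).
  + by rewrite (homM hphi); exact: (subM (hT n)).
  + by rewrite (homS hphi); exact: (subS (hT n)).
- have [N [b hb]] := fd n; exists N.
  apply: (@spanned_dimension _ _ _ _ (fun i => psi (mu n (b i)))) => x [s _ es].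
  have [c ec] := hb s; exists c; apply: (can_inj phiK).
  rewrite -es ec (hom_sum (hmu n)) (hom_sum hphi); apply: eq_bigr => i' _.
  by rewrite (homZ (hmu n)) (homZ hphi) psiK.
- by move=> x; exact: TS.
- have [y [n Ty] hy] := allD (phi x) e e0; exists n, (psi y); first by rewrite /= psiK.
  apply: le_lt_trans hy; rewrite -[x in leLHS]phiK -(homB hpsi); exact: (hom_le hpsi).
Qed.

Definition fits (n : nat) (b : nat -> nat) (v : nat -> A) (xs : seq A) (e : R) :=
  forall x, x \in xs -> exists2 y, mspan n b v y & cnorm (x - y) < e.

Lemma mspan_corner n b (v : nat -> A) x i : msystem n b v -> (i < n)%N -> mspan n b v x ->
  exists c, cmul (munit v i i) (cmul x (munit v i i)) = c *: munit v i i.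
Proof.
move=> hv ik [c ec]; exists (c i i).
have h := mspan_coord hv ik ik ec; rewrite eqxx in h.
have -> : cmul (munit v i i) (cmul x (munit v i i)) =
   cmul (v i) (cmul (cmul (cstar (v i)) (cmul x (v i))) (cstar (v i))) by rewrite /munit; cring.
by rewrite h cmulZl cmulZr cmulA (mv_block hv).
Qed.

Lemma munit_projection n b (v : nat -> A) i : msystem n b v -> (i < n)%N ->
  projection (munit v i i).
Proof.
move=> hv ik; split; first by rewrite /munit cstarM cstarK.
by rewrite (munitM hv) ?eqxx.
Qed.

Section Simple.
Variable S : nat -> set A.
Hypothesis hS : fd_chain S.
Let Ssub n : star_subalgebra (S n). Proof. by case: hS. Qed.
Let Sle m n : (m <= n)%N -> S m `<=` S n. Proof. by case: hS => _ _ h _; exact: chain_le. Qed.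

(** The ideal generated by a projection [q] at stage [m]. It stays inside [S m] and so has matrix
    units of its own, all of which are reachable from [q]. *)
Definition principal_ideal q m : set A := [set x | exists2 s : seq (A * A),
  forall t, t \in s -> S m t.1 /\ S m t.2 & x = \sum_(t <- s) cmul t.1 (cmul q t.2)].

Lemma principal_ideal_le q m n : (m <= n)%N -> principal_ideal q m `<=` principal_ideal q n.
Proof. by move=> mn x [s hs ->]; exists s => // t /hs[h1 h2]; split; exact: Sle mn _ _. Qed.

Lemma principal_ideal_lin q m k x y : principal_ideal q m x -> principal_ideal q m y -> principal_ideal q m (k *: x + y).
Proof.
move=> [s hs ->] [t ht ->]; exists ([seq (k *: u.1, u.2) | u <- s] ++ t).
  move=> u; rewrite mem_cat => /orP[/mapP[u' /hs[h1 h2] ->]|/ht //]; split=> //.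
  exact: (subZ (Ssub m)).
rewrite big_cat /= big_map scaler_sumr; congr (_ + _).
by apply: eq_bigr => u _; rewrite cmulZl.
Qed.

Lemma principal_ideal_mull q m x y : S m y -> principal_ideal q m x -> principal_ideal q m (cmul y x).
Proof.
move=> Sy [s hs ->]; exists [seq (cmul y u.1, u.2) | u <- s].
  by move=> u /mapP[u' /hs[h1 h2] ->]; split=> //; exact: (subM (Ssub m)).
by rewrite big_map cmul_sumr; apply: eq_bigr => u _; rewrite /= !cmulA.
Qed.

Lemma principal_ideal_star q m x : cstar q = q -> principal_ideal q m x -> principal_ideal q m (cstar x).
Proof.
move=> sq [s hs ->]; exists [seq (cstar u.2, cstar u.1) | u <- s].
  by move=> u /mapP[u' /hs[h1 h2] ->]; split; exact: (subS (Ssub m)).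
by rewrite big_map cstar_sum; apply: eq_bigr => u _; rewrite /= !cstarM sq cmulA.
Qed.

Lemma principal_ideal_in q m x : S m q -> principal_ideal q m x -> S m x.
Proof.
move=> Sq [s hs ->]; elim: s hs => [|t s IH] hs; rewrite ?big_nil ?big_cons; first exact: (sub0 (Ssub m)).
apply: (subD (Ssub m)); last by apply: IH => u us; apply: hs; rewrite inE us orbT.
have [h1 h2] := hs t (mem_head _ _).
by apply: (subM (Ssub m)) => //; apply: (subM (Ssub m)).
Qed.

Lemma principal_ideal_star_subalgebra q m : S m q -> cstar q = q -> star_subalgebra (principal_ideal q m).
Proof.
move=> Sq sq; split=> [|k x y|x y hx hy|x]; first by exists [::]; rewrite ?big_nil.
- exact: principal_ideal_lin.
- by apply: principal_ideal_mull => //; exact: principal_ideal_in hx.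
- exact: principal_ideal_star.
Qed.

(** The closure of the union over all stages is a closed ideal of [A] containing [q]; simplicity
    makes it everything. *)
Lemma principal_ideal_dense q m0 : simple_cstar A -> projection q -> q <> 0 -> S m0 q ->
  forall x e, 0 < e -> exists m, exists2 y, principal_ideal q m y & cnorm (x - y) < e.
Proof.
move=> simp [sq qq] q0 Sq.
pose K : set A := [set x | forall e, 0 < e -> exists m, exists2 y, principal_ideal q m y & cnorm (x - y) < e].
have Kstar x : K x -> K (cstar x).
  move=> Kx e e0; have [m [y Jy hy]] := Kx e e0; exists m, (cstar y); first exact: principal_ideal_star.
  by rewrite -cstarB cnormS.
have Kl x y : K x -> K (cmul y x).
  move=> Kx e e0; have y1 : 0 < cnorm y + 1 by have := cnorm_ge0 y; lra.
  have [|m [z Jz hz]] := Kx (e / 2 / (cnorm y + 1)); first by rewrite divr_gt0 // divr_gt0.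
  have z1 : 0 < cnorm z + 1 by have := cnorm_ge0 z; lra.
  have [_ _ _ dS] := hS.
  have [|m' [y' Sy' hy']] := dS y (e / 2 / (cnorm z + 1)); first by rewrite divr_gt0 // divr_gt0.
  exists (maxn m m'), (cmul y' z).
    by apply: principal_ideal_mull; [apply: Sle (leq_maxr _ _) _ Sy'|apply: principal_ideal_le (leq_maxl _ _) _ Jz].
  have -> : cmul y x - cmul y' z = cmul y (x - z) + cmul (y - y') z by cring.
  apply: le_lt_trans (cnormD _ _) _.
  have h1 := cnormM_le y (x - z); have h2 := cnormM_le (y - y') z.
  rewrite ltr_pdivlMr // in hz; rewrite ltr_pdivlMr // in hy'.
  have := cnorm_ge0 (x - z); have := cnorm_ge0 (y - y'); clear -h1 h2 hz hy' => h3 h4; nra.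
have hK : closed_ideal K.
  split=> [e e0|k x y Kx Ky e e0|x y|x y Kx|].
  - exists 0%N, 0; last by rewrite subrr cnorm0.
    by exists [::]; rewrite ?big_nil.
  - have k1 : 0 < cabs k + 1 by have := cabs_ge0 k; lra.
    have [|m [x' Jx hx]] := Kx (e / 2 / (cabs k + 1)); first by rewrite divr_gt0 // divr_gt0.
    have [|m' [y' Jy hy]] := Ky (e / 2); first by rewrite divr_gt0.
    exists (maxn m m'), (k *: x' + y').
      by apply: principal_ideal_lin; [apply: principal_ideal_le (leq_maxl _ _) _ Jx|apply: principal_ideal_le (leq_maxr _ _) _ Jy].
    rewrite opprD addrACA -scalerBr; apply: le_lt_trans (cnormD _ _) _; rewrite cnormZ.
    rewrite ltr_pdivlMr // in hx; have := cnorm_ge0 (x - x'); clear -hx hy => h; nra.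
  - exact: Kl.
  - by rewrite -[cmul x y]cstarK cstarM; exact: (Kstar _ (Kl _ _ (Kstar _ Kx))).
  - apply/cclosedP => x hx e e0; have [|y Ky hy] := hx (e / 2); first by rewrite divr_gt0.
    have [|m [z Jz hz]] := Ky (e / 2); first by rewrite divr_gt0.
    exists m, z => //; apply: le_lt_trans (cnorm_tri y _ _) _; lra.
have Kq : K q.
  move=> e e0; exists m0, q; last by rewrite subrr cnorm0.
  exists [:: (q, q)]; last by rewrite big_seq1 /= !qq.
  by move=> t; rewrite inE => /eqP ->.
case: (simp K hK) => eK x; last by have : K x by rewrite eK.
by case: q0; move: Kq; rewrite eK.
Qed.

(** Matrix units are taken in the ideal generated at a late stage by a spectral projection [q] of
    [x^* x], where [x] is near [a]. For a diagonal unit [p], some [r = p t q] is nonzero, and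
    [r x^* x r^*] is a multiple of [p]. The scalars are distributed so that [w] has norm at most 1
    and [u] at most [|x| / |l| <= 64/15]; an error [1/32] in [x] then costs less than 1/4. The
    bounds 16 and 2 are generous, and all are strict, to survive approximation. *)
Lemma simple_fits a (xs : seq A) e : simple_cstar A -> 0 < e ->
  exists n b v, [/\ msystem n b v, fits n b v xs e &
   cnorm a < 1 / 2 \/ forall i, (i < n)%N -> exists u w,
     [/\ cnorm u < 16, cnorm w < 2 & cnorm (cmul u (cmul a w) - munit v i i) < 1 / 4]].
Proof.
move=> simp e0; have [_ dS iS aS] := hS.
have [ha|ha] := ltP (cnorm a) (1 / 2).
  have [m hm] : exists m, forall x, x \in xs -> exists2 y, S m y & cnorm (x - y) < e.
    elim: xs => [|x xs [m IH]]; first by exists 0%N.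
    have [m' [y Sy hy]] := aS x e e0; exists (maxn m m') => x'; rewrite inE => /orP[/eqP ->|/IH[y' Sy' hy']].
      by exists y => //; exact: Sle (leq_maxr _ _) _ Sy.
    by exists y' => //; exact: Sle (leq_maxl _ _) _ Sy'.
  have [N dm] := dS m; have [n [b [v [hv ev]]]] := finite_dimensional_system (Ssub m) dm.
  by exists n, b, v; split=> //; [rewrite /fits ev|left].
have [|m0 [x Sx hx]] := aS a 32^-1; first by rewrite invr_gt0.
have xa := cnorm_le a x; have nx : 15 / 32 < cnorm x by lra.
have x0 : x <> 0 by move=> e'; move: nx; rewrite e' cnorm0; lra.
pose y := cmul (cstar x) x.
have Sy : S m0 y by apply: (subM (Ssub _)) => //; exact: (subS (Ssub _)).
have sy : cstar y = y by rewrite /y cstarM cstarK.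
have ny : cnorm y = cnorm x ^+ 2 by rewrite cnorm_cstar.
have y0 : y <> 0 by move=> /cstar_eq0.
have [N0 d0] := dS m0.
have [q [l [Sq hq q0 yq hl]]] := spectral_projection (Ssub m0) d0 Sy sy y0.
have [sq qq] := hq.
have [m [m0m hm]] : exists m, (m0 <= m)%N /\ forall x, x \in xs -> exists2 y, principal_ideal q m y & cnorm (x - y) < e.
  elim: xs => [|t xs [m [mm IH]]]; first by exists m0.
  have [m' [t' Jt ht]] := principal_ideal_dense simp hq q0 Sq t e0.
  exists (maxn m m'); split; first exact: leq_trans mm (leq_maxl _ _).
  move=> x'; rewrite inE => /orP[/eqP ->|/IH[y' Sy' hy']].
    by exists t' => //; exact: principal_ideal_le (leq_maxr _ _) _ Jt.
  by exists y' => //; exact: principal_ideal_le (leq_maxl _ _) _ Sy'.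
have Sqm := Sle m0m Sq.
have hJ := principal_ideal_star_subalgebra Sqm sq.
have [N dm] := dS m.
have dJ : dimension_le (principal_ideal q m) N by apply: dimension_le_sub dm => z; exact: principal_ideal_in.
have [n [b [v [hv ev]]]] := finite_dimensional_system hJ dJ.
exists n, b, v; split=> //; first by rewrite /fits ev.
right=> i ik; have hp := munit_projection hv ik; have [sp pp] := hp.
set p := munit v i i in hp sp pp *.
(* A system may contain zero elements, since only the relations are demanded. *)
have [p0|p0] := EM (p = 0).
  by exists 0, 0; rewrite p0 cmul0l subrr cnorm0; split; lra.
have Jp : principal_ideal q m p.
  by rewrite -ev; apply: mspan_munit => //; case: (hv).
have [s hs es] := Jp.
have [t ts tq0] : exists2 t, t \in s & cmul p (cmul t.1 q) <> 0.
  apply: contrapT => hno; apply: p0; rewrite -[LHS]pp {2}es cmul_sumr big_seq big1 // => t ts.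
  have -> : cmul p (cmul t.1 (cmul q t.2)) = cmul (cmul p (cmul t.1 q)) t.2 by cring.
  have [->|hn] := EM (cmul p (cmul t.1 q) = 0); first by rewrite cmul0l.
  by case: hno; exists t.
have [St _] := hs t ts; set r := cmul p (cmul t.1 q) in tq0.
have Jr : principal_ideal q m r.
  apply: principal_ideal_mull; first exact: principal_ideal_in Jp.
  exists [:: (t.1, q)]; last by rewrite big_seq1 /= qq.
  by move=> u; rewrite inE => /eqP ->.
have rq : cmul r q = r by rewrite /r -!cmulA qq.
have pr : cmul p r = r by rewrite /r cmulA pp.
have [c hc] : exists c, cmul r (cstar r) = c *: p.
  have [|c hc] := @mspan_corner n b v (cmul r (cstar r)) i hv ik.
    by rewrite ev; apply: (subM hJ) => //; exact: (subS hJ).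
  exists c; rewrite -hc -/p.
  have -> : cmul p (cmul (cmul r (cstar r)) p) = cmul (cmul p r) (cstar (cmul (cstar p) r)) by cring.
  by rewrite sp pr.
have p1 : cnorm p = 1.
  apply: le_anti; rewrite projection_le1 //= leNgt; apply/negP => /(projection_lt1 hp); exact: p0.
have nr : cnorm r ^+ 2 = cabs c.
  by rewrite -(cnormS r) -cnorm_cstar cstarK hc cnormZ p1 mulr1.
have r0 : 0 < cnorm r := cnorm_gt0 tq0.
have c0 : c != 0.
  by rewrite -cabs_eq0 -nr gt_eqF // exprn_gt0.
have l0 : l != 0.
  rewrite -cabs_eq0 gt_eqF //; have := cnorm_gt0 y0; lra.
have cabsV (z : R[i]) : z != 0 -> cabs z^-1 = (cabs z)^-1.
  move=> z0; apply: (@mulIf _ (cabs z)); rewrite ?cabs_eq0 // -cabsM !mulVf ?cabs_eq0 //.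
  by rewrite /cabs normr1.
pose rho := (cnorm r)%:C%C; pose rhoV := ((cnorm r)^-1)%:C%C.
have rhoVV : rhoV * rho = 1 by rewrite /rho /rhoV -rmorphM /= mulVf ?gt_eqF.
have nrho : cabs rho = cnorm r by rewrite cabs_real gtr0_norm.
have nrhoV : cabs rhoV = (cnorm r)^-1 by rewrite cabs_real gtr0_norm // invr_gt0.
(* As [y q = l q] and [r r^* = c p], the product [r y r^*] is [l c p]; the factor [rho] compensates
   the normalization of [w]. *)
pose k := c^-1 * l^-1 * rho.
exists (k *: cmul r (cstar x)), (rhoV *: cstar r).
have ex : cmul (k *: cmul r (cstar x)) (cmul x (rhoV *: cstar r)) = p.
  have -> : cstar r = cmul q (cstar r) by rewrite -{1}rq cstarM sq.
  rewrite !cmulZl !cmulZr scalerA.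
  have -> : cmul (cmul r (cstar x)) (cmul x (cmul q (cstar r))) = cmul r (cmul (cmul y q) (cstar r)).
    by rewrite /y; cring.
  rewrite yq cmulZl cmulZr cmulA rq hc !scalerA.
  rewrite -[RHS]scale1r; congr (_ *: _).
  transitivity ((c^-1 * c) * (l^-1 * l) * (rhoV * rho)); first by rewrite /k; ring.
  by rewrite rhoVV !mulVf // !mulr1.
have nk : cabs k = (cnorm r)^-1 * (cabs l)^-1.
  rewrite !cabsM !cabsV // nrho -nr expr2 invfM.
  have rn : cnorm r != 0 by rewrite gt_eqF.
  have ln : cabs l != 0 by rewrite cabs_eq0.
  by field; rewrite ?rn ?ln.
have lx : (cabs l)^-1 * cnorm x <= 64 / 15.
  have lp : 0 < cabs l by rewrite lt_neqAle eq_sym cabs_eq0 l0 cabs_ge0.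
  rewrite mulrC ler_pdivrMr //; rewrite ny in hl; nra.
have nu : cnorm (k *: cmul r (cstar x)) <= 64 / 15.
  rewrite cnormZ nk; apply: le_trans lx.
  have := cnormM_le r (cstar x); rewrite cnormS => h.
  rewrite [(cnorm r)^-1 * _]mulrC -mulrA ler_wpM2l ?invr_ge0 ?cabs_ge0 //.
  by rewrite ler_pdivrMl.
have nw : cnorm (rhoV *: cstar r) <= 1.
  by rewrite cnormZ nrhoV cnormS mulVf // gt_eqF.
split; [lra|lra|].
rewrite -{1}ex.
have -> U W : cmul U (cmul a W) - cmul U (cmul x W) = cmul U (cmul (a - x) W) by cring.
apply: le_lt_trans (cnormM_le _ _) _.
have h := cnormM_le (a - x) (rhoV *: cstar r).
have h1 := cnorm_ge0 (k *: cmul r (cstar x)); have h2 := cnorm_ge0 (a - x).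
have h3 := cnorm_ge0 (rhoV *: cstar r).
have h4 : cnorm (cmul (a - x) (rhoV *: cstar r)) <= 32^-1.
  apply: le_trans h _; clear -h2 h3 nw hx; nra.
have h5 := cnorm_ge0 (cmul (a - x) (rhoV *: cstar r)).
clear -h1 h4 h5 nu; nra.
Qed.
End Simple.
End Chains.

(** * AF algebras from local approximation *)

(** The extension is characterized by [|psi x - N d| <= |x - d|] for all [d] in [D], from which
    every algebraic law follows by approximation. *)
Lemma dense_extension (R : realType) (A C : cstarType R) (D : set A) (N : A -> C) :
  star_subalgebra D -> (forall x e, 0 < e -> exists2 y, D y & cnorm (x - y) < e) ->
  (forall k x y, D x -> D y -> N (k *: x + y) = k *: N x + N y) ->
  (forall x y, D x -> D y -> N (cmul x y) = cmul (N x) (N y)) ->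
  (forall x, D x -> N (cstar x) = cstar (N x)) ->
  (forall x, D x -> cnorm (N x) <= cnorm x) ->
  exists2 psi, star_hom psi & forall x, D x -> psi x = N x.
Proof.
move=> hD dD Nlin NM NS Nle.
have NB x y : D x -> D y -> N (x - y) = N x - N y.
  by move=> Dx Dy; rewrite addrC -scaleN1r Nlin // scaleN1r addrC.
have NBle x y : D x -> D y -> cnorm (N x - N y) <= cnorm (x - y).
  by move=> Dx Dy; rewrite -NB //; apply: Nle; exact: (subB hD).
have h0 := halves_gt0 R.
have ex x : exists l, forall d, D d -> cnorm (l - N d) <= cnorm (x - d).
  have /choice[s hs] : forall k, exists y, D y /\ cnorm (x - y) < halves R k.
    by move=> k; have [y Dy hy] := dD x _ (h0 k); exists y.
  have [|l hl] := @fast_cvg R C (fun k => N (s k)) 2.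
    move=> k; have [D1 h1] := hs k; have [D2 h2] := hs k.+1.
    apply: le_trans (NBle _ _ D2 D1) _; have := cnorm_tri x (s k.+1) (s k).
    by rewrite (cnormC _ x); move: h2; rewrite halvesS; have := h0 k; lra.
  exists l => d Dd; apply/ler_addgt0Pr => e e0.
  have [|n hn] := @halves_small R (e / 5); first by rewrite divr_gt0.
  have {}hn := hn n (leqnn n); have {}hl := hl n; have [Ds hsn] := hs n.
  have h1 := cnorm_tri (N (s n)) l (N d); have h2 := NBle _ _ Ds Dd.
  have h3 := cnorm_tri x (s n) d; rewrite (cnormC (s n) x) in h3; lra.
have [psi hpsi] := choice ex.
have pN x : D x -> psi x = N x.
  move=> Dx; apply/eqP; rewrite -subr_eq0; apply/eqP/cnorm_eq0/le_anti.
  by rewrite cnorm_ge0 andbT -(cnorm0 A) -(subrr x); exact: hpsi.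
have psiL k x y : psi (k *: x + y) = k *: psi x + psi y.
  apply/eqP; rewrite -subr_eq0; apply/eqP/cnorm_small => e e0.
  have k0 := cabs_ge0 k; pose d := e / (2 * (cabs k + 1)).
  have d0 : 0 < d by rewrite divr_gt0 // mulr_gt0 //; lra.
  have de : d * (2 * (cabs k + 1)) = e by rewrite divfK // gt_eqF // mulr_gt0 //; lra.
  have [x' Dx hx] := dD x _ d0; have [y' Dy hy] := dD y _ d0.
  have h1 := hpsi x _ Dx; have h2 := hpsi y _ Dy.
  have h3 := hpsi (k *: x + y) (k *: x' + y') (subD hD (subZ hD _ Dx) Dy).
  have -> : psi (k *: x + y) - (k *: psi x + psi y) =
    (psi (k *: x + y) - N (k *: x' + y')) - (k *: (psi x - N x') + (psi y - N y')).
    by rewrite Nlin // scalerBr; cring.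
  apply: le_trans (cnormB _ _) _; have := cnormD (k *: (psi x - N x')) (psi y - N y').
  rewrite cnormZ => h4.
  have h5 : cnorm (k *: x + y - (k *: x' + y')) <= cabs k * cnorm (x - x') + cnorm (y - y').
    by rewrite opprD addrACA -scalerBr; apply: le_trans (cnormD _ _) _; rewrite cnormZ.
  have := ler_wpM2l k0 (ltW hx); have := ler_wpM2l k0 h1; clear -h2 h3 h4 h5 hy de k0 => h6 h7; nra.
have psiB x y : psi (x - y) = psi x - psi y.
  by rewrite addrC -scaleN1r psiL scaleN1r addrC.
have psi_le x : cnorm (psi x) <= cnorm x.
  have := hpsi x 0 (sub0 hD); rewrite -(pN 0 (sub0 hD)).
  have -> : psi 0 = 0 by rewrite -[X in psi X](subrr 0) psiB subrr.
  by rewrite !subr0.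
exists psi => //; split=> // [x y|x].
  apply/eqP; rewrite -subr_eq0; apply/eqP/cnorm_small => e e0.
  have nx := cnorm_ge0 x; have ny := cnorm_ge0 y.
  pose d := Num.min 1 (e / (2 * (cnorm x + cnorm y + 1))).
  have d0 : 0 < d by rewrite lt_min ltr01 divr_gt0 // mulr_gt0 //; lra.
  have de : d * (2 * (cnorm x + cnorm y + 1)) <= e.
    by rewrite -ler_pdivlMr ?ge_min ?lexx ?orbT // mulr_gt0 //; lra.
  have d1 : d <= 1 by rewrite ge_min lexx.
  have [x' Dx hx] := dD x _ d0; have [y' Dy hy] := dD y _ d0.
  have h1 : cnorm (psi (cmul x y - cmul x' y')) <= d * (cnorm x + cnorm y + 1).
    apply: le_trans (psi_le _) _.
    have -> : cmul x y - cmul x' y' = cmul (x - x') y + cmul x (y - y') - cmul (x - x') (y - y') by cring.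
    have h3 := cnormB (cmul (x - x') y + cmul x (y - y')) (cmul (x - x') (y - y')).
    have h4 := cnormD (cmul (x - x') y) (cmul x (y - y')).
    have h5 := cnormM_le (x - x') y; have h6 := cnormM_le x (y - y').
    have h7 := cnormM_le (x - x') (y - y').
    have h8 := cnorm_ge0 (x - x'); have h9 := cnorm_ge0 (y - y').
    clear -nx ny d0 d1 hx hy h3 h4 h5 h6 h7 h8 h9; nra.
  have h2 : cnorm (cmul (psi x) (psi y) - cmul (psi x') (psi y')) <= d * (cnorm x + cnorm y + 1).
    have -> : cmul (psi x) (psi y) - cmul (psi x') (psi y') =
      cmul (psi (x - x')) (psi y) + cmul (psi x) (psi (y - y')) - cmul (psi (x - x')) (psi (y - y')).
      by rewrite !psiB; cring.
    have h3 := cnormB (cmul (psi (x - x')) (psi y) + cmul (psi x) (psi (y - y'))) (cmul (psi (x - x')) (psi (y - y'))).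
    have h4 := cnormD (cmul (psi (x - x')) (psi y)) (cmul (psi x) (psi (y - y'))).
    have h5 := cnormM_le (psi (x - x')) (psi y); have h6 := cnormM_le (psi x) (psi (y - y')).
    have h7 := cnormM_le (psi (x - x')) (psi (y - y')).
    have h8 := psi_le (x - x'); have h9 := psi_le (y - y').
    have h10 := psi_le x; have h11 := psi_le y.
    have := cnorm_ge0 (psi (x - x')); have := cnorm_ge0 (psi (y - y')).
    have := cnorm_ge0 (psi x); have := cnorm_ge0 (psi y).
    clear -nx ny d0 d1 hx hy h3 h4 h5 h6 h7 h8 h9 h10 h11 => p1 p2 p3 p4.
    have q1 : cnorm (psi (x - x')) * cnorm (psi y) <= d * cnorm y by rewrite ler_pM //; lra.
    have q2 : cnorm (psi x) * cnorm (psi (y - y')) <= cnorm x * d by rewrite ler_pM //; lra.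
    have q3 : cnorm (psi (x - x')) * cnorm (psi (y - y')) <= d * 1 by rewrite ler_pM //; lra.
    lra.
  have -> : psi (cmul x y) - cmul (psi x) (psi y) =
    psi (cmul x y - cmul x' y') - (cmul (psi x) (psi y) - cmul (psi x') (psi y')).
    have -> : cmul (psi x') (psi y') = psi (cmul x' y') by rewrite !pN ?NM //; exact: (subM hD).
    by rewrite psiB; cring.
  apply: le_trans (cnormB _ _) _; lra.
apply/eqP; rewrite -subr_eq0; apply/eqP/cnorm_small => e e0.
have [|x' Dx hx] := dD x (e / 2); first by rewrite divr_gt0.
have -> : psi (cstar x) - cstar (psi x) = psi (cstar (x - x')) - cstar (psi (x - x')).
  by rewrite cstarB !psiB (pN (cstar x')) ?NS // ?(pN x') ?cstarB //; [cring|exact: (subS hD)].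
apply: le_trans (cnormB _ _) _; have := psi_le (cstar (x - x')); have := psi_le (x - x').
rewrite !cnormS; lra.
Qed.

(** * Inductive limits of nested spans *)

Section Nested.
Variables (R : realType) (A : cstarType R).

Lemma mspan_finite_dimensional n b (v : nat -> A) (hv : msystem n b v) :
  finite_dimensional (sub_cstar (mspan_sub hv) (mspan_closed hv)).
Proof.
set hS := mspan_sub hv; set cS := mspan_closed hv.
pose g0 (p : 'I_n * 'I_n) : A := if b p.1 == b p.2 then munit v p.1 p.2 else 0.
have Sg p : mspan n b v (g0 p).
  rewrite /g0; case: eqP => e; last exact: mspan0.
  by apply: mspan_munit => //; exact: ltn_ord.
exists #|{: 'I_n * 'I_n}|, (fun i => sub_mk hS cS (Sg (enum_val i))) => x.
have [c ec] := sub_valP x; exists (fun i : 'I_#|{: 'I_n * 'I_n}| => c (enum_val i).1 (enum_val i).2).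
apply: sub_val_inj; rewrite ec (hom_sum (sub_val_hom hS cS)).
transitivity (\sum_(p : 'I_n * 'I_n) c p.1 p.2 *: g0 p).
  rewrite -(pair_bigA _ (fun i j : 'I_n => c i j *: g0 (i, j))) /=; apply: eq_bigr => i _.
  rewrite big_mkcond; apply: eq_bigr => j _; rewrite /g0 /=; case: eqP => //; by rewrite scaler0.
rewrite (reindex (@enum_val _ {: 'I_n * 'I_n})) /=; last exact: onW_bij (enum_val_bij _).
by apply: eq_bigr.
Qed.

Variables (n : nat -> nat) (b : nat -> nat -> nat) (v : nat -> nat -> A).
Hypothesis hv : forall k, msystem (n k) (b k) (v k).
Let S k := mspan (n k) (b k) (v k).
Hypothesis nest : forall k, S k `<=` S k.+1.
Hypothesis dS : forall x e, 0 < e -> exists k, exists2 y, S k y & cnorm (x - y) < e.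
Let hS k : star_subalgebra (S k) := mspan_sub (hv k).
Let cS k : closed (S k) := mspan_closed (hv k).

(** A cocone glues to a map on the union of the spans; [hom_le] makes it contractive at each stage,
    so it extends by density. The extension is unique because homomorphisms are continuous. *)
Theorem nested_AF : AF A.
Proof.
pose An k : cstarType R := sub_cstar (hS k) (@cS k).
pose f k (x : An k) : An k.+1 := sub_mk (hS k.+1) (@cS k.+1) (nest (sub_valP x)).
pose mu k : An k -> A := @sub_val _ _ _ (hS k) (@cS k).
have hmu k : star_hom (mu k) := sub_val_hom (hS k) (@cS k).
have muI k : injective (mu k) by exact: sub_val_inj.
have muf k x : mu k.+1 (f k x) = mu k x by [].
have hf k : star_hom (f k).
  split=> [c x y|x y|x]; apply: (muI k.+1).
  - by rewrite (homD (hmu _)) (homZ (hmu _)) !muf (homD (hmu _)) (homZ (hmu _)).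
  - by rewrite (homM (hmu _)) !muf (homM (hmu _)).
  - by rewrite (homS (hmu _)) !muf (homS (hmu _)).
have Sle := chain_le nest.
exists An, f, A, mu; split=> //; last 1 first.
- by exists id; [split|exists id].
- by move=> k; exact: mspan_finite_dimensional.
split; first by split.
move=> C nu [hnu nuf].
pose D := [set x | exists k, S k x].
pose N0 k x := if pselect (S k x) is left h then nu k (sub_mk (hS k) (@cS k) h) else 0.
have N0E k (x : An k) : N0 k (mu k x) = nu k x.
  rewrite /N0; case: pselect => [h|]; last by case; exact: sub_valP.
  by congr (nu k _); exact: muI.
have N0S k x : S k x -> N0 k.+1 x = N0 k x.
  move=> Sx; have -> : x = mu k (sub_mk (hS k) (@cS k) Sx) by [].
  by rewrite -[in LHS]muf !N0E nuf.
have N0le k m x : (k <= m)%N -> S k x -> N0 m x = N0 k x.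
  move=> /subnK <- Sx; elim: (m - k)%N => [|i IH]; first by rewrite add0n.
  by rewrite addSn N0S //; exact: (Sle _ _ (leq_addl _ _) _ Sx).
have ex x : exists y, forall k, S k x -> y = N0 k x.
  have [[k Sk]|no] := EM (D x); last by exists 0 => k Sk; case: no; exists k.
  exists (N0 k x) => m Sm; rewrite -(N0le k (maxn k m)) ?leq_maxl //.
  by rewrite (N0le m) ?leq_maxr.
have [N hN] := choice ex.
have NE k (x : An k) : N (mu k x) = nu k x by rewrite (hN _ k) ?N0E //; exact: sub_valP.
have up k x : S k x -> exists y : An k, x = mu k y by move=> Sx; exists (sub_mk (hS k) (@cS k) Sx).
have up2 x y : D x -> D y -> exists k (x' y' : An k), x = mu k x' /\ y = mu k y'.
  move=> [k Sk] [m Sm]; exists (maxn k m).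
  have [x' ->] := up _ _ (Sle _ _ (leq_maxl k m) _ Sk).
  by have [y' ->] := up _ _ (Sle _ _ (leq_maxr k m) _ Sm); exists x', y'.
have hD : star_subalgebra D.
  split=> [|c x y Dx Dy|x y Dx Dy|x [k Sk]].
  - by exists 0%N; exact: (sub0 (hS 0)).
  - have [k [x' [y' [-> ->]]]] := up2 x y Dx Dy; exists k.
    by rewrite -(homZ (hmu k)) -(homD (hmu k)); exact: sub_valP.
  - have [k [x' [y' [-> ->]]]] := up2 x y Dx Dy; exists k.
    by rewrite -(homM (hmu k)); exact: sub_valP.
  - by exists k; exact: (subS (hS k)).
have dD x e : 0 < e -> exists2 y, D y & cnorm (x - y) < e.
  by move=> e0; have [k [y Sy hy]] := dS x e0; exists y => //; exists k.
have [||||psi hpsi pN] := @dense_extension R A C D N hD dD.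
- move=> c x y Dx Dy; have [k [x' [y' [-> ->]]]] := up2 x y Dx Dy.
  by rewrite -(homZ (hmu k)) -(homD (hmu k)) !NE (homD (hnu k)) (homZ (hnu k)).
- move=> x y Dx Dy; have [k [x' [y' [-> ->]]]] := up2 x y Dx Dy.
  by rewrite -(homM (hmu k)) !NE (homM (hnu k)).
- by move=> x [k /up[x' ->]]; rewrite -(homS (hmu k)) !NE (homS (hnu k)).
- move=> x [k /up[x' ->]]; rewrite NE; apply: le_trans (hom_le (hnu k) x') _.
  by rewrite sub_val_norm.
have pmu k x : psi (mu k x) = nu k x.
  by rewrite pN ?NE //; exists k; exact: sub_valP.
exists psi; split=> // psi' [hpsi' pmu']; apply/funext => x.
apply/eqP; rewrite -subr_eq0; apply/eqP/cnorm_small => e e0.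
have [|k [y /up[y' ->] hy]] := dS x (_ : 0 < e / 2); first by rewrite divr_gt0.
have -> : psi x - psi' x = psi (x - mu k y') - psi' (x - mu k y').
  by rewrite (homB hpsi) (homB hpsi') pmu pmu'; cring.
apply: le_trans (cnormB _ _) _.
have := hom_le hpsi (x - mu k y'); have := hom_le hpsi' (x - mu k y'); lra.
Qed.
End Nested.

Section Conjugation.
Variables (R : realType) (A : cstarType R).
Implicit Types x y z t h : A.

(* [uconj t] is the conjugation by the unitary [1 + t]. *)
Definition uconj t x := x + cmul t x + cmul x (cstar t) + cmul t (cmul x (cstar t)).
Definition unit_unitary t := t + cstar t + cmul (cstar t) t = 0 /\ t + cstar t + cmul t (cstar t) = 0.

Lemma uconj_hom t : unit_unitary t -> star_hom (uconj t).
Proof.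
move=> [g0 _]; split=> [k x y|x y|x]; rewrite /uconj.
- by rewrite !(cmulDl, cmulDr, cmulZl, cmulZr) !scalerDr; cring.
- have -> : cmul (x + cmul t x + cmul x (cstar t) + cmul t (cmul x (cstar t)))
   (y + cmul t y + cmul y (cstar t) + cmul t (cmul y (cstar t))) =
   cmul x y + cmul t (cmul x y) + cmul (cmul x y) (cstar t) + cmul t (cmul (cmul x y) (cstar t))
   + (let w := cmul x (cmul (t + cstar t + cmul (cstar t) t) y) in w + cmul t w + cmul w (cstar t) + cmul t (cmul w (cstar t))).
    by rewrite /=; cring.
  by rewrite /= g0 !(cmul0l, cmul0r) !addr0.
- by cring.
Qed.

Lemma uconj_near t x : cnorm t <= 1 -> cnorm (uconj t x - x) <= 3 * cnorm t * cnorm x.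
Proof.
move=> t1; have -> : uconj t x - x = cmul t x + cmul x (cstar t) + cmul t (cmul x (cstar t)) by rewrite /uconj; cring.
have h1 := cnormD (cmul t x + cmul x (cstar t)) (cmul t (cmul x (cstar t))).
have h2 := cnormD (cmul t x) (cmul x (cstar t)).
have h3 := cnormM_le t x; have h4 := cnormM_le x (cstar t).
have h5 := cnormM_le t (cmul x (cstar t)); rewrite cnormS in h4.
have n1 := cnorm_ge0 t; have n2 := cnorm_ge0 x; have n3 := cnorm_ge0 (cmul x (cstar t)).
have h6 : cnorm t * cnorm (cmul x (cstar t)) <= cnorm (cmul x (cstar t)) by rewrite ler_piMl.
have -> : 3 * cnorm t * cnorm x = cnorm t * cnorm x + cnorm x * cnorm t + cnorm x * cnorm t by ring.
lra.
Qed.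

Lemma msunit_projection n b (v : nat -> A) : msystem n b v -> projection (msunit n v).
Proof.
move=> hv; split; first by rewrite /msunit cstar_sum; apply: eq_bigr => i _; rewrite /munit cstarM cstarK.
rewrite {2}/msunit cmul_sumr; apply: eq_bigr => i _.
rewrite /msunit cmul_suml (bigD1 i) //= (munitM hv) ?eqxx // big1 ?addr0 // => j ji.
by rewrite (munitM hv) //; case: eqP => // e; case/eqP: ji; exact: val_inj.
Qed.

Lemma msunit_mv n b (v : nat -> A) i : msystem n b v -> (i < n)%N -> cmul (msunit n v) (v i) = v i.
Proof.
move=> hv ik; rewrite /msunit cmul_suml (bigD1 (Ordinal ik)) //= -cmulA (proj2 hv) // /gram eqxx.
rewrite (mv_block hv) // big1 ?addr0 // => j ji; rewrite -cmulA (proj2 hv) // /gram.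
by case: eqP => [e|_]; [case/eqP: ji; exact: val_inj|rewrite cmul0r].
Qed.

(* The unitary is the polar part of [X + (1 - p) (1 - q)], where [X] is the sum
   of the [v i w_i^*]; it intertwines the two systems. *)
Lemma close_systems n b (v w : nat -> A) (d : R) : msystem n b v -> msystem n b w ->
  (forall i, (i < n)%N -> cnorm (w i - v i) <= d) -> 96 * n%:R * d <= 1 ->
  exists t, [/\ unit_unitary t, cnorm t <= 15 * n%:R * d, cnorm t <= 5 / 32 &
    forall i j, (i < n)%N -> (j < n)%N -> b i = b j -> uconj t (munit w i j) = munit v i j].
Proof.
move=> hv hw vw dn; pose p := msunit n v; pose q := msunit n w.
have [sp pp] := msunit_projection hv; have [sq qq] := msunit_projection hw.
pose X := \sum_(i < n) cmul (v i) (cstar (w i)).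
(* [1 + x = X + (1 - p)(1 - q)], so that the unit cancels. *)
pose x := X - p - q + cmul p q.
have nx : cnorm x <= 3 * n%:R * d.
  have -> : x = (X - p) + (cmul p q - q) by rewrite /x; cring.
  apply: le_trans (cnormD _ _) _; have -> : 3 * n%:R * d = \sum_(i < n) d + \sum_(i < n) (2 * d).
    by rewrite !sumr_const card_ord -[d *+ n]mulr_natr -[(2 * d) *+ n]mulr_natr; ring.
  apply: lerD.
    rewrite /X /p /msunit -sumrB; apply: le_trans (cnorm_sum _ _ _) _; apply: ler_sum => i _.
    rewrite /munit -cmulBr -cstarB; apply: le_trans (cnormM_le _ _) _; rewrite cnormS.
    have := vw i (ltn_ord i); have := mnorm_le1 hv (ltn_ord i); have := cnorm_ge0 (v i).
    by have := cnorm_ge0 (w i - v i); nra.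
  rewrite /q /msunit cmul_sumr -sumrB; apply: le_trans (cnorm_sum _ _ _) _; apply: ler_sum => i _.
  have -> : cmul p (munit w i i) - munit w i i = cmul (cmul p (w i - v i) - (w i - v i) + (cmul p (v i) - v i)) (cstar (w i)).
    by rewrite /munit; cring.
  rewrite (msunit_mv hv) // subrr addr0; apply: le_trans (cnormM_le _ _) _; rewrite cnormS.
  have := cnormB (cmul p (w i - v i)) (w i - v i); have := cnormM_le p (w i - v i).
  have := projection_le1 (msunit_projection hv); rewrite -/p.
  have := vw i (ltn_ord i); have := mnorm_le1 hw (ltn_ord i); have := cnorm_ge0 (w i).
  have := cnorm_ge0 (w i - v i); have := cnorm_ge0 p; have := cnorm_ge0 (cmul p (w i - v i) - (w i - v i)).
  move: (cnorm (cmul p (w i - v i) - (w i - v i))) (cnorm p) (cnorm (w i - v i)) (cnorm (w i)) (cnorm (cmul p (w i - v i))).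
  clear => a0 a1 a2 a3 a4; move=> *; nra.
have nx' : cnorm x <= 32^-1 by lra.
pose E i j := munit w i j; pose V i j := munit v i j.
have Es i j : cstar (E i j) = E j i by rewrite /E /munit cstarM cstarK.
have Vs i j : cstar (V i j) = V j i by rewrite /V /munit cstarM cstarK.
(* The intertwining relation [(1 + x) E = V (1 + x)]: both sides reduce to [v i w_j^*]. *)
have ZE i j : (i < n)%N -> (j < n)%N -> b i = b j -> E i j + cmul x (E i j) = V i j + cmul (V i j) x.
  move=> ik jk bij; have bi := (hv.1 _ ik).1; have bj := (hv.1 _ jk).1.
  have qE : cmul q (E i j) = E i j by rewrite /E /munit cmulA (msunit_mv hw).
  have Vp : cmul (V i j) p = V i j.
    have : cmul p (V j i) = V j i by rewrite /V /munit cmulA (msunit_mv hv).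
    by move=> /(congr1 cstar); rewrite cstarM sp /V /munit cstarM cstarK.
  have XE : cmul X (E i j) = cmul (v i) (cstar (w j)).
    rewrite /X cmul_suml (bigD1 (Ordinal ik)) //= big1 => [|k ki].
      rewrite addr0 /E /munit.
      have -> : cmul (cmul (v i) (cstar (w i))) (cmul (w i) (cstar (w j))) =
        cmul (v i) (cstar (cmul (w j) (cstar (cmul (cstar (w i)) (w i))))) by cring.
      rewrite (proj2 hw) // /gram eqxx; have [sb _] := block_projection hw ik.
      by rewrite sb bij (mv_block hw).
    have -> : cmul (cmul (v k) (cstar (w k))) (E i j) = cmul (v k) (cmul (cmul (cstar (w k)) (w i)) (cstar (w j))).
      by rewrite /E /munit; cring.
    rewrite (proj2 hw) // /gram; case: eqP => [e|_]; last by rewrite cmul0l cmul0r.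
    by case/eqP: ki; exact: val_inj.
  have VX : cmul (V i j) X = cmul (v i) (cstar (w j)).
    rewrite /X cmul_sumr (bigD1 (Ordinal jk)) //= big1 => [|k ki].
      rewrite addr0 /V /munit.
      have -> : cmul (cmul (v i) (cstar (v j))) (cmul (v j) (cstar (w j))) =
        cmul (cmul (v i) (cmul (cstar (v j)) (v j))) (cstar (w j)) by cring.
      by rewrite (proj2 hv) // /gram eqxx -bij (mv_block hv).
    have -> : cmul (V i j) (cmul (v k) (cstar (w k))) = cmul (v i) (cmul (cmul (cstar (v j)) (v k)) (cstar (w k))).
      by rewrite /V /munit; cring.
    rewrite (proj2 hv) // /gram; case: eqP => [e|_]; last by rewrite cmul0l cmul0r.
    by case/eqP: ki; apply: val_inj.
  have -> : cmul x (E i j) = cmul X (E i j) - cmul p (E i j) - cmul q (E i j) + cmul p (cmul q (E i j)) by rewrite /x; cring.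
  have -> : cmul (V i j) x = cmul (V i j) X - cmul (V i j) p - cmul (V i j) q + cmul (cmul (V i j) p) q by rewrite /x; cring.
  by rewrite qE Vp XE VX; cring.
(* [1 - h] is the product of the adjoint of [1 + x] with [1 + x], and it commutes with the [E i j].
   So does the root [z], hence the polar part [1 + t = (1 + x)(1 + z)] still intertwines. *)
pose g := x + cstar x + cmul (cstar x) x; pose h := - g.
have sh : cstar h = h by rewrite /h /g; cring.
have hE i j : (i < n)%N -> (j < n)%N -> b i = b j -> cmul (E i j) h = cmul h (E i j).
  move=> ik jk bij; have e1 := ZE i j ik jk bij.
  have e2 := ZE j i jk ik (esym bij).
  have {}e2 : E i j + cmul (E i j) (cstar x) = V i j + cmul (cstar x) (V i j).
    by have := congr1 cstar e2; rewrite [cstar (E j i + _)]cstarD [cstar (V j i + _)]cstarD [cstar (cmul x _)]cstarM [cstar (cmul _ x)]cstarM !Es !Vs.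
  have -> : cmul (E i j) h = - cmul (E i j + cmul (E i j) (cstar x)) x - cmul (E i j) (cstar x) by rewrite /h /g; cring.
  have -> : cmul h (E i j) = - cmul (cstar x) (E i j + cmul x (E i j)) - cmul x (E i j) by rewrite /h /g; cring.
  rewrite e1 e2.
  have -> : cmul x (E i j) = V i j + cmul (V i j) x - E i j by rewrite -e1; cring.
  have -> : cmul (E i j) (cstar x) = V i j + cmul (cstar x) (V i j) - E i j by rewrite -e2; cring.
  by cring.
have nh : cnorm h <= 3 * cnorm x.
  rewrite /h cnormN /g; have := cnormD (x + cstar x) (cmul (cstar x) x).
  have := cnormD x (cstar x); rewrite cnormS cnorm_cstar; have := cnorm_ge0 x; clear -nx'; nra.
have [|z [sz nz ez zT]] := inv_sqrt sh; first by have := cnorm_ge0 x; lra.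
pose T := [set y | forall i j, (i < n)%N -> (j < n)%N -> b i = b j -> cmul (E i j) y = cmul y (E i j)].
have hT : star_subalgebra T.
  split=> [i j _ _ _|k y y' h1 h2 i j ik jk bij|y y' h1 h2 i j ik jk bij|y h1 i j ik jk bij].
  - by rewrite cmul0l cmul0r.
  - by rewrite cmulDl cmulDr cmulZl cmulZr h1 // h2.
  - by rewrite cmulA h1 // -cmulA h2 // cmulA.
  - by rewrite -Es -!cstarM h1.
have cT : closed T.
  apply/cclosedP => y hy i j ik jk bij; have /cclosedP := @commutant_closed _ _ (E i j); apply => e e0.
  by have [y' Ty' hy'] := hy e e0; exists y' => //; exact: Ty'.
have zE := zT T hT cT hE.
have zh : cmul h z = cmul z h.
  exact: (zT _ (commutant_sub sh) (@commutant_closed _ _ h) erefl).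
pose t := x + z + cmul x z; exists t.
have nt : cnorm t <= 5 * cnorm x.
  have h1 := cnormD (x + z) (cmul x z); have h2 := cnormD x z; have h3 := cnormM_le x z.
  have := cnorm_ge0 x; have := cnorm_ge0 z; rewrite /t; clear -h1 h2 h3 nx' nz nh; nra.
have nt' : cnorm t <= 5 / 32 by lra.
have g0 : t + cstar t + cmul (cstar t) t = 0.
  have -> : t + cstar t + cmul (cstar t) t = (z + cstar z + cmul (cstar z) z) -
     (h + cmul (cstar z) h + cmul h z + cmul (cstar z) (cmul h z)) by rewrite /t /h /g; cring.
  rewrite sz zh; have -> : z + z + cmul z z = z *+ 2 + cmul z z by cring.
  by rewrite ez (cmulA h z z) zh -(cmulA z h z) zh; cring.
(* An isometry near 1 is unitary: its defect [- f] is a projection of norm less than 1, hence 0. *)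
have f0 : t + cstar t + cmul t (cstar t) = 0.
  set f := _ + _ + _; have sf : cstar f = f by rewrite /f; cring.
  have ff : cmul f f + f = 0.
    have -> : cmul f f + f = let g1 := t + cstar t + cmul (cstar t) t in
       g1 + cmul t g1 + cmul g1 (cstar t) + cmul t (cmul g1 (cstar t)) by rewrite /f /=; cring.
    by rewrite /= g0 !(cmul0l, cmul0r) !addr0.
  have pf : projection (- f).
    split; first by rewrite cstarN sf.
    by rewrite cmulNl cmulNr opprK -[RHS]addr0 -ff; cring.
  rewrite -[LHS]opprK (projection_lt1 pf) ?oppr0 // cnormN /f.
  have := cnormD (t + cstar t) (cmul t (cstar t)); have := cnormD t (cstar t).
  have := cnormM_le t (cstar t); rewrite cnormS; have := cnorm_ge0 t; clear -nt'; nra.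
split=> //; first by lra.
move=> i j ik jk bij.
have e1 : E i j + cmul t (E i j) = V i j + cmul (V i j) t.
  have -> : E i j + cmul t (E i j) = (E i j + cmul x (E i j)) + (cmul z (E i j) + cmul x (cmul z (E i j))) by rewrite /t; cring.
  rewrite -zE // ZE //.
  have -> : cmul (E i j) z + cmul x (cmul (E i j) z) = cmul (E i j + cmul x (E i j)) z by cring.
  by rewrite ZE // /t; cring.
have -> : uconj t (munit w i j) = (E i j + cmul t (E i j)) + cmul (E i j + cmul t (E i j)) (cstar t).
  by rewrite /uconj /E; cring.
rewrite e1.
have -> : V i j + cmul (V i j) t + cmul (V i j + cmul (V i j) t) (cstar t) = V i j + cmul (V i j) (t + cstar t + cmul t (cstar t)) by cring.
by rewrite f0 cmul0r addr0.
Qed.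

Lemma msystem_hom (B : cstarType R) (f : A -> B) n b v : star_hom f -> msystem n b v ->
  msystem n b (f \o v).
Proof.
move=> hf [bb hv]; split=> // i j ik jk; rewrite /= -(homS hf) -(homM hf) hv // /gram.
by case: eqP => //= _; rewrite (hom0 hf).
Qed.

Lemma mspan_hom (B : cstarType R) (f : A -> B) n b v x : star_hom f -> mspan n b v x ->
  mspan n b (f \o v) (f x).
Proof.
move=> hf [c ->]; exists c; rewrite (hom_sum hf); apply: eq_bigr => i _; rewrite (hom_sum hf).
by apply: eq_bigr => j _; rewrite (homZ hf) /munit (homM hf) (homS hf).
Qed.
End Conjugation.

Section Local.
Variables (R : realType) (A : cstarType R).
Implicit Types x y z : A.

(** The perturbation theorem is applied inside [G], regarded as a C*-algebra of its own, so that the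
    corrected system cannot leave [G]. *)
Lemma approximate_system n b (v : nat -> A) (d : R) : msystem n b v -> 0 < d ->
  exists2 e, 0 < e & forall (G : set A), star_subalgebra G -> closed G ->
    (forall i, (i < n)%N -> exists2 y, G y & cnorm (v i - y) < e) ->
    exists w, [/\ msystem n b w, forall i, (i < n)%N -> G (w i) &
      forall i, (i < n)%N -> cnorm (w i - v i) <= d].
Proof.
move=> hv d0; set c : R := (3 * n%:R + 4).
have c1 : 1 <= c by have : 0 <= n%:R :> R by []; rewrite /c; lra.
have cn1 : 1 <= c ^+ n by rewrite exprn_ege1.
(* The factor 128 provides both the smallness required by [system_perturbation] and the bound
   [64 c^n s <= d / 2]. *)
pose s := Num.min 1 d / (128 * c ^+ n.+1).
have m0 : 0 < Num.min 1 d by rewrite lt_min ltr01.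
have [m1 md] : Num.min 1 d <= 1 /\ Num.min 1 d <= d by rewrite !ge_min !lexx orbT.
have cS0 : 0 < 128 * c ^+ n.+1 by rewrite mulr_gt0 // exprn_gt0 //; lra.
have s0 : 0 < s by rewrite divr_gt0.
have es : s * (128 * c ^+ n.+1) = Num.min 1 d by rewrite divfK // gt_eqF.
have cn0 : 0 < c ^+ n by lra.
have es' : 128 * (c ^+ n * s) <= Num.min 1 d.
  rewrite -es exprS; have : 0 <= c ^+ n * s by rewrite mulr_ge0 ?ltW.
  by move: c1; clear; nra.
have s1 : 128 * s <= Num.min 1 d by have := es'; have := cn1; have := s0; clear; nra.
exists (s ^+ 2 / 4); first by rewrite divr_gt0 // exprn_gt0.
move=> G hG cG hy.
have /choice[y {}hy] : forall i, exists y : sub_cstar hG cG, (i < n)%N -> cnorm (v i - sub_val y) < s ^+ 2 / 4.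
  move=> i; have [ik|_] := boolP (i < n)%N; last by exists 0.
  by have [y Gy hi] := hy i ik; exists (sub_mk hG cG Gy).
have sv := sub_val_hom hG cG.
have ssq : s ^+ 2 <= s by rewrite expr2 ler_piMl ?ltW //; lra.
have s20 : 0 < s ^+ 2 by rewrite exprn_gt0.
have [||||w [hw nw]] := @system_perturbation R (sub_cstar hG cG) n b y s => //.
- by have [] := hv.
- by rewrite -/c -mulrA; have := es; clear -m1; lra.
- move=> i j ik jk; rewrite -sub_val_norm (homB sv) (homM sv) (homS sv).
  have -> : sub_val (gram b y i j) = gram b (fun k => sub_val (y k)) i j.
    by rewrite /gram; case: eqP => // _; rewrite (hom0 sv).
  set Y := fun k => sub_val (y k); have hY k : (k < n)%N -> cnorm (v k - Y k) < s ^+ 2 / 4 by exact: hy.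
  have vk k : (k < n)%N -> cnorm (v k) <= 1 by exact: (mnorm_le1 hv).
  have Yk k : (k < n)%N -> cnorm (Y k) <= 5 / 4.
    by move=> kn; have := cnorm_le (Y k) (v k); rewrite cnormC; have := hY k kn; have := vk k kn; lra.
  have -> : cmul (cstar (Y i)) (Y j) - gram b Y i j =
     (gram b v i j - gram b Y i j) - (cmul (cstar (v i - Y i)) (Y j) + cmul (cstar (v i)) (v j - Y j)).
    by rewrite -(proj2 hv) //; cring.
  have hg : cnorm (gram b v i j - gram b Y i j) <= s ^+ 2 / 4.
    rewrite /gram; case: eqP => _; last by rewrite subrr cnorm0; lra.
    by apply: ltW; apply: hY; have [bb _] := hv; have [] := bb i ik.
  have h1 := cnormB (gram b v i j - gram b Y i j) (cmul (cstar (v i - Y i)) (Y j) + cmul (cstar (v i)) (v j - Y j)).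
  have h2 := cnormD (cmul (cstar (v i - Y i)) (Y j)) (cmul (cstar (v i)) (v j - Y j)).
  have h3 := cnormM_le (cstar (v i - Y i)) (Y j); have h4 := cnormM_le (cstar (v i)) (v j - Y j).
  rewrite !cnormS in h3 h4.
  have q1 : cnorm (v i - Y i) * cnorm (Y j) <= s ^+ 2 / 4 * (5 / 4).
    by apply: ler_pM; rewrite ?cnorm_ge0 ?Yk // ltW // hY.
  have q2 : cnorm (v i) * cnorm (v j - Y j) <= 1 * (s ^+ 2 / 4).
    by apply: ler_pM; rewrite ?cnorm_ge0 ?vk // ltW // hY.
  lra.
exists (fun i => sub_val (w i)); split=> [|i _|i ik]; first exact: (msystem_hom sv hw).
  exact: sub_valP.
have h1 := nw i ik; rewrite -sub_val_norm (homB sv) -/c in h1.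
have h2 := cnorm_tri (sub_val (y i)) (sub_val (w i)) (v i).
rewrite (cnormC (sub_val (y i)) (v i)) in h2; have h3 := hy i ik.
have h4 : 64 * c ^+ n * s <= d / 2 by have := es'; rewrite -mulrA; lra.
have h5 : s ^+ 2 / 4 <= d / 2 by lra.
lra.
Qed.

(** A fine system [g] whose span nearly contains the [v i] has an exact copy [w] of the old system
    in its span. Conjugating [g] by the unitary that carries [w] to [v] nests the spans, and it
    moves elements of norm at most [M] by less than [e / 2]. *)
Lemma nest_step n b (v : nat -> A) xs (e : R) : msystem n b v -> 0 < e ->
  (forall (ys : seq A) d, 0 < d -> exists n b v, msystem n b v /\ fits n b v ys d) ->
  exists n' b' v', [/\ msystem n' b' v', mspan n b v `<=` mspan n' b' v' & fits n' b' v' xs e].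
Proof.
move=> hv e0 loc; have [M [M1 hM]] : exists M : R, 1 <= M /\ forall x, x \in xs -> cnorm x + 1 <= M.
  elim: xs => [|x xs [M [M1 IH]]]; first by exists 1.
  exists (M + cnorm x); have := cnorm_ge0 x => h; split; first lra.
  by move=> y; rewrite inE => /orP[/eqP ->|/IH]; lra.
pose m := Num.min 1 (e / M); have M0 : 0 < M by lra.
have m0 : 0 < m by rewrite lt_min ltr01 divr_gt0.
have m1 : m <= 1 by rewrite ge_min lexx.
have mM : m * M <= e by rewrite -ler_pdivlMr // ge_min lexx orbT.
pose d := m / (96 * n.+1%:R); have d0 : 0 < d by rewrite divr_gt0 // mulr_gt0.
have ed : 96 * n.+1%:R * d = m by rewrite mulrC divfK // gt_eqF // mulr_gt0.
have nd : 96 * n%:R * d <= m by rewrite -ed -natr1; have := d0; clear; lra.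
have [d' d'0 happ] := approximate_system hv d0.
pose dd := Num.min d' (Num.min 1 (e / 2)).
have dd0 : 0 < dd by rewrite !lt_min d'0 ltr01 divr_gt0.
have [l1 [l2 l3]] : dd <= d' /\ dd <= 1 /\ dd <= e / 2 by rewrite /dd !ge_min !lexx !orbT.
have [n1 [b1 [g [hg fg]]]] := loc ([seq v i | i <- iota 0 n] ++ xs) dd dd0.
have [|w [hw Gw wv]] := happ _ (mspan_sub hg) (mspan_closed hg).
  move=> i ik; have [|y Gy hy] := fg (v i); last by exists y => //; lra.
  by rewrite mem_cat map_f // mem_iota.
have [|t [ut nt nt' ct]] := @close_systems R A n b v w d hv hw wv; first lra.
have ht := uconj_hom ut; exists n1, b1, (uconj t \o g); split.
- exact: (msystem_hom ht).
- have hs := msystem_hom ht hg.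
  move=> x [c ->]; apply: mspan_sum => i _; rewrite big_mkcond; apply: mspan_sum => j _.
  case: eqP => bij; last exact: mspan0.
  apply: mspanZ; rewrite -(ct i j) //; apply: (mspan_hom ht).
  by apply: (subM (mspan_sub hg)); [|apply: (subS (mspan_sub hg))]; exact: Gw.
- move=> x hx; have [|y Gy hy] := fg x; first by rewrite mem_cat hx orbT.
  exists (uconj t y); first exact: (mspan_hom ht).
  have h1 := cnorm_tri y x (uconj t y); have t1 : cnorm t <= 1 by lra.
  have h2 := uconj_near y t1.
  rewrite (cnormC y) in h1.
  have h3 : cnorm y <= M.
    by have := cnorm_le y x; rewrite cnormC; have := hM x hx; lra.
  have h4 : 3 * cnorm t * cnorm y <= 45 / 96 * m * M.
    apply: ler_pM; rewrite ?mulr_ge0 ?cnorm_ge0 //; clear -nt nd; lra.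
  have : 45 / 96 * m * M < e / 2 by rewrite -mulrA; clear -mM e0; lra.
  clear -h1 h2 h4 hy l3; lra.
Qed.

(** [nest_step] is iterated; step [k] treats the first [k + 1] points of the dense sequence with
    precision [halves R k], so each point is approximated arbitrarily well. *)
Theorem local_AF (d : nat -> A) :
  (forall x (e : R), 0 < e -> exists k, cnorm (x - d k) < e) ->
  (forall (ys : seq A) (e : R), 0 < e -> exists n b v, msystem n b v /\ fits n b v ys e) -> AF A.
Proof.
move=> dd loc.
pose T := {s : nat * (nat -> nat) * (nat -> A) | msystem s.1.1 s.1.2 s.2}.
pose sp (s : T) := mspan (sval s).1.1 (sval s).1.2 (sval s).2.
have step k (s : T) : exists s' : T, sp s `<=` sp s' /\
    fits (sval s').1.1 (sval s').1.2 (sval s').2 [seq d i | i <- iota 0 k.+1] (halves R k).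
  have [n [b [v [hv sub fit]]]] := nest_step [seq d i | i <- iota 0 k.+1] (svalP s) (halves_gt0 R k) loc.
  by exists (exist _ (n, b, v) hv).
have /choice[nx hnx] : forall ks : nat * T, exists s' : T, sp ks.2 `<=` sp s' /\
    fits (sval s').1.1 (sval s').1.2 (sval s').2 [seq d i | i <- iota 0 ks.1.+1] (halves R ks.1).
  by case=> k s; exact: step.
have s0 : T by exists (0%N, id, fun=> 0); split.
pose sq := fix sq k := if k is k'.+1 then nx (k', sq k') else s0.
have sqS k : sq k.+1 = nx (k, sq k) by [].
apply: (@nested_AF R A (fun k => (sval (sq k)).1.1) (fun k => (sval (sq k)).1.2) (fun k => (sval (sq k)).2)).
- by move=> k; exact: (svalP (sq k)).
- by move=> k; rewrite sqS; have [] := hnx (k, sq k).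
- move=> x e e0; have [|k hk] := dd x (e / 2); first by rewrite divr_gt0.
  have [|N hN] := @halves_small R (e / 2); first by rewrite divr_gt0.
  have [_ fit] := hnx (maxn N k, sq (maxn N k)).
  have [|y Sy hy] := fit (d k); first by rewrite map_f // mem_iota /= add0n ltnS leq_maxr.
  exists (maxn N k).+1, y; first by rewrite sqS.
  have := hN _ (leq_maxl N k); have := cnorm_tri (d k) x y; rewrite /= in hy; lra.
Qed.
End Local.

(** * Generated points *)

Definition evt (P : nat -> Prop) := exists N, forall n, (N <= n)%N -> P n.

Lemma evtT (P : nat -> Prop) : (forall n, P n) -> evt P.
Proof. by exists 0%N. Qed.
Lemma evtI (P Q S : nat -> Prop) : (forall n, P n -> Q n -> S n) -> evt P -> evt Q -> evt S.
Proof.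
move=> h [N hN] [M hM]; exists (maxn N M) => n; rewrite geq_max => /andP[? ?].
by apply: h; [apply: hN|apply: hM].
Qed.
Lemma evtW (P Q : nat -> Prop) : (forall n, P n -> Q n) -> evt P -> evt Q.
Proof. by move=> h [N hN]; exists N => n /hN /h. Qed.
Lemma evt_ex (P : nat -> Prop) : evt P -> exists n, P n.
Proof. by move=> [N hN]; exists N; exact: hN. Qed.
Lemma evt_all (m : nat) (P : nat -> nat -> Prop) :
  (forall i, (i < m)%N -> evt (P i)) -> evt (fun n => forall i, (i < m)%N -> P i n).
Proof.
elim: m => [|m IH] h; first exact: evtT.
apply: evtI (IH _) (h m (ltnSn m)) => [n h1 h2 i|i im]; last by apply: h; exact: leqW.
by rewrite ltnS leq_eqVlt => /orP[/eqP ->|/h1].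
Qed.

Section Limits.
Variables (R : realType).

Definition slim (u : nat -> R[i]) k := forall e : R, 0 < e -> evt (fun n => cabs (u n - k) <= e).

Lemma slim_cst k : slim (fun=> k) k.
Proof. by move=> e e0; apply: evtT => n; rewrite subrr; apply/ltW; rewrite (_ : cabs 0 = 0) //; apply/eqP; rewrite cabs_eq0. Qed.

Variable A : cstarType R.
Implicit Types (u v : nat -> A) (x y : A).

Definition clim u x := forall e : R, 0 < e -> evt (fun n => cnorm (u n - x) <= e).

Lemma clim_cst x : clim (fun=> x) x.
Proof. by move=> e e0; apply: evtT => n; rewrite subrr cnorm0 ltW. Qed.

Lemma clim_halves u x : (forall n, cnorm (u n - x) <= halves R n) -> clim u x.
Proof.
move=> h e e0; have [N hN] := halves_small e0; exists N => n /hN; exact: le_trans (h n).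
Qed.

Lemma climD u v x y : clim u x -> clim v y -> clim (fun n => u n + v n) (x + y).
Proof.
move=> ux vy e e0; have e2 : 0 < e / 2 by rewrite divr_gt0.
apply: evtI (ux _ e2) (vy _ e2) => n h1 h2.
by rewrite opprD addrACA; apply: le_trans (cnormD _ _) _; lra.
Qed.

Lemma climN u x : clim u x -> clim (fun n => - u n) (- x).
Proof. by move=> ux e /ux; apply: evtW => n; rewrite -opprD cnormN. Qed.

Lemma climB u v x y : clim u x -> clim v y -> clim (fun n => u n - v n) (x - y).
Proof. by move=> ux vy; apply: climD => //; exact: climN. Qed.

Lemma climS u x : clim u x -> clim (fun n => cstar (u n)) (cstar x).
Proof. by move=> ux e /ux; apply: evtW => n; rewrite -cstarB cnormS. Qed.

Lemma climM u v x y : clim u x -> clim v y -> clim (fun n => cmul (u n) (v n)) (cmul x y).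
Proof.
move=> ux vy e e0; have nx := cnorm_ge0 x; have ny := cnorm_ge0 y.
pose d := Num.min 1 (e / (cnorm x + cnorm y + 1)).
have d0 : 0 < d by rewrite lt_min ltr01 divr_gt0 //; lra.
have d1 : d <= 1 by rewrite ge_min lexx.
have de : d * (cnorm x + cnorm y + 1) <= e by rewrite -ler_pdivlMr ?ge_min ?lexx ?orbT //; lra.
apply: evtI (ux _ d0) (vy _ d0) => n h1 h2.
have -> : cmul (u n) (v n) - cmul x y =
  cmul (u n - x) (v n - y) + (cmul (u n - x) y + cmul x (v n - y)) by cring.
apply: le_trans (cnormD _ _) _; have := cnormD (cmul (u n - x) y) (cmul x (v n - y)).
have := cnormM_le (u n - x) (v n - y); have := cnormM_le (u n - x) y; have := cnormM_le x (v n - y).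
have q1 : cnorm (u n - x) * cnorm (v n - y) <= d * 1 by rewrite ler_pM ?cnorm_ge0 //; lra.
have q2 : cnorm (u n - x) * cnorm y <= d * cnorm y by rewrite ler_wpM2r.
have q3 : cnorm x * cnorm (v n - y) <= cnorm x * d by rewrite ler_wpM2l.
lra.
Qed.

Lemma climZ (k : nat -> R[i]) l u x : slim k l -> clim u x -> clim (fun n => k n *: u n) (l *: x).
Proof.
move=> kl ux e e0; have nx := cnorm_ge0 x; have nl := cabs_ge0 l.
pose d := Num.min 1 (e / (cnorm x + cabs l + 1)).
have d0 : 0 < d by rewrite lt_min ltr01 divr_gt0 //; lra.
have d1 : d <= 1 by rewrite ge_min lexx.
have de : d * (cnorm x + cabs l + 1) <= e by rewrite -ler_pdivlMr ?ge_min ?lexx ?orbT //; lra.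
apply: evtI (kl _ d0) (ux _ d0) => n h1 h2.
have -> : k n *: u n - l *: x = (k n - l) *: (u n - x) + ((k n - l) *: x + l *: (u n - x)).
  by rewrite !scalerBl !scalerBr; cring.
apply: le_trans (cnormD _ _) _; have := cnormD ((k n - l) *: x) (l *: (u n - x)).
rewrite !cnormZ.
have q1 : cabs (k n - l) * cnorm (u n - x) <= d * 1 by rewrite ler_pM ?cnorm_ge0 ?cabs_ge0 //; lra.
have q2 : cabs (k n - l) * cnorm x <= d * cnorm x by rewrite ler_wpM2r.
have q3 : cabs l * cnorm (u n - x) <= cabs l * d by rewrite ler_wpM2l.
lra.
Qed.

Lemma clim_sum I (s : seq I) (P : pred I) (F : I -> nat -> A) (L : I -> A) :
  (forall i, P i -> clim (F i) (L i)) ->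
  clim (fun n => \sum_(i <- s | P i) F i n) (\sum_(i <- s | P i) L i).
Proof.
move=> h; elim: s => [|i s IH]; first by move=> e e0; apply: evtT => n; rewrite !big_nil subrr cnorm0 ltW.
move=> e e0; have [Pi|Pi] := boolP (P i).
  have := climD (h i Pi) IH e0; apply: evtW => n; by rewrite !big_cons Pi.
by have := IH e e0; apply: evtW => n; rewrite !big_cons (negbTE Pi).
Qed.

Lemma clim_lt u x (e : R) : clim u x -> cnorm x < e -> evt (fun n => cnorm (u n) < e).
Proof.
move=> ux xe; have [|N hN] := ux ((e - cnorm x) / 2); first by rewrite divr_gt0 // subr_gt0.
by exists N => n /hN h; have h2 := cnorm_le (u n) x; apply: (le_lt_trans h2); rewrite -ltrBrDr; apply: (le_lt_trans h); rewrite ltr_pdivrMr // ltr_pMr ?subr_gt0 // ltr1n.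
Qed.

End Limits.

Section FitsSimple.
Variables (R : realType) (A : cstarType R).

(* [z] is congruent to [e] modulo [I], hence so are its powers, which tend to 0. *)
Lemma ideal_projection (I : set A) (e c u w : A) : closed_ideal I -> projection e -> I c ->
  cnorm (cmul u (cmul c w) - e) <= 1 / 2 -> I e.
Proof.
move=> [I0 Il Ir Irr Ic] hp Icc h; have [se ee] := hp.
have ID x y : I x -> I y -> I (x + y) by move=> Ix Iy; rewrite -[x]scale1r; exact: Il.
pose z := e - cmul e (cmul (cmul u (cmul c w)) e).
have nz : cnorm z <= 1 / 2.
  have -> : z = - cmul e (cmul (cmul u (cmul c w) - e) e).
    have -> : cmul e (cmul (cmul u (cmul c w) - e) e) = cmul e (cmul (cmul u (cmul c w)) e) - cmul e (cmul e e) by cring.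
    by rewrite !ee /z; cring.
  rewrite cnormN; apply: le_trans h.
  have [_ h1] := projection_normM (cmul (cmul u (cmul c w) - e) e) hp; apply: le_trans h1 _.
  by have [] := projection_normM (cmul u (cmul c w) - e) hp.
have Iez : I (e - z) by rewrite /z opprB addrC subrK; apply: (Ir); apply: (Irr); apply: (Ir); exact: (Irr).
have ze : cmul z e = z by rewrite /z cmulBl ee -!cmulA ee.
pose zz k := iter k (cmul z) e.
have Ik k : I (e - zz k).
  elim: k => [|k IH]; first by rewrite subrr.
  have -> : e - zz k.+1 = (e - z) + cmul z (e - zz k) by rewrite cmulBr ze /zz /=; cring.
  by apply: ID => //; exact: (Ir).
have nk k : cnorm (zz k) <= halves R k.
  elim: k => [|k IH]; first by rewrite /halves expr0; exact: projection_le1.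
  rewrite halvesS /zz /=; apply: le_trans (cnormM_le _ _) _.
  have := ler_pM (cnorm_ge0 z) (cnorm_ge0 (zz k)) nz IH; rewrite /zz; lra.
have /cclosedP cI := Ic; apply: cI => d d0; have [|N hN] := @halves_small R (d / 2); first by rewrite divr_gt0.
exists (e - zz N) => //; rewrite opprB addrC subrK; have := hN N (leqnn N); have := nk N; lra.
Qed.

(** A nonzero element of the ideal is normalized to [c1] and approximated by [a] in [P] within
    [1 / (32 * 16)]. This excludes the first alternative, and the second holds for [c1] with error
    at most [3/8 + 16 * 2 / 512 < 1/2], as [ideal_projection] requires. *)
Lemma fits_simple (P : set A) :
  (forall x (e : R), 0 < e -> exists2 y, P y & cnorm (x - y) < e) ->
  (forall a (ys : seq A) (e : R), P a -> 0 < e -> exists n b v, [/\ msystem n b v, fits n b v ys e &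
     cnorm a < 1 / 2 \/ forall i, (i < n)%N -> exists u w,
     [/\ cnorm u < 16, cnorm w < 2 & cnorm (cmul u (cmul a w) - munit v i i) < 3 / 8]]) ->
  simple_cstar A.
Proof.
move=> dP cert I hI; have [I0 Il Ir Irr Ic] := hI.
have [[c [Ic0 c0]]|no] := EM (exists c, I c /\ c <> 0); last first.
  left; apply/seteqP; split=> x; last by move=> ->.
  by move=> Ix; apply: contrapT => x0; apply: no; exists x.
right; apply/seteqP; split=> // x _.
have IZ k y : I y -> I (k *: y) by move=> Iy; rewrite -[_ *: _]addr0; exact: Il.
pose c1 := ((cnorm c)^-1)%:C%C *: c; have Ic1 : I c1 by exact: IZ.
have nc : cnorm c1 = 1.
  by rewrite cnormZ cabs_real ger0_norm ?invr_ge0 ?cnorm_ge0 // mulVf // gt_eqF // cnorm_gt0.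
have [|a Pa ha] := dP c1 (1 / (32 * 16)); first by rewrite divr_gt0 // mulr_gt0.
have na : 1 / 2 < cnorm a by have := cnorm_le c1 a; lra.
have /cclosedP cI := Ic; apply: (cI) => e e0.
have [n [b [v [hv fit [h|uw]]]]] := cert a [:: x] e Pa e0; first by exfalso; clear -h na; lra.
have [|y Sy hy] := fit x; first by rewrite mem_head.
exists y => //; have [k ->] := Sy.
have Isum (T : Type) (s : seq T) (Q : pred T) F : (forall i, Q i -> I (F i)) -> I (\sum_(i <- s | Q i) F i).
  by move=> h; elim/big_ind: _ => // u w Iu Iw; rewrite -[u]scale1r; exact: Il.
apply: (Isum) => i _; apply: (Isum) => j _; apply: (IZ).
have [u [w [nu nw huw]]] := uw i (ltn_ord i).
have Ie : I (munit v i i).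
  apply: (@ideal_projection I _ c1 u w hI (munit_projection hv (ltn_ord i)) Ic1).
  have -> : cmul u (cmul c1 w) - munit v i i = cmul u (cmul (c1 - a) w) + (cmul u (cmul a w) - munit v i i) by cring.
  apply: le_trans (cnormD _ _) _; have := cnormM_le u (cmul (c1 - a) w); have := cnormM_le (c1 - a) w.
  have q1 : cnorm (c1 - a) * cnorm w <= (1 / (32 * 16)) * 2 by rewrite ler_pM ?cnorm_ge0 // ltW.
  move=> h1; have q2 : cnorm u * cnorm (cmul (c1 - a) w) <= 16 * ((1 / (32 * 16)) * 2).
    by rewrite ler_pM ?cnorm_ge0 ?(le_trans h1) // ltW.
  lra.
suff -> : munit v i j = cmul (munit v i i) (munit v i j) by exact: (Irr).
have -> : cmul (munit v i i) (munit v i j) = cmul (cmul (v i) (cmul (cstar (v i)) (v i))) (cstar (v j)).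
  by rewrite /munit; cring.
by rewrite (proj2 hv) // /gram eqxx (mv_block hv).
Qed.
End FitsSimple.

(** * Polynomials over the Gaussian rationals and their values *)

Definition qmul (z w : rat * rat) : rat * rat :=
  (z.1 * w.1 - z.2 * w.2, z.1 * w.2 + z.2 * w.1).
Definition qconj (z : rat * rat) : rat * rat := (z.1, - z.2).
Definition pmul : star_poly -> star_poly -> star_poly := gpmul qmul.
Definition pstar : star_poly -> star_poly := gpstar qconj.
Definition pscale (z : rat * rat) (p : star_poly) : star_poly := [seq (qmul z m.1, m.2) | m <- p].
Definition psub (p q : star_poly) : star_poly := p ++ pscale (-1, 0) q.

Section GaussianRationals.
Variable R : realType.
Local Notation gauss := (@gaussian_rat R).

Lemma gaussD z w : gauss (z + w) = gauss z + gauss w.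
Proof. by apply/eqP; rewrite eq_complex /= !rmorphD !eqxx. Qed.
Lemma gaussM z w : gauss (qmul z w) = gauss z * gauss w.
Proof. by apply/eqP; rewrite eq_complex /= rmorphB rmorphD !rmorphM !eqxx. Qed.
Lemma gauss_conj z : gauss (qconj z) = (gauss z)^*%C.
Proof. by apply/eqP; rewrite eq_complex /= rmorphN !eqxx. Qed.
Lemma gaussN1 : gauss (-1, 0) = -1.
Proof. by apply/eqP; rewrite eq_complex /= rmorphN rmorph1 rmorph0 oppr0 !eqxx. Qed.

Lemma rat_near (x e : R) : 0 < e -> exists q : rat, `|ratr q - x| < e.
Proof.
move=> e0; have [|q] := @rat_in_itvoo R (x - e) (x + e); first by lra.
by rewrite in_itv /= => /andP[h1 h2]; exists q; rewrite ltr_norml; apply/andP; split; lra.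
Qed.

Lemma gauss_near (k : R[i]) e : 0 < e -> exists z, cabs (gauss z - k) < e.
Proof.
move=> e0; have e2 : 0 < e / 2 by rewrite divr_gt0.
have [p hp] := rat_near (complex.Re k) e2; have [q hq] := rat_near (complex.Im k) e2.
exists (p, q); apply: le_lt_trans (cabs_le _) _; case: k hp hq => a b /= hp hq; lra.
Qed.

Lemma gauss_lim (k : R[i]) : exists z, slim (fun n => gauss (z n)) k.
Proof.
have /choice[z hz] : forall n, exists z, cabs (gauss z - k) < halves R n.
  by move=> n; exact: gauss_near (halves_gt0 R n).
exists z => e e0; have [N hN] := halves_small e0; exists N => n /hN; apply: le_trans; exact: ltW.
Qed.

Variables (A : cstarType R) (a : nat -> A).
Local Notation G := (generated_point a).
Let phi (c : rat * rat) (x : A) := gauss c *: x.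

Lemma gen_phi p : G p = gpeval phi a p. Proof. by []. Qed.
Let phiD c d x : phi (c + d) x = phi c x + phi d x.
Proof. by rewrite /phi gaussD scalerDl. Qed.
Let phiM c d x y : phi (qmul c d) (cmul x y) = cmul (phi c x) (phi d y).
Proof. by rewrite /phi gaussM cmulZl cmulZr scalerA. Qed.
Let phiS c x : phi (qconj c) (cstar x) = cstar (phi c x).
Proof. by rewrite /phi gauss_conj cstarZ. Qed.

Lemma genD p q : G (p ++ q) = G p + G q.
Proof. by rewrite gen_phi gpeval_cat. Qed.
Lemma genM p q : G (pmul p q) = cmul (G p) (G q).
Proof. by rewrite gen_phi (gpeval_mul a phiM). Qed.
Lemma genS p : G (pstar p) = cstar (G p).
Proof. by rewrite gen_phi (gpeval_star a phiS). Qed.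
Lemma genZ z p : G (pscale z p) = gauss z *: G p.
Proof.
by rewrite /generated_point big_map scaler_sumr; apply: eq_bigr => m _; rewrite gaussM scalerA.
Qed.
Lemma genB p q : G (psub p q) = G p - G q.
Proof. by rewrite genD genZ gaussN1 scaleN1r. Qed.
Lemma gen_zero p : gpzero p -> G p = 0.
Proof. by rewrite gen_phi; apply: gpeval_zero; exact: phiD. Qed.
Lemma gen_var i : G [:: ((1, 0), ((i, false), [::]))] = a i.
Proof.
rewrite /generated_point big_seq1 /= /eval_word /=.
have -> : gauss (1, 0) = 1 by apply/eqP; rewrite eq_complex /= rmorph1 rmorph0 !eqxx.
by rewrite scale1r.
Qed.

(** The limits of generated points form a star-subalgebra, complex scalars being limits of Gaussian
    rationals; it contains the special points and hence all that they generate. *)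
Lemma gen_dense : presentation a -> forall x, exists p, clim (fun n => G (p n)) x.
Proof.
move=> /cdenseP pa; pose T := [set x | exists p, clim (fun n => G (p n)) x].
have hT : star_subalgebra T.
  split=> [|k x y [p hp] [q hq]|x y [p hp] [q hq]|x [p hp]].
  - by exists (fun=> [::]); rewrite /generated_point big_nil; exact: clim_cst.
  - have [z hz] := gauss_lim k; exists (fun n => pscale (z n) (p n) ++ q n).
    have := climD (climZ hz hp) hq; by congr clim; apply/funext => n; rewrite genD genZ.
  - exists (fun n => pmul (p n) (q n)).
    by have := climM hp hq; congr clim; apply/funext => n; rewrite genM.
  - by exists (fun n => pstar (p n)); have := climS hp; congr clim; apply/funext => n; rewrite genS.
have gT : generated_star_subalgebra (range a) `<=` T.
  move=> x; apply; split=> // _ [i _ <-].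
  by exists (fun=> [:: ((1, 0), ((i, false), [::]))]); rewrite gen_var; exact: clim_cst.
move=> x; have /choice[p hp] : forall n, exists p, cnorm (G p - x) <= halves R n.
  move=> n; have h0 := halves_gt0 R n.
  have [|y /gT[p hp] hy] := pa x (halves R n / 2); first by rewrite divr_gt0.
  have [|N hN] := hp (halves R n / 2); first by rewrite divr_gt0.
  by exists (p N); have := hN N (leqnn N); have := cnorm_tri y (G (p N)) x; rewrite (cnormC y x); lra.
by exists p; exact: clim_halves.
Qed.

Lemma gen_near : presentation a -> forall x e, 0 < e -> exists p, cnorm (x - G p) < e.
Proof.
move=> /gen_dense h x e e0; have [p hp] := h x.
have [|N hN] := hp (e / 2); first by rewrite divr_gt0.
by exists (p N); rewrite cnormC; have := hN N (leqnn N); lra.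
Qed.

Lemma gen_in_subalgebra p : generated_star_subalgebra (range a) (G p).
Proof.
move=> S [hS aS]; rewrite /generated_point; apply: (sub_sum hS) => m _; apply: (subZ hS).
have hl l : S (eval_letter a l).
  by rewrite /eval_letter; case: ifP => _; [apply: (subS hS)|]; apply: aS; exists l.1.
rewrite /eval_word; elim/last_ind: (m.2.2) => [|s l IH] //=.
by rewrite -cats1 foldl_cat; exact: (subM hS).
Qed.

Lemma near_presentation : (forall x e, 0 < e -> exists p, cnorm (x - G p) < e) -> presentation a.
Proof.
move=> h; apply/cdenseP => x e e0; have [p hp] := h x e e0; exists (G p) => //.
exact: gen_in_subalgebra.
Qed.
End GaussianRationals.

(** * Certificates *)

Definition qn (m d : nat) : rat := fracq (Posz m, Posz d).

Lemma ratr_qn (R : realType) m d : (0 < d)%N -> ratr (qn m d) = m%:R / d%:R :> R.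
Proof. by move=> d0; rewrite /qn fracqE /= rmorphM /= fmorphV /= !ratr_nat. Qed.

(* An approximate system [v] with block map [b], coefficients of approximants
   in its span, elements [u], [w] as in [simple_fits], a bound [L] on the
   coefficients, a precision [D] and a flag for small norm. *)
Definition cert : Type :=
  ((nat * seq nat * seq star_poly) *
   (seq (seq ((rat * rat) * (nat * nat))) * (seq star_poly * seq star_poly)) *
   (nat * nat * bool))%type.

Section Cert.
Variables (a : star_poly) (bs : seq star_poly) (k : nat) (c : cert).
Definition c_n := c.1.1.1.1.
Definition c_b i := nth 0%N c.1.1.1.2 i.
Definition c_v i := nth [::] c.1.1.2 i.
Definition c_s l := nth [::] c.1.2.1 l.
Definition c_u i := nth [::] c.1.2.2.1 i.
Definition c_w i := nth [::] c.1.2.2.2 i.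
Definition c_L := c.2.1.1.
Definition c_D := c.2.1.2.
Definition c_flag := c.2.2.

(* The last condition makes the error incurred in [system_perturbation] at most
   1 / (96 (L + 1)^2 (k + 1)). *)
Definition cert_ok : bool :=
  [&& all (fun i => (c_b i < c_n)%N && (c_b (c_b i) == c_b i)) (iota 0 c_n),
      all (fun cs : seq ((rat * rat) * (nat * nat)) => (size cs <= c_L)%N &&
        all (fun t : (rat * rat) * (nat * nat) =>
          [&& (t.2.1 < c_n)%N, (t.2.2 < c_n)%N, c_b t.2.1 == c_b t.2.2,
              t.1.1 <= qn c_L 1, - t.1.1 <= qn c_L 1, t.1.2 <= qn c_L 1 & - t.1.2 <= qn c_L 1]) cs)
        c.1.2.1 &
      (96 * 16 * c_L.+1 ^ 2 * k.+1 * (3 * c_n + 4) ^ c_n.+1 <= c_D)%N].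

Definition c_gram i j := psub (pmul (pstar (c_v i)) (c_v j)) (if i == j then c_v (c_b i) else [::]).
Definition c_comb l := flatten [seq pscale t.1 (pmul (c_v t.2.1) (pstar (c_v t.2.2))) | t <- c_s l].
Definition c_full i := psub (pmul (c_u i) (pmul a (c_w i))) (pmul (c_v i) (pstar (c_v i))).

Definition c_units i : seq (star_poly * rat) :=
  [:: (c_u i, qn 16 1); (c_w i, qn 2 1); (c_full i, qn 1 4)].

Definition cert_reqs : seq (star_poly * rat) :=
  flatten [seq [seq (c_gram i j, qn 1 (c_D * c_D)) | j <- iota 0 c_n] | i <- iota 0 c_n] ++
  ([seq (psub (nth [::] bs l) (c_comb l), qn 1 k.+1) | l <- iota 0 (size bs)] ++
   (if c_flag then [:: (a, qn 1 2)] else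
    flatten [seq c_units i | i <- iota 0 c_n])).

Lemma cert_reqsP (Q : star_poly -> rat -> Prop) :
  (forall r, r \in cert_reqs -> Q r.1 r.2) <->
  [/\ forall i j, (i < c_n)%N -> (j < c_n)%N -> Q (c_gram i j) (qn 1 (c_D * c_D)),
      forall l, (l < size bs)%N -> Q (psub (nth [::] bs l) (c_comb l)) (qn 1 k.+1) &
      if c_flag then Q a (qn 1 2) else forall i, (i < c_n)%N ->
        [/\ Q (c_u i) (qn 16 1), Q (c_w i) (qn 2 1) & Q (c_full i) (qn 1 4)]].
Proof.
split=> [h|[h1 h2 h3] r].
  split=> [i j ik jk|l lk|].
  - apply: (h (_, _)); rewrite mem_cat; apply/orP; left; apply/flatten_mapP; exists i.
      by rewrite mem_iota.
    by apply/mapP; exists j => //; rewrite mem_iota.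
  - apply: (h (_, _)); rewrite !mem_cat; apply/orP; right; apply/orP; left.
    by apply/mapP; exists l => //; rewrite mem_iota.
  - rewrite /cert_reqs in h; case: c_flag h => h.
      by apply: (h (_, _)); rewrite !mem_cat mem_head !orbT.
    have hi i r : (i < c_n)%N -> r \in c_units i -> Q r.1 r.2.
      move=> ik ri; apply: h; rewrite !mem_cat; do 2 (apply/orP; right).
      by apply/flatten_mapP; exists i; rewrite ?mem_iota.
    by move=> i ik; split; apply: (hi i (_, _) ik); rewrite !inE eqxx ?orbT.
rewrite !mem_cat => /or3P[/flatten_mapP[i ik /mapP[j jk ->]]|/mapP[l lk ->]|].
- by apply: h1; [move: ik|move: jk]; rewrite mem_iota.
- by apply: h2; move: lk; rewrite mem_iota.
- case: c_flag h3 => h3; first by rewrite inE => /eqP ->.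
  move=> hr; have [i ik ri] := flatten_mapP hr; rewrite mem_iota add0n /= in ik.
  move: ri.
  by have [q1 q2 q3] := h3 i ik; rewrite !inE => /or3P[] /eqP ->.
Qed.
End Cert.

Section Certificates.
Variables (R : realType) (A : cstarType R) (a : nat -> A).
Local Notation G := (generated_point a).
Local Notation gauss := (@gaussian_rat R).

Definition certified p bs k c := cert_ok k c /\
  forall r, r \in cert_reqs p bs k c -> cnorm (G r.1) < ratr r.2.

Lemma cabs_gauss (z : rat * rat) (L : nat) : z.1 <= qn L 1 -> - z.1 <= qn L 1 ->
  z.2 <= qn L 1 -> - z.2 <= qn L 1 -> cabs (gauss z) <= 2 * L%:R.
Proof.
have H q : q <= qn L 1 -> - q <= qn L 1 -> `|ratr q : R| <= L%:R.
  move=> h1 h2; rewrite ler_norml -[L%:R]divr1 -(ratr_qn R L (ltn0Sn 0)) -rmorphN !ler_rat /=.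
  by rewrite h1 andbT lerNl.
move=> h1 h2 h3 h4; apply: le_trans (cabs_le _) _ => /=.
by have := H _ h1 h2; have := H _ h3 h4; lra.
Qed.

(** With [s = 1 / D] the exact system is within [eta = 64 (3 n + 4)^n s] of the approximate one.
    Matrix units move by at most [3 eta], and combinations of at most [L] terms with coefficients
    bounded by [2 L] by at most [6 (L + 1)^2 eta], which is below half of [1 / (k + 1)]. Hence
    [1 / (k + 1)] becomes [2 / (k + 1)], and 1/4 becomes 3/8. *)
Lemma certified_system p bs k c : certified p bs k c ->
  exists n b v, [/\ msystem n b v, fits n b v [seq G x | x <- bs] (2 / k.+1%:R) &
    cnorm (G p) < 1 / 2 \/ forall i, (i < n)%N -> exists u w,
     [/\ cnorm u < 16, cnorm w < 2 & cnorm (cmul u (cmul (G p) w) - munit v i i) < 3 / 8]].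
Proof.
move=> [/and3P[/allP okb /allP oks okD] hr].
have [r1 r2 r3] := (@cert_reqsP p bs k c (fun q x => cnorm (G q) < ratr x)).1 hr.
set n := c_n c in okb oks okD r1 r2 r3; set b := c_b c in okb oks r1 r2 r3.
set L := c_L c in oks okD; set D := c_D c in okD r1.
pose V i := G (c_v c i).
have bb : block_map n b.
  by move=> i ik; have := okb i; rewrite mem_iota => /(_ ik) /andP[-> /eqP].
set X := ((3 * n%:R + 4) ^+ n.+1 : R); set Y := ((3 * n%:R + 4) ^+ n : R).
have n0 : 0 <= n%:R :> R by [].
have Y1 : 1 <= Y by rewrite exprn_ege1 //; lra.
have XY : X = (3 * n%:R + 4) * Y by rewrite /X exprS.
have X1 : 4 * Y <= X by rewrite XY; apply: ler_wpM2r; lra.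
set K : R := k.+1%:R; have K1 : 1 <= K by rewrite /K ler1n.
set M : R := (L.+1)%:R; have M1 : 1 <= M by rewrite /M ler1n.
have M0 : 0 <= M := le_trans ler01 M1.
have K0 : 0 < K := lt_le_trans ltr01 K1.
have DX : 96 * 16 * M ^+ 2 * K * X <= D%:R.
  move: okD; rewrite -(ler_nat R); apply: le_trans; rewrite !natrM !natrX natrD natrM.
  by rewrite /M /K /X lexx.
have MK1 : 1 <= M ^+ 2 * K by rewrite -[1]mulr1 ler_pM // exprn_ege1.
have MK0 : 0 < M ^+ 2 * K by lra.
have D0 : 0 < D%:R :> R.
  apply: lt_le_trans DX; have -> : 96 * 16 * M ^+ 2 * K * X = 96 * 16 * (M ^+ 2 * K) * X by ring.
  by rewrite !mulr_gt0 //; lra.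
have Dn0 : (0 < D)%N by rewrite -(ltr0n R).
pose s : R := D%:R^-1; have s0 : 0 < s by rewrite invr_gt0.
have sX : 96 * 16 * (M ^+ 2 * K) * X * s <= 1.
  by rewrite ler_pdivrMr // mul1r -!mulrA; move: DX; rewrite -!mulrA.
pose eta : R := 64 * Y * s.
have eta0 : 0 <= eta by rewrite /eta !mulr_ge0 ?ltW //; lra.
have etaM : 96 * (M ^+ 2 * K) * eta <= 1.
  apply: le_trans sX; have -> : 96 * (M ^+ 2 * K) * eta = 96 * 16 * (M ^+ 2 * K) * (4 * Y) * s by rewrite /eta; ring.
  by rewrite ler_pM2r // ler_pM2l // !mulr_gt0.
have eta1 : 96 * eta <= 1.
  by apply: le_trans etaM; rewrite -mulrA ler_pM2l // ler_peMl.
have [|i j ik jk|w [hw wV]] := @system_perturbation R A n b V s bb s0.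
- apply: le_trans sX; rewrite ler_pM2r // -/X ler_pM2r; last by lra.
  by rewrite -[16]mulr1 ler_pM //; lra.
- have := r1 i j ik jk; rewrite ratr_qn ?muln_gt0 ?Dn0 // natrM mul1r invfM -expr2 -/s.
  rewrite /c_gram genB genM genS /gram; case: eqP => _ /ltW //.
  by rewrite [G [::]]big_nil.
rewrite -/Y -/eta in wV.
have w1 i : (i < n)%N -> cnorm (w i) <= 1 by exact: (mnorm_le1 hw).
have mu i j : (i < n)%N -> (j < n)%N -> cnorm (munit V i j - munit w i j) <= 3 * eta.
  move=> ik jk; have -> : munit V i j - munit w i j = cmul (w i) (cstar (V j - w j)) -
    (cmul (w i - V i) (cstar (V j - w j)) + cmul (w i - V i) (cstar (w j))) by rewrite /munit; cring.
  have h1 := wV i ik; have h2 := wV j jk; rewrite cnormC in h2.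
  have := cnormB (cmul (w i) (cstar (V j - w j))) (cmul (w i - V i) (cstar (V j - w j)) + cmul (w i - V i) (cstar (w j))).
  have := cnormD (cmul (w i - V i) (cstar (V j - w j))) (cmul (w i - V i) (cstar (w j))).
  have := cnormM_le (w i) (cstar (V j - w j)); have := cnormM_le (w i - V i) (cstar (V j - w j)).
  have := cnormM_le (w i - V i) (cstar (w j)); rewrite !cnormS.
  have q1 : cnorm (w i) * cnorm (V j - w j) <= 1 * eta by rewrite ler_pM ?cnorm_ge0 ?w1.
  have q2 : cnorm (w i - V i) * cnorm (V j - w j) <= eta * 1.
    by rewrite ler_pM ?cnorm_ge0 // (le_trans h2) //; lra.
  have q3 : cnorm (w i - V i) * cnorm (w j) <= eta * 1 by rewrite ler_pM ?cnorm_ge0 ?w1.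
  lra.
exists n, b, w; split=> //.
- move=> _ /mapP[x /(nthP [::])[l lk <-] ->].
  exists (\sum_(t <- c_s c l) gauss t.1 *: munit w t.2.1 t.2.2).
    rewrite big_seq; apply: mspan_sum => t ht; apply: mspanZ.
    have [lc|lc] := ltnP l (size c.1.2.1); last by move: ht; rewrite /c_s nth_default.
    have /andP[_ /allP/(_ _ ht)] := oks _ (mem_nth [::] lc).
    by case/and5P => ? ? /eqP ? _ _; exact: mspan_munit.
  have := r2 l lk; rewrite ratr_qn // mul1r genB => h.
  apply: le_lt_trans (cnorm_tri (G (c_comb c l)) _ _) _.
  have -> : G (c_comb c l) = \sum_(t <- c_s c l) gauss t.1 *: munit V t.2.1 t.2.2.
    rewrite /c_comb; elim: (c_s c l) => [|t ss IH] /=; first by rewrite [G [::]]big_nil big_nil.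
    by rewrite genD IH big_cons genZ genM genS.
  have : cnorm (\sum_(t <- c_s c l) gauss t.1 *: munit V t.2.1 t.2.2 -
    \sum_(t <- c_s c l) gauss t.1 *: munit w t.2.1 t.2.2) <= K^-1 / 2.
    rewrite -sumrB; apply: le_trans (cnorm_sum _ _ _) _.
    apply: (@le_trans _ _ (\sum_(t <- c_s c l) 6 * M * eta)).
      rewrite big_seq [leRHS]big_seq; apply: ler_sum => t ht.
      have [lc|lc] := ltnP l (size c.1.2.1); last by move: ht; rewrite /c_s nth_default.
      have /andP[_ /allP/(_ _ ht)] := oks _ (mem_nth [::] lc).
      case/and5P => t1 t2 _ t3 /and3P[t4 t5 t6].
      rewrite -scalerBr cnormZ; have -> : 6 * M * eta = (2 * M) * (3 * eta) by ring.
      apply: ler_pM; rewrite ?cabs_ge0 ?cnorm_ge0 ?mu //.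
      apply: le_trans (cabs_gauss t3 t4 t5 t6) _.
      by rewrite ler_pM2l // /M ler_nat leqnSn.
    rewrite big_const_seq count_predT iter_addr_0 -[X in X <= _]mulr_natr.
    have sz : (size (c_s c l))%:R <= M.
      rewrite /M ler_nat; have [lc|lc] := ltnP l (size c.1.2.1); last by rewrite /c_s nth_default.
      by have /andP[h1 _] := oks _ (mem_nth [::] lc); exact: leqW.
    apply: (@le_trans _ _ (6 * M * eta * M)).
      rewrite ler_wpM2l //; apply: mulr_ge0 => //; exact: mulr_ge0.
    rewrite -(ler_pM2r K0) [leRHS]mulrAC mulVf ?gt_eqF //.
    have -> : 6 * M * eta * M * K = 6 * (M ^+ 2 * K * eta) by ring.
    by move: etaM; rewrite -mulrA; clear; lra.
  move: h; rewrite -/K; have : 0 < K^-1 by rewrite invr_gt0.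
  have -> : G (c_comb c l) = \sum_(t <- c_s c l) gauss t.1 *: munit V t.2.1 t.2.2.
    rewrite /c_comb; elim: (c_s c l) => [|t ss IH] /=; first by rewrite [G [::]]big_nil big_nil.
    by rewrite genD IH big_cons genZ genM genS.
  move=> h0 h1 h2; apply: (lt_le_trans (ltr_leD h1 h2)).
  have -> : 2 / k.+1%:R = K^-1 + K^-1 by rewrite mulr_natl mulr2n.
  by rewrite lerD2l ler_pdivrMr // ler_peMr ?(ltW h0) // ler1n.
case: (c_flag c) r3 => [|r3]; first by rewrite ratr_qn //; left.
right=> i ik; have [q1 q2 q3] := r3 i ik; rewrite !ratr_qn ?divr1 // in q1 q2 q3.
exists (G (c_u c i)), (G (c_w c i)); split=> //.
rewrite /c_full genB !genM genS in q3.
apply: le_lt_trans (cnorm_tri (munit V i i) _ _) _; have := mu i i ik ik.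
move: q3 eta1; rewrite /munit; clear; lra.
Qed.

Lemma certified_simple_AF : presentation a -> (forall p bs k, exists c, certified p bs k c) ->
  simple_cstar A /\ AF A.
Proof.
move=> pa cert; have near := gen_near pa.
have loc p (ys : seq A) (e : R) : 0 < e -> exists n b v, [/\ msystem n b v, fits n b v ys e &
    cnorm (G p) < 1 / 2 \/ forall i, (i < n)%N -> exists u w,
     [/\ cnorm u < 16, cnorm w < 2 & cnorm (cmul u (cmul (G p) w) - munit v i i) < 3 / 8]].
  move=> e0; have e2 : 0 < e / 2 by rewrite divr_gt0.
  have [q hq] : exists q : seq star_poly, forall y, y \in ys -> exists2 x, x \in q & cnorm (y - G x) < e / 2.
    elim: ys => [|y ys [q hq]]; first by exists [::].
    have [x hx] := near y _ e2; exists (x :: q) => z; rewrite inE => /orP[/eqP ->|/hq[x' xq hx']].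
      by exists x; rewrite ?mem_head.
    by exists x' => //; rewrite inE xq orbT.
  have [|k hk] := @evt_ex (fun k => 2 / k.+1%:R < e / 2 :> R).
    exists (Num.bound (4 / e)) => k hk; rewrite ltr_pdivrMr // mulrC -ltr_pdivrMr //.
    have -> : 2 / (e / 2) = 4 / e by field; rewrite gt_eqF.
    apply: lt_le_trans (archi_boundP _) _; first by rewrite divr_ge0 // ltW.
    by rewrite ler_nat leqW.
  have [c hc] := cert p q k; have [n [b [v [hv fit alt]]]] := certified_system hc.
  exists n, b, v; split=> // y /hq[x xq hx]; have [|z Sz hz] := fit (G x); first by rewrite map_f.
  exists z => //; apply: le_lt_trans (cnorm_tri (G x) _ _) _.
  by have := lt_trans hz hk; move: hx; clear; lra.
split.
  apply: (@fits_simple R A (range G)) => [x e e0|_ ys e [p _ <-] e0].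
    by have [p hp] := near x e e0; exists (G p) => //; exists p.
  exact: loc.
apply: (@local_AF R A (fun k => G (odflt [::] (unpickle k)))) => [x e e0|ys e e0].
  by have [p hp] := near x e e0; exists (pickle p); rewrite pickleK.
by have [n [b [v [hv fit _]]]] := loc [::] ys e e0; exists n, b, v.
Qed.

Lemma evt_nat_ge (x : R) : evt (fun L => x <= L%:R).
Proof.
exists (Num.bound x) => L hL; apply: le_trans (ler_norm x) _; apply: ltW.
have := archi_boundP (normr_ge0 x) => h; apply: lt_le_trans h _; rewrite ler_nat.
by apply: leq_trans hL; rewrite /Num.bound normr_id.
Qed.

Lemma gen_flatten T (s : seq T) (F : T -> star_poly) :
  G (flatten [seq F t | t <- s]) = \sum_(t <- s) G (F t).
Proof.
by elim: s => [|t s IH] /=; [rewrite [G [::]]big_nil big_nil|rewrite genD IH big_cons].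
Qed.

(** All requirements are strict inequalities that hold for exact data. These data are limits of
    generated points, so each requirement holds for all large [m] in the approximating certificates
    [c m], and finitely many hold at once. *)
Lemma simple_AF_certified : presentation a -> simple_cstar A -> AF A ->
  forall p bs k, exists c, certified p bs k c.
Proof.
move=> pa simp /AF_chain[S hS] p bs k.
have k0 : 0 < k.+1%:R^-1 :> R by rewrite invr_gt0.
have [n [b [v [hv fit alt]]]] := simple_fits hS (G p) [seq G x | x <- bs] simp k0.
have bn i : (i < n)%N -> (b i < n)%N by case: hv => bb _ /bb[].
have /choice[cf hcf] : forall l, exists cf : nat -> nat -> R[i], (l < size bs)%N ->
   cnorm (G (nth [::] bs l) - \sum_(i < n) \sum_(j < n | b i == b j) cf i j *: munit v i j) < k.+1%:R^-1.
  move=> l; have [lb|_] := ltnP l (size bs); last by exists (fun _ _ => 0).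
  have [|y [cf ->] hy] := fit (G (nth [::] bs l)); last by exists cf.
  by rewrite map_f // mem_nth.
have /choice[Vp hVp] : forall i, exists q, clim (fun m => G (q m)) (v i) by move=> i; exact: gen_dense.
have /choice[Z hZ] : forall t : nat * (nat * nat), exists z, slim (fun m => gauss (z m)) (cf t.1 t.2.1 t.2.2).
  by move=> t; exact: gauss_lim.
have [flag [Up [Wp [U [W [hU [hW hflag]]]]]]] : exists (flag : bool) (Up Wp : nat -> nat -> star_poly) (U W : nat -> A),
   (forall i, clim (fun m => G (Up i m)) (U i)) /\ (forall i, clim (fun m => G (Wp i m)) (W i)) /\
   if flag then is_true (cnorm (G p) < 1 / 2) else forall i, (i < n)%N ->
     [/\ cnorm (U i) < 16, cnorm (W i) < 2 & cnorm (cmul (U i) (cmul (G p) (W i)) - munit v i i) < 1 / 4].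
  case: alt => [h|h].
    exists true, (fun _ _ => [::]), (fun _ _ => [::]), (fun=> G [::]), (fun=> G [::]).
    by split; [|split=> //] => i; exact: clim_cst.
  have /choice[UW hUW] : forall i, exists uw : A * A, (i < n)%N ->
     [/\ cnorm uw.1 < 16, cnorm uw.2 < 2 & cnorm (cmul uw.1 (cmul (G p) uw.2) - munit v i i) < 1 / 4].
    move=> i; have [ik|_] := ltnP i n; last by exists (0, 0).
    by have [u [w huw]] := h i ik; exists (u, w).
  have /choice[Up hUp] : forall i, exists q, clim (fun m => G (q m)) (UW i).1 by move=> i; exact: gen_dense.
  have /choice[Wp hWp] : forall i, exists q, clim (fun m => G (q m)) (UW i).2 by move=> i; exact: gen_dense.
  by exists false, Up, Wp, (fun i => (UW i).1), (fun i => (UW i).2).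
(* [n * n] bounds the number of terms of a combination; the slack 1 absorbs the approximation of the
   coefficients by Gaussian rationals. *)
have [L [hL LC]] : exists L : nat, (n * n <= L)%N /\ forall l, (l < size bs)%N -> forall i, (i < n)%N ->
    forall j, (j < n)%N -> cabs (cf l i j) + 1 <= L%:R.
  have h1 : evt (fun L => forall l, (l < size bs)%N -> forall i, (i < n)%N ->
    forall j, (j < n)%N -> cabs (cf l i j) + 1 <= L%:R).
    do 3 (apply: evt_all => ? _); exact: evt_nat_ge.
  by have [N hN] := h1; exists (maxn (n * n) N); split; [exact: leq_maxl|apply: hN; exact: leq_maxr].
pose D := (96 * 16 * L.+1 ^ 2 * k.+1 * (3 * n + 4) ^ n.+1)%N.
have D0 : (0 < D)%N by rewrite /D !muln_gt0 !expn_gt0 addn_gt0 /= orbT.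
have DD : (0 < D * D)%N by rewrite (muln_gt0 D D) D0.
pose pairs := [seq t <- [seq (i, j) | i <- iota 0 n, j <- iota 0 n] | b t.1 == b t.2].
pose cs m l := [seq (Z (l, t) m, t) | t <- pairs].
pose c m : cert := ((n, mkseq b n, mkseq (Vp^~ m) n), (mkseq (cs m) (size bs), (mkseq (Up^~ m) n, mkseq (Wp^~ m) n)),
   (L, D, flag)).
have ncb m i : (i < n)%N -> c_b (c m) i = b i by move=> ik; rewrite /c_b /= nth_mkseq.
have ncv m i : (i < n)%N -> c_v (c m) i = Vp i m by move=> ik; rewrite /c_v /= nth_mkseq.
have ncu m i : (i < n)%N -> c_u (c m) i = Up i m by move=> ik; rewrite /c_u /= nth_mkseq.
have ncw m i : (i < n)%N -> c_w (c m) i = Wp i m by move=> ik; rewrite /c_w /= nth_mkseq.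
have pairsP t : t \in pairs -> [/\ (t.1 < n)%N, (t.2 < n)%N & b t.1 == b t.2].
  rewrite mem_filter => /andP[bt /allpairsP[[i j] /= [h1 h2 et]]].
  by move: h1 h2 bt; rewrite et !mem_iota.
have szp : (size pairs <= L)%N.
  apply: leq_trans hL; rewrite size_filter; apply: leq_trans (count_size _ _) _.
  by rewrite size_allpairs size_iota.
have lim_comb l : (l < size bs)%N -> clim (fun m => G (c_comb (c m) l))
   (\sum_(i < n) \sum_(j < n | b i == b j) cf l i j *: munit v i j).
  move=> lb; have -> : \sum_(i < n) \sum_(j < n | b i == b j) cf l i j *: munit v i j =
     \sum_(t <- pairs) cf l t.1 t.2 *: munit v t.1 t.2.
    rewrite big_filter [RHS]big_mkcond big_allpairs.
    have io : iota 0 n = index_iota 0 n by rewrite /index_iota subn0.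
    rewrite io big_mkord; apply: eq_bigr => i _.
    by rewrite [LHS]big_mkcond big_mkord.
  have h : clim (fun m => \sum_(t <- pairs) gauss (Z (l, t) m) *: cmul (G (Vp t.1 m)) (cstar (G (Vp t.2 m))))
     (\sum_(t <- pairs) cf l t.1 t.2 *: munit v t.1 t.2).
    apply: clim_sum => t _; apply: climZ; first exact: (hZ (l, t)).
    by apply: climM; [|apply: climS]; exact: hVp.
  move=> e /h; apply: evtW => m; congr (_ <= _); congr (cnorm (_ - _)).
  rewrite /c_comb gen_flatten /c_s /= nth_mkseq // /cs big_map big_seq [RHS]big_seq.
  by apply: eq_bigr => t /pairsP[t1 t2 _]; rewrite genZ genM genS /= !ncv.
have ev_small : evt (fun m => forall l, (l < size bs)%N -> forall t, (t \in pairs) ->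
    cabs (gauss (Z (l, t) m) - cf l t.1 t.2) <= 1).
  apply: evt_all => l lb; elim: pairs {szp cs c ncb ncv ncu ncw lim_comb} pairsP => [|t s IH] ps; first by apply: evtT.
  have h1 := hZ (l, t) 1 ltr01.
  apply: evtI (IH _) h1 => [m h2 h3 t'|t' ts]; last by apply: ps; rewrite inE ts orbT.
  by rewrite inE => /orP[/eqP ->|/h2].
have ev_gram : evt (fun m => forall i, (i < n)%N -> forall j, (j < n)%N ->
    cnorm (G (c_gram (c m) i j)) < ratr (qn 1 (D * D))).
  apply: evt_all => i ik; apply: evt_all => j jk.
  have h : clim (fun m => G (c_gram (c m) i j)) (cmul (cstar (v i)) (v j) - gram b v i j).
    have h : clim (fun m => cmul (cstar (G (Vp i m))) (G (Vp j m)) - (if i == j then G (Vp (b i) m) else 0))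
        (cmul (cstar (v i)) (v j) - gram b v i j).
      apply: climB; first by apply: climM => //; apply: climS.
      by rewrite /gram; case: eqP => _; [exact: hVp|exact: clim_cst].
    move=> e /h; apply: evtW => m; congr (_ <= _); congr (cnorm (_ - _)).
    rewrite /c_gram genB genM genS ncb // !ncv ?bn //; case: (i == j) => //.
    by rewrite [G [::]]big_nil.
  apply: (clim_lt h); rewrite (proj2 hv) // subrr cnorm0 ratr_qn //.
  by rewrite divr_gt0 // ltr0n.
have ev_span : evt (fun m => forall l, (l < size bs)%N ->
    cnorm (G (psub (nth [::] bs l) (c_comb (c m) l))) < ratr (qn 1 k.+1)).
  apply: evt_all => l lb.
  have h := climB (clim_cst (G (nth [::] bs l))) (lim_comb l lb).
  have := clim_lt h (hcf l lb); apply: evtW => m; by rewrite genB ratr_qn // mul1r.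
have ev_full : evt (fun m => if flag then is_true (cnorm (G p) < ratr (qn 1 2)) else forall i, (i < n)%N ->
    [/\ cnorm (G (c_u (c m) i)) < ratr (qn 16 1), cnorm (G (c_w (c m) i)) < ratr (qn 2 1) &
     cnorm (G (c_full p (c m) i)) < ratr (qn 1 4)]).
  case: flag hflag @c ncb ncv ncu ncw lim_comb ev_gram ev_span => hflag c ncb ncv ncu ncw _ _ _.
    by apply: evtT => m; rewrite ratr_qn.
  apply: evt_all => i ik; have [q1 q2 q3] := hflag i ik.
  have e3 := clim_lt (climB (climM (hU i) (climM (clim_cst (G p)) (hW i))) (climM (hVp i) (climS (hVp i)))) q3.
  apply: (evtI _ (clim_lt (hU i) q1)) (evtI (fun m h1 h2 => conj h1 h2) (clim_lt (hW i) q2) e3) => m h1 [h2 h3].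
  by rewrite !ratr_qn // !divr1 ncu // ncw // /c_full genB !genM genS ncu // ncw // ncv.
have [m [hs [hg [hsp hf]]]] := evt_ex (evtI (fun m h1 h2 => conj h1 h2) ev_small
  (evtI (fun m h1 h2 => conj h1 h2) ev_gram (evtI (fun m h1 h2 => conj h1 h2) ev_span ev_full))).
exists (c m); split; last first.
  apply/(@cert_reqsP p bs k (c m) (fun q x => cnorm (G q) < ratr x)).
  by split=> // i j ik jk; exact: hg.
apply/and3P; split; last exact: leqnn.
- apply/allP => i; rewrite mem_iota => /andP[_ ik]; have [bb _] := hv; have [h1 h2] := bb i ik.
  by rewrite !ncb // h1 h2 eqxx.
- apply/allP => _ /mapP[l lb ->]; rewrite mem_iota /= add0n in lb; rewrite size_map szp /=.
  apply/allP => _ /mapP[t tp ->] /=; have [t1 t2 bt] := pairsP t tp.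
  rewrite t1 t2 !ncb // bt /=.
  have hc : cabs (gauss (Z (l, t) m)) <= L%:R.
    have := cabsD (gauss (Z (l, t) m) - cf l t.1 t.2) (cf l t.1 t.2); rewrite subrK.
    have := hs l lb t tp; have := LC l lb _ t1 _ t2; lra.
  have q1 (x : rat) : `|ratr x : R| <= L%:R -> x <= qn L 1 /\ - x <= qn L 1.
    rewrite ler_norml -[L%:R]divr1 -(ratr_qn R L (ltn0Sn 0)) => /andP[h1 h2].
    by rewrite -!(ler_rat R) h2 rmorphN lerNl.
  have [-> ->] := q1 _ (le_trans (Re_le_cabs (gauss (Z (l, t) m))) hc).
  by have [-> ->] := q1 _ (le_trans (Im_le_cabs (gauss (Z (l, t) m))) hc).
Qed.
End Certificates.

(** * Completion of the *-polynomials *)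

Section FormalIdentities.
Implicit Types (x y z : rat * rat) (p q r : star_poly).

Lemma pair_eq (a b c d : rat) : a = c -> b = d -> (a, b) = (c, d).
Proof. by move=> -> ->. Qed.
Lemma qmulC x y : qmul x y = qmul y x.
Proof. by apply: pair_eq; ring. Qed.
Lemma qmulA x y z : qmul x (qmul y z) = qmul (qmul x y) z.
Proof. by apply: pair_eq => /=; ring. Qed.
Lemma qmul1 x : qmul (1, 0) x = x.
Proof. by case: x => u v; apply: pair_eq => /=; ring. Qed.
Lemma qmulDl x y z : qmul (x + y) z = qmul x z + qmul y z.
Proof. by apply: pair_eq => /=; ring. Qed.
Lemma qmulDr x y z : qmul z (x + y) = qmul z x + qmul z y.
Proof. by rewrite qmulC qmulDl !(qmulC z). Qed.
Lemma qmulNl x y : qmul (- x) y = - qmul x y.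
Proof. by apply: pair_eq => /=; ring. Qed.
Lemma qmulNr x y : qmul x (- y) = - qmul x y.
Proof. by apply: pair_eq => /=; ring. Qed.
Lemma qmul0 x : qmul x 0 = 0.
Proof. by apply: pair_eq => /=; ring. Qed.
Lemma qmulN1 x : qmul (-1, 0) x = - x.
Proof. by case: x => u v; apply: pair_eq => /=; ring. Qed.
Lemma qconjK x : qconj (qconj x) = x.
Proof. by case: x => u v; apply: pair_eq => /=; ring. Qed.
Lemma qconjM x y : qconj (qmul x y) = qmul (qconj x) (qconj y).
Proof. by apply: pair_eq => /=; ring. Qed.
Lemma qmul_sum I (s : seq I) (P : pred I) (F : I -> rat * rat) z :
  qmul z (\sum_(i <- s | P i) F i) = \sum_(i <- s | P i) qmul z (F i).
Proof. by apply: big_morph; [move=> x y; exact: qmulDr|exact: qmul0]. Qed.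

Lemma wmulA (u v w : word) : wmul u (wmul v w) = wmul (wmul u v) w.
Proof. by rewrite /wmul /= -catA. Qed.
Definition wseq (w : word) := w.1 :: w.2.
Lemma wseq_inj : injective wseq. Proof. by move=> [a s] [b t] [-> ->]. Qed.
Definition lflip (l : letter) : letter := (l.1, ~~ l.2).
Lemma wseq_star w : wseq (wstar w) = rev [seq lflip l | l <- wseq w].
Proof.
rewrite /wseq /wstar; case E: (rev _) => [|l s] //=.
by have := congr1 size E; rewrite size_rev size_map.
Qed.
Lemma wseq_mul u v : wseq (wmul u v) = wseq u ++ wseq v.
Proof. by []. Qed.
Lemma wstarK w : wstar (wstar w) = w.
Proof.
apply: wseq_inj; rewrite !wseq_star map_rev revK -map_comp map_id_in // => l _.
by case: l => i b; rewrite /lflip /= negbK.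
Qed.
Lemma wstarM u v : wstar (wmul u v) = wmul (wstar v) (wstar u).
Proof. by apply: wseq_inj; rewrite wseq_mul !wseq_star wseq_mul map_cat rev_cat. Qed.

(** Polynomials are unnormalized lists, so laws such as commutativity of [++] hold only up to this
    relation. *)
Definition peq p q := forall w, gpcoef p w = gpcoef q w.

Lemma coef_cat p q w : gpcoef (p ++ q) w = gpcoef p w + gpcoef q w.
Proof. by rewrite !gpcoefE big_cat. Qed.
Lemma coef_scale z p w : gpcoef (pscale z p) w = qmul z (gpcoef p w).
Proof. by rewrite !gpcoefE big_map /= qmul_sum. Qed.
Lemma coef_sub p q w : gpcoef (psub p q) w = gpcoef p w - gpcoef q w.
Proof. by rewrite coef_cat coef_scale qmulN1. Qed.
Lemma coef_mul p q w : gpcoef (pmul p q) w =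
  \sum_(m <- p) \sum_(n <- q | wmul m.2 n.2 == w) qmul m.1 n.1.
Proof.
rewrite gpcoefE /pmul /gpmul big_flatten big_map; apply: eq_bigr => m _.
by rewrite big_map.
Qed.

Lemma peq_zero p q : peq p q -> gpzero (psub p q).
Proof. by move=> h; apply/allP => m _; rewrite coef_sub h subrr. Qed.

Lemma pscaleA z w p : pscale z (pscale w p) = pscale (qmul z w) p.
Proof. by rewrite /pscale -map_comp; apply: eq_map => m; rewrite /= qmulA. Qed.
Lemma pscale1 p : pscale (1, 0) p = p.
Proof. by rewrite /pscale map_id_in // => m _; rewrite qmul1; case: m. Qed.
Lemma pscale_cat z p q : pscale z (p ++ q) = pscale z p ++ pscale z q.
Proof. exact: map_cat. Qed.
Lemma pscaleD z w p : peq (pscale (z + w) p) (pscale z p ++ pscale w p).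
Proof. by move=> u; rewrite coef_cat !coef_scale qmulDl. Qed.
Lemma pmul_catl p q r : pmul (p ++ q) r = pmul p r ++ pmul q r.
Proof. by rewrite /pmul /gpmul map_cat flatten_cat. Qed.
Lemma pmul_catr p q r : peq (pmul p (q ++ r)) (pmul p q ++ pmul p r).
Proof.
by move=> w; rewrite coef_cat !coef_mul -big_split /=; apply: eq_bigr => m _; rewrite big_cat.
Qed.
Lemma pmul_scalel z p q : pmul (pscale z p) q = pscale z (pmul p q).
Proof.
rewrite /pmul /gpmul /pscale map_flatten -!map_comp; congr flatten; apply: eq_map => m /=.
by rewrite -map_comp; apply: eq_map => n /=; rewrite qmulA.
Qed.
Lemma pmul_scaler z p q : pmul p (pscale z q) = pscale z (pmul p q).
Proof.
rewrite /pmul /gpmul /pscale map_flatten -!map_comp; congr flatten; apply: eq_map => m /=.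
by rewrite -!map_comp; apply: eq_map => n /=; rewrite !qmulA (qmulC m.1).
Qed.
Lemma pmulA p q r : pmul p (pmul q r) = pmul (pmul p q) r.
Proof.
have h m s : pmul [:: m] s = [seq (qmul m.1 n.1, wmul m.2 n.2) | n <- s].
  by rewrite /pmul /gpmul /= cats0.
elim: p => [|m p IH] //.
have e0 s : pmul (m :: p) s = pmul [:: m] s ++ pmul p s := pmul_catl [:: m] p s.
rewrite !e0 pmul_catl IH; congr (_ ++ _).
elim: q {IH} => [|n q IH] //.
have hc s t : pmul [:: m] (s ++ t) = pmul [:: m] s ++ pmul [:: m] t by rewrite !h map_cat.
have e1 : pmul [:: m] (n :: q) = pmul [:: m] [:: n] ++ pmul [:: m] q := hc [:: n] q.
have e2 : pmul (n :: q) r = pmul [:: n] r ++ pmul q r := pmul_catl [:: n] q r.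
rewrite e1 e2 hc pmul_catl IH; congr (_ ++ _); rewrite [pmul [:: m] [:: n]]h /= !h -map_comp.
by apply: eq_map => l /=; rewrite qmulA wmulA.
Qed.
Lemma pstarK p : pstar (pstar p) = p.
Proof.
by rewrite /pstar /gpstar -map_comp map_id_in // => m _; rewrite /= qconjK wstarK; case: m.
Qed.
Lemma pstar_cat p q : pstar (p ++ q) = pstar p ++ pstar q.
Proof. exact: map_cat. Qed.
Lemma pstar_scale z p : pstar (pscale z p) = pscale (qconj z) (pstar p).
Proof.
by rewrite /pstar /gpstar /pscale -!map_comp; apply: eq_map => m; rewrite /= qconjM.
Qed.
Lemma pstarM p q : peq (pstar (pmul p q)) (pmul (pstar q) (pstar p)).
Proof.
move=> w; rewrite coef_mul gpcoefE /pstar /gpstar big_map big_flatten big_map /=.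
rewrite big_map; under [RHS]eq_bigr do rewrite big_map /=.
under eq_bigr do rewrite big_map /= big_mkcond.
rewrite exchange_big; apply: eq_bigr => n _; rewrite [RHS]big_mkcond; apply: eq_bigr => m _ /=.
by rewrite wstarM qconjM qmulC.
Qed.
End FormalIdentities.

Section Completion.
Variables (R : realType) (N : star_poly -> R).
Local Notation gauss := (@gaussian_rat R).
Hypothesis N_ge0 : forall p, 0 <= N p.
Hypothesis N_nil : N [::] = 0.
Hypothesis N_cat : forall p q, N (p ++ q) <= N p + N q.
Hypothesis N_scale : forall z p, N (pscale z p) <= cabs (gauss z) * N p.
Hypothesis N_mul : forall p q, N (pmul p q) <= N p * N q.
Hypothesis N_star : forall p, N p ^+ 2 <= N (pmul (pstar p) p).
Hypothesis N_eq : forall p q, gpzero (psub p q) -> N p = N q.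

Implicit Types (p q r : star_poly) (s t : nat -> star_poly).
Let Npeq p q : peq p q -> N p = N q. Proof. by move=> /peq_zero /N_eq. Qed.
Let dist p q := N (psub p q).

Lemma Nopp p : N (pscale (-1, 0) p) = N p.
Proof.
have h q : N (pscale (-1, 0) q) <= N q.
  by apply: le_trans (N_scale _ _) _; rewrite gaussN1 cabsN cabs1 mul1r.
apply: le_anti; rewrite h /=; apply: le_trans (h _).
by rewrite pscaleA qmulN1 (_ : - (-1, 0) = (1, 0)) ?pscale1 //; apply: pair_eq; rewrite ?opprK ?oppr0.
Qed.

Lemma distxx p : dist p p = 0.
Proof. by rewrite -N_nil; apply: Npeq => w; rewrite coef_sub subrr. Qed.
Lemma peq_dist p q : peq p q -> dist p q = 0.
Proof. by move=> h; rewrite -N_nil; apply: Npeq => w; rewrite coef_sub h subrr. Qed.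
Lemma distC p q : dist p q = dist q p.
Proof.
by rewrite -[RHS]Nopp; apply: Npeq => w; rewrite coef_scale !coef_sub qmulN1 opprB.
Qed.
Lemma dist_tri q p r : dist p r <= dist p q + dist q r.
Proof.
apply: le_trans (N_cat _ _); rewrite le_eqVlt; apply/orP; left; apply/eqP; apply: Npeq => w.
by rewrite coef_cat !coef_sub addrA subrK.
Qed.
Lemma N_dist p q : N p <= dist p q + N q.
Proof.
apply: le_trans (N_cat _ _); rewrite le_eqVlt; apply/orP; left; apply/eqP; apply: Npeq => w.
by rewrite coef_cat coef_sub subrK.
Qed.
Lemma dist_cat p q p' q' : dist (p ++ q) (p' ++ q') <= dist p p' + dist q q'.
Proof.
apply: le_trans (N_cat _ _); rewrite le_eqVlt; apply/orP; left; apply/eqP; apply: Npeq => w.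
by rewrite coef_cat !coef_sub !coef_cat opprD addrACA.
Qed.
Lemma gaussB z w : gauss (z - w) = gauss z - gauss w.
Proof. by apply/eqP; rewrite eq_complex /= !rmorphB !eqxx. Qed.
Lemma dist_scale z p z' p' : dist (pscale z p) (pscale z' p') <=
  cabs (gauss z - gauss z') * N p + cabs (gauss z') * dist p p'.
Proof.
apply: (@le_trans _ _ (N (pscale (z - z') p ++ pscale z' (psub p p')))).
  rewrite le_eqVlt; apply/orP; left; apply/eqP; apply: Npeq => w.
  rewrite coef_cat !coef_sub !coef_scale coef_sub qmulDl qmulDr qmulNl qmulNr.
  by rewrite addrA subrK.
by apply: le_trans (N_cat _ _) _; rewrite -gaussB lerD.
Qed.
Lemma dist_mul p q p' q' : dist (pmul p q) (pmul p' q') <= dist p p' * N q + N p' * dist q q'.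
Proof.
apply: (@le_trans _ _ (N (pmul (psub p p') q ++ pmul p' (psub q q')))).
  rewrite le_eqVlt; apply/orP; left; apply/eqP; apply: Npeq => w.
  rewrite coef_cat coef_sub pmul_catl coef_cat pmul_scalel coef_scale (pmul_catr p') coef_cat.
  by rewrite pmul_scaler coef_scale !qmulN1 addrA subrK.
by apply: le_trans (N_cat _ _) _; rewrite lerD.
Qed.

(** Since [N q ^+ 2] is at most [N (pstar q) * N q], one half of the C*-identity gives the isometry
    of the adjoint, and with it the other half. *)
Lemma N_pstar p : N (pstar p) = N p.
Proof.
have h q : N q <= N (pstar q).
  have := N_star q; have := N_mul (pstar q) q; have := N_ge0 q.
  rewrite le_eqVlt => /orP[/eqP <- _ _|q0 h1 h2]; first exact: N_ge0.
  by rewrite -(ler_pM2r q0) -expr2; exact: le_trans h1.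
by apply: le_anti; rewrite h andbT; have := h (pstar p); rewrite pstarK.
Qed.
Lemma dist_star p q : dist (pstar p) (pstar q) = dist p q.
Proof.
rewrite -[RHS]N_pstar; congr N; rewrite /psub pstar_cat pstar_scale; congr (_ ++ pscale _ _).
Qed.

Definition pcauchy s := forall e : R, 0 < e -> exists M, forall m n, (M <= m)%N -> (M <= n)%N -> dist (s m) (s n) <= e.
Definition psim s t := forall e : R, 0 < e -> evt (fun n => dist (s n) (t n) <= e).

Lemma psim_refl s : psim s s.
Proof. by move=> e e0; apply: evtT => n; rewrite distxx ltW. Qed.
Lemma psim_sym s t : psim s t -> psim t s.
Proof. by move=> h e /h; apply: evtW => n; rewrite distC. Qed.
Lemma psim_trans s t u : psim s t -> psim t u -> psim s u.
Proof.
move=> h1 h2 e e0; have e2 : 0 < e / 2 by rewrite divr_gt0.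
apply: evtI (h1 _ e2) (h2 _ e2) => n h3 h4; apply: le_trans (dist_tri (t n) _ _) _; lra.
Qed.
Lemma psim_cauchy s t : psim s t -> pcauchy t -> pcauchy s.
Proof.
move=> h ct e e0; have e3 : 0 < e / 3 by rewrite divr_gt0.
have [M hM] := ct _ e3; have [K hK] := h _ e3; exists (maxn M K) => m n.
rewrite !geq_max => /andP[m1 m2] /andP[n1 n2].
have := hM m n m1 n1; have := hK m m2; have := hK n n2; rewrite (distC (s n)).
have := dist_tri (t m) (s m) (s n); have := dist_tri (t n) (t m) (s n); lra.
Qed.
Lemma psim_peq s t : (forall n, peq (s n) (t n)) -> psim s t.
Proof. by move=> h e e0; apply: evtT => n; rewrite peq_dist // ltW. Qed.

Let ex_sim s : exists t, psim t s. Proof. by exists s; exact: psim_refl. Qed.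
Let canon s : nat -> star_poly := sval (cid (ex_sim s)).
Let canonP s : psim (canon s) s. Proof. by rewrite /canon; case: cid. Qed.
(** Equivalent sequences define the same predicate, hence [cid] selects the same representative once
    the existence proofs are identified. *)
Let canon_eq s t : psim s t -> canon s = canon t.
Proof.
move=> st; have : (fun u => psim u s) = (fun u => psim u t).
  apply/funext => u; apply/propext; split=> h; first exact: psim_trans st.
  exact: psim_trans h (psim_sym st).
rewrite /canon; move: (ex_sim s) (ex_sim t) => h1 h2 e; move: h1 h2; rewrite e => h1 h2.
by rewrite (Prop_irrelevance h1 h2).
Qed.

(* Elements are canonical representatives of Cauchy sequences modulo null
   sequences; [conv s x] says that [s] represents [x]. *)
Definition ctype := {s : nat -> star_poly | pcauchy s /\ canon s = s}.
Implicit Types x y : ctype.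
Definition conv s x := psim s (sval x).

Lemma conv_cauchy s x : conv s x -> pcauchy s.
Proof. by move=> h; apply: psim_cauchy h _; have [] := svalP x. Qed.
Lemma conv_uniq s x y : conv s x -> conv s y -> x = y.
Proof.
move=> h1 h2; apply: eq_sig_hprop => [s' ? ?|]; first exact: Prop_irrelevance.
have [_ <-] := svalP x; have [_ <-] := svalP y; apply: canon_eq.
exact: psim_trans (psim_sym h1) h2.
Qed.
Lemma conv_sim s t x : psim s t -> conv t x -> conv s x.
Proof. exact: psim_trans. Qed.
Lemma conv_eq s t x y : conv s x -> conv t y -> (forall n, peq (s n) (t n)) -> x = y.
Proof. by move=> h1 h2 h; apply: (conv_uniq h1); apply: conv_sim h2; exact: psim_peq. Qed.

Lemma pcauchy_cst p : pcauchy (fun=> p).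
Proof. by move=> e e0; exists 0%N => m n _ _; rewrite distxx ltW. Qed.

(** Sequences that are not Cauchy are sent to the class of the empty polynomial, so that [clim_of]
    is total. *)
Lemma conv_exists s : exists x, pcauchy s -> conv s x.
Proof.
have [cs|ncs] := EM (pcauchy s).
  have h : pcauchy (canon s) /\ canon (canon s) = canon s.
    by split; [exact: psim_cauchy (canonP s) cs|exact: canon_eq (canonP s)].
  by exists (exist (fun s => pcauchy s /\ canon s = s) _ h) => _; exact: psim_sym (canonP s).
have c0 := @pcauchy_cst [::]; set t : nat -> star_poly := (fun=> _) in c0.
have h : pcauchy (canon t) /\ canon (canon t) = canon t.
  by split; [exact: psim_cauchy (canonP t) c0|exact: canon_eq (canonP t)].
by exists (exist (fun s => pcauchy s /\ canon s = s) _ h).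
Qed.
Definition clim_of s : ctype := sval (cid (conv_exists s)).
Lemma clim_ofP s : pcauchy s -> conv s (clim_of s).
Proof. by rewrite /clim_of; case: cid. Qed.

Let crep x : nat -> star_poly := sval x.
Let convr x : conv (crep x) x. Proof. exact: psim_refl. Qed.
Let repc x : pcauchy (crep x). Proof. by have [] := svalP x. Qed.

Lemma pcauchy_bounded s : pcauchy s -> exists2 B : R, 1 <= B & evt (fun n => N (s n) <= B).
Proof.
move=> cs; have [M hM] := cs 1 ltr01; exists (N (s M) + 1); first by have := N_ge0 (s M); lra.
by exists M => n hn; have := hM n M hn (leqnn M); have := N_dist (s n) (s M); lra.
Qed.

Section Operation.
Variable op : star_poly -> star_poly -> star_poly.
Hypothesis op_lip : forall B : R, 1 <= B -> forall p q p' q', N p <= B -> N q <= B ->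
  N p' <= B -> N q' <= B -> dist (op p q) (op p' q') <= B * (dist p p' + dist q q').
(** Lipschitz continuity on bounded sets is enough because Cauchy sequences are bounded. Unary
    operations are covered by ignoring an argument. *)
Lemma op_sim s t s' t' : pcauchy s -> pcauchy t -> psim s s' -> psim t t' ->
  psim (fun n => op (s n) (t n)) (fun n => op (s' n) (t' n)).
Proof.
move=> cs ct ss' tt' e e0.
have [B B1 hB] := pcauchy_bounded cs; have [B' B1' hB'] := pcauchy_bounded ct.
pose b := B + B' + 1; have b0 : 0 < b by rewrite /b; lra.
pose d := Num.min 1 (e / (2 * b)).
have d0 : 0 < d by rewrite lt_min ltr01 divr_gt0 // mulr_gt0.
have d1 : d <= 1 by rewrite ge_min lexx.
have de : d * (2 * b) <= e by rewrite -ler_pdivlMr ?ge_min ?lexx ?orbT // mulr_gt0.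
have h1 := evtI (fun n a c => conj a c) (ss' _ d0) (tt' _ d0).
apply: evtI (evtI (fun n a c => conj a c) hB hB') h1 => n [h3 h4] [h5 h6].
have [q1 q2] := (N_dist (s' n) (s n), N_dist (t' n) (t n)).
rewrite (distC (s' n)) in q1; rewrite (distC (t' n)) in q2.
apply: le_trans (op_lip _ _ _ _ _ : _ <= b * _) _; rewrite ?/b; try lra.
rewrite -/b; apply: (@le_trans _ _ (b * (d + d))); first by rewrite ler_pM2l // lerD.
by apply: le_trans de; rewrite le_eqVlt; apply/orP; left; apply/eqP; ring.
Qed.
Lemma op_cauchy s t : pcauchy s -> pcauchy t -> pcauchy (fun n => op (s n) (t n)).
Proof.
move=> cs ct e e0.
have [B B1 hB] := pcauchy_bounded cs; have [B' B1' hB'] := pcauchy_bounded ct.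
pose b := B + B'; have b0 : 0 < b by rewrite /b; lra.
pose d := e / (2 * b); have d0 : 0 < d by rewrite divr_gt0 // mulr_gt0.
have de : d * (2 * b) = e by rewrite divfK // gt_eqF // mulr_gt0.
have [M1 h1] := cs _ d0; have [M2 h2] := ct _ d0; have [M3 h3] := hB; have [M4 h4] := hB'.
exists (maxn (maxn M1 M2) (maxn M3 M4)) => m n.
rewrite !geq_max => /andP[/andP[m1 m2] /andP[m3 m4]] /andP[/andP[n1 n2] /andP[n3 n4]].
have := h1 m n m1 n1; have := h2 m n m2 n2.
have := h3 m m3; have := h3 n n3; have := h4 m m4; have := h4 n n4 => *.
apply: le_trans (op_lip _ _ _ _ _ : _ <= b * _) _; rewrite ?/b; try lra.
by rewrite -/b -de; nra.
Qed.
Lemma conv_op s t x y : conv s x -> conv t y ->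
  conv (fun n => op (s n) (t n)) (clim_of (fun n => op (crep x n) (crep y n))).
Proof.
move=> sx ty; apply: conv_sim (clim_ofP (op_cauchy (repc x) (repc y))).
exact: op_sim (conv_cauchy sx) (conv_cauchy ty) sx ty.
Qed.
End Operation.

Definition c_emb p := clim_of (fun=> p).
Definition c_add x y := clim_of (fun n => crep x n ++ crep y n).
Definition c_mul x y := clim_of (fun n => pmul (crep x n) (crep y n)).
Definition c_star x := clim_of (fun n => pstar (crep x n)).
Definition c_opp x := clim_of (fun n => pscale (-1, 0) (crep x n)).
Let gl (k : R[i]) := sval (cid (gauss_lim k)).
Let glP k : slim (fun n => gauss (gl k n)) k. Proof. by rewrite /gl; case: cid. Qed.
(** A complex scalar acts through a chosen sequence of Gaussian rationals; [conv_scale] shows that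
    the choice does not matter. *)
Definition c_scale k x := clim_of (fun n => pscale (gl k n) (crep x n)).

Lemma conv_emb p : conv (fun=> p) (c_emb p).
Proof. exact: clim_ofP (@pcauchy_cst p). Qed.
Lemma conv_add s t x y : conv s x -> conv t y -> conv (fun n => s n ++ t n) (c_add x y).
Proof.
apply: (@conv_op (fun p q => p ++ q)) => B B1 p q p' q' _ _ _ _.
apply: le_trans (dist_cat _ _ _ _) _; rewrite ler_peMl // addr_ge0 ?N_ge0 //.
Qed.
Lemma conv_mul s t x y : conv s x -> conv t y -> conv (fun n => pmul (s n) (t n)) (c_mul x y).
Proof.
apply: (@conv_op pmul) => B B1 p q p' q' h1 h2 h3 h4.
apply: le_trans (dist_mul _ _ _ _) _; rewrite mulrDr lerD //.
  by rewrite mulrC ler_wpM2r ?N_ge0.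
by rewrite ler_wpM2r ?N_ge0.
Qed.
Lemma conv_star s x : conv s x -> conv (fun n => pstar (s n)) (c_star x).
Proof.
move=> sx; apply: (@conv_op (fun p _ => pstar p) _ s s x x sx sx) => B B1 p q p' q' _ _ _ _.
by rewrite dist_star; apply: le_trans (ler_peMl _ B1); rewrite ?addr_ge0 ?N_ge0 // lerDl N_ge0.
Qed.
Lemma conv_scale z s k x : slim (fun n => gauss (z n)) k -> conv s x ->
  conv (fun n => pscale (z n) (s n)) (c_scale k x).
Proof.
move=> zk sx.
have main z' s' : slim (fun n => gauss (z' n)) k -> pcauchy s' ->
    psim s' (crep x) -> psim (fun n => pscale (z' n) (s' n)) (fun n => pscale (gl k n) (crep x n)).
  move=> zk' cs' sx' e e0; have [B B1 hB] := pcauchy_bounded cs'; have k0 := cabs_ge0 k.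
  pose b := 2 * B + cabs k + 1; have b0 : 0 < b by rewrite /b; lra.
  pose d := Num.min 1 (e / b); have d0 : 0 < d by rewrite lt_min ltr01 divr_gt0.
  have d1 : d <= 1 by rewrite ge_min lexx.
  have de : d * b <= e by rewrite -ler_pdivlMr ?ge_min ?lexx ?orbT.
  have hz := evtI (fun n a c => conj a c) (zk' _ d0) (glP k d0).
  apply: evtI hz (evtI (fun n a c => conj a c) hB (sx' _ d0)) => n [h1 h2] [h3 h4].
  apply: le_trans (dist_scale _ _ _ _) _.
  have h5 : cabs (gauss (z' n) - gauss (gl k n)) <= 2 * d.
    have := cabsD (gauss (z' n) - k) (k - gauss (gl k n)); rewrite addrA subrK.
    by have := cabsN (gauss (gl k n) - k); rewrite opprB => ->; lra.
  have h6 : cabs (gauss (gl k n)) <= cabs k + 1.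
    by have := cabsD (gauss (gl k n) - k) k; rewrite subrK; lra.
  have h7 : cabs (gauss (z' n) - gauss (gl k n)) * N (s' n) <= 2 * d * B by rewrite ler_pM ?cabs_ge0.
  have h8 : cabs (gauss (gl k n)) * dist (s' n) (crep x n) <= (cabs k + 1) * d by rewrite ler_pM ?cabs_ge0 ?N_ge0.
  apply: le_trans (lerD h7 h8) _; apply: le_trans de.
  by rewrite le_eqVlt; apply/orP; left; apply/eqP; rewrite /b; ring.
apply: conv_sim (main z s zk (conv_cauchy sx) sx) _; apply: clim_ofP.
move=> e e0; have [B B1 hB] := pcauchy_bounded (repc x); have k0 := cabs_ge0 k.
pose b := 2 * B + cabs k + 1; have b0 : 0 < b by rewrite /b; lra.
pose d := Num.min 1 (e / b); have d0 : 0 < d by rewrite lt_min ltr01 divr_gt0.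
have d1 : d <= 1 by rewrite ge_min lexx.
have de : d * b <= e by rewrite -ler_pdivlMr ?ge_min ?lexx ?orbT.
have [M1 h1] := glP k d0; have [M2 h2] := hB; have [M3 h3] := repc x d0.
exists (maxn M1 (maxn M2 M3)) => m n; rewrite !geq_max => /and3P[m1 m2 m3] /and3P[n1 n2 n3].
apply: le_trans (dist_scale _ _ _ _) _.
have h5 : cabs (gauss (gl k m) - gauss (gl k n)) <= 2 * d.
  have := cabsD (gauss (gl k m) - k) (k - gauss (gl k n)); rewrite addrA subrK.
  by have := cabsN (gauss (gl k n) - k); rewrite opprB => ->; have := h1 m m1; have := h1 n n1; lra.
have h6 : cabs (gauss (gl k n)) <= cabs k + 1.
  by have := cabsD (gauss (gl k n) - k) k; rewrite subrK; have := h1 n n1; lra.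
have h7 : cabs (gauss (gl k m) - gauss (gl k n)) * N (crep x m) <= 2 * d * B by rewrite ler_pM ?cabs_ge0 // h2.
have h8 : cabs (gauss (gl k n)) * dist (crep x m) (crep x n) <= (cabs k + 1) * d by rewrite ler_pM ?cabs_ge0 ?N_ge0 // h3.
apply: le_trans (lerD h7 h8) _; apply: le_trans de.
  by rewrite le_eqVlt; apply/orP; left; apply/eqP; rewrite /b; ring.
Qed.
Lemma conv_scale_cst z s x : conv s x -> conv (fun n => pscale z (s n)) (c_scale (gauss z) x).
Proof. by apply: conv_scale; exact: slim_cst. Qed.
Lemma conv_opp s x : conv s x -> conv (fun n => pscale (-1, 0) (s n)) (c_opp x).
Proof.
move=> sx; have := conv_scale_cst (-1, 0) sx; suff -> : c_scale (gauss (-1, 0)) x = c_opp x by [].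
have h := conv_scale_cst (-1, 0) (convr x); apply: conv_uniq h _; apply: clim_ofP.
exact: conv_cauchy (conv_scale_cst (-1, 0) (convr x)).
Qed.

Lemma c_norm_exists x : exists l : R, forall e, 0 < e -> evt (fun n => `|l - N (crep x n)| <= e).
Proof.
have [|l hl] := @real_complete R (fun n => N (crep x n)); last by exists l.
move=> e e0; have [M hM] := repc x e0; exists M => m n hm hn.
have := N_dist (crep x m) (crep x n); have := N_dist (crep x n) (crep x m); rewrite (distC (crep x n)).
by have := hM m n hm hn; rewrite ler_norml => *; apply/andP; split; lra.
Qed.
Definition c_norm x : R := sval (cid (c_norm_exists x)).
Lemma conv_norm s x : conv s x -> forall e, 0 < e -> evt (fun n => `|c_norm x - N (s n)| <= e).
Proof.
move=> sx e e0; have e2 : 0 < e / 2 by rewrite divr_gt0.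
rewrite /c_norm; case: cid => l /= hl; apply: evtI (hl _ e2) (sx _ e2) => n h1 h2.
have := N_dist (s n) (crep x n); have := N_dist (crep x n) (s n); rewrite (distC (crep x n)).
by move: h1; rewrite !ler_norml => /andP[h3 h4] *; apply/andP; split; lra.
Qed.
Lemma c_norm_le s x (B : R) : conv s x -> evt (fun n => N (s n) <= B) -> c_norm x <= B.
Proof.
move=> sx hB; apply/ler_addgt0Pr => e e0.
have [n [h1 h2]] := evt_ex (evtI (fun n a c => conj a c) hB (conv_norm sx e0)).
by move: h2; rewrite ler_norml => /andP[h2 h3]; lra.
Qed.
Lemma c_norm_ge s x (B : R) : conv s x -> evt (fun n => B <= N (s n)) -> B <= c_norm x.
Proof.
move=> sx hB; apply/ler_addgt0Pr => e e0.
have [n [h1 h2]] := evt_ex (evtI (fun n a c => conj a c) hB (conv_norm sx e0)).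
by move: h2; rewrite ler_norml => /andP[h2 h3]; lra.
Qed.
Lemma c_norm_emb p : c_norm (c_emb p) = N p.
Proof.
apply: le_anti; rewrite (c_norm_le (conv_emb p)) ?(c_norm_ge (conv_emb p)) //; exact: evtT.
Qed.

Lemma evt_norm_le s x (e : R) : conv s x -> 0 < e -> evt (fun n => N (s n) <= c_norm x + e).
Proof.
move=> sx e0; apply: evtW (conv_norm sx e0) => n; rewrite ler_norml => /andP[h _].
by rewrite addrC -lerBlDr; move: h; rewrite lerNl opprB.
Qed.
Lemma evt_norm_ge s x (e : R) : conv s x -> 0 < e -> evt (fun n => c_norm x - e <= N (s n)).
Proof.
by move=> sx e0; apply: evtW (conv_norm sx e0) => n; rewrite ler_norml => /andP[_ h]; rewrite lerBlDr -lerBlDl.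
Qed.
Lemma c_norm_ge0 x : 0 <= c_norm x.
Proof. by apply: (c_norm_ge (convr x)); exact: evtT. Qed.
Lemma c_norm_eq s t x y : conv s x -> conv t y -> (forall n, N (s n) = N (t n)) -> c_norm x = c_norm y.
Proof.
move=> sx ty h; apply: le_anti; apply/andP; split; apply/ler_addgt0Pr => e e0.
  by apply: (c_norm_le sx); apply: evtW (evt_norm_le ty e0) => n; rewrite h.
by apply: (c_norm_le ty); apply: evtW (evt_norm_le sx e0) => n; rewrite h.
Qed.
Lemma conv_sub s t x y : conv s x -> conv t y -> conv (fun n => psub (s n) (t n)) (c_add x (c_opp y)).
Proof. by move=> sx ty; apply: conv_add => //; exact: conv_opp. Qed.

Lemma c_normD x y : c_norm (c_add x y) <= c_norm x + c_norm y.
Proof.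
apply/ler_addgt0Pr => e e0; have e2 : 0 < e / 2 by rewrite divr_gt0.
apply: (c_norm_le (conv_add (convr x) (convr y))).
apply: evtI (evt_norm_le (convr x) e2) (evt_norm_le (convr y) e2) => n h1 h2.
by apply: le_trans (N_cat _ _) _; lra.
Qed.

Lemma small_product (a b e : R) : 0 <= a -> 0 <= b -> 0 < e -> exists2 d, 0 < d & (a + d) * (b + d) <= a * b + e.
Proof.
move=> a0 b0 e0; pose d := Num.min 1 (e / (a + b + 1)).
have d0 : 0 < d by rewrite lt_min ltr01 divr_gt0 //; lra.
have d1 : d <= 1 by rewrite ge_min lexx.
have de : d * (a + b + 1) <= e by rewrite -ler_pdivlMr ?ge_min ?lexx ?orbT //; lra.
exists d => //; have : d * d <= d * 1 by rewrite ler_pM2l.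
by move: de; rewrite !mulrDl !mulrDr; lra.
Qed.

Lemma c_normM x y : c_norm (c_mul x y) <= c_norm x * c_norm y.
Proof.
apply/ler_addgt0Pr => e e0; have [d d0 hd] := small_product (c_norm_ge0 x) (c_norm_ge0 y) e0.
apply: (c_norm_le (conv_mul (convr x) (convr y))).
apply: evtI (evt_norm_le (convr x) d0) (evt_norm_le (convr y) d0) => n h1 h2.
by apply: le_trans (N_mul _ _) _; apply: le_trans hd; apply: ler_pM.
Qed.

Lemma c_normZ_le k x : c_norm (c_scale k x) <= cabs k * c_norm x.
Proof.
apply/ler_addgt0Pr => e e0; have [d d0 hd] := small_product (cabs_ge0 k) (c_norm_ge0 x) e0.
apply: (c_norm_le (conv_scale (glP k) (convr x))).
apply: evtI (glP k d0) (evt_norm_le (convr x) d0) => n h1 h2.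
apply: le_trans (N_scale _ _) _; apply: le_trans hd; apply: ler_pM; rewrite ?cabs_ge0 //.
by have := cabsD (gauss (gl k n) - k) k; rewrite subrK; lra.
Qed.

Lemma slimD (u v : nat -> R[i]) k l : slim u k -> slim v l -> slim (fun n => u n + v n) (k + l).
Proof.
move=> uk vl e e0; have e2 : 0 < e / 2 by rewrite divr_gt0.
apply: evtI (uk _ e2) (vl _ e2) => n h1 h2; rewrite opprD addrACA.
by apply: le_trans (cabsD _ _) _; lra.
Qed.
Lemma slimM (u v : nat -> R[i]) k l : slim u k -> slim v l -> slim (fun n => u n * v n) (k * l).
Proof.
move=> uk vl e e0; have [d d0 hd] := small_product (cabs_ge0 k) (cabs_ge0 l) e0.
apply: evtI (uk _ d0) (vl _ d0) => n h1 h2.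
have -> : u n * v n - k * l = (u n - k) * (v n - l) + ((u n - k) * l + k * (v n - l)) by ring.
apply: le_trans (cabsD _ _) _; have := cabsD ((u n - k) * l) (k * (v n - l)); rewrite !cabsM.
have := ler_pM (cabs_ge0 _) (cabs_ge0 _) h1 h2; have := ler_wpM2r (cabs_ge0 l) h1.
have := ler_wpM2l (cabs_ge0 k) h2; move: hd; rewrite !mulrDl !mulrDr; lra.
Qed.
Lemma slim_conj (u : nat -> R[i]) k : slim u k -> slim (fun n => (u n)^*%C) k^*%C.
Proof. by move=> uk e /uk; apply: evtW => n; rewrite -rmorphB cabs_conj. Qed.

Lemma c_scaleA k l x : c_scale k (c_scale l x) = c_scale (k * l) x.
Proof.
have zk : slim (fun n => gauss (qmul (gl k n) (gl l n))) (k * l).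
  by have := slimM (glP k) (glP l); congr slim; apply/funext => n; rewrite gaussM.
apply: conv_eq (conv_scale (glP k) (conv_scale (glP l) (convr x))) (conv_scale zk (convr x)) _ => n.
by rewrite pscaleA.
Qed.
Lemma c_scale1 x : c_scale 1 x = x.
Proof.
have z1 : slim (fun=> gauss (1, 0)) 1.
  have -> : gauss (1, 0) = 1 by apply/eqP; rewrite eq_complex /= rmorph1 rmorph0 !eqxx.
  exact: slim_cst.
by apply: conv_eq (conv_scale z1 (convr x)) (convr x) _ => n; rewrite pscale1.
Qed.
Lemma c_normZ k x : c_norm (c_scale k x) = cabs k * c_norm x.
Proof.
apply: le_anti; rewrite c_normZ_le /=; have [->|k0] := eqVneq k 0.
  have -> : cabs (0 : R[i]) = 0 by apply/eqP; rewrite cabs_eq0.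
  by rewrite mul0r c_norm_ge0.
have := c_normZ_le k^-1 (c_scale k x); rewrite c_scaleA mulVf // c_scale1 => h.
have kp : 0 < cabs k by rewrite lt_neqAle eq_sym cabs_eq0 k0 cabs_ge0.
apply: le_trans (ler_wpM2l (ltW kp) h) _.
by rewrite mulrA -cabsM mulfV // cabs1 mul1r.
Qed.
Lemma c_norm_eq0 x : c_norm x = 0 -> x = c_emb [::].
Proof.
move=> x0; apply: (conv_uniq (convr x)); apply: conv_sim (conv_emb [::]) => e e0.
by apply: evtW (evt_norm_le (convr x) e0) => n; rewrite x0 add0r /dist /psub /pscale /= cats0.
Qed.
Lemma c_norm_star x : c_norm (c_mul (c_star x) x) = c_norm x ^+ 2.
Proof.
have ns : c_norm (c_star x) = c_norm x.
  by apply: c_norm_eq (conv_star (convr x)) (convr x) _ => n; rewrite N_pstar.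
apply: le_anti; apply/andP; split; first by rewrite expr2 -{1}ns; exact: c_normM.
have n0 := c_norm_ge0 x; apply/ler_addgt0Pr => e e0.
have [->|xp] := eqVneq (c_norm x) 0.
  by rewrite expr0n /= addr_ge0 ?c_norm_ge0 // ltW.
have {}xp : 0 < c_norm x by rewrite lt_neqAle eq_sym xp.
pose d := Num.min (c_norm x) (e / (2 * c_norm x)).
have d0 : 0 < d by rewrite lt_min xp divr_gt0 // mulr_gt0.
have dx : d <= c_norm x by rewrite ge_min lexx.
have de : d * (2 * c_norm x) <= e by rewrite -ler_pdivlMr ?ge_min ?lexx ?orbT // mulr_gt0.
rewrite -lerBlDr; apply: (c_norm_ge (conv_mul (conv_star (convr x)) (convr x))).
apply: evtW (evt_norm_ge (convr x) d0) => n h; apply: le_trans (N_star _).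
apply: (@le_trans _ _ ((c_norm x - d) ^+ 2)).
  by rewrite sqrrB; have := sqr_ge0 d; rewrite expr2 -mulr_natl; lra.
by rewrite lerXn2r // nnegrE ?subr_ge0.
Qed.

Lemma c_dist_tri x y z : c_norm (c_add x (c_opp z)) <=
  c_norm (c_add x (c_opp y)) + c_norm (c_add y (c_opp z)).
Proof.
have h := conv_add (conv_sub (convr x) (convr y)) (conv_sub (convr y) (convr z)).
apply: le_trans _ (c_normD _ _).
rewrite le_eqVlt; apply/orP; left; apply/eqP; apply: c_norm_eq (conv_sub (convr x) (convr z)) h _ => n.
by apply: Npeq => w; rewrite coef_cat !coef_sub addrA subrK.
Qed.
Lemma c_distC x y : c_norm (c_add x (c_opp y)) = c_norm (c_add y (c_opp x)).
Proof.
apply: c_norm_eq (conv_sub (convr x) (convr y)) (conv_sub (convr y) (convr x)) _ => n; exact: distC.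
Qed.
Lemma c_dist_emb p q : c_norm (c_add (c_emb p) (c_opp (c_emb q))) = dist p q.
Proof. by rewrite /dist -c_norm_emb; apply: c_norm_eq (conv_sub (conv_emb p) (conv_emb q)) (conv_emb _) _. Qed.

Lemma c_near x (e : R) : 0 < e -> exists p, c_norm (c_add x (c_opp (c_emb p))) <= e.
Proof.
move=> e0; have [M hM] := repc x e0; exists (crep x M).
by apply: (c_norm_le (conv_sub (convr x) (conv_emb _))); exists M => n hn; exact: hM.
Qed.

Lemma c_complete (u : nat -> ctype) :
  (forall e, 0 < e -> exists M, forall m n, (M <= m)%N -> (M <= n)%N ->
     c_norm (c_add (u m) (c_opp (u n))) <= e) ->
  exists l, forall e, 0 < e -> exists M, forall n, (M <= n)%N -> c_norm (c_add l (c_opp (u n))) <= e.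
Proof.
move=> cu; have /choice[p hp] : forall n, exists p, c_norm (c_add (u n) (c_opp (c_emb p))) <= halves R n.
  by move=> n; exact: c_near (halves_gt0 R n).
have cp : pcauchy p.
  move=> e e0; have e3 : 0 < e / 3 by rewrite divr_gt0.
  have [M hM] := cu _ e3; have [K hK] := halves_small e3; exists (maxn M K) => m n.
  rewrite !geq_max => /andP[m1 m2] /andP[n1 n2]; rewrite -c_dist_emb.
  have h1 := c_dist_tri (c_emb (p m)) (u m) (c_emb (p n)).
  have h2 := c_dist_tri (u m) (u n) (c_emb (p n)).
  rewrite (c_distC (c_emb (p m)) (u m)) in h1.
  by have := hM m n m1 n1; have := hK m m2; have := hK n n2; have := hp m; have := hp n; lra.
exists (clim_of p) => e e0; have e2 : 0 < e / 2 by rewrite divr_gt0.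
have [M hM] := cp _ e2; have [K hK] := halves_small e2; exists (maxn M K) => n.
rewrite geq_max => /andP[n1 n2].
have h1 := c_dist_tri (clim_of p) (c_emb (p n)) (u n); rewrite (c_distC (c_emb (p n)) (u n)) in h1.
have h2 : c_norm (c_add (clim_of p) (c_opp (c_emb (p n)))) <= e / 2.
  by apply: (c_norm_le (conv_sub (clim_ofP cp) (conv_emb _))); exists M => m hm; exact: hM.
by have := hK n n2; have := hp n; lra.
Qed.

Definition completion_data : cstar_data R.
Proof.
refine (@CStarData R ctype (c_emb [::]) c_add c_opp c_scale c_mul c_star c_norm
  _ _ _ _ c_scaleA c_scale1 _ _ _ _ _ _ _ _ _ _ _ c_normD c_normZ c_norm_eq0 c_normM
  c_norm_star c_complete).
- move=> x y z; have [[cx cy] cz] := (convr x, convr y, convr z).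
  by apply: conv_eq (conv_add cx (conv_add cy cz)) (conv_add (conv_add cx cy) cz) _ => n; rewrite catA.
- move=> x y; apply: conv_eq (conv_add (convr x) (convr y)) (conv_add (convr y) (convr x)) _ => n w.
  by rewrite !coef_cat addrC.
- by move=> x; apply: conv_eq (conv_add (conv_emb [::]) (convr x)) (convr x) _ => n.
- move=> x; apply: conv_eq (conv_add (conv_opp (convr x)) (convr x)) (conv_emb [::]) _ => n w.
  by rewrite coef_cat coef_scale qmulN1 addNr.
- move=> k x y; have [cx cy] := (convr x, convr y).
  apply: conv_eq (conv_scale (glP k) (conv_add cx cy))
    (conv_add (conv_scale (glP k) cx) (conv_scale (glP k) cy)) _ => n.
  by rewrite pscale_cat.
- move=> x k l; have zk : slim (fun n => gauss (gl k n + gl l n)) (k + l).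
    by have := slimD (glP k) (glP l); congr slim; apply/funext => n; rewrite gaussD.
  apply: conv_eq (conv_scale zk (convr x))
    (conv_add (conv_scale (glP k) (convr x)) (conv_scale (glP l) (convr x))) _ => n.
  exact: pscaleD.
- move=> x y z; have [[cx cy] cz] := (convr x, convr y, convr z).
  by apply: conv_eq (conv_mul cx (conv_mul cy cz)) (conv_mul (conv_mul cx cy) cz) _ => n; rewrite pmulA.
- move=> x y z; have [[cx cy] cz] := (convr x, convr y, convr z).
  apply: conv_eq (conv_mul (conv_add cx cy) cz) (conv_add (conv_mul cx cz) (conv_mul cy cz)) _ => n.
  by rewrite pmul_catl.
- move=> x y z; have [[cx cy] cz] := (convr x, convr y, convr z).
  apply: conv_eq (conv_mul cx (conv_add cy cz)) (conv_add (conv_mul cx cy) (conv_mul cx cz)) _ => n.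
  exact: pmul_catr.
- move=> k x y; have [cx cy] := (convr x, convr y).
  apply: conv_eq (conv_mul (conv_scale (glP k) cx) cy) (conv_scale (glP k) (conv_mul cx cy)) _ => n.
  by rewrite pmul_scalel.
- move=> k x y; have [cx cy] := (convr x, convr y).
  apply: conv_eq (conv_mul cx (conv_scale (glP k) cy)) (conv_scale (glP k) (conv_mul cx cy)) _ => n.
  by rewrite pmul_scaler.
- by move=> x; apply: conv_eq (conv_star (conv_star (convr x))) (convr x) _ => n; rewrite pstarK.
- move=> x y; have [cx cy] := (convr x, convr y).
  apply: conv_eq (conv_star (conv_add cx cy)) (conv_add (conv_star cx) (conv_star cy)) _ => n.
  by rewrite pstar_cat.
- move=> k x; have zk : slim (fun n => gauss (qconj (gl k n))) k^*%C.
    by have := slim_conj (glP k); congr slim; apply/funext => n; rewrite gauss_conj.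
  apply: conv_eq (conv_star (conv_scale (glP k) (convr x))) (conv_scale zk (conv_star (convr x))) _ => n.
  by rewrite pstar_scale.
- move=> x y; have [cx cy] := (convr x, convr y).
  apply: conv_eq (conv_star (conv_mul cx cy)) (conv_mul (conv_star cy) (conv_star cx)) _ => n.
  exact: pstarM.
Defined.

Definition completion : cstarType R := cstar_of completion_data.
Definition pvar (l : letter) : star_poly := [:: ((1, 0), (l, [::]))].
Definition completion_var (i : nat) : completion := c_emb (pvar (i, false)).

Lemma completion_gen p : generated_point completion_var p = c_emb p :> completion.
Proof.
pose F (q : star_poly) : completion := c_emb q.
have FD q r : F q + F r = F (q ++ r).
  by apply: conv_eq (conv_add (conv_emb q) (conv_emb r)) (conv_emb _) _.
have FM q r : cmul (F q) (F r) = F (pmul q r).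
  by apply: conv_eq (conv_mul (conv_emb q) (conv_emb r)) (conv_emb _) _.
have FS q : cstar (F q) = F (pstar q).
  by apply: conv_eq (conv_star (conv_emb q)) (conv_emb _) _.
have FZ z q : gauss z *: F q = F (pscale z q).
  by apply: conv_eq (conv_scale_cst z (conv_emb q)) (conv_emb _) _.
have Fl l : eval_letter completion_var l = F (pvar l).
  by rewrite /eval_letter; case: l => i [] //=; rewrite FS.
have Fw w : eval_word completion_var w = F [:: ((1, 0), w)].
  case: w => l s; rewrite /eval_word /=; elim/last_ind: s => [|s m IH] /=; first exact: Fl.
  rewrite -cats1 foldl_cat /= IH Fl FM; congr F.
rewrite /generated_point; elim: p => [|m p IH]; first by rewrite big_nil.
rewrite big_cons IH Fw FZ FD; congr F; rewrite /pscale /= qmulC qmul1; by case: m.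
Qed.

Theorem completion_presents : presentation completion_var /\
  forall p, cnorm (generated_point completion_var p) = N p.
Proof.
split; last by move=> p; rewrite completion_gen data_cnorm; exact: c_norm_emb.
apply: near_presentation => x e e0; have [|p hp] := @c_near x (e / 2); first by rewrite divr_gt0.
exists p; rewrite completion_gen data_cnorm; apply: le_lt_trans hp _.
by rewrite ltr_pdivrMr // ltr_pMr // ltr1n.
Qed.
End Completion.

(** * Effectivity of the certificates *)

Ltac comp_ext ::= lazymatch goal with
  | |- C (fun x => divn (@?f x) (@?g x)) => refine (C_divn (f := f) (g := g) _ _)
  | |- C (fun x => modn (@?f x) (@?g x)) => refine (C_modn (f := f) (g := g) _ _)
  | |- C (fun x => gcdn (@?f x) (@?g x)) => refine (C_gcdn (f := f) (g := g) _ _)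
  | |- C (fun x => odd (@?f x)) => refine (C_odd (f := f) _)
  | |- C (fun x => CodeSeq.decode (@?f x)) => refine (C_decode (f := f) _)
  | |- C (fun x => Posz (@?f x)) => refine (C_Posz (f := f) _)
  | |- C (fun x => Negz (@?f x)) => refine (C_Negz (f := f) _)
  | |- C (fun x => match (@?z x) with Posz _ => _ | Negz _ => _ end) =>
      refine (C_int (z := z) _ _ _)
  | |- C (fun x => fracq (@?f x)) => refine (C_fracq (f := f) _)
  | |- C (fun x => (@?f x + @?g x)%R) => refine (C_addq (f := f) (g := g) _ _)
  | |- C (fun x => (@?f x * @?g x)%R) => refine (C_mulq (f := f) (g := g) _ _)
  | |- C (fun x => (- @?f x)%R) => refine (C_oppq (f := f) _)
  | |- C (fun x => (@?f x <= @?g x)%R) => refine (C_leq_rat (f := f) (g := g) _ _)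
  | |- C (fun x => (@?f x < @?g x)%R) => refine (C_ltq (f := f) (g := g) _ _)
  | |- C (fun x => halts (@?e x) (@?n x) (@?m x) (@?t x)) =>
      refine (C_halts (e := e) (n := n) (m := m) (t := t) _ _ _ _) end.

Section Polynomials.
Implicit Types T : countType.

Lemma C_qn T (f g : T -> nat) : C f -> C g -> C (fun x => qn (f x) (g x)).
Proof. by move=> hf hg; rewrite /qn; comp. Qed.
Lemma C_qmul T (f g : T -> rat * rat) : C f -> C g -> C (fun x => qmul (f x) (g x)).
Proof. by move=> hf hg; rewrite /qmul; comp. Qed.
Lemma C_qconj T (f : T -> rat * rat) : C f -> C (fun x => qconj (f x)).
Proof. by move=> hf; rewrite /qconj; comp. Qed.
Lemma C_wmul T (f g : T -> word) : C f -> C g -> C (fun x => wmul (f x) (g x)).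
Proof. by move=> hf hg; rewrite /wmul; comp. Qed.
Lemma C_wstar T (f : T -> word) : C f -> C (fun x => wstar (f x)).
Proof. by move=> hf; rewrite /wstar; cbv zeta; comp. Qed.
Lemma C_pmul T (f g : T -> star_poly) : C f -> C g -> C (fun x => pmul (f x) (g x)).
Proof.
move=> hf hg; rewrite /pmul /gpmul; apply: C_flatten; apply: C_map => //; apply: C_map; first by comp.
by apply: C_pair; [apply: C_qmul|apply: C_wmul]; comp.
Qed.
Lemma C_pstar T (f : T -> star_poly) : C f -> C (fun x => pstar (f x)).
Proof.
move=> hf; rewrite /pstar /gpstar; apply: C_map => //.
by apply: C_pair; [apply: C_qconj|apply: C_wstar]; comp.
Qed.
Lemma C_pscale T (z : T -> rat * rat) (f : T -> star_poly) : C z -> C f -> C (fun x => pscale (z x) (f x)).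
Proof.
by move=> hz hf; rewrite /pscale; apply: C_map => //; apply: C_pair; [apply: C_qmul|]; comp.
Qed.
Lemma C_psub T (f g : T -> star_poly) : C f -> C g -> C (fun x => psub (f x) (g x)).
Proof.
move=> hf hg; rewrite /psub.
refine (C_cat (l := f) (m := fun x => pscale (-1, 0) (g x)) hf _).
refine (C_pscale (z := fun=> (-1, 0)) _ hg); exact (C_const _ _).
Qed.
Lemma C_gpzero T (f : T -> star_poly) : C f -> C (fun x => gpzero (f x)).
Proof.
move=> hf; apply: (C_ext (f := fun x => all (fun m : rat * rat * word =>
  foldl (fun (acc : rat * rat) (n : rat * rat * word) =>
    if n.2 == m.2 then (acc.1 + n.1.1, acc.2 + n.1.2) else acc) (0, 0) (f x) == (0, 0)) (f x))) => //.
by comp.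
Qed.
End Polynomials.

Ltac comp_poly := repeat (first [ progress (cbv beta) | comp_step
  | lazymatch goal with
  | |- C (fun x => qn (@?f x) (@?g x)) => refine (C_qn (f := f) (g := g) _ _)
  | |- C (fun x => pmul (@?f x) (@?g x)) => refine (C_pmul (f := f) (g := g) _ _)
  | |- C (fun x => pstar (@?f x)) => refine (C_pstar (f := f) _)
  | |- C (fun x => pscale (@?f x) (@?g x)) => refine (C_pscale (z := f) (f := g) _ _)
  | |- C (fun x => psub (@?f x) (@?g x)) => refine (C_psub (f := f) (g := g) _ _)
  | |- C (fun x => qmul (@?f x) (@?g x)) => refine (C_qmul (f := f) (g := g) _ _)
  | |- C (fun x => gpzero (@?f x)) => refine (C_gpzero (f := f) _) end ]).

Section Certificates.
Implicit Types T : countType.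

Lemma C_cert_ok T (k : T -> nat) (c : T -> cert) : C k -> C c -> C (fun x => cert_ok (k x) (c x)).
Proof. by move=> hk hc; rewrite /cert_ok /c_b /c_n /c_L /c_D; comp_poly. Qed.

Lemma C_cert_reqs T (p : T -> star_poly) (bs : T -> seq star_poly) (k : T -> nat) (c : T -> cert) :
  C p -> C bs -> C k -> C c -> C (fun x => cert_reqs (p x) (bs x) (k x) (c x)).
Proof.
move=> hp hbs hk hc.
rewrite /cert_reqs /c_gram /c_comb /c_units /c_full /c_v /c_u /c_w /c_s /c_b /c_n /c_D /c_flag.
by comp_poly.
Qed.
End Certificates.

Lemma C_pickle (T U : countType) (f : T -> U) : C f -> C (fun x => pickle (f x)).
Proof. by case=> F e h; exists F. Qed.

(** * Closure properties of Pi02 sets *)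

Section Pi.
Local Open Scope nat_scope.

(** The matrix is asked to be computable in the sense of [C] and not merely by a machine, which
    makes substitution available. *)
Definition piC (S : set nat) := exists P : nat -> nat -> nat -> bool,
  C (fun x : nat * nat * nat => P x.1.1 x.1.2 x.2) /\
  forall e, S e <-> forall y, exists z, P e y z.

Lemma piC_Pi02 S : piC S -> Pi02 S.
Proof. by move=> [P [cP hP]]; exists P => //; exact: C_rel3. Qed.

Lemma piC_ext (S T : set nat) : (forall e, S e <-> T e) -> piC T -> piC S.
Proof.
by move=> h [P [cP hP]]; exists P; split=> // e; split=> [/h/hP//|/hP/h].
Qed.

(** Odd and even values of the universal variable test the two conditions. *)
Lemma piCI S T : piC S -> piC T -> piC (S `&` T).
Proof.
move=> [P [cP hP]] [Q [cQ hQ]].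
exists (fun e y z => if odd y then P e (y %/ 2) z else Q e (y %/ 2) z); split.
  refine (C_if (b := fun x : nat * nat * nat => odd x.1.2)
    (f := fun x => P x.1.1 (x.1.2 %/ 2) x.2) (g := fun x => Q x.1.1 (x.1.2 %/ 2) x.2) _ _ _).
  - by comp.
  - by refine (C_comp (f := fun x : nat * nat * nat => (x.1.1, x.1.2 %/ 2, x.2)) cP _); comp.
  - by refine (C_comp (f := fun x : nat * nat * nat => (x.1.1, x.1.2 %/ 2, x.2)) cQ _); comp.
move=> e; split=> [[/hP h1 /hQ h2] y|h]; first by case: (odd y).
split; [apply/hP|apply/hQ] => y.
  have e1 : odd (y * 2).+1 by lia.
  have e2 : (y * 2).+1 %/ 2 = y by lia.
  by have := h (y * 2).+1; rewrite e1 e2.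
have e1 : odd (y * 2) = false by lia.
have e2 : (y * 2) %/ 2 = y by lia.
by have := h (y * 2); rewrite e1 e2.
Qed.

(** A computable surjection from [nat], which lets quantifiers range over [T] without decoding
    failures. *)
Definition enumerable (T : countType) := exists s : nat -> T, C s /\ forall x, exists n, s n = x.

Lemma enum_nat : enumerable nat.
Proof. by exists id; split; [exact: C_id|move=> x; exists x]. Qed.
Lemma enum_bool : enumerable bool.
Proof. by exists odd; split; [comp|move=> x; exists x; rewrite oddb]. Qed.
Lemma enum_pair (T U : countType) : enumerable T -> enumerable U -> enumerable (T * U)%type.
Proof.
move=> [s [cs hs]] [t [ct ht]].
exists (fun n => (s (nth 0 (CodeSeq.decode n) 0), t (nth 0 (CodeSeq.decode n) 1))); split; first by comp.
move=> [x y]; have [m <-] := hs x; have [n <-] := ht y.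
by exists (CodeSeq.code [:: m; n]); rewrite CodeSeq.codeK.
Qed.
Lemma enum_seq (T : countType) : enumerable T -> enumerable (seq T).
Proof.
move=> [s [cs hs]]; exists (fun n => map s (CodeSeq.decode n)); split; first by comp.
move=> x; suff [l <-] : exists l, map s l = x by exists (CodeSeq.code l); rewrite CodeSeq.codeK.
elim: x => [|a x [l <-]]; first by exists [::].
by have [n <-] := hs a; exists (n :: l).
Qed.
Lemma enum_int : enumerable int.
Proof.
have [s [cs hs]] := enum_pair enum_bool enum_nat.
exists (fun n => if (s n).1 then Posz (s n).2 else Negz (s n).2); split; first by comp.
by case=> m; [have [n e] := hs (true, m)|have [n e] := hs (false, m)]; exists n; rewrite e.
Qed.
Lemma enum_rat : enumerable rat.
Proof.
have [s [cs hs]] := enum_pair enum_int enum_int; exists (fun n => fracq (s n)); split; first by comp.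
by move=> x; have [n e] := hs (numq x, denq x); exists n; rewrite e fracqE /= divq_num_den.
Qed.
Lemma enum_star_poly : enumerable star_poly.
Proof.
by do ![exact: enum_rat|exact: enum_nat|exact: enum_bool|apply: enum_pair|apply: enum_seq].
Qed.
Lemma enum_cert : enumerable cert.
Proof.
by do ![exact: enum_star_poly|exact: enum_rat|exact: enum_nat|exact: enum_bool|apply: enum_pair|apply: enum_seq].
Qed.

Lemma piC_enum (Y Z : countType) (Q : nat -> Y -> Z -> bool) : enumerable Y -> enumerable Z ->
  C (fun x : nat * (Y * Z) => Q x.1 x.2.1 x.2.2) ->
  piC [set e | forall y, exists z, Q e y z].
Proof.
move=> [s [cs hs]] [t [ct ht]] cQ; exists (fun e y z => Q e (s y) (t z)); split.
  by refine (C_comp (f := fun x : nat * nat * nat => (x.1.1, (s x.1.2, t x.2))) cQ _); comp.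
move=> e; split=> [h y|h y]; first by have [z hz] := h (s y); have [n en] := ht z; exists n; rewrite en.
by have [m <-] := hs y; have [n hn] := h m; exists (t n).
Qed.
End Pi.

(* [U p alpha] stands for [|p| < alpha]. *)
Definition core (U : star_poly -> rat -> Prop) : Prop :=
  (forall p, exists alpha, U p alpha) /\
  (forall p alpha, U p alpha -> 0 < alpha) /\
  (forall k : nat, U [::] (qn 1 k.+1)) /\
  (forall p q alpha, gpzero (psub p q) -> U p alpha -> U q alpha) /\
  (forall p q alpha beta, U p alpha -> U q beta -> U (p ++ q) (alpha + beta)) /\
  (forall z p alpha gamma, U p alpha -> 0 < gamma ->
     (z.1 * z.1 + z.2 * z.2) * (alpha * alpha) < gamma * gamma -> U (pscale z p) gamma) /\
  (forall p q alpha beta, U p alpha -> U q beta -> U (pmul p q) (alpha * beta)) /\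
  (forall p alpha, 0 < alpha -> U (pmul (pstar p) p) (alpha * alpha) -> U p alpha) /\
  (forall p bs k, exists c, cert_ok k c /\ forall r, r \in cert_reqs p bs k c -> U r.1 r.2).

(** * Arithmetical form of the conditions on an index *)

Section Formula.
(* The outputs are approximations within 2^-k if [b] holds, else upper bounds. *)
Variable b : bool.
Definition off (k : nat) : rat := if b then qn 1 (2 ^ k) else qn 0 1.
Definition wit : Type := (nat * nat * rat)%type.
Definition D (e : nat) (p : star_poly) (alpha : rat) (w : wit) : bool :=
  halts e (pickle (p, w.1.1)) (pickle w.2) w.1.2 && (w.2 + off w.1.1 < alpha).
Definition upper e p alpha := exists w, D e p alpha w.

Lemma C_off (T : countType) (k : T -> nat) : C k -> C (fun x => off (k x)).
Proof. by move=> h; rewrite /off; case: b; [apply: C_qn; comp|exact: C_const]. Qed.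

Lemma C_D (T : countType) (e : T -> nat) (p : T -> star_poly) (al : T -> rat) (w : T -> wit) :
  C e -> C p -> C al -> C w -> C (fun x => D (e x) (p x) (al x) (w x)).
Proof.
move=> he hp hal hw; rewrite /D.
refine (C_andb (f := fun x => halts (e x) (pickle (p x, (w x).1.1)) (pickle (w x).2) (w x).1.2)
  (g := fun x => (w x).2 + off (w x).1.1 < al x) _ _).
  refine (C_halts (e := e) (n := fun x => pickle (p x, (w x).1.1)) (m := fun x => pickle (w x).2)
    (t := fun x => (w x).1.2) he _ _ _).
  - by refine (C_pickle (f := fun x => (p x, (w x).1.1)) _); comp.
  - by refine (C_pickle (f := fun x => (w x).2) _); comp.
  - by comp.
refine (C_ltq (f := fun x => (w x).2 + off (w x).1.1) (g := al) _ hal).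
refine (C_addq (f := fun x => (w x).2) (g := fun x => off (w x).1.1) _ _); first by comp.
by refine (C_off (k := fun x => (w x).1.1) _); comp.
Qed.

Ltac comp_D := repeat (first [ progress (cbv beta) | comp_step
  | lazymatch goal with
  | |- C (fun x => D (@?e x) (@?p x) (@?al x) (@?w x)) => refine (C_D (e := e) (p := p) (al := al) (w := w) _ _ _ _)
  | |- C (fun x => qn (@?f x) (@?g x)) => refine (C_qn (f := f) (g := g) _ _)
  | |- C (fun x => pmul (@?f x) (@?g x)) => refine (C_pmul (f := f) (g := g) _ _)
  | |- C (fun x => pstar (@?f x)) => refine (C_pstar (f := f) _)
  | |- C (fun x => pscale (@?f x) (@?g x)) => refine (C_pscale (z := f) (f := g) _ _)
  | |- C (fun x => psub (@?f x) (@?g x)) => refine (C_psub (f := f) (g := g) _ _)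
  | |- C (fun x => cert_ok (@?f x) (@?g x)) => refine (C_cert_ok (k := f) (c := g) _ _)
  | |- C (fun x => cert_reqs (@?f x) (@?g x) (@?h x) (@?i x)) =>
     refine (C_cert_reqs (p := f) (bs := g) (k := h) (c := i) _ _ _ _)
  | |- C (fun x => off (@?f x)) => refine (C_off (k := f) _)
  | |- C (fun x => pickle (@?f x)) => refine (C_pickle (f := f) _)
  | |- C (fun x => gpzero (@?f x)) => refine (C_gpzero (f := f) _) end ]).

Let w0 : wit := (0%N, 0%N, 0).
Ltac enums := do ![exact: enum_cert|exact: enum_star_poly|exact: enum_rat|exact: enum_nat|exact: enum_bool|apply: enum_pair|apply: enum_seq].
Ltac pi Q := apply: (@piC_ext _ [set e | forall y, exists z, Q e y z]);
  last (by apply: piC_enum; [enums|enums|comp_D]).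

Lemma core_pos : piC [set e | forall p alpha, upper e p alpha -> 0 < alpha].
Proof.
pi (fun e (y : star_poly * (rat * wit)) (z : nat) => D e y.1 y.2.1 y.2.2 ==> (0 < y.2.1)).
move=> e; split=> [h [p [al w]]|h p al [w hw]].
  by exists 0%N; apply/implyP => hw; apply: (h p); exists w.
by have [_] := h (p, (al, w)); rewrite /= hw.
Qed.

Lemma core_total : piC [set e | forall p, exists alpha, upper e p alpha].
Proof.
pi (fun e (y : star_poly) (z : rat * wit) => D e y z.1 z.2).
move=> e; split=> h p; have := h p; first by move=> [al [w hw]]; exists (al, w).
by move=> [[al w] hw]; exists al, w.
Qed.

Lemma core_nil : piC [set e | forall k : nat, upper e [::] (qn 1 k.+1)].
Proof.
pi (fun e (y : nat) (z : wit) => D e [::] (qn 1 y.+1) z).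
by move=> e; split=> h k; have [w hw] := h k; exists w.
Qed.

(** An existential premise joins the universal block, since [(exists w, D w) -> X] amounts to
    [forall w, D w -> X]; the conclusion keeps its own witness, for which [w0] is a filler when the
    premise fails. The next lemmas of this kind follow the same pattern. *)
Lemma core_eq : piC [set e | forall p q alpha, gpzero (psub p q) -> upper e p alpha -> upper e q alpha].
Proof.
pi (fun e (y : (star_poly * star_poly) * (rat * wit)) (z : wit) =>
  (gpzero (psub y.1.1 y.1.2) && D e y.1.1 y.2.1 y.2.2) ==> D e y.1.2 y.2.1 z).
move=> e; split=> [h [[p q] [al w]]|h p q al pq [w hw]].
  case E: (_ && _); last by exists w0.
  by move/andP: E => [h1 h2]; have [|w' hw'] := h p q al h1; [exists w|exists w'].
by have [w'] := h ((p, q), (al, w)); rewrite /= hw pq /= => hw'; exists w'.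
Qed.

Lemma core_add : piC [set e | forall p q alpha beta, upper e p alpha -> upper e q beta ->
  upper e (p ++ q) (alpha + beta)].
Proof.
pi (fun e (y : (star_poly * star_poly) * (rat * rat) * (wit * wit)) (z : wit) =>
  (D e y.1.1.1 y.1.2.1 y.2.1 && D e y.1.1.2 y.1.2.2 y.2.2) ==>
  D e (y.1.1.1 ++ y.1.1.2) (y.1.2.1 + y.1.2.2) z).
move=> e; split=> [h [[[p q] [al be]] [w w']]|h p q al be [w hw] [w' hw']].
  case E: (_ && _); last by exists w0.
  by move/andP: E => [h1 h2]; have [||w2 hw2] := h p q al be; [exists w|exists w'|exists w2].
by have [w2] := h ((p, q), (al, be), (w, w')); rewrite /= hw hw' /= => hw2; exists w2.
Qed.

Lemma core_mul : piC [set e | forall p q alpha beta, upper e p alpha -> upper e q beta ->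
  upper e (pmul p q) (alpha * beta)].
Proof.
pi (fun e (y : (star_poly * star_poly) * (rat * rat) * (wit * wit)) (z : wit) =>
  (D e y.1.1.1 y.1.2.1 y.2.1 && D e y.1.1.2 y.1.2.2 y.2.2) ==>
  D e (pmul y.1.1.1 y.1.1.2) (y.1.2.1 * y.1.2.2) z).
move=> e; split=> [h [[[p q] [al be]] [w w']]|h p q al be [w hw] [w' hw']].
  case E: (_ && _); last by exists w0.
  by move/andP: E => [h1 h2]; have [||w2 hw2] := h p q al be; [exists w|exists w'|exists w2].
by have [w2] := h ((p, q), (al, be), (w, w')); rewrite /= hw hw' /= => hw2; exists w2.
Qed.

Lemma core_scale : piC [set e | forall z p alpha gamma, upper e p alpha -> 0 < gamma ->
  (z.1 * z.1 + z.2 * z.2) * (alpha * alpha) < gamma * gamma -> upper e (pscale z p) gamma].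
Proof.
pi (fun e (y : (rat * rat) * star_poly * ((rat * rat) * wit)) (z : wit) =>
  [&& D e y.1.2 y.2.1.1 y.2.2, 0 < y.2.1.2 &
    (y.1.1.1 * y.1.1.1 + y.1.1.2 * y.1.1.2) * (y.2.1.1 * y.2.1.1) < y.2.1.2 * y.2.1.2] ==>
  D e (pscale y.1.1 y.1.2) y.2.1.2 z).
move=> e; split=> [h [[z p] [[al ga] w]]|h z p al ga [w hw] g0 hz].
  case E: [&& _, _ & _]; last by exists w0.
  by move/and3P: E => [h1 h2 h3]; have [|||w2 hw2] := h z p al ga; [exists w| | |exists w2].
by have [w2] := h ((z, p), ((al, ga), w)); rewrite /= hw g0 hz /= => hw2; exists w2.
Qed.

Lemma core_star : piC [set e | forall p alpha, 0 < alpha ->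
  upper e (pmul (pstar p) p) (alpha * alpha) -> upper e p alpha].
Proof.
pi (fun e (y : star_poly * (rat * wit)) (z : wit) =>
  ((0 < y.2.1) && D e (pmul (pstar y.1) y.1) (y.2.1 * y.2.1) y.2.2) ==> D e y.1 y.2.1 z).
move=> e; split=> [h [p [al w]]|h p al a0 [w hw]].
  case E: (_ && _); last by exists w0.
  by move/andP: E => [h1 h2]; have [|w2 hw2] := h p al h1; [exists w|exists w2].
by have [w2] := h (p, (al, w)); rewrite /= hw a0 /= => hw2; exists w2.
Qed.

(** The witnesses of all requirements are pooled in one finite list, so a bounded conjunction of
    existential statements becomes a single one. *)
Lemma core_cert : piC [set e | forall p bs k, exists c, cert_ok k c /\
  forall r, r \in cert_reqs p bs k c -> upper e r.1 r.2].
Proof.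
pi (fun e (y : star_poly * seq star_poly * nat) (z : cert * seq wit) => cert_ok y.2 z.1 &&
  all (fun r : star_poly * rat => has (fun w : wit => D e r.1 r.2 w) z.2) (cert_reqs y.1.1 y.1.2 y.2 z.1)).
move=> e; split=> [h [[p bs] k]|h p bs k].
  have [c [okc hc]] := h p bs k.
  suff [W hW] : exists W, all (fun r : star_poly * rat => has (fun w : wit => D e r.1 r.2 w) W) (cert_reqs p bs k c).
    by exists (c, W); rewrite okc.
  elim: (cert_reqs p bs k c) hc => [|r s IH] hc; first by exists [::].
  have [|W hW] := IH; first by move=> r' rs; apply: hc; rewrite inE rs orbT.
  have [w hw] := hc r (mem_head _ _); exists (w :: W); rewrite /= hw /=.
  by apply: sub_all hW => r' /= ->; rewrite orbT.
have [[c W] /andP[okc /allP hW]] := h (p, bs, k); exists c; split=> // r /hW /hasP[w _ hw].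
by exists w.
Qed.

Lemma core_piC : piC [set e | core (upper e)].
Proof.
apply: piC_ext (piCI core_total (piCI core_pos (piCI core_nil (piCI core_eq (piCI core_add
  (piCI core_scale (piCI core_mul (piCI core_star core_cert)))))))) => e.
by [].
Qed.

Definition totality e := forall (p : star_poly) (k : nat), exists r : rat, phi e (pickle (p, k)) (pickle r).
Definition approx e (p : star_poly) (k : nat) (r : rat) := phi e (pickle (p, k)) (pickle r).

Lemma totality_piC : piC [set e | totality e].
Proof.
pi (fun e (y : star_poly * nat) (z : rat * nat) => halts e (pickle (y.1, y.2)) (pickle z.1) z.2).
move=> e; split=> [h [p k]|h p k]; first by have [r /phiP[t ht]] := h p k; exists (r, t).
by have [[r t] ht] := h (p, k); exists r; apply/phiP; exists t.
Qed.

Lemma decreasing_piC : piC [set e | forall p k r r', approx e p k r -> approx e p k.+1 r' -> r' <= r].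
Proof.
pi (fun e (y : star_poly * nat * ((rat * rat) * (nat * nat))) (z : nat) =>
  (halts e (pickle (y.1.1, y.1.2)) (pickle y.2.1.1) y.2.2.1 &&
   halts e (pickle (y.1.1, y.1.2.+1)) (pickle y.2.1.2) y.2.2.2) ==> (y.2.1.2 <= y.2.1.1)).
move=> e; split=> [h [[p k] [[r r'] [t t']]]|h p k r r' /phiP[t ht] /phiP[t' ht']].
  by exists 0%N; apply/implyP => /andP[h1 h2]; apply: (h p k); apply/phiP; [exists t|exists t'].
by have [_] := h ((p, k), ((r, r'), (t, t'))); rewrite /= ht ht'.
Qed.

(** Expresses that the norm lies strictly between [r - 2^-k] and [r + 2^-k] in terms of outputs
    alone: one output certifies a smaller upper bound, another a larger lower bound. [consistent]
    forbids lower bounds above upper bounds. *)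
Definition tight e := forall p k r, approx e p k r ->
  (exists m r', approx e p m r' /\ r' + qn 1 (2 ^ m) < r + qn 1 (2 ^ k)) /\
  (exists m r', approx e p m r' /\ r - qn 1 (2 ^ k) < r' - qn 1 (2 ^ m)).

Definition consistent e := forall p k m r r', approx e p k r -> approx e p m r' ->
  r - qn 1 (2 ^ k) <= r' + qn 1 (2 ^ m).

Lemma tight_piC : piC [set e | tight e].
Proof.
pi (fun e (y : star_poly * nat * (rat * nat)) (z : (nat * (rat * nat)) * (nat * (rat * nat))) =>
  halts e (pickle (y.1.1, y.1.2)) (pickle y.2.1) y.2.2 ==>
  [&& halts e (pickle (y.1.1, z.1.1)) (pickle z.1.2.1) z.1.2.2,
      z.1.2.1 + qn 1 (2 ^ z.1.1) < y.2.1 + qn 1 (2 ^ y.1.2),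
      halts e (pickle (y.1.1, z.2.1)) (pickle z.2.2.1) z.2.2.2 &
      y.2.1 + (- qn 1 (2 ^ y.1.2)) < z.2.2.1 + (- qn 1 (2 ^ z.2.1))]).
move=> e; split=> [h [[p k] [r t]]|h p k r /phiP[t ht]].
  have [hr|] := boolP (halts e (pickle (p, k)) (pickle r) t); last by exists ((0%N, (0, 0%N)), (0%N, (0, 0%N))).
  have [|[m [r1 [/phiP[t1 h1] q1]]] [m' [r2 [/phiP[t2 h2] q2]]]] := h p k r; first by apply/phiP; exists t.
  by exists ((m, (r1, t1)), (m', (r2, t2))); rewrite /= h1 q1 h2 q2.
have [[[m [r1 t1]] [m' [r2 t2]]]] := h ((p, k), (r, t)); rewrite /= ht /= => /and4P[h1 q1 h2 q2].
split; [exists m, r1|exists m', r2]; split=> //; apply/phiP; by [exists t1|exists t2].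
Qed.

Lemma consistent_piC : piC [set e | consistent e].
Proof.
pi (fun e (y : star_poly * (nat * nat) * ((rat * rat) * (nat * nat))) (z : nat) =>
  (halts e (pickle (y.1.1, y.1.2.1)) (pickle y.2.1.1) y.2.2.1 &&
   halts e (pickle (y.1.1, y.1.2.2)) (pickle y.2.1.2) y.2.2.2) ==>
   (y.2.1.1 + (- qn 1 (2 ^ y.1.2.1)) <= y.2.1.2 + qn 1 (2 ^ y.1.2.2))).
move=> e; split=> [h [[p [k m]] [[r r'] [t t']]]|h p k m r r' /phiP[t ht] /phiP[t' ht']].
  by exists 0%N; apply/implyP => /andP[h1 h2]; apply: (h p k m); apply/phiP; [exists t|exists t'].
by have [_] := h ((p, (k, m)), ((r, r'), (t, t'))); rewrite /= ht ht'.
Qed.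
End Formula.

(** * Algebras from upper bounds on norms *)

Section Core.
Variable R : realType.
Local Notation gauss := (@gaussian_rat R).

Lemma cabs_sq (k : R[i]) : cabs k ^+ 2 = complex.Re k ^+ 2 + complex.Im k ^+ 2.
Proof.
have -> : cabs k = Num.sqrt (complex.Re k ^+ 2 + complex.Im k ^+ 2) by case: k.
by rewrite sqr_sqrtr // addr_ge0 // sqr_ge0.
Qed.

Lemma cabs_gauss_sq z : cabs (gauss z) ^+ 2 = ratr (z.1 * z.1 + z.2 * z.2).
Proof. by rewrite cabs_sq /= rmorphD !rmorphM !expr2. Qed.

Lemma rat_between (x y : R) : x < y -> exists q : rat, x < ratr q < y.
Proof. by move=> /rat_in_itvoo[q]; rewrite in_itv /= => h; exists q. Qed.

Lemma gpzero_coef (p : star_poly) w : gpzero p -> gpcoef p w = 0.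
Proof.
move=> /allP h; have [/hasP[m mp /eqP <-]|no] := boolP (has (fun m => m.2 == w) p).
  by apply/eqP; exact: h.
rewrite gpcoefE big1_seq // => m /andP[mw mp]; case/hasP: no; by exists m.
Qed.
Lemma gpzero_peq p q : gpzero (psub p q) -> peq p q.
Proof. by move=> h w; apply/eqP; rewrite -subr_eq0 -coef_sub gpzero_coef. Qed.

Lemma core_of_algebra (A : cstarType R) (a : nat -> A) (U : star_poly -> rat -> Prop) :
  presentation a -> simple_cstar A -> AF A ->
  (forall p alpha, U p alpha <-> cnorm (generated_point a p) < ratr alpha) -> core U.
Proof.
move=> pa simp af UN; pose G := generated_point a.
have rpos (q : rat) : 0 < q -> 0 < ratr q :> R by rewrite ltr0q.
refine (conj _ (conj _ (conj _ (conj _ (conj _ (conj _ (conj _ (conj _ _)))))))).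
- move=> p; have [|q /andP[h _]] := @rat_between (cnorm (G p)) (cnorm (G p) + 1); first by rewrite ltrDl.
  by exists q; apply/UN.
- by move=> p al /UN h; rewrite -(ltr0q R); exact: le_lt_trans (cnorm_ge0 _) h.
- by move=> k; apply/UN; rewrite /generated_point big_nil cnorm0 ratr_qn // divr_gt0.
- move=> p q al /(gen_zero a); rewrite genB => /eqP; rewrite subr_eq0 => /eqP e /UN h.
  by apply/UN; rewrite -e.
- move=> p q al be /UN h1 /UN h2; apply/UN; rewrite genD rmorphD.
  by apply: le_lt_trans (cnormD _ _) _; rewrite ltrD.
- move=> z p al ga /UN h1 g0 hz; apply/UN; rewrite genZ cnormZ.
  have hz' : cabs (gauss z) ^+ 2 * ratr al ^+ 2 < ratr ga ^+ 2 :> R.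
    by rewrite cabs_gauss_sq !expr2 -!rmorphM /= ltr_rat.
  have g0' := rpos _ g0; have c0 := cabs_ge0 (gauss z); have n0 := cnorm_ge0 (generated_point a p).
  apply: (@le_lt_trans _ _ (cabs (gauss z) * ratr al)); first by rewrite ler_wpM2l // ltW.
  have ca0 : 0 <= cabs (gauss z) * ratr al by rewrite mulr_ge0 // (le_trans n0) // ltW.
  by rewrite -(@ltr_pXn2r _ 2) ?nnegrE ?(ltW g0') // exprMn.
- move=> p q al be /UN h1 /UN h2; apply/UN; rewrite genM rmorphM.
  by apply: le_lt_trans (cnormM_le _ _) _; rewrite ltr_pM ?cnorm_ge0.
- move=> p al al0 /UN h; apply/UN; move: h; rewrite genM genS cnorm_cstar rmorphM -expr2.
  by rewrite ltr_pXn2r // nnegrE ?cnorm_ge0 // ltW // rpos.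
- move=> p bs k; have [c [okc hc]] := simple_AF_certified pa simp af p bs k.
  by exists c; split=> // r /hc /UN.
Qed.

(** [N p] is the infimum of the bounds of [p]. Upward closure and openness of [U] turn [U p alpha]
    into [N p < alpha]; the clauses of [core] then say that [N] is a C*-seminorm, and that the
    certificates hold in its completion. *)
Lemma algebra_of_core (U : star_poly -> rat -> Prop) :
  (forall p alpha beta, U p alpha -> alpha <= beta -> U p beta) ->
  (forall p alpha, U p alpha -> exists2 beta, beta < alpha & U p beta) -> core U ->
  exists (A : cstarType R) (a : nat -> A), [/\ presentation a, simple_cstar A, AF A &
    forall p alpha, U p alpha <-> cnorm (generated_point a p) < ratr alpha].
Proof.
move=> Uup Uopen [K1 [K2 [K3 [K4 [K5 [K6 [K7 [K8 K9]]]]]]]].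
have /choice[N hN] : forall p, exists n : R, forall al, U p al <-> n < ratr al.
  move=> p; pose E : set R := [set ratr al | al in U p].
  have hE : has_inf E.
    split; first by have [al hal] := K1 p; exists (ratr al), al.
    by exists 0 => _ [al /K2 al0 <-]; rewrite ler0q ltW.
  exists (inf E) => al; split=> [/Uopen[be ba Ube]|h].
    apply: (@le_lt_trans _ _ (ratr be)); last by rewrite ltr_rat.
    by apply: ge_inf; [case: hE|exists be].
  have [||x [be Ube <-] hbe] := @inf_adherent R E (ratr al - inf E); [by rewrite subr_gt0|exact: hE|].
  by move: hbe; rewrite addrC subrK ltr_rat => /ltW; exact: Uup.
have near p e : 0 < e -> exists al, [/\ U p al, N p < ratr al & ratr al < N p + e].
  move=> e0; have [|q /andP[h1 h2]] := @rat_between (N p) (N p + e); first by rewrite ltrDl.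
  by exists q; split=> //; apply/hN.
have N_ge0 p : 0 <= N p.
  rewrite leNgt; apply/negP => n0; have [q /andP[h1 h2]] := rat_between n0.
  by have /K2 := (hN p q).2 h1; rewrite -(ltr0q R) ltNge (ltW h2).
have N_nil : N [::] = 0.
  apply: eps_eq0 => // e e0; have [k hk] := evt_ex (evt_nat_ge e^-1).
  have := (hN [::] (qn 1 k.+1)).1 (K3 k); rewrite ratr_qn // mul1r => /ltW h.
  apply: le_trans h _; rewrite -[e]invrK lef_pV2 ?posrE ?invr_gt0 //.
  by apply: le_trans hk _; rewrite ler_nat.
have N_cat p q : N (p ++ q) <= N p + N q.
  apply/ler_addgt0Pr => e e0; have e2 : 0 < e / 2 by rewrite divr_gt0.
  have [al [h1 _ h2]] := near p _ e2; have [be [h3 _ h4]] := near q _ e2.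
  by have /hN := K5 _ _ _ _ h1 h3; rewrite rmorphD /=; lra.
have N_scale z p : N (pscale z p) <= cabs (gauss z) * N p.
  apply/ler_addgt0Pr => e e0; have c0 := cabs_ge0 (gauss z).
  have [d d0 hd] := small_product c0 (N_ge0 p) e0; have [al [h1 h2 h3]] := near p d d0.
  have al0 : 0 < ratr al :> R by apply: le_lt_trans h2.
  have lt1 : cabs (gauss z) * ratr al < cabs (gauss z) * N p + e.
    apply: lt_le_trans hd; apply: (@le_lt_trans _ _ (cabs (gauss z) * (N p + d))).
      by rewrite ler_wpM2l // ltW.
    by rewrite ltr_pM2r ?ltrDl //; have := N_ge0 p; lra.
  have [ga /andP[g1 g2]] := rat_between lt1.
  have ca0 : 0 <= cabs (gauss z) * ratr al by rewrite mulr_ge0 // ltW.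
  have ga0 : 0 < ratr ga :> R by apply: le_lt_trans g1.
  have : U (pscale z p) ga.
    apply: K6 h1 _ _; first by rewrite -(ltr0q R).
    rewrite -(ltr_rat R) !rmorphM /= -cabs_gauss_sq -!expr2 -exprMn.
    by rewrite ltr_pXn2r // nnegrE // ltW.
  by move/hN => h; apply: ltW; apply: lt_trans g2.
have N_mul p q : N (pmul p q) <= N p * N q.
  apply/ler_addgt0Pr => e e0; have [d d0 hd] := small_product (N_ge0 p) (N_ge0 q) e0.
  have [al [h1 h1' h2]] := near p _ d0; have [be [h3 h3' h4]] := near q _ d0.
  have /hN := K7 _ _ _ _ h1 h3; rewrite rmorphM /= => h; apply: ltW; apply: lt_le_trans h _.
  apply: le_trans hd; apply: ler_pM; try exact: ltW; apply: ltW.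
    exact: le_lt_trans (N_ge0 p) h1'.
  exact: le_lt_trans (N_ge0 q) h3'.
have N_star p : N p ^+ 2 <= N (pmul (pstar p) p).
  rewrite leNgt; apply/negP => h; set m := N (pmul (pstar p) p) in h.
  have m0 : 0 <= m by exact: N_ge0.
  have : Num.sqrt m < N p.
    by rewrite -(@ltr_pXn2r _ 2) ?nnegrE ?sqrtr_ge0 // sqr_sqrtr.
  move=> /rat_between[al /andP[h1 h2]].
  have al0 : 0 < ratr al :> R by apply: le_lt_trans h1; exact: sqrtr_ge0.
  have /hN : U p al.
    apply: K8; first by rewrite -(ltr0q R).
    apply/hN; rewrite rmorphM /= -expr2 -/m -[m]sqr_sqrtr // ltr_pXn2r // nnegrE ?sqrtr_ge0 //.
    exact: ltW.
  by rewrite ltNge (ltW h2).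
have N_eq p q : gpzero (psub p q) -> N p = N q.
  move=> h; have h' : gpzero (psub q p) by apply: peq_zero => w; rewrite (gpzero_peq h).
  have le p' q' : gpzero (psub p' q') -> N q' <= N p'.
    move=> h1; apply/ler_addgt0Pr => e e0; have [al [h2 _ h3]] := near p' e e0.
    by have /hN h4 := K4 _ _ _ h1 h2; apply: ltW; apply: lt_trans h3.
  by apply: le_anti; rewrite !le.
have [pa hn] := completion_presents N_ge0 N_nil N_cat N_scale N_mul N_star N_eq.
set A := completion _ _ _ _ _ _ _ in pa hn; set a := completion_var _ _ _ _ _ _ _ in pa hn.
have [|simp af] := @certified_simple_AF R A a pa.
  move=> p bs k; have [c [okc hc]] := K9 p bs k; exists c; split=> // r /hc /hN h; by rewrite hn.
by exists A, a; split=> // p al; rewrite hn.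
Qed.
End Core.

(** * Membership and hardness *)

Section Membership.
Variable R : realType.

Lemma approx_fun e p k r r' : approx e p k r -> approx e p k r' -> r = r'.
Proof. by move=> h1 h2; apply: pickle_inj; exact: phi_fun h1 h2. Qed.

Lemma upper_up b e p (al be : rat) : upper b e p al -> al <= be -> upper b e p be.
Proof. by move=> [w /andP[h1 h2]] ab; exists w; rewrite /D h1 (lt_le_trans h2). Qed.
Lemma upper_open b e p (al : rat) : upper b e p al -> exists2 be, be < al & upper b e p be.
Proof.
move=> [w /andP[h1 h2]]; have [h3 h4] := midf_lt h2.
by exists ((w.2 + off b w.1.1 + al) / 2) => //; exists w; rewrite /D h1.
Qed.
Lemma upperP b e p al : upper b e p al <-> exists k r, approx e p k r /\ r + off b k < al.
Proof.
split=> [[[[k t] r] /andP[h1 h2]]|[k [r [/phiP[t ht] h]]]]; last by exists (k, t, r); rewrite /D ht.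
by exists k, r; split=> //; apply/phiP; exists t.
Qed.

Lemma ratr_pow2 k : ratr (qn 1 (2 ^ k)) = halves R k.
Proof. by rewrite ratr_qn ?expn_gt0 // natrX mul1r /halves exprVn. Qed.

Lemma qn0 : qn 0 1 = 0. Proof. by rewrite /qn fracqE /= mul0r. Qed.

(** The terms of a decreasing sequence are upper bounds of its limit, so the offset is 0; conversely
    the norm constructed by [algebra_of_core] is the infimum of the outputs, hence their limit. *)
Lemma ce_indices e : ce_simple_AF_indices R e <-> [/\ totality e,
  forall p k r r', approx e p k r -> approx e p k.+1 r' -> r' <= r & core (upper false e)].
Proof.
split=> [[A [a [pa ce simp af]]]|[tot dec cor]].
  split=> [p k|p k r r' h h'|].
  - by have [r [hr _ _]] := ce p; exists (r k).
  - by have [s [hs ds _]] := ce p; rewrite (approx_fun h (hs k)) (approx_fun h' (hs k.+1)).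
  - apply: (core_of_algebra pa simp af) => p al; have [s [hs ds cs]] := ce p.
    have ni : {homo (fun k => ratr (s k) : R) : n m / (n <= m)%N >-> m <= n}.
      by apply/nonincreasing_seqP => k; rewrite ler_rat.
    rewrite upperP; split=> [[k [r [h]]]|h].
      rewrite /off qn0 addr0 (approx_fun h (hs k)) -(ltr_rat R); apply: le_lt_trans.
      have := nonincreasing_cvgn_ge ni (cvgP _ cs) k; rewrite (cvg_lim _ cs) //.
    have /cvgrPdist_lt := cs; move=> /(_ (ratr al - cnorm (generated_point a p))).
    rewrite subr_gt0 => /(_ h) [K _ hK]; exists K, (s K); split; first exact: hs.
    rewrite /off qn0 addr0 -(ltr_rat R); have := hK K (leqnn K).
    by rewrite /= ltr_distlC => /andP[_]; rewrite addrC subrK.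
have [A [a [pa simp af hU]]] := algebra_of_core R (@upper_up false e) (@upper_open false e) cor.
exists A, a; split=> // p; have /choice[s hs] := tot p; exists s.
have ds k : s k.+1 <= s k by apply: (dec p k); exact: hs.
split=> //; set n := cnorm _.
have ge k : n <= ratr (s k).
  apply/ler_addgt0Pr => d d0; have [|q /andP[h1 h2]] := @rat_between R (ratr (s k)) (ratr (s k) + d).
    by rewrite ltrDl.
  apply: ltW; apply: lt_trans h2; apply/hU/upperP; exists k, (s k); split; first exact: hs.
  by rewrite /off qn0 addr0 -(ltr_rat R).
apply/cvgrPdist_lt => d d0; have [|q /andP[h1 h2]] := @rat_between R n (n + d); first by rewrite ltrDl.
have /upperP[k [r [h3]]] := (hU p q).2 h1; rewrite /off qn0 addr0 (approx_fun h3 (hs k)) // => h4.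
exists k => // m /= km; rewrite distrC ger0_norm ?subr_ge0 // ltrBlDr addrC.
apply: lt_trans h2; apply: le_lt_trans (_ : ratr (s k) < _); last by rewrite ltr_rat.
rewrite ler_rat; elim: m km => [|m IH]; first by rewrite leqn0 => /eqP ->.
by rewrite leq_eqVlt => /orP[/eqP -> //|/IH]; apply: le_trans.
Qed.

(** The upper bounds [r + 2^-k] already determine the algebra through [core]; [tight] and
    [consistent] tie the lower bounds [r - 2^-k] to the same norm. *)
Lemma computable_indices e : computable_simple_AF_indices R e <->
  [/\ totality e, tight e, consistent e & core (upper true e)].
Proof.
have small (d : R) : 0 < d -> exists m, halves R m + halves R m < d.
  move=> d0; have [|m hm] := @halves_small R (d / 3); first by rewrite divr_gt0.
  by exists m; have := hm m (leqnn m); lra.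
split=> [[A [a [pa comp simp af]]]|[tot tig con cor]].
  have two k : 2 ^- k = halves R k by rewrite /halves exprVn.
  have ap p k r : approx e p k r -> `|ratr r - cnorm (generated_point a p)| < halves R k.
    by have [s [hs h]] := comp p k => hr; rewrite (approx_fun hr hs) -two.
  split=> [p k|p k r hr|p k m r r' hr hr'|].
  - by have [r [hr _]] := comp p k; exists r.
  - have := ap _ _ _ hr; rewrite ltr_norml => /andP[h1 h2]; set n := cnorm _ in h1 h2.
    split.
      have [|m hm] := small (ratr r + halves R k - n); first by lra.
      have [s [hs _]] := comp p m; have := ap _ _ _ hs; rewrite ltr_norml -/n => /andP[h3 h4].
      by exists m, s; split=> //; rewrite -(ltr_rat R) !rmorphD /= !ratr_pow2; lra.
    have [|m hm] := small (n - (ratr r - halves R k)); first by lra.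
    have [s [hs _]] := comp p m; have := ap _ _ _ hs; rewrite ltr_norml -/n => /andP[h3 h4].
    by exists m, s; split=> //; rewrite -(ltr_rat R) !rmorphB /= !ratr_pow2; lra.
  - have := ap _ _ _ hr; have := ap _ _ _ hr'; rewrite !ltr_norml => /andP[h1 h2] /andP[h3 h4].
    by rewrite -(ler_rat R) rmorphB rmorphD /= !ratr_pow2; lra.
  - apply: (core_of_algebra pa simp af) => p al; rewrite upperP; split=> [[k [r [hr h]]]|h].
      have := ap _ _ _ hr; rewrite ltr_norml => /andP[h1 h2].
      by move: h; rewrite -(ltr_rat R) rmorphD /= ratr_pow2; lra.
    have [|m hm] := small (ratr al - cnorm (generated_point a p)); first by rewrite subr_gt0.
    have [s [hs _]] := comp p m; exists m, s; split=> //.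
    have := ap _ _ _ hs; rewrite ltr_norml => /andP[h1 h2].
    by rewrite -(ltr_rat R) rmorphD /= ratr_pow2; lra.
have [A [a [pa simp af hU]]] := algebra_of_core R (@upper_up true e) (@upper_open true e) cor.
exists A, a; split=> // p k; have [r hr] := tot p k; exists r; split=> //.
have -> : 2 ^- k = halves R k by rewrite /halves exprVn.
have [[m [r1 [h1 q1]]] [m' [r2 [h2 q2]]]] := tig p k r hr.
have b1 : cnorm (generated_point a p) < ratr r + halves R k.
  rewrite -ratr_pow2 -rmorphD; apply/hU/upperP; exists m, r1; by split.
have b2 : ratr r - halves R k < cnorm (generated_point a p).
  rewrite -ratr_pow2 -rmorphB; apply: (@lt_le_trans _ _ (ratr (r2 - qn 1 (2 ^ m')))); first by rewrite ltr_rat.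
  (* A norm below the certified lower bound would itself have an output as upper bound below it,
     against [consistent]. *)
  rewrite leNgt; apply/negP => /hU/upperP[j [s [hs hlt]]].
  by have := con p m' j r2 s h2 hs; rewrite leNgt hlt.
by rewrite ltr_norml; apply/andP; split; lra.
Qed.

Lemma ce_Pi02 : Pi02 (ce_simple_AF_indices R).
Proof.
apply: piC_Pi02; apply: piC_ext (piCI totality_piC (piCI decreasing_piC (core_piC false))) => e.
by rewrite ce_indices; split=> [[]|[? []]].
Qed.

Lemma computable_Pi02 : Pi02 (computable_simple_AF_indices R).
Proof.
apply: piC_Pi02.
apply: piC_ext (piCI totality_piC (piCI tight_piC (piCI consistent_piC (core_piC true)))) => e.
by rewrite computable_indices; split=> [[]|[? [? []]]].
Qed.
End Membership.

Section Hardness.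

Lemma trivial_core : core (fun _ (alpha : rat) => 0 < alpha).
Proof.
have q0 m d : (0 < m)%N -> (0 < d)%N -> 0 < qn m d by move=> m0 d0; rewrite /qn fracqE /= divr_gt0 ?ltr0z.
refine (conj _ (conj _ (conj _ (conj _ (conj _ (conj _ (conj _ (conj _ _)))))))) => //.
- by move=> _; exists 1.
- by move=> k; exact: q0.
- by move=> _ _ al be; exact: addr_gt0.
- by move=> _ _ al be; exact: mulr_gt0.
(* The empty system with empty combinations and the flag for small norm; the precision is the least
   value that [cert_ok] admits for [n = L = 0]. *)
- move=> p bs k; exists ((0%N, [::], [::]), ([::], ([::], [::])), (0%N, (96 * 16 * 1 ^ 2 * k.+1 * (3 * 0 + 4) ^ 1)%N, true)).
  split; first by rewrite /cert_ok /c_n /c_L /c_D /=.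
  by apply/(@cert_reqsP p bs k _ (fun _ al => 0 < al)); split=> // l _; exact: q0.
Qed.

Lemma decode_pair (T U : countType) (x : T) (y : U) :
  CodeSeq.decode (pickle (x, y)) = [:: pickle x; pickle y].
Proof. exact: (CodeSeq.codeK [:: pickle x; pickle y]). Qed.

(** [search_machine] outputs successors only, so the code of the rational 0 must be one. *)
Lemma pickle_rat0 : exists c, pickle (0 : rat) = c.+1.
Proof. by case E: (pickle (0 : rat)) => [|c]; [|exists c]. Qed.

Lemma hard (S : set nat) :
  (forall e, S e -> totality e) ->
  (forall e, (forall p k, approx e p k 0) -> S e) ->
  forall B : set nat, Pi02 B -> many_one_reducible B S.
Proof.
move=> Stot S0 B [P [eP hP] hB]; have [c ec] := pickle_rat0.
(* [P] is given by the machine [eP] only, so its truth is detected by simulation. The single bound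
   [z] limits both the candidate [w] and the clock, which makes [Q] monotone in [z] and lets
   finitely many searches succeed together. Entry 1 of the decoded input is [k]. *)
pose Q (x m z : nat) := all (fun y => has (fun w => halts eP (pickle (x, y, w)) 1 z) (iota 0 z.+1))
  (iota 0 (nth 0%N (CodeSeq.decode m) 1).+1).
have cQ : C (fun x : nat * nat * nat => Q x.1.1 x.1.2 x.2).
  rewrite /Q; refine (C_all (l := fun x : nat * nat * nat => iota 0 (nth 0%N (CodeSeq.decode x.1.2) 1).+1)
    (p := fun x y => has (fun w => halts eP (pickle (x.1.1, y, w)) 1 x.2) (iota 0 x.2.+1)) _ _); first by comp.
  refine (C_has (l := fun x : nat * nat * nat * nat => iota 0 x.1.2.+1)
    (p := fun x w => halts eP (pickle (x.1.1.1, x.2, w)) 1 x.1.2) _ _); first by comp.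
  refine (C_halts (e := fun=> eP) (n := fun x : nat * nat * nat * nat * nat => pickle (x.1.1.1.1, x.1.2, x.2))
    (m := fun=> 1%N) (t := fun x => x.1.1.2) _ _ _ _); try by comp.
  by refine (C_pickle (f := fun x : nat * nat * nat * nat * nat => (x.1.1.1.1, x.1.2, x.2)) _); comp.
have [M [cM M1 M2]] := search_machine c cQ.
have QP x (p : star_poly) (k : nat) : (exists z, Q x (pickle (p, k)) z) <->
    forall y, (y <= k)%N -> exists w, P x y w.
  have hw (y w : nat) t : halts eP (pickle (x, y, w)) 1 t -> P x y w.
    move=> ht; have h : phi eP (pickle (x, y, w)) 1 by apply/phiP; exists t.
    by have := phi_fun (hP x y w) h; case: (P x y w).
  rewrite /Q decode_pair -[nth _ _ _]/k; split=> [[z hz] y yk|h].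
    by have := elimT allP hz y; rewrite mem_iota => /(_ yk) /hasP[w _ /hw]; exists w.
  elim: k h => [|k IH] h.
  - have [w Pw] := h 0%N (leqnn 0); have := hP x 0%N w; rewrite Pw => /phiP[t ht].
    exists (maxn t w); apply/allP => y; rewrite mem_iota add0n ltnS leqn0 => /eqP ->; apply/hasP; exists w.
      by rewrite mem_iota /= add0n ltnS leq_maxr.
    exact: halts_mono ht (leq_maxl _ _).
  - have [|z hz] := IH; first by move=> y yk; apply: h; exact: leqW.
    have [w Pw] := h k.+1 (leqnn _); have := hP x k.+1 w; rewrite Pw => /phiP[t ht].
    exists (maxn z (maxn t w)); apply/allP => y; rewrite mem_iota add0n leq0n andTb ltnS leq_eqVlt => /orP[/eqP ->|yk].
      apply/hasP; exists w; first by rewrite mem_iota /= add0n ltnS !leq_max leqnn !orbT.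
      by apply: halts_mono ht _; rewrite !leq_max leqnn !orbT.
    have := elimT allP hz y; rewrite mem_iota add0n => /(_ yk) /hasP[w' hw' ht'].
    apply/hasP; exists w'; last by apply: halts_mono ht' (leq_maxl _ _).
    by move: hw'; rewrite !mem_iota !add0n !ltnS => /leq_trans; apply; exact: leq_maxl.
exists (fun n => pickle (M n)); first by apply: C_total; exact: C_pickle.
move=> n; rewrite hB; split=> [h|/Stot tot y].
  apply: S0 => p k; rewrite /approx ec; exists (M n); first by rewrite pickleK.
  by apply: M1; apply/QP => y _; exact: h.
have [r [M' ]] := tot [::] y; rewrite pickleK => -[<-] hM.
have /(QP n [::]) : exists z, Q n (pickle ([::] : star_poly, y)) z; last by apply.
apply: contrapT => no; apply: M2 hM => z; apply/negP => hz; apply: no; by exists z.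
Qed.
(** Obtained as a completion for the seminorm 0, for which exactly the positive rationals are strict
    upper bounds. *)
Lemma zero_algebra (R : realType) : exists (A : cstarType R) (a : nat -> A),
  [/\ presentation a, simple_cstar A, AF A & forall p, cnorm (generated_point a p) = 0].
Proof.
have [|| A [a [pa simp af h]]] := algebra_of_core R _ _ trivial_core.
- by move=> _ al be h1; exact: lt_le_trans.
- by move=> _ al h; exists (al / 2); [rewrite gtr_pMr // invf_lt1 // ltr1n|rewrite divr_gt0].
exists A, a; split=> // p; apply: le_anti; rewrite cnorm_ge0 andbT leNgt; apply/negP => n0.
have [q /andP[h1 h2]] := rat_between n0.
have : 0 < q by rewrite -(ltr0q R).
by move=> /(h p q).1; rewrite ltNge (ltW h2).
Qed.

End Hardness.

Theorem theorem12p5 (R : realType) :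
  Pi02_complete (ce_simple_AF_indices R) /\
  Pi02_complete (computable_simple_AF_indices R).
Proof.
have [A [a [pa simp af n0]]] := zero_algebra R.
split; split; [exact: ce_Pi02| |exact: computable_Pi02|]; apply: hard => e.
- by move/ce_indices => [].
- move=> h; exists A, a; split=> // p; exists (fun=> 0); split=> [k|k|]; [exact: h|by []|].
  by rewrite n0 rmorph0; exact: cvg_cst.
- by move/computable_indices => [].
- move=> h; exists A, a; split=> // p k; exists 0; split; first exact: h.
  by rewrite n0 rmorph0 subrr normr0 invr_gt0 exprn_gt0.
Qed.
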